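(* Let $n\ge 4$, $\mathfrak g=sl(n,\mathbb C)$, let $\alpha_0\in\mathbb C$, $\alpha_0\neq 0$, let $\mathcal O\subset\mathfrak g^*$ be the coadjoint orbit of $\alpha_0\omega_1$ ($\omega_1$ the first fundamental weight, extended by $0$ to $\mathfrak n_\pm$), and let $\mathcal A=\mathrm{Fun}(\mathcal O)$ be the algebra of polynomial functions on $\mathcal O$. Let $\mathcal A_{\hbar,q}$ be the quotient of the tensor algebra $T(\mathfrak g_q)$ (with scalars extended to formal series in $\hbar$ and $\nu=\log q$) by the two-sided ideal generated by the $U_q(sl(n))$-submodule of $\mathbb C\oplus\mathfrak g_q\oplus\mathfrak g_q^{\otimes 2}$ generated by the elements $$s_{2\omega_1+\omega_{n-2}},\qquad s_{\omega_2+2\omega_{n-1}},\qquad s_{\omega_2+\omega_{n-2}},$$ $$s^1_{\omega_1+\omega_{n-1}}-\alpha_0\,q^{n-2}\,\frac{[n-1]_q(\gamma(q)+\hbar)-1}{[n]_q}\,g_{1,n},$$ $$s^2_{\omega_1+\omega_{n-1}}-\alpha_0\,q\,\frac{[n-1]_q-(\gamma(q)+\hbar)}{[n]_q}\,g_{1,n},$$ $$s_0-\alpha_0^2\,q^n\,\frac{[n-1]_q}{[n]_q}\,(\gamma(q)+\hbar)\cdot 1 .$$ Then: (1) $\mathcal A_{\hbar,q}$ is a flat two-parameter deformation of $\mathcal A$, and $\mathcal A_q=\mathcal A_{\hbar,q}/\hbar\mathcal A_{\hbar,q}$ is a flat one-parameter deformation of $\mathcal A$. (2) The Poisson pencil on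 $\mathcal O$ corresponding to the deformation $\mathcal A\to\mathcal A_{\hbar,q}$ is the pencil $$\{\,,\,\}_{a,b}=a\{\,,\,\}_{KKS}+b\{\,,\,\}_R$$ generated by the Kirillov–Kostant–Souriau bracket and the $R$-matrix bracket associated with the canonical $R$-matrix $R=\sum_{\alpha\in\Omega^+}\frac{X_\alpha\wedge X_{-\alpha}}{\langle X_\alpha,X_{-\alpha}\rangle}$.
   Context: **Brackets.** $\Omega^+$ is the set of positive roots of $\mathfrak g$, $X_{\pm\alpha}$ are root vectors, $\langle\,,\rangle$ is the Killing form. $\{f,g\}_{KKS}(x)=\langle[df,dg],x\rangle$ for $x\in\mathcal O$. $\{f,g\}_R=\mu\langle\rho^{\otimes2}(R),df\otimes dg\rangle$, where $\rho$ sends $\mathfrak g$ to vector fields on $\mathcal O$ via the coadjoint action and $\mu$ is the usual commutative product of functions. On $\mathcal O$ these brackets are Poisson and compatible. **Flat deformation.** An algebra $\mathcal A_\hbar$ over $\mathbb C[[\hbar]]$ is a flat deformation of $\mathcal A$ if $\mathcal A_\hbar/\hbar\mathcal A_\hbar=\mathcal A$ and $\mathcal A_\hbar\cong\mathcal A[[\hbar]]$ as $\mathbb C[[\hbar]]$-modules; two-parameter flat deformations (here in $\hbar$ and $\nu$, $q=e^\nu$) are defined similarly. The corresponding Poisson pencil is the linear span of the Poisson brackets on the commutative algebra $\mathcal A$ given by the first-order terms (in $\hbar$ and in $\nu$) of the commutator. Formal objects are completed in the adic topology. **Function $\gamma$.** $\gamma(q)=q^n$ if $|q|>1$, $\gamma(q)=q^{-n}$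 if $|q|<1$ (it is assumed that $|q|\ne1$; as formal series one uses $e^{n\nu}$ or $e^{-n\nu}$ accordingly). **$U_q(sl(n))$.** $[m]_q=\frac{q^m-q^{-m}}{q-q^{-1}}$. $U_q(sl(n))$ has Chevalley generators $e_i,f_i,h_i$, $1\le i\le n-1$, with the standard relations of the quantized enveloping algebra, $[e_i,f_j]=\delta_{ij}\frac{q^{h_i}-q^{-h_i}}{q-q^{-1}}$, the quantum Serre relations, and coproduct $\Delta h_i=h_i\otimes1+1\otimes h_i$, $\Delta e_i=e_i\otimes 1+q^{-h_i}\otimes e_i$, $\Delta f_i=1\otimes f_i+f_i\otimes q^{h_i}$. **The module $\mathfrak g_q$.** It is the $(n^2-1)$-dimensional $U_q(sl(n))$-module with basis $g_{i,j}$ ($1\le i\ne j\le n$) and $t_i$ ($1\le i\le n-1$) and action $h_i(t_k)=0$, $h_i(g_{k,l})=(\delta_{i,k}-\delta_{i,l}-\delta_{i+1,k}+\delta_{i+1,l})g_{k,l}$, and (all other matrix coefficients being zero) $e_i(g_{a,i})=-g_{a,i+1}$, $e_i(g_{i+1,a})=g_{i,a}$ for $a\ne i,i+1$; $e_i(g_{i+1,i})=t_i$, $e_i(t_i)=-[2]_qg_{i,i+1}$, $e_i(t_{i\pm1})=g_{i,i+1}$; $f_i(g_{a,i+1})=-g_{a,i}$, $f_i(g_{i,a})=g_{i+1,a}$ for $a\neq i,i+1$; $f_i(g_{i,i+1})=-t_i$, $f_i(t_i)=[2]_qg_{i+1,i}$, $f_i(t_{i\pm1})=-g_{i+1,i}$.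 At $q=1$ this is the adjoint module. $T(\mathfrak g_q)$ is a $U_q(sl(n))$-module via $\Delta$. **The elements of $\mathfrak g_q^{\otimes 2}$.** $s_{2\omega_1+\omega_{n-2}}=g_{1,n}\otimes g_{1,n-1}-q^{-1}g_{1,n-1}\otimes g_{1,n}$; $s_{\omega_2+2\omega_{n-1}}=g_{1,n}\otimes g_{2,n}-q^{-1}g_{2,n}\otimes g_{1,n}$; $s_{\omega_2+\omega_{n-2}}=q\,g_{1,n}\otimes g_{2,n-1}+q^{-1}g_{2,n-1}\otimes g_{1,n}-g_{1,n-1}\otimes g_{2,n}-g_{2,n}\otimes g_{1,n-1}$; $s^1_{\omega_1+\omega_{n-1}}=\sum_{k=2}^{n-1}q^{k-2}g_{1,k}\otimes g_{k,n}+q^{-2}\sum_{k=1}^{n-1}\frac{[n-k]_q}{[n]_q}t_k\otimes g_{1,n}-q^{n-2}\sum_{k=1}^{n-1}\frac{[k]_q}{[n]_q}g_{1,n}\otimes t_k$; $s^2_{\omega_1+\omega_{n-1}}=\sum_{k=2}^{n-1}q^{2-k}g_{k,n}\otimes g_{1,k}-q^{1-n}\sum_{k=1}^{n-1}\frac{[k]_q}{[n]_q}t_k\otimes g_{1,n}+q\sum_{k=1}^{n-1}\frac{[n-k]_q}{[n]_q}g_{1,n}\otimes t_k$; $s_0=\sum_{1\le i\le j\le n-1}\frac{[i]_q[n-j]_q}{[n]_q}t_i\otimes t_j+\sum_{1\le j<i\le n-1}\frac{[j]_q[n-i]_q}{[n]_q}t_i\otimes t_j+q\sum_{1\le i\neq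 j\le n}q^{j-i}g_{i,j}\otimes g_{j,i}$. *)

(* Defs.v *)
From HB Require Import structures.
From mathcomp Require Import all_boot all_order all_algebra.
From mathcomp Require Import finmap mpoly monalg.
From mathcomp Require Import boolp classical_sets functions reals.

Set Implicit Arguments.
Unset Strict Implicit.
Unset Printing Implicit Defensive.

Import Order.TTheory GRing.Theory Num.Theory.
Local Open Scope ring_scope.

(* [FPS a] is the formal series with n-th coefficient [a n]; series in two
   variables are iterated series. *)
Record fps (V : Type) := FPS { fcoef : nat -> V }.

HB.instance Definition _ (V : Type) := gen_eqMixin (fps V).
HB.instance Definition _ (V : Type) := gen_choiceMixin (fps V).

Lemma fpsP (V : Type) (x y : fps V) : fcoef x =1 fcoef y -> x = y.
Proof. by case: x y => [x] [y] /= /funext ->. Qed.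

Section FpsZmod.
Variable V : zmodType.
Implicit Types x y : fps V.

Definition fps_zero : fps V := FPS (fun=> 0).
Definition fps_opp x : fps V := FPS (fun n => - fcoef x n).
Definition fps_add x y : fps V := FPS (fun n => fcoef x n + fcoef y n).

Fact fps_addA : associative fps_add.
Proof. by move=> x y z; apply: fpsP => n; apply: addrA. Qed.
Fact fps_addC : commutative fps_add.
Proof. by move=> x y; apply: fpsP => n; apply: addrC. Qed.
Fact fps_add0 : left_id fps_zero fps_add.
Proof. by move=> x; apply: fpsP => n; apply: add0r. Qed.
Fact fps_addN : left_inverse fps_zero fps_opp fps_add.
Proof. by move=> x; apply: fpsP => n; apply: addNr. Qed.

HB.instance Definition _ :=
  GRing.isZmodule.Build (fps V) fps_addA fps_addC fps_add0 fps_addN.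

Lemma fcoef0 n : fcoef (0 : fps V) n = 0. Proof. by []. Qed.
Lemma fcoefD x y n : fcoef (x + y) n = fcoef x n + fcoef y n.
Proof. by []. Qed.
Lemma fcoefN x n : fcoef (- x) n = - fcoef x n. Proof. by []. Qed.

End FpsZmod.

Section FpsRing.
Variable A : pzRingType.
Implicit Types x y z : fps A.

Definition fpsC (a : A) : fps A := FPS (fun n => a *+ (n == 0%N)).
Definition fpsX : fps A := FPS (fun n => (n == 1%N)%:R).
Definition fps_mul x y : fps A :=
  FPS (fun n => \sum_(i < n.+1) fcoef x i * fcoef y (n - i)).

Fact fcoef_mul_rev x y n :
  fcoef (fps_mul x y) n = \sum_(i < n.+1) fcoef x (n - i) * fcoef y i.
Proof.
rewrite /= (reindex_inj rev_ord_inj) /=.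
by apply: eq_bigr => j _; rewrite (sub_ordK j).
Qed.

Fact fps_mulA : associative fps_mul.
Proof.
move=> p q r; apply: fpsP => i; rewrite [RHS]fcoef_mul_rev [LHS]/=.
pose coef3 j k := fcoef p j * (fcoef q (i - j - k) * fcoef r k).
transitivity (\sum_(j < i.+1) \sum_(k < i.+1 | (k <= i - j)%N) coef3 j k).
  apply: eq_bigr => /= j _.
  rewrite -[\sum_(_ < _) _]/(fcoef (fps_mul q r) (i - j)) fcoef_mul_rev.
  by rewrite big_distrr /= (big_ord_narrow_leq (leq_subr _ _)).
rewrite (exchange_big_dep predT) //=; apply: eq_bigr => k _.
transitivity (\sum_(j < i.+1 | (j <= i - k)%N) coef3 j k).
  apply: eq_bigl => j; rewrite -ltnS -(ltnS j) -!subSn ?leq_ord //.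
  by rewrite -subn_gt0 -(subn_gt0 j) -!subnDA addnC.
rewrite (big_ord_narrow_leq (leq_subr _ _)) big_distrl /=.
by apply: eq_bigr => j _; rewrite /coef3 -!subnDA addnC mulrA.
Qed.

Fact fps_mul1 : left_id (fpsC 1) fps_mul.
Proof.
move=> x; apply: fpsP => n /=; rewrite big_ord_recl /= subn0 mul1r.
by rewrite big1 ?addr0 // => j _; rewrite mul0r.
Qed.

Fact fps_mulr1 : right_id (fpsC 1) fps_mul.
Proof.
move=> x; apply: fpsP => n; rewrite fcoef_mul_rev big_ord_recl /= subn0 mulr1.
by rewrite big1 ?addr0 // => j _; rewrite mulr0.
Qed.

Fact fps_mulDl : left_distributive fps_mul +%R.
Proof.
move=> x y z; apply: fpsP => n; rewrite fcoefD /= -big_split /=.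
by apply: eq_bigr => j _; rewrite mulrDl.
Qed.

Fact fps_mulDr : right_distributive fps_mul +%R.
Proof.
move=> x y z; apply: fpsP => n; rewrite fcoefD /= -big_split /=.
by apply: eq_bigr => j _; rewrite mulrDr.
Qed.

HB.instance Definition _ := GRing.Zmodule_isPzRing.Build (fps A)
  fps_mulA fps_mul1 fps_mulr1 fps_mulDl fps_mulDr.

Lemma fcoefM x y n :
  fcoef (x * y) n = \sum_(i < n.+1) fcoef x i * fcoef y (n - i).
Proof. by []. Qed.

Lemma fcoefMr x y n :
  fcoef (x * y) n = \sum_(i < n.+1) fcoef x (n - i) * fcoef y i.
Proof. exact: fcoef_mul_rev. Qed.

Fact fpsC_zmod_morphism : zmod_morphism fpsC.
Proof. by move=> a b; apply: fpsP => n; rewrite /= mulrnBl. Qed.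
Fact fpsC_monoid_morphism : monoid_morphism fpsC.
Proof.
split=> // a b; apply: fpsP => n; rewrite fcoefM /= big_ord_recl /= subn0.
rewrite big1 ?addr0 ?mulrnAr // => j _; by rewrite mul0r.
Qed.
HB.instance Definition _ :=
  GRing.isZmodMorphism.Build A (fps A) fpsC fpsC_zmod_morphism.
HB.instance Definition _ :=
  GRing.isMonoidMorphism.Build A (fps A) fpsC fpsC_monoid_morphism.

End FpsRing.

Arguments fpsX {A}.

Section FpsNzRing.
Variable A : nzRingType.

Fact fps1_neq0 : (1 : fps A) != 0.
Proof.
apply/eqP => /(congr1 (fun x => fcoef x 0)) /= /eqP.
by rewrite oner_eq0.
Qed.

HB.instance Definition _ :=
  GRing.PzSemiRing_isNonZero.Build (fps A) fps1_neq0.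
End FpsNzRing.

Section FpsComPzRing.
Variable A : comPzRingType.

Fact fps_mulC : commutative (@GRing.mul (fps A)).
Proof.
move=> x y; apply: fpsP => n; rewrite fcoefM fcoefMr.
by apply: eq_bigr => i _; rewrite mulrC.
Qed.

HB.instance Definition _ :=
  GRing.PzRing_hasCommutativeMul.Build (fps A) fps_mulC.
End FpsComPzRing.

HB.instance Definition _ (A : comNzRingType) := GRing.ComPzRing.on (fps A).

Section FpsUnit.
Variable A : comNzRingType.

(* Only series with a two-sided inverse are units; [x^-1 = x] otherwise. *)
Definition fps_unit : {pred fps A} := fun x => `[< exists y, y * x = 1 >].
Definition fps_inv (x : fps A) : fps A :=
  if pselect (exists y, y * x = 1) is left h then projT1 (cid h) else x.

Fact fps_mulVx : {in fps_unit, left_inverse 1 fps_inv *%R}.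
Proof.
move=> x /asboolP ux; rewrite /fps_inv.
by case: pselect => // h; case: (cid h).
Qed.
Fact fps_unitPl (x y : fps A) : y * x = 1 -> fps_unit x.
Proof. by move=> yx; apply/asboolP; exists y. Qed.
Fact fps_inv_out : {in [predC fps_unit], fps_inv =1 id}.
Proof.
move=> x; rewrite inE /= => /asboolP ux; rewrite /fps_inv.
by case: pselect.
Qed.

HB.instance Definition _ :=
  GRing.ComNzRing_hasMulInverse.Build (fps A) fps_mulVx fps_unitPl fps_inv_out.
End FpsUnit.

Section FpsMap.
Variables (A B : pzRingType) (f : {rmorphism A -> B}).

Definition fps_map (x : fps A) : fps B := FPS (fun n => f (fcoef x n)).

Fact fps_map_zmod_morphism : zmod_morphism fps_map.
Proof. by move=> x y; apply: fpsP => n; rewrite /= rmorphB. Qed.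
Fact fps_map_monoid_morphism : monoid_morphism fps_map.
Proof.
split=> [|x y]; apply: fpsP => n; first by rewrite /= rmorphMn rmorph1.
by rewrite /= rmorph_sum; apply: eq_bigr => i _; rewrite rmorphM.
Qed.
HB.instance Definition _ :=
  GRing.isZmodMorphism.Build (fps A) (fps B) fps_map fps_map_zmod_morphism.
HB.instance Definition _ :=
  GRing.isMonoidMorphism.Build (fps A) (fps B) fps_map fps_map_monoid_morphism.
End FpsMap.

(* The library's [algType] requires 1 <> 0, which is not known a priori for the
   quotients below; an algebra is given here by its central structure map. *)
Record alg (k : comPzRingType) := Alg {
  alg_sort :> pzRingType;
  scal : {rmorphism k -> alg_sort};
  scalC : forall (c : k) (x : alg_sort), scal c * x = x * scal c }.

Section FpsAlg.
Variables (k : comPzRingType) (A : alg k).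

Fact fps_scalC (c : fps k) (x : fps A) :
  fps_map (@scal k A) c * x = x * fps_map (@scal k A) c.
Proof.
apply: fpsP => n; rewrite fcoefM fcoefMr.
by apply: eq_bigr => i _; apply: scalC.
Qed.

Definition fps_alg : alg (fps k) := @Alg (fps k) (fps A) _ fps_scalC.
End FpsAlg.

Section RestrictScalars.
Variables (k k' : comPzRingType) (f : {rmorphism k' -> k}) (A : alg k).

Fact restrict_scalC (c : k') (x : A) :
  (@scal k A \o f) c * x = x * (@scal k A \o f) c.
Proof. exact: scalC. Qed.

Definition restrict_scalars : alg k' := @Alg k' A _ restrict_scalC.
End RestrictScalars.

Record is_ideal (B : pzRingType) (I : B -> Prop) : Prop := IsIdeal {
  ideal0 : I 0;
  idealD : forall x y, I x -> I y -> I (x + y);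
  idealMl : forall a x, I x -> I (a * x);
  idealMr : forall a x, I x -> I (x * a) }.

Record ideal (B : pzRingType) := Ideal {
  in_ideal :> B -> Prop;
  idealP : is_ideal in_ideal }.

Section QuotientAlg.
Variables (k : comPzRingType) (B : alg k) (I : ideal B).

Definition ideal_pred : B -> bool := fun x => `[< I x >].

Fact ideal_pred_zmod_closed : zmod_closed ideal_pred.
Proof.
have [I0 ID IMl _] := idealP I.
split=> [|x y /asboolP Ix /asboolP Iy]; apply/asboolP => //.
by apply: ID => //; rewrite -mulN1r; apply: IMl.
Qed.
HB.instance Definition _ :=
  GRing.isZmodClosed.Build B ideal_pred ideal_pred_zmod_closed.

Definition ideal_zmod : zmodClosed B := GRing.ZmodClosed.clone B ideal_pred _.

Definition quot : Type := Quotient.quot ideal_zmod.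
HB.instance Definition _ := GRing.Zmodule.on quot.

Definition to_quot (x : B) : quot := \pi_(Quotient.quot ideal_zmod)%qT x.

Lemma to_quotP (x y : B) : to_quot x = to_quot y <-> I (x - y).
Proof.
rewrite /to_quot; split=> [/eqP|Ixy]; last apply/eqP;
  rewrite -Quotient.idealrBE; [by move/asboolP | exact/asboolP].
Qed.

Lemma to_quot_repr (x : quot) : to_quot (repr x) = x.
Proof. exact: reprK. Qed.

Definition quot_one : quot := to_quot 1.
Definition quot_mul (x y : quot) : quot := to_quot (repr x * repr y).

Lemma quot_mulE x y : quot_mul (to_quot x) (to_quot y) = to_quot (x * y).
Proof.
have [_ ID IMl IMr] := idealP I; apply/to_quotP.
have -> : repr (to_quot x) * repr (to_quot y) - x * y =
    repr (to_quot x) * (repr (to_quot y) - y) + (repr (to_quot x) - x) * y.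
  by rewrite mulrBr mulrBl addrA subrK.
by apply: ID; [apply: IMl | apply: IMr]; apply/to_quotP; rewrite to_quot_repr.
Qed.

Lemma to_quotD x y : to_quot (x + y) = to_quot x + to_quot y.
Proof. exact: (@raddfD _ _ \pi_(Quotient.quot ideal_zmod)%qT). Qed.
Lemma to_quotB x y : to_quot (x - y) = to_quot x - to_quot y.
Proof. exact: (@raddfB _ _ \pi_(Quotient.quot ideal_zmod)%qT). Qed.

Fact quot_mulA : associative quot_mul.
Proof.
move=> x y z; rewrite -(to_quot_repr x) -(to_quot_repr y) -(to_quot_repr z).
by rewrite !quot_mulE mulrA.
Qed.
Fact quot_mul1 : left_id quot_one quot_mul.
Proof. by move=> x; rewrite -(to_quot_repr x) quot_mulE mul1r. Qed.
Fact quot_mulr1 : right_id quot_one quot_mul.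
Proof. by move=> x; rewrite -(to_quot_repr x) quot_mulE mulr1. Qed.
Fact quot_mulDl : left_distributive quot_mul +%R.
Proof.
move=> x y z; rewrite -(to_quot_repr x) -(to_quot_repr y) -(to_quot_repr z).
by rewrite -to_quotD !quot_mulE mulrDl to_quotD.
Qed.
Fact quot_mulDr : right_distributive quot_mul +%R.
Proof.
move=> x y z; rewrite -(to_quot_repr x) -(to_quot_repr y) -(to_quot_repr z).
by rewrite -to_quotD !quot_mulE mulrDr to_quotD.
Qed.

HB.instance Definition _ := GRing.Zmodule_isPzRing.Build quot
  quot_mulA quot_mul1 quot_mulr1 quot_mulDl quot_mulDr.

Fact to_quot_monoid_morphism : monoid_morphism to_quot.
Proof. by split=> // x y; rewrite -quot_mulE. Qed.
HB.instance Definition _ := GRing.isZmodMorphism.Build B quot to_quot to_quotB.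
HB.instance Definition _ :=
  GRing.isMonoidMorphism.Build B quot to_quot to_quot_monoid_morphism.

Fact quot_scalC (c : k) (x : quot) :
  (to_quot \o @scal k B) c * x = x * (to_quot \o @scal k B) c.
Proof. by rewrite -(to_quot_repr x) /= -!rmorphM scalC. Qed.

Definition quot_alg : alg k := @Alg k quot _ quot_scalC.
Definition quot_pr : {rmorphism B -> quot_alg} := to_quot.

End QuotientAlg.

Section PrincipalIdeal.
Variables (k : comPzRingType) (B : alg k) (c : k).

Fact scal_is_ideal : is_ideal (fun x : B => exists y, x = scal B c * y).
Proof.
split=> [|_ _ [y ->] [z ->]|a _ [y ->]|a _ [y ->]].
- by exists 0; rewrite mulr0.
- by exists (y + z); rewrite mulrDr.
- by exists (a * y); rewrite !mulrA scalC.
- by exists (y * a); rewrite mulrA.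
Qed.

Definition scal_ideal : ideal B := Ideal scal_is_ideal.
End PrincipalIdeal.

Section Flat.
Variables (k : comPzRingType) (A : alg k).

(* [p] induces B/hB = A, and B is isomorphic to A[[h]] as a k[[h]]-module. *)
Record flat_deformation (B : alg (fps k)) (p : {rmorphism B -> A}) : Prop :=
  FlatDeformation {
    flat_scal : forall c, p (scal B c) = scal A (fcoef c 0);
    flat_surj : forall a, exists b, p b = a;
    flat_ker : forall b, p b = 0 <-> exists x, b = scal B fpsX * x;
    flat_free : exists phi : B -> fps_alg A,
      [/\ bijective phi,
          forall x y, phi (x + y) = phi x + phi y &
          forall c x, phi (scal B c * x) = scal (fps_alg A) c * phi x] }.

(* Two parameters: the outer variable of [fps (fps k)] is h, the inner is nu. *)
Definition hbar : fps (fps k) := fpsX.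
Definition nu : fps (fps k) := fpsC fpsX.

Record flat_deformation2 (B : alg (fps (fps k))) (p : {rmorphism B -> A}) :
  Prop := FlatDeformation2 {
    flat2_scal : forall c, p (scal B c) = scal A (fcoef (fcoef c 0) 0);
    flat2_surj : forall a, exists b, p b = a;
    flat2_ker : forall b,
      p b = 0 <-> exists x y, b = scal B hbar * x + scal B nu * y;
    flat2_free : exists phi : B -> fps_alg (fps_alg A),
      [/\ bijective phi,
          forall x y, phi (x + y) = phi x + phi y &
          forall c x,
            phi (scal B c * x) = scal (fps_alg (fps_alg A)) c * phi x] }.

Implicit Types P Q : A -> A -> A.

(* [x, y] = h P1 + nu P2 modulo (h, nu)^2. *)
Definition first_order_brackets (B : alg (fps (fps k))) (p : {rmorphism B -> A})
    P1 P2 : Prop :=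
  forall x y : B, exists u v : B,
    [/\ x * y - y * x = scal B hbar * u + scal B nu * v,
        p u = P1 (p x) (p y) & p v = P2 (p x) (p y)].

Definition in_pencil P1 P2 Q : Prop :=
  exists a b : k, forall f g : A, Q f g = scal A a * P1 f g + scal A b * P2 f g.

Record is_poisson P : Prop := IsPoisson {
  poissonD : forall f g h, P (f + g) h = P f h + P g h;
  poissonZ : forall c f g, P (scal A c * f) g = scal A c * P f g;
  poisson_skew : forall f g, P f g = - P g f;
  poisson_leibniz : forall f g h, P (f * g) h = f * P g h + P f h * g;
  poisson_jacobi : forall f g h, P f (P g h) + P g (P h f) + P h (P f g) = 0 }.

End Flat.

(* Labels of the basis of sl(n) (and of g_q): [inl (i, j)] with i <> j for the
   root vector g_{i+1,j+1}, [inr k] for the Cartan element t_{k+1}. *)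
Definition label (n : nat) : finType :=
  ({p : 'I_n * 'I_n | p.1 != p.2} + 'I_n.-1)%type.

Section Orbit.
Variables (C : fieldType) (n : nat).

Definition sl_space : {vspace 'M[C]_n} :=
  lker (linfun (mxtrace : 'M[C]_n -> C^o)).
Definition sl : vectType C := subvs_of sl_space.

(* [to_sl] is a linear projection; see [to_slK] for traceless matrices. *)
Definition to_sl (M : 'M[C]_n) : sl := vsproj sl_space M.
Definition mx_of (y : sl) : 'M[C]_n := vsval y.

Lemma to_slK (M : 'M[C]_n) : \tr M = 0 -> mx_of (to_sl M) = M.
Proof. by move=> trM; rewrite /mx_of vsprojK // memv_ker lfunE /= trM. Qed.

Lemma mx_ofK (y : sl) : to_sl (mx_of y) = y.
Proof. exact: vsvalK. Qed.

Lemma mxtrace_mx_of (y : sl) : \tr (mx_of y) = 0.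
Proof.
by have := subvsP y; rewrite memv_ker lfunE => /eqP.
Qed.

Definition lie (y z : sl) : sl :=
  to_sl (mx_of y *m mx_of z - mx_of z *m mx_of y).

(* The matrix unit in row i and column j, where i and j count from 1. *)
Definition mxunit (i j : nat) : 'M[C]_n :=
  \matrix_(a, b) ((a.+1 == i) && (b.+1 == j))%:R.

Definition sl_basis (x : label n) : sl :=
  match x with
  | inl p => to_sl (mxunit (val p).1.+1 (val p).2.+1)
  | inr k => to_sl (mxunit k.+1 k.+1 - mxunit k.+2 k.+2)
  end.

Definition root_vector (i j : nat) : sl := to_sl (mxunit i j).

Definition killing (y z : sl) : C :=
  \sum_i coord (vbasis {:sl}) i (lie y (lie z (vbasis {:sl})`_i)).

Definition sl_dual : Type := 'Hom(sl, C^o).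

(* omega_1 takes the value delta_{1,k} on the coroot E_{k,k} - E_{k+1,k+1}, so
   on the Cartan subalgebra it is the (1,1) entry. *)
Definition omega1 (y : sl) : C := \sum_(i < n | val i == 0%N) mx_of y i i.

Definition coadjoint_orbit (alpha0 : C) : set sl_dual :=
  [set x | exists2 u : 'M[C]_n, \det u = 1 &
     forall y : sl, x y = alpha0 * omega1 (to_sl (invmx u *m mx_of y *m u))].

(* Polynomials on the dual of sl(n); the variable of index i is the linear
   function given by the i-th element of the basis. *)
Definition poly_fun := mpoly #|label n| C.
Definition lin_coord (x : sl_dual) (i : 'I_#|label n|) : C :=
  x (sl_basis (enum_val i)).
Definition pf_eval (F : poly_fun) (x : sl_dual) : C := F.@[lin_coord x].

(* The differential at x, an element of sl(n) = T^*_x(sl(n)^* ). *)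
Definition pf_diff (F : poly_fun) (x : sl_dual) : sl :=
  \sum_i (mderiv i F).@[lin_coord x] *: sl_basis (enum_val i).

(* The coadjoint vector field of y: the derivative at t = 0 of F (exp (-ty) x),
   where exp (-ty) moves x in the direction z |-> x [y, z]. *)
Definition rho (y : sl) (F : poly_fun) (x : sl_dual) : C :=
  x (lie y (pf_diff F x)).

Section Fun.
Variable alpha0 : C.

Definition is_polynomial : {pred coadjoint_orbit alpha0 -> C} :=
  fun f => `[< exists F : poly_fun, forall x, f x = pf_eval F (val x) >].

Fact is_polynomial_subring_closed : subring_closed is_polynomial.
Proof.
split=> [|f g /asboolP[F fE] /asboolP[G gE]|f g /asboolP[F fE] /asboolP[G gE]];
  apply/asboolP.
- by exists 1 => x; rewrite /pf_eval mevalC.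
- by exists (F - G) => x; rewrite /pf_eval mevalB -!/(pf_eval _ _) -fE -gE.
- by exists (F * G) => x; rewrite /pf_eval mevalM -!/(pf_eval _ _) -fE -gE.
Qed.

Record orbit_fun := OrbitFun {
  fun_val :> coadjoint_orbit alpha0 -> C;
  _ : is_polynomial fun_val }.

HB.instance Definition _ := [isSub for fun_val].
HB.instance Definition _ := [Choice of orbit_fun by <:].
HB.instance Definition _ := GRing.SubChoice_isSubComPzRing.Build _ _ orbit_fun
  is_polynomial_subring_closed.

Fact restrict_subproof (F : poly_fun) :
  is_polynomial (fun x : coadjoint_orbit alpha0 => pf_eval F (val x)).
Proof. by apply/asboolP; exists F. Qed.

Definition restrict_orbit (F : poly_fun) : orbit_fun :=
  OrbitFun (restrict_subproof F).

Definition cst_fun (c : C) : orbit_fun := restrict_orbit (mpolyC #|label n| c).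

Fact cst_fun_zmod_morphism : zmod_morphism cst_fun.
Proof.
move=> c d; apply: val_inj; apply/funext => x.
by rewrite /= /pf_eval mpoly.mpolyCB mevalB.
Qed.
Fact cst_fun_monoid_morphism : monoid_morphism cst_fun.
Proof.
split=> [|c d]; apply: val_inj; apply/funext => x; rewrite /= /pf_eval.
  by rewrite mevalC.
by rewrite mpoly.mpolyCM mevalM.
Qed.
HB.instance Definition _ :=
  GRing.isZmodMorphism.Build C orbit_fun cst_fun cst_fun_zmod_morphism.
HB.instance Definition _ :=
  GRing.isMonoidMorphism.Build C orbit_fun cst_fun cst_fun_monoid_morphism.

Fact cst_funC (c : C) (f : orbit_fun) : cst_fun c * f = f * cst_fun c.
Proof. exact: mulrC. Qed.

Definition FunO : alg C := @Alg C orbit_fun cst_fun cst_funC.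

Definition is_KKS (P : FunO -> FunO -> FunO) : Prop :=
  forall (F G : poly_fun) (x : coadjoint_orbit alpha0),
    fun_val (P (restrict_orbit F) (restrict_orbit G)) x =
      val x (lie (pf_diff F (val x)) (pf_diff G (val x))).

(* The bracket of R = sum_(i < j) (E_ij ^ E_ji) / <E_ij, E_ji>, with the
   convention y ^ z = y (x) z - z (x) y. *)
Definition is_R_bracket (P : FunO -> FunO -> FunO) : Prop :=
  forall (F G : poly_fun) (x : coadjoint_orbit alpha0),
    fun_val (P (restrict_orbit F) (restrict_orbit G)) x =
      \sum_(1 <= i < n.+1) \sum_(i.+1 <= j < n.+1)
        (rho (root_vector i j) F (val x) * rho (root_vector j i) G (val x)
         - rho (root_vector j i) F (val x) * rho (root_vector i j) G (val x))
        / killing (root_vector i j) (root_vector j i).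

End Fun.
End Orbit.

Section Quantum.
Variables (C : numFieldType) (n : nat).

(* C[[h, nu]] *)
Definition K_hn : comUnitRingType := fps (fps C).

(* q^m = e^(m nu) *)
Definition qpow (m : int) : K_hn := fpsC (FPS (fun j => m%:~R ^+ j / (j`!)%:R)).

(* (q^m - q^-m) / (q - q^-1), expanded because the denominator is not a unit of
   C[[nu]]. *)
Definition qnum (m : nat) : K_hn :=
  \sum_(i < m) qpow (m%:Z - 1 - 2 * i%:Z).

(* The tensor algebra of g_q, with scalars extended to C[[h, nu]]. *)
Definition tens_K : lalgType K_hn := {malg K_hn[{fmonom (label n)}]}.

Definition gq_gen (x : label n) : tens_K := << fmu x >>.
Definition word (w : seq (label n)) : tens_K := \prod_(x <- w) gq_gen x.

(* The basis of g_q, with indices counted from 1 (and zero when the indices are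
   out of range). *)
Definition gq (i j : nat) : tens_K :=
  \sum_(p : {p : 'I_n * 'I_n | p.1 != p.2} |
          ((val p).1.+1 == i) && ((val p).2.+1 == j)) gq_gen (inl p).
Definition tq (i : nat) : tens_K := \sum_(k < n.-1 | k.+1 == i) gq_gen (inr k).

Definition wt_gen (i : nat) (x : label n) : int :=
  match x with
  | inl p => let k := (val p).1.+1 in let l := (val p).2.+1 in
      (i == k)%:Z - (i == l)%:Z - (i.+1 == k)%:Z + (i.+1 == l)%:Z
  | inr _ => 0
  end.

Definition e_gen (i : nat) (x : label n) : tens_K :=
  match x with
  | inl p => let k := (val p).1.+1 in let l := (val p).2.+1 in
      if (k == i.+1) && (l == i) then tq i
      else if l == i then - gq k i.+1
      else if k == i.+1 then gq i l
      else 0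
  | inr m => let k := m.+1 in
      if k == i then - (qnum 2 *: gq i i.+1)
      else if (k == i.+1) || (k.+1 == i) then gq i i.+1
      else 0
  end.

Definition f_gen (i : nat) (x : label n) : tens_K :=
  match x with
  | inl p => let k := (val p).1.+1 in let l := (val p).2.+1 in
      if (k == i) && (l == i.+1) then - tq i
      else if l == i.+1 then - gq k i
      else if k == i then gq i.+1 l
      else 0
  | inr m => let k := m.+1 in
      if k == i then qnum 2 *: gq i.+1 i
      else if (k == i.+1) || (k.+1 == i) then - gq i.+1 i
      else 0
  end.

(* The action on tensors is given by the coproduct
   h_i |-> h_i (x) 1 + 1 (x) h_i,  e_i |-> e_i (x) 1 + q^(-h_i) (x) e_i,
   f_i |-> 1 (x) f_i + f_i (x) q^(h_i), and by the counit on scalars. *)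
Definition wt_word (i : nat) (w : seq (label n)) : int :=
  \sum_(x <- w) wt_gen i x.

Definition h_word (i : nat) (w : seq (label n)) : tens_K :=
  (wt_word i w)%:~R *: word w.

Fixpoint e_word (i : nat) (w : seq (label n)) : tens_K :=
  if w is x :: w' then
    e_gen i x * word w' + qpow (- wt_gen i x) *: (gq_gen x * e_word i w')
  else 0.

Fixpoint f_word (i : nat) (w : seq (label n)) : tens_K :=
  if w is x :: w' then
    gq_gen x * f_word i w' + qpow (wt_word i w') *: (f_gen i x * word w')
  else 0.

Definition lin_ext (op : seq (label n) -> tens_K) (z : tens_K) : tens_K :=
  \sum_(w <- msupp z) mcoeff w z *: op (fmonom_val w).

(* A submodule over U_q(sl(n)): stability under the Chevalley generators. *)
Record Uq_submodule (S : tens_K -> Prop) : Prop := UqSubmodule {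
  Uq_sub0 : S 0;
  Uq_subD : forall y z, S y -> S z -> S (y + z);
  Uq_subZ : forall (c : K_hn) z, S z -> S (c *: z);
  Uq_subh : forall i z, (1 <= i < n)%N -> S z -> S (lin_ext (h_word i) z);
  Uq_sube : forall i z, (1 <= i < n)%N -> S z -> S (lin_ext (e_word i) z);
  Uq_subf : forall i z, (1 <= i < n)%N -> S z -> S (lin_ext (f_word i) z) }.

Local Notation "[ m ]_q" := (qnum m)
  (at level 0, m at level 99, format "[ m ]_q").

(* Highest weight vectors, named after their weights: [s1_w1_wn1] and [s2_w1_wn1]
   are the two vectors of weight omega_1 + omega_(n-1). *)
Definition s_2w1_wn2 : tens_K :=
  gq 1 n * gq 1 n.-1 - qpow (-1) *: (gq 1 n.-1 * gq 1 n).

Definition s_w2_2wn1 : tens_K := gq 1 n * gq 2 n - qpow (-1) *: (gq 2 n * gq 1 n).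

Definition s_w2_wn2 : tens_K :=
  qpow 1 *: (gq 1 n * gq 2 n.-1) + qpow (-1) *: (gq 2 n.-1 * gq 1 n)
  - gq 1 n.-1 * gq 2 n - gq 2 n * gq 1 n.-1.

Definition s1_w1_wn1 : tens_K :=
  \sum_(2 <= k < n) qpow (k%:Z - 2) *: (gq 1 k * gq k n)
  + qpow (-2) *: \sum_(1 <= k < n) ([n - k]_q / [n]_q) *: (tq k * gq 1 n)
  - qpow (n%:Z - 2) *: \sum_(1 <= k < n) ([k]_q / [n]_q) *: (gq 1 n * tq k).

Definition s2_w1_wn1 : tens_K :=
  \sum_(2 <= k < n) qpow (2 - k%:Z) *: (gq k n * gq 1 k)
  - qpow (1 - n%:Z) *: \sum_(1 <= k < n) ([k]_q / [n]_q) *: (tq k * gq 1 n)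
  + qpow 1 *: \sum_(1 <= k < n) ([n - k]_q / [n]_q) *: (gq 1 n * tq k).

Definition s_0 : tens_K :=
  \sum_(1 <= i < n) \sum_(i <= j < n)
     ([i]_q * [n - j]_q / [n]_q) *: (tq i * tq j)
  + \sum_(1 <= i < n) \sum_(1 <= j < i)
     ([j]_q * [n - i]_q / [n]_q) *: (tq i * tq j)
  + qpow 1 *: \sum_(1 <= i < n.+1) \sum_(1 <= j < n.+1 | i != j)
     qpow (j%:Z - i%:Z) *: (gq i j * gq j i).

Variables (alpha0 : C) (q_gt1 : bool).

(* gamma (q) = q^n if |q| > 1, and q^-n if |q| < 1; for the formal q = e^nu the
   case is a parameter. *)
Definition gamma_q : K_hn := if q_gt1 then qpow n else qpow (- n%:Z).

Definition gamma_h : K_hn := gamma_q + hbar C.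
Definition alpha0_K : K_hn := fpsC (fpsC alpha0).

Definition defining_relation (z : tens_K) : Prop :=
  [\/ z = s_2w1_wn2, z = s_w2_2wn1, z = s_w2_wn2 |
   [\/ z = s1_w1_wn1 -
             (alpha0_K * qpow (n%:Z - 2) *
                (([n.-1]_q * gamma_h - 1) / [n]_q)) *: gq 1 n,
       z = s2_w1_wn1 -
             (alpha0_K * qpow 1 * (([n.-1]_q - gamma_h) / [n]_q)) *: gq 1 n |
       z = s_0 - (alpha0_K ^+ 2 * qpow n * ([n.-1]_q / [n]_q) * gamma_h) *: 1]].

Definition relation_module (z : tens_K) : Prop :=
  forall S, Uq_submodule S -> (forall r, defining_relation r -> S r) -> S z.

Fact tens_scalC (c : C) (x : {malg C[{fmonom (label n)}]}) :
  malgC c * x = x * malgC c.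
Proof.
rewrite !malgM_def fgmulUg fgmulgU.
by apply: eq_bigr => v _; rewrite mul1m mulm1 mulrC.
Qed.

Definition tens_C : alg C := @Alg C {malg C[{fmonom (label n)}]} _ tens_scalC.

(* T(g)[[h, nu]], the (h, nu)-adic completion of [tens_K]. *)
Definition tens_hat : alg (fps (fps C)) := fps_alg (fps_alg tens_C).

Definition gen_hat (x : label n) : tens_hat :=
  fpsC (fpsC (<< fmu x >> : tens_C)).

Definition to_tens_hat (z : tens_K) : tens_hat :=
  \sum_(w <- msupp z)
     scal tens_hat (mcoeff w z) * \prod_(x <- fmonom_val w) gen_hat x.

(* Membership in the N-th power of the ideal (h, nu). *)
Definition adic (N : nat) (z : tens_hat) : Prop :=
  forall i j : nat, (i + j < N)%N -> fcoef (fcoef (z : fps (fps tens_C)) i) j = 0.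

Definition adically_closed (J : tens_hat -> Prop) : Prop :=
  forall z : tens_hat, (forall N, exists2 y, J y & adic N (z - y)) -> J z.

(* The smallest closed two-sided ideal containing the relations. *)
Definition in_defining_ideal (z : tens_hat) : Prop :=
  forall J : ideal tens_hat, adically_closed J ->
    (forall r, relation_module r -> J (to_tens_hat r)) -> J z.

Fact defining_is_ideal : is_ideal in_defining_ideal.
Proof.
split=> [|y z Iy Iz|a z Iz|a z Iz] J cJ rJ; have [J0 JD JMl JMr] := idealP J.
- exact: J0.
- by apply: JD; [apply: Iy | apply: Iz].
- by apply: JMl; apply: Iz.
- by apply: JMr; apply: Iz.
Qed.

Definition Ahq : alg (fps (fps C)) := quot_alg (Ideal defining_is_ideal).

(* The image in [Ahq] of a basis element of g_q. *)
Definition Ahq_gen (x : label n) : Ahq :=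
  quot_pr (Ideal defining_is_ideal) (gen_hat x).

Definition hbar_ideal : ideal Ahq := scal_ideal Ahq (hbar C).

Definition Aq : alg (fps C) :=
  restrict_scalars (@fpsC (fps C)) (quot_alg hbar_ideal).

Definition to_Aq : {rmorphism Ahq -> Aq} := quot_pr hbar_ideal.

End Quantum.

(* Main.v *)
From HB Require Import structures.
Require Import Defs.
From mathcomp Require Import all_boot all_order all_algebra.
From mathcomp Require Import finmap mpoly monalg.
From mathcomp Require Import zify ring.
From mathcomp Require Import complex boolp classical_sets functions reals.

Set Implicit Arguments.
Unset Strict Implicit.
Unset Printing Implicit Defensive.

Import Order.TTheory GRing.Theory Num.Theory.
Local Open Scope ring_scope.

(* The algebra acts on functions of mu in a lattice by operators
   Phi |-> (mu |-> c(mu) Phi(mu + l)): the generator g_ij shifts mu by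
   eps_i - eps_j and has the coefficient q^(...) Y_j(mu), a deformation of the
   entry w_i y_j / w_j of a matrix of rank one.  Up to a factor, e_i and f_i act on
   the image of the tensor algebra as q-commutators with operators of the same
   shape, so the kernel of the action is stable under U_q(sl(n)), and it contains
   the defining ideal because it contains the six highest weight vectors.  The y_j
   are free parameters of sum alpha0; hence for a series in the ideal the
   coefficient that comes first in the lexicographic order vanishes on the orbit.

   Conversely, at h = nu = 0 the ideal contains the commutators, the 2 x 2 minors
   and the trace relation, as it is stable under the derivations induced by the
   e_i and f_i.  A tensor vanishing on the orbit, made homogeneous with the trace
   and evaluated at b_i = x_ik and a_j = x_kj, is then killed by a power of every
   x_kk, and the x_kk add up to alpha0: it lies in the ideal.

   A linear section Fun(O) -> T(g) applied to the coefficients is therefore an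
   isomorphism from Fun(O)[[h, nu]] to the algebra: it is injective by the first
   statement and surjective by successive approximation with the second.  The
   first-order brackets of the generators are read off from the commutators of the
   operators at a generic point, where the bracket in h is alpha0 / n times the
   Kirillov-Kostant-Souriau one and the bracket in nu is a multiple of it plus 2 n
   times the R-matrix one. *)

(** * Formal series *)

(** The image of a tensor has with [Eop i] a q-commutator equal to [spar i] times the image of its
    translate by e_i. The series [spar i] is 0 at h = nu = 0, where all leading coefficients
    commute, so it is not invertible; but its coefficient of h is alpha0 / n, so it is nonzero and
    can be cancelled in a torsion-free algebra. This is where alpha0 <> 0 and the parameter h make
    the kernel of the action a submodule. The coefficients Y_j come from quantities S_k = [spar k] *
    q^(-2 mu_k) by Y_j = (S_j - S_(j-1)) / (q - q^-1). The denominator is not a unit, so the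
    quotient is written out in [Yfun], and identities are proved after multiplication by it. Most
    sums then telescope. The end values S_0 and S_n do not depend on mu. Two linear conditions fix
    them: the sum of the Y_j is q^n alpha0 (gamma(q) + h), and q^(-2n) S_n - S_0 is (q - q^-1)
    alpha0. The odd-looking scalars of the last three relations are what these conditions
    produce. *)

Section TriangularSums.
Variable V : nmodType.

Lemma sum_antidiag (H : nat -> nat -> V) n :
  \sum_(i < n.+1) \sum_(a < i.+1) H a (i - a)%N =
  \sum_(a < n.+1) \sum_(c < (n - a).+1) H a c.
Proof.
elim: n H => [|n IH] H; first by rewrite !big_ord1.
rewrite big_ord_recr /= IH [RHS]big_ord_recr /= subnn big_ord1.
rewrite [X in _ + X]big_ord_recr /= subnn addrA; congr (_ + _).
rewrite -big_split /=; apply: eq_bigr => a _.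
by rewrite subSn ?[RHS]big_ord_recr //= -ltnS.
Qed.

Lemma exchange_antidiag (G : nat -> nat -> V) n :
  \sum_(c < n.+1) \sum_(b < (n - c).+1) G b c =
  \sum_(b < n.+1) \sum_(c < (n - b).+1) G b c.
Proof.
rewrite -(sum_antidiag (fun c b => G b c)) -sum_antidiag.
apply: eq_bigr => i _; rewrite [LHS](reindex_inj rev_ord_inj) /=.
by apply: eq_bigr => a _; rewrite subSS (sub_ordK a).
Qed.

End TriangularSums.

Lemma fcoef_sum (V : zmodType) (I : Type) (r : seq I) (P : pred I)
    (F : I -> fps V) n :
  fcoef (\sum_(i <- r | P i) F i) n = \sum_(i <- r | P i) fcoef (F i) n.
Proof. by elim/big_rec2: _ => // j a b _ <-. Qed.

Lemma fcoef1 (A : pzRingType) n : fcoef (1 : fps A) n = (n == 0%N)%:R.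
Proof. by []. Qed.

Section FpsDiag.
Variable A : pzRingType.

(* Identifies the two variables of an iterated series. *)
Definition fps_diag (x : fps (fps A)) : fps A :=
  FPS (fun n => \sum_(i < n.+1) fcoef (fcoef x i) (n - i)).

Fact fps_diag_zmod_morphism : zmod_morphism fps_diag.
Proof. by move=> x y; apply: fpsP => n; rewrite /= -sumrB. Qed.

Fact fps_diag_monoid_morphism : monoid_morphism fps_diag.
Proof.
split=> [|x y]; apply: fpsP => n /=.
  rewrite big_ord_recl subn0 big1 ?addr0 => [|i _] //.
(* The fourth degree is n - a - b - c. The diagonal of a product groups these terms by a + c, the
   outer degree of the product, whereas the product of the diagonals groups them by a + b. *)
pose F a b c := fcoef (fcoef x a) b * fcoef (fcoef y c) (n - a - b - c).
transitivity (\sum_(a < n.+1) \sum_(c < (n - a).+1) \sum_(b < (n - a - c).+1)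
    F a b c).
  rewrite -(sum_antidiag (fun a c => \sum_(b < (n - a - c).+1) F a b c)).
  apply: eq_bigr => i _.
  rewrite fcoef_sum; apply: eq_bigr => a _; rewrite fcoefM.
  have lai : (a <= i)%N by rewrite -ltnS.
  have E : (n - i)%N = (n - a - (i - a))%N by rewrite -subnDA subnKC.
  by rewrite -E; apply: eq_bigr => b _; rewrite /F; congr (_ * fcoef _ _); lia.
transitivity (\sum_(a < n.+1) \sum_(b < (n - a).+1) \sum_(c < (n - a - b).+1)
    F a b c).
  by apply: eq_bigr => a _; rewrite (exchange_antidiag (fun b c => F a b c)).
rewrite -(sum_antidiag (fun a b => \sum_(c < (n - a - b).+1) F a b c)).
apply: eq_bigr => m _; rewrite big_distrl /=.
apply: eq_bigr => a _; rewrite big_distrr /=.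
have lai : (a <= m)%N by rewrite -ltnS.
have E : (n - m)%N = (n - a - (m - a))%N by rewrite -subnDA subnKC.
by rewrite -E; apply: eq_bigr => b _; rewrite /F; congr (_ * fcoef _ _); lia.
Qed.

HB.instance Definition _ := GRing.isZmodMorphism.Build (fps (fps A)) (fps A)
  fps_diag fps_diag_zmod_morphism.
HB.instance Definition _ := GRing.isMonoidMorphism.Build (fps (fps A)) (fps A)
  fps_diag fps_diag_monoid_morphism.

(** Exchanges h and nu, so that [fps_ext] can bring two copies of the same variable next to each
    other before [fps_diag] identifies them. *)
Definition fps_swap (x : fps (fps A)) : fps (fps A) :=
  FPS (fun i => FPS (fun j => fcoef (fcoef x j) i)).

Fact fps_swap_zmod_morphism : zmod_morphism fps_swap.
Proof. by move=> x y; apply: fpsP => i; apply: fpsP. Qed.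

Fact fps_swap_monoid_morphism : monoid_morphism fps_swap.
Proof.
split=> [|x y]; apply: fpsP => i; apply: fpsP => j.
  by rewrite /=; case: i j => [|i] [|j].
change (fcoef (fcoef (x * y) j) i =
  fcoef (fcoef (fps_swap x * fps_swap y) i) j).
rewrite !fcoefM !fcoef_sum (eq_bigr _ (fun a _ => fcoefM _ _ _)).
by rewrite exchange_big.
Qed.

HB.instance Definition _ := GRing.isZmodMorphism.Build _ _
  fps_swap fps_swap_zmod_morphism.
HB.instance Definition _ := GRing.isMonoidMorphism.Build _ _
  fps_swap fps_swap_monoid_morphism.

End FpsDiag.

Section FpsExtend.
Variables (T A : pzRingType) (f : {rmorphism T -> fps (fps A)}).

(* The continuous extension of [f] that is linear over the two variables. *)
Definition fps_ext : fps (fps T) -> fps (fps A) :=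
  @fps_diag (fps A) \o
  fps_map (@fps_swap A \o @fps_diag (fps A) \o fps_map (@fps_swap A \o f)).

HB.instance Definition _ := GRing.RMorphism.on fps_ext.

Lemma fcoef_fps_ext z i j :
  fcoef (fcoef (fps_ext z) i) j =
  \sum_(a < i.+1) \sum_(b < j.+1)
     fcoef (fcoef (f (fcoef (fcoef z a) b)) (i - a)) (j - b).
Proof. by rewrite /= fcoef_sum; apply: eq_bigr => a _; rewrite /= fcoef_sum. Qed.

End FpsExtend.

Definition torsion_free (k : comPzRingType) (A : alg k) :=
  forall (c : k) (x : A), scal A c * x = 0 -> c = 0 \/ x = 0.

Lemma fcoef_neq0 (V : zmodType) (x : fps V) :
  x <> 0 -> exists2 n, fcoef x n <> 0 & forall m, (m < n)%N -> fcoef x m = 0.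
Proof.
move=> x0; have ex : exists n, fcoef x n != 0.
  apply: contra_notP x0 => nex; apply: fpsP => n.
  by apply/eqP/negPn/negP => xn; apply: nex; exists n.
have [m /eqP xm mP] := ex_minnP ex; exists m => // i lim.
by apply/eqP/negPn/negP => /mP; rewrite leqNgt lim.
Qed.

(** If c and x have orders i and j, the coefficient of degree i + j of their product is the product
    of the leading coefficients. *)
Lemma fps_torsion_free (k : comPzRingType) (A : alg k) : torsion_free A -> torsion_free (fps_alg A).
Proof.
move=> tfA c x cx; apply: contrapT => /not_orP[/fcoef_neq0[i ci cm]].
move=> /fcoef_neq0[j xj xm].
have := congr1 (fun y => fcoef y (i + j)) cx; rewrite fcoefM.
have lij : (i < (i + j).+1)%N by rewrite ltnS leq_addr.
rewrite (bigD1 (Ordinal lij)) //= addKn big1 ?addr0 => [/tfA[]//|a].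
rewrite -val_eqE /= => ai; have [lt|le] := ltnP a i.
  by rewrite cm // rmorph0 mul0r.
rewrite [fcoef x _]xm ?mulr0 //.
by move: ai le (ltn_ord a); lia.
Qed.

(** * Free algebras and algebras of shift operators *)

Section MalgSum.
Variables (K : choiceType) (G V : zmodType) (H : K -> G -> V).
Hypothesis HB : forall w, {morph H w : x y / x - y}.

(** Common form of [free_ev] and [lin_ext], which use the coefficient of a word in different
    ways. *)
Definition malg_sum (z : {malg G[K]}) : V := \sum_(w <- msupp z) H w (mcoeff w z).

Lemma malg_sum_coef0 w : H w 0 = 0.
Proof. by rewrite -(subrr 0) HB subrr. Qed.

Lemma malg_sumEw (d : {fset K}) (z : {malg G[K]}) : (msupp z `<=` d)%fset ->
  malg_sum z = \sum_(w <- d) H w (mcoeff w z).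
Proof.
move=> le; rewrite /malg_sum (big_fset_incl _ le) // => x xd /mcoeff_outdom ->.
exact: malg_sum_coef0.
Qed.

Lemma malg_sum_zmod_morphism : zmod_morphism malg_sum.
Proof.
move=> x y.
rewrite (malg_sumEw (fsubset_trans (msuppB_le x y) (fsubset_refl _))).
rewrite (malg_sumEw (fsubsetUl (msupp x) (msupp y))).
rewrite (malg_sumEw (fsubsetUr (msupp x) (msupp y))).
by rewrite -sumrB; apply: eq_bigr => w _; rewrite mcoeffB HB.
Qed.

Lemma malg_sumU c w : malg_sum << c *g w >> = H w c.
Proof. by rewrite (malg_sumEw msuppU_le) big_seq_fset1 mcoeffUU. Qed.

End MalgSum.

Lemma malg_ind (K : choiceType) (G : zmodType) (P : {malg G[K]} -> Prop) :
  P 0 -> (forall x y, P x -> P y -> P (x + y)) ->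
  (forall c w, P << c *g w >>) -> forall z, P z.
Proof. by move=> P0 PD PU z; rewrite [z]monalgE; elim/big_ind: _. Qed.

Section FreeAlgebra.
Variables (k : comNzRingType) (I : choiceType).
Notation T := {malg k[{fmonom I}]}.

Lemma fmonom_valK (w : {fmonom I}) : FMonom (fmonom_val w) = w.
Proof. by case: w. Qed.

Lemma malgUU (c d : k) (v w : {fmonom I}) :
  << c *g v >> * << d *g w >> = << c * d *g mmul v w >> :> T.
Proof. by rewrite malgM_def fgmulUU. Qed.

Lemma prod_gen (w : seq I) : \prod_(x <- w) << fmu x >> = << FMonom w >> :> T.
Proof.
elim: w => [|x w IH]; first by rewrite big_nil -fmoneE.
by rewrite big_cons IH malgUU mulr1 fmuE; congr << _ *g _ >>; apply: fmmulE.
Qed.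

Lemma malgU_word (c : k) (w : {fmonom I}) :
  << c *g w >> = c *: \prod_(x <- fmonom_val w) << fmu x >> :> T.
Proof.
by rewrite prod_gen fmonom_valK -mul_malgC malgUU mulr1 mul1m.
Qed.

Lemma free_ind (P : T -> Prop) :
  P 0 -> (forall x y, P x -> P y -> P (x + y)) ->
  (forall c w, P << c *g w >>) -> forall z, P z.
Proof. exact: malg_ind. Qed.

Lemma malg_morphM (A : pzRingType) (g : T -> A) :
  g 0 = 0 -> {morph g : x y / x + y} ->
  (forall c d v w, g (<< c *g v >> * << d *g w >>) = g << c *g v >> * g << d *g w >>) ->
  {morph g : x y / x * y}.
Proof.
move=> g0 gD gU x y; elim/free_ind: x => [|x1 x2 IH1 IH2|c v].
- by rewrite mul0r g0 mul0r.
- by rewrite (mulrDl x1 x2 y) (gD (x1 * y)) (gD x1) mulrDl; congr (_ + _).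
elim/free_ind: y => [|y1 y2 IH1 IH2|d w].
- by rewrite mulr0 g0 mulr0.
- by rewrite (mulrDr _ y1 y2) (gD (_ * y1)) (gD y1) mulrDr; congr (_ + _).
exact: gU.
Qed.

Section Eval.
Variables (A : alg k) (F : I -> A).

Definition free_ev (z : T) : A :=
  \sum_(w <- msupp z) scal A (mcoeff w z) * \prod_(x <- fmonom_val w) F x.

Let H (w : {fmonom I}) (c : k) : A := scal A c * \prod_(x <- fmonom_val w) F x.
Let HB w : {morph H w : x y / x - y}.
Proof. by move=> x y; rewrite /H rmorphB mulrBl. Qed.

Fact free_ev_zmod_morphism : zmod_morphism free_ev.
Proof. exact: malg_sum_zmod_morphism HB. Qed.
HB.instance Definition _ :=
  GRing.isZmodMorphism.Build T A free_ev free_ev_zmod_morphism.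

Lemma free_ev0 : free_ev 0 = 0. Proof. exact: raddf0. Qed.
Lemma free_evD x y : free_ev (x + y) = free_ev x + free_ev y.
Proof. exact: raddfD. Qed.

Lemma free_evU c w :
  free_ev << c *g w >> = scal A c * \prod_(x <- fmonom_val w) F x.
Proof. exact: (malg_sumU HB). Qed.

Fact free_ev_monoid_morphism : monoid_morphism free_ev.
Proof.
split; first by rewrite free_evU rmorph1 mul1r fm1 big_nil.
apply: malg_morphM => [||c d v w]; [exact: free_ev0|exact: free_evD|].
rewrite malgUU (free_evU (c * d)) (free_evU c v) (free_evU d w) fmM big_cat rmorphM /=.
rewrite -(mulrA (scal A c)) -(mulrA (scal A c)); congr (_ * _).
by rewrite !mulrA scalC.
Qed.
HB.instance Definition _ :=
  GRing.isMonoidMorphism.Build T A free_ev free_ev_monoid_morphism.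

Lemma free_ev_gen x : free_ev << fmu x >> = F x.
Proof. by rewrite free_evU rmorph1 mul1r fmU big_seq1. Qed.

Lemma free_evC c : free_ev << c *g mone >> = scal A c.
Proof. by rewrite free_evU fm1 big_nil mulr1. Qed.

Lemma free_evZ c z : free_ev (c *: z) = scal A c * free_ev z.
Proof. by rewrite -mul_malgC rmorphM /= free_evC. Qed.

Lemma free_ev_word (w : seq I) :
  free_ev (\prod_(x <- w) << fmu x >>) = \prod_(x <- w) F x.
Proof. by rewrite rmorph_prod; apply: eq_bigr => x _; rewrite /= free_ev_gen. Qed.

Lemma free_ev_unique (g : {rmorphism T -> A}) :
  (forall c, g << c *g mone >> = scal A c) -> (forall x, g << fmu x >> = F x) ->
  g =1 free_ev.
Proof.
move=> gC gF; elim/free_ind => [|x y IHx IHy|c w].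
- by rewrite !raddf0.
- by rewrite [LHS]raddfD free_evD /= IHx IHy.
rewrite malgU_word -mul_malgC !rmorphM gC /= free_evC; congr (_ * _).
by rewrite free_ev_word rmorph_prod; apply: eq_bigr => x _; rewrite /= gF.
Qed.

End Eval.
End FreeAlgebra.

Section Endomorphisms.
Variable V : zmodType.

Record endo := Endo { endo_fun :> V -> V; endo_additive : zmod_morphism endo_fun }.

HB.instance Definition _ := gen_eqMixin endo.
HB.instance Definition _ := gen_choiceMixin endo.

Lemma endoP (f g : endo) : f =1 g -> f = g.
Proof.
case: f g => [f fB] [g gB] /= /funext E; case: g / E gB => gB.
have -> : fB = gB by exact: Prop_irrelevance.
by [].
Qed.

Lemma endoB (f : endo) x y : f (x - y) = f x - f y.
Proof. exact: endo_additive. Qed.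
Lemma endo0 (f : endo) : f 0 = 0.
Proof. by rewrite -{1}(subrr 0) endoB subrr. Qed.
Lemma endoN (f : endo) x : f (- x) = - f x.
Proof. by rewrite -sub0r endoB endo0 sub0r. Qed.
Lemma endoD (f : endo) x y : f (x + y) = f x + f y.
Proof. by rewrite -{1}(opprK y) endoB endoN opprK. Qed.

Fact endo_zero_additive : zmod_morphism (fun _ : V => 0 : V).
Proof. by move=> x y; rewrite subrr. Qed.
Fact endo_opp_additive (f : endo) : zmod_morphism (fun x => - f x).
Proof. by move=> x y; rewrite endoB opprB opprK addrC. Qed.
Fact endo_add_additive (f g : endo) : zmod_morphism (fun x => f x + g x).
Proof. by move=> x y; rewrite !endoB opprD addrACA. Qed.
Fact endo_one_additive : zmod_morphism (fun x : V => x).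
Proof. by []. Qed.
Fact endo_mul_additive (f g : endo) : zmod_morphism (f \o g).
Proof. by move=> x y; rewrite /= !endoB. Qed.

Definition endo_zero := Endo endo_zero_additive.
Definition endo_opp f := Endo (endo_opp_additive f).
Definition endo_add f g := Endo (endo_add_additive f g).
Definition endo_one := Endo endo_one_additive.
Definition endo_mul f g := Endo (endo_mul_additive f g).

Fact endo_addA : associative endo_add.
Proof. by move=> f g h; apply: endoP => x; apply: addrA. Qed.
Fact endo_addC : commutative endo_add.
Proof. by move=> f g; apply: endoP => x; apply: addrC. Qed.
Fact endo_add0 : left_id endo_zero endo_add.
Proof. by move=> f; apply: endoP => x; apply: add0r. Qed.
Fact endo_addN : left_inverse endo_zero endo_opp endo_add.
Proof. by move=> f; apply: endoP => x; apply: addNr. Qed.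
HB.instance Definition _ :=
  GRing.isZmodule.Build endo endo_addA endo_addC endo_add0 endo_addN.

Fact endo_mulA : associative endo_mul.
Proof. by move=> f g h; apply: endoP. Qed.
Fact endo_mul1 : left_id endo_one endo_mul.
Proof. by move=> f; apply: endoP. Qed.
Fact endo_mulr1 : right_id endo_one endo_mul.
Proof. by move=> f; apply: endoP. Qed.
Fact endo_mulDl : left_distributive endo_mul endo_add.
Proof. by move=> f g h; apply: endoP. Qed.
Fact endo_mulDr : right_distributive endo_mul endo_add.
Proof. by move=> f g h; apply: endoP => x; apply: endoD. Qed.
HB.instance Definition _ := GRing.Zmodule_isPzRing.Build endo
  endo_mulA endo_mul1 endo_mulr1 endo_mulDl endo_mulDr.

End Endomorphisms.

Section ShiftOperators.
Variable C : numFieldType.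

Definition lattice := nat -> int.
Definition lat_add (x y : lattice) : lattice := fun k => x k + y k.
Definition lat0 : lattice := fun=> 0.

Notation fn := (lattice -> C).
Notation K := (K_hn C).

Lemma lat_addA : associative lat_add.
Proof. by move=> x y z; apply/funext => k; apply: addrA. Qed.
Lemma lat_addC : commutative lat_add.
Proof. by move=> x y; apply/funext => k; apply: addrC. Qed.
Lemma lat_add0 : left_id lat0 lat_add.
Proof. by move=> x; apply/funext => k; apply: add0r. Qed.
Lemma lat_addr0 : right_id lat0 lat_add.
Proof. by move=> x; rewrite lat_addC lat_add0. Qed.

Fact shift_endo_additive (c : lattice -> C) (l : lattice) :
  zmod_morphism (fun (Phi : fn) mu => c mu * Phi (lat_add mu l)).
Proof. by move=> P Q; apply/funext => mu; apply: mulrBr. Qed.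
Definition shift_endo c l : endo fn := Endo (shift_endo_additive c l).

Lemma shift_endoM c l d m :
  shift_endo c l * shift_endo d m =
  shift_endo (fun mu => c mu * d (lat_add mu l)) (lat_add l m).
Proof.
by apply: endoP => P; apply/funext => mu; rewrite /= mulrA lat_addA.
Qed.

Lemma shift_endoD c d l :
  shift_endo c l + shift_endo d l = shift_endo (fun mu => c mu + d mu) l.
Proof. by apply: endoP => P; apply/funext => mu; rewrite [RHS]mulrDl. Qed.

Fact endo_scal_zmod_morphism : zmod_morphism (fun c : C => shift_endo (fun=> c) lat0).
Proof.
by move=> c d; apply: endoP => P; apply/funext => mu; apply: mulrBl.
Qed.
Fact endo_scal_monoid_morphism :
  monoid_morphism (fun c : C => shift_endo (fun=> c) lat0).
Proof.
split=> [|c d]; last by rewrite shift_endoM lat_addr0.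
by apply: endoP => P; apply/funext => mu; rewrite /= mul1r lat_addr0.
Qed.
Definition endo_scal : C -> endo fn := fun c => shift_endo (fun=> c) lat0.
HB.instance Definition _ :=
  GRing.isZmodMorphism.Build _ _ endo_scal endo_scal_zmod_morphism.
HB.instance Definition _ :=
  GRing.isMonoidMorphism.Build _ _ endo_scal endo_scal_monoid_morphism.

(* The scalars act by multiplication, but only endomorphisms that are linear
   over [C] commute with them. *)
Record lin_endo := LinEndo {
  lin_endo_val :> endo fn;
  _ : `[< forall c, endo_scal c * lin_endo_val = lin_endo_val * endo_scal c >] }.
HB.instance Definition _ := [isSub for lin_endo_val].
HB.instance Definition _ := [Choice of lin_endo by <:].

Fact lin_endo_subring_closed : subring_closed
  (fun f => `[< forall c, endo_scal c * f = f * endo_scal c >]).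
Proof.
split=> [|f g /asboolP Hf /asboolP Hg|f g /asboolP Hf /asboolP Hg];
  apply/asboolP => c.
- by rewrite mulr1 mul1r.
- by rewrite mulrBr mulrBl Hf Hg.
- by rewrite mulrA Hf -!mulrA Hg.
Qed.
HB.instance Definition _ := GRing.SubChoice_isSubPzRing.Build _ _ lin_endo
  lin_endo_subring_closed.

Fact shift_op_subproof c l :
  `[< forall a, endo_scal a * shift_endo c l = shift_endo c l * endo_scal a >].
Proof.
apply/asboolP => a; rewrite /endo_scal !shift_endoM lat_addC; congr shift_endo.
by apply/funext => mu; rewrite mulrC lat_addr0.
Qed.
Definition shift_op c l : lin_endo := LinEndo (shift_op_subproof c l).

Lemma shift_opM c l d m :
  shift_op c l * shift_op d m =
  shift_op (fun mu => c mu * d (lat_add mu l)) (lat_add l m).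
Proof. by apply: val_inj; apply: shift_endoM. Qed.

Lemma shift_opD c d l :
  shift_op c l + shift_op d l = shift_op (fun mu => c mu + d mu) l.
Proof. by apply: val_inj; apply: shift_endoD. Qed.

Lemma shift_op0 l : shift_op (fun=> 0) l = 0.
Proof.
by apply: val_inj; apply: endoP => P; apply/funext => mu; rewrite /= mul0r.
Qed.

Definition lin_endo_scal (c : C) : lin_endo := shift_op (fun=> c) lat0.
Fact lin_endo_scal_zmod_morphism : zmod_morphism lin_endo_scal.
Proof. by move=> c d; apply: val_inj; apply: (raddfB endo_scal). Qed.
Fact lin_endo_scal_monoid_morphism : monoid_morphism lin_endo_scal.
Proof.
split=> [|c d]; apply: val_inj; first exact: (rmorph1 endo_scal).
exact: (rmorphM endo_scal).
Qed.
HB.instance Definition _ :=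
  GRing.isZmodMorphism.Build _ _ lin_endo_scal lin_endo_scal_zmod_morphism.
HB.instance Definition _ :=
  GRing.isMonoidMorphism.Build _ _ lin_endo_scal lin_endo_scal_monoid_morphism.

Fact lin_endo_scalC c (x : lin_endo) : lin_endo_scal c * x = x * lin_endo_scal c.
Proof. by apply: val_inj; case: x => x /= /asboolP ->. Qed.

Definition endo_alg : alg C := @Alg C lin_endo lin_endo_scal lin_endo_scalC.

Lemma endo_alg_torsion_free : torsion_free endo_alg.
Proof.
move=> c x cx0; have [->|c0] := eqVneq c 0; [by left | right].
by rewrite -[x]mul1r -(rmorph1 (scal endo_alg)) -(mulVf c0) rmorphM -mulrA cx0
  mulr0.
Qed.

Fact op_key : unit. Proof. by []. Qed.

(* The operators Phi |-> (mu |-> c(mu) Phi(mu + l)), with c(mu) in C[[h, nu]],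
   expanded in h and nu. *)
Definition op_alg : alg K := fps_alg (fps_alg endo_alg).

Definition std_op (c : lattice -> K) (l : lattice) : op_alg := locked_with op_key
  (FPS (fun i => FPS (fun j => shift_op (fun mu => fcoef (fcoef (c mu) i) j) l))).

Lemma fcoef_std_op c l i j :
  fcoef (fcoef (std_op c l) i) j = shift_op (fun mu => fcoef (fcoef (c mu) i) j) l.
Proof. by rewrite /std_op unlock. Qed.

Lemma op_alg_torsion_free : torsion_free op_alg.
Proof. by do 2!apply: fps_torsion_free; apply: endo_alg_torsion_free. Qed.

Lemma shift_op_sum (I : Type) (r : seq I) (P : pred I) (c : I -> lattice -> C) l :
  \sum_(i <- r | P i) shift_op (c i) l =
  shift_op (fun mu => \sum_(i <- r | P i) c i mu) l.
Proof.
elim: r => [|i r IH].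
  rewrite big_nil -(shift_op0 l); congr shift_op; apply/funext => mu.
  by rewrite big_nil.
rewrite big_cons IH; case E: (P i); last first.
  by congr shift_op; apply/funext => mu; rewrite big_cons E.
by rewrite shift_opD; congr shift_op; apply/funext => mu; rewrite big_cons E.
Qed.

Lemma std_opM c l d m :
  std_op c l * std_op d m = std_op (fun mu => c mu * d (lat_add mu l)) (lat_add l m).
Proof.
apply: fpsP => i; apply: fpsP => j; rewrite fcoefM fcoef_sum fcoef_std_op /=.
rewrite (eq_bigr (fun a : 'I_i.+1 => shift_op (fun mu => \sum_(b < j.+1)
   fcoef (fcoef (c mu) a) b *
     fcoef (fcoef (d (lat_add mu l)) (i - a)) (j - b)) (lat_add l m))) => [|a _].
  rewrite shift_op_sum; congr shift_op; apply/funext => mu.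
  by rewrite fcoef_sum.
by rewrite -shift_op_sum; apply: eq_bigr => b _; rewrite !fcoef_std_op shift_opM.
Qed.

Lemma std_opD c d l : std_op c l + std_op d l = std_op (fun mu => c mu + d mu) l.
Proof.
apply: fpsP => i; apply: fpsP => j; rewrite !(fcoefD, fcoef_std_op).
exact: shift_opD.
Qed.

Lemma std_op0 l : std_op (fun=> 0) l = 0.
Proof. by apply: fpsP => i; apply: fpsP => j; rewrite fcoef_std_op; apply: shift_op0. Qed.

Lemma std_op_scal a : scal op_alg a = std_op (fun=> a) lat0.
Proof. by apply: fpsP => i; apply: fpsP => j; rewrite fcoef_std_op. Qed.

End ShiftOperators.

(* An algebra containing a copy of these operators; arguments that use only their
   composition rules are carried out for an arbitrary one. *)
Record shift_rep (C : numFieldType) (A : alg (K_hn C)) := ShiftRep {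
  rep_op :> (lattice -> K_hn C) -> lattice -> A;
  rep_opM : forall c l d m,
    rep_op c l * rep_op d m = rep_op (fun mu => c mu * d (lat_add mu l)) (lat_add l m);
  rep_opD : forall c d l, rep_op c l + rep_op d l = rep_op (fun mu => c mu + d mu) l;
  rep_op0 : forall l, rep_op (fun=> 0) l = 0;
  rep_op_scal : forall a, scal A a = rep_op (fun=> a) lat0 }.

Definition std_rep (C : numFieldType) : shift_rep (op_alg C) :=
  ShiftRep (@std_opM C) (@std_opD C) (@std_op0 C) (@std_op_scal C).

Section ShiftRepTheory.
Variables (C : numFieldType) (A : alg (K_hn C)) (op : shift_rep A).
Notation K := (K_hn C).

Definition opM := rep_opM op.
Definition opD := rep_opD op.
Definition op0 := rep_op0 op.
Definition op_scal := rep_op_scal op.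

Lemma opP c d l : c =1 d -> op c l = op d l.
Proof. by move=> /funext ->. Qed.

Lemma opN c l : - op c l = op (fun mu => - c mu) l.
Proof.
apply/eqP; rewrite eq_sym -subr_eq0 opprK opD -(op0 l); apply/eqP/opP => mu.
by rewrite addNr.
Qed.

Lemma opB c d l : op c l - op d l = op (fun mu => c mu - d mu) l.
Proof. by rewrite opN opD. Qed.

Lemma op1 : op (fun=> 1) lat0 = 1.
Proof. by rewrite -op_scal rmorph1. Qed.

Lemma opZ a c l : scal A a * op c l = op (fun mu => a * c mu) l.
Proof. by rewrite op_scal opM lat_add0; apply: opP => mu; rewrite lat_addr0. Qed.

Lemma op_sum (I : Type) (r : seq I) (P : pred I) (c : I -> lattice -> K) l :
  \sum_(i <- r | P i) op (c i) l =
  op (fun mu => \sum_(i <- r | P i) c i mu) l.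
Proof.
elim: r => [|i r IH].
  by rewrite big_nil -(op0 l); apply: opP => mu; rewrite big_nil.
rewrite big_cons IH; case E: (P i); last first.
  by apply: opP => mu; rewrite big_cons E.
by rewrite opD; apply: opP => mu; rewrite big_cons E.
Qed.

End ShiftRepTheory.

Lemma fcoef_fpsC0 (A : pzRingType) (a : A) : fcoef (fpsC a) 0 = a.
Proof. exact: mulr1n. Qed.

Lemma fcoef_fpsCS (A : pzRingType) (a : A) i : fcoef (fpsC a) i.+1 = 0.
Proof. exact: mulr0n. Qed.

Section FormalExponentials.
Variable C : numFieldType.
Notation K := (K_hn C).
Notation qp := (qpow C).
Notation qn := (qnum C).

Definition regular_alg (k : comPzRingType) : alg k := @Alg k k idfun (@mulrC k).

Lemma K_mulf_eq0 (c x : K) : c * x = 0 -> c = 0 \/ x = 0.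
Proof.
have tf : torsion_free (regular_alg C).
  by move=> a b /eqP; rewrite mulf_eq0 => /orP[]/eqP; [left|right].
have E : scal (fps_alg (fps_alg (regular_alg C))) c = c.
  by apply: fpsP => i; apply: fpsP.
move=> cx; apply: (@fps_torsion_free _ _ (fps_torsion_free tf) c x).
by rewrite E.
Qed.

(** Most identities between coefficients are proved after multiplication by [delta], which is not
    invertible; this removes the factor again. *)
Lemma K_mulfI (c x y : K) : c <> 0 -> c * x = c * y -> x = y.
Proof.
move=> c0 /eqP; rewrite -subr_eq0 -mulrBr => /eqP /K_mulf_eq0[//|/eqP].
by rewrite subr_eq0 => /eqP.
Qed.

Lemma qpow0 : qp 0 = 1.
Proof.
rewrite -(rmorph1 (@fpsC _)); congr fpsC; apply: fpsP => -[|j] /=.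
  by rewrite expr0 fact0 divr1.
by rewrite expr0n mul0r.
Qed.

Lemma qpowD a b : qp (a + b) = qp a * qp b.
Proof.
rewrite -rmorphM; congr fpsC; apply: fpsP => j; rewrite fcoefMr /= intrD.
rewrite exprDn mulr_suml; apply: eq_bigr => i _.
have fN0 (m : nat) : m`!%:R != 0 :> C by rewrite pnatr_eq0 -lt0n fact_gt0.
have lij : (i <= j)%N by rewrite -ltnS.
have E : 'C(j, i)%:R * (i`!%:R * (j - i)`!%:R) = j`!%:R :> C.
  by rewrite -!natrM bin_fact.
have B0 : 'C(j, i)%:R != 0 :> C by rewrite pnatr_eq0 -lt0n bin_gt0.
rewrite -mulr_natr -E; field.
by rewrite B0 !fN0.
Qed.

Lemma qpowK a : qp a * qp (- a) = 1.
Proof. by rewrite -qpowD subrr qpow0. Qed.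

Definition delta : K := qp 1 - qp (-1).

Lemma qnumE m : delta * qn m = qp m - qp (- m%:Z).
Proof.
elim: m => [|m IH]; first by rewrite /qnum big_ord0 mulr0 subrr.
have -> : qn m.+1 = qp 1 * qn m + qp (- m%:Z).
  rewrite /qnum big_ord_recr /= mulr_sumr; congr (_ + _).
    by apply: eq_bigr => i _; rewrite -qpowD; congr qp; lia.
  by congr qp; lia.
have -> : qp m.+1 = qp 1 * qp m by rewrite -qpowD; congr qp; lia.
have -> : qp (- m.+1%:Z) = qp (- m%:Z) * qp (-1) by rewrite -qpowD; congr qp; lia.
rewrite mulrDr mulrCA IH /delta.
have := qpowK 1; move: (qp 1) (qp (-1)) (qp m) (qp (- m%:Z)) => q q' a a' qq.
ring.
Qed.

Lemma fcoef00_qpow a : fcoef (fcoef (qp a) 0) 0 = 1.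
Proof. by rewrite fcoef_fpsC0 /= expr0 fact0 divr1. Qed.

Lemma fcoef01_qpow a : fcoef (fcoef (qp a) 0) 1 = a%:~R.
Proof. by rewrite fcoef_fpsC0 /= expr1 divr1. Qed.

Lemma fcoefS_qpow a i : fcoef (qp a) i.+1 = 0.
Proof. exact: fcoef_fpsCS. Qed.

Lemma delta_neq0 : delta <> 0.
Proof.
have E : fcoef (fcoef delta 0) 1 = 2%:R :> C.
  transitivity (fcoef (fcoef (qp 1) 0) 1 - fcoef (fcoef (qp (-1)) 0) 1) => //.
  by rewrite !fcoef01_qpow mulrN1z opprK.
by move=> d0; move: E; rewrite d0 => /eqP; rewrite eq_sym pnatr_eq0.
Qed.

(** If u is the constant term, x = u (1 - t) where t has constant term 0. The geometric series in t
    converges coefficientwise, because t^j has order at least j. *)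
Lemma fps_unitP (A : comUnitRingType) (x : fps A) :
  fcoef x 0 \is a GRing.unit -> x \is a GRing.unit.
Proof.
move=> ux; pose u := fcoef x 0; pose t : fps A := 1 - fpsC u^-1 * x.
have t0 : fcoef t 0 = 0.
  by rewrite fcoefD fcoefN fcoefM big_ord1 fcoef_fpsC0 mulVr ?fcoef1 ?subrr.
have tn j : forall i, (i < j)%N -> fcoef (t ^+ j) i = 0.
  elim: j => // j IH i; rewrite ltnS => lij; rewrite exprSr fcoefM big1 // => a _.
  have [lt|le] := ltnP a j; first by rewrite IH ?mul0r.
  by rewrite (_ : i - a = 0)%N ?t0 ?mulr0 //; apply/eqP; rewrite subn_eq0
    (leq_trans lij).
pose y : fps A := FPS (fun i => fcoef (\sum_(j < i.+1) t ^+ j) i).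
have yE N i : (i <= N)%N -> fcoef y i = fcoef (\sum_(j < N.+1) t ^+ j) i.
  move=> iN; rewrite /= !fcoef_sum -!(big_mkord xpredT (fun j => fcoef (t ^+ j) i)).
  rewrite [RHS](big_cat_nat (n := i.+1)) //= [X in _ + X]big_nat_cond.
  by rewrite [X in _ + X]big1 ?addr0 // => j /andP[/andP[ij _] _]; apply: tn.
have yt : y * (1 - t) = 1.
  apply: fpsP => N; rewrite fcoefM.
  transitivity (fcoef ((\sum_(j < N.+1) t ^+ j) * (1 - t)) N).
    rewrite fcoefM; apply: eq_bigr => i _; congr (_ * _); apply: yE.
    by rewrite -ltnS.
  rewrite mulrC -opprB mulNr -subrX1 opprB fcoefD fcoefN tn // subr0.
  by [].
have e : 1 - t = fpsC u^-1 * x by rewrite opprB addrC subrK.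
by apply/unitrPr; exists (y * fpsC u^-1); rewrite mulrCA (mulrC x) -e yt.
Qed.

Lemma fcoef00_qnum m : fcoef (fcoef (qn m) 0) 0 = m%:R.
Proof.
have -> : qn m = \sum_(i < m) qp (m%:Z - 1 - 2 * i%:Z) by [].
rewrite [X in fcoef X 0]fcoef_sum fcoef_sum (eq_bigr (fun=> 1)) => [|i _].
  by rewrite sumr_const card_ord.
exact: fcoef00_qpow.
Qed.

(** The series is free of h, so it suffices to invert it in C[[nu]], where its constant term is the
    nonzero number m. *)
Lemma qnum_unit m : (0 < m)%N -> qn m \is a GRing.unit.
Proof.
move=> m0; have [s E] : exists s : fps C, qn m = fpsC s.
  exists (\sum_(i < m) fcoef (qp (m%:Z - 1 - 2 * i%:Z)) 0).
  rewrite /qnum rmorph_sum; apply: eq_bigr => i _; apply: fpsP => -[|j].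
    by rewrite [RHS]fcoef_fpsC0.
  by rewrite [RHS]fcoef_fpsCS fcoefS_qpow.
rewrite E; apply: (rmorph_unit (@fpsC (fps C))); apply: fps_unitP.
have := fcoef00_qnum m; rewrite E fcoef_fpsC0 => ->.
by rewrite unitfE pnatr_eq0 -lt0n.
Qed.

Definition qnumz (m : int) : K := if m is Posz j then qn j else - qn `|m|%N.

Lemma qnumzE m : delta * qnumz m = qp m - qp (- m).
Proof.
case: m => m /=; first exact: qnumE.
by rewrite NegzE mulrN qnumE opprB opprK.
Qed.

Lemma qnum1 : qn 1 = 1.
Proof. by rewrite /qnum big_ord1 mulr0 subr0 subrr qpow0. Qed.

Lemma qnum2 : qn 2 = qp 1 + qp (-1).
Proof.
rewrite /qnum big_ord_recr big_ord1 /=.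
by congr (qp _ + qp _).
Qed.

(* (q^(-2 x) - q^(-2 y)) / (q - q^-1) *)
Definition qdiff (x y : int) : K := qp (- x - y) * qnumz (y - x).

Lemma qdiffE x y : delta * qdiff x y = qp (- x *+ 2) - qp (- y *+ 2).
Proof.
rewrite /qdiff mulrCA qnumzE mulrBr -!qpowD.
by congr (qp _ - qp _); lia.
Qed.

Lemma qdiffxx x : qdiff x x = 0.
Proof. by rewrite /qdiff subrr /= /qnum big_ord0 mulr0. Qed.

Lemma qdiff_simp : (qdiff 1 0 = - qp (-1)) * (qdiff 0 1 = qp (-1))
  * (qdiff (-1) 0 = qp 1) * (qdiff 0 (-1) = - qp 1).
Proof.
by do ![split]; rewrite /qdiff /= qnum1 ?mulrN mulr1.
Qed.

End FormalExponentials.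

(** * Shift operators representing the generators *)

(** A lattice element is recorded by the partial sums of its coordinates: this is eps_i - eps_j,
    whose first k coordinates add up to the given value. *)
Definition sh (i j : nat) : lattice := fun k => (i <= k)%N%:Z - (j <= k)%N%:Z.

Lemma shD i j k : lat_add (sh i j) (sh j k) = sh i k.
Proof. by apply/funext => l; rewrite /lat_add /sh; lia. Qed.

Lemma shxx i : sh i i = lat0.
Proof. by apply/funext => l; rewrite /sh /lat0 subrr. Qed.

Definition wt_idx (i k l : nat) : int :=
  (i == k)%:Z - (i == l)%:Z - (i.+1 == k)%:Z + (i.+1 == l)%:Z.

Ltac qpnorm := repeat match goal with |- context [qpow ?C ?e] =>
  is_ground e; let v := eval vm_compute in e in
  tryif constr_eq e v then fail else change (qpow C e) with (qpow C v) end.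

Ltac shv e v := let H := fresh in
  (have H : e = v by rewrite /sh /wt_idx; lia); rewrite ?H {H}.

Section ShiftRealization.
Variables (C : numFieldType) (A : alg (K_hn C)) (op : shift_rep A) (n : nat) (alpha0 : C) (q_gt1 : bool) (y : nat -> C).
Hypothesis n_gt1 : (1 < n)%N.
Notation K := (K_hn C).
Notation qp := (qpow C).
Notation qn := (qnum C).
Notation delta := (delta C).
Notation aK := (alpha0_K alpha0).
Notation g := (gamma_h C n q_gt1).

(** At mu = 0 the coefficient Y_j is z_j - z_(j-1), so inside the range the z_k are the partial sums
    of the parameters. The last one is forced: it deforms the condition that the y_j add up to
    alpha0. *)
Definition zpar (k : nat) : K :=
  if k == 0%N then 0
  else if (k < n)%N then fpsC (fpsC (\sum_(1 <= j < k.+1) y j)) else qp n * aK * g.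

(** The constant S_0. With S_n = S_0 + delta q^n alpha0 (gamma + h), it is the solution of q^(-2n)
    S_n - S_0 = delta alpha0; see [Sfunn] and [Sfunn_alpha0]. *)
Definition spar0 : K := aK * ((g - qp n) / qn n).
Definition spar (k : nat) : K := spar0 + delta * zpar k.

(** The coordinates of eps_i - eps_j add up to 0, so the partial sums at 0 and n carry no weight.
    The truncation makes S_0 and S_n independent of mu. *)
Definition wt (mu : lattice) (k : nat) : int := if (0 < k < n)%N then mu k else 0.

Definition Sfun (k : nat) (mu : lattice) : K := spar k * qp (- wt mu k *+ 2).

(* delta * Yfun j = Sfun j - Sfun j.-1, with the division by delta carried out. *)
Definition Yfun (j : nat) (mu : lattice) : K :=
  qp (- wt mu j *+ 2) * zpar j - qp (- wt mu j.-1 *+ 2) * zpar j.-1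
  + spar0 * qdiff C (wt mu j) (wt mu j.-1).

Lemma YfunE j mu : delta * Yfun j mu = Sfun j mu - Sfun j.-1 mu.
Proof.
rewrite /Yfun mulrDr mulrCA qdiffE /Sfun /spar.
ring.
Qed.

Lemma wt_sh mu i j k : (0 < i <= n)%N -> (0 < j <= n)%N -> (k <= n)%N ->
  wt (lat_add mu (sh i j)) k = wt mu k + sh i j k.
Proof.
rewrite /wt /lat_add /sh => ? ? ?; case: ifP => //; lia.
Qed.

(** A shift multiplies each S_k by q^(-2 d_k), where d_k is the change of the weight. Eliminating
    S_(j-1) in favour of Y_j and S_j leaves a difference of two powers of q, and its quotient by
    [delta] is [qdiff]. *)
Lemma Yfun_shift j mu mu' :
  Yfun j mu' = qp (- (wt mu' j.-1 - wt mu j.-1) *+ 2) * Yfun j mu +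
    qdiff C (wt mu' j - wt mu j) (wt mu' j.-1 - wt mu j.-1) * Sfun j mu.
Proof.
apply: (K_mulfI (@delta_neq0 C)); rewrite (YfunE j mu') mulrDr [X in _ = X + _]mulrCA (YfunE j mu).
rewrite mulrA qdiffE /Sfun.
have E k : qp (- wt mu' k *+ 2) = qp (- (wt mu' k - wt mu k) *+ 2) * qp (- wt mu k *+ 2).
  by rewrite -qpowD; congr qp; lia.
rewrite !E; ring.
Qed.

Definition Xop (i j : nat) : A := op (fun mu =>
  qp (- i%:Z - (i < j)%N%:Z - wt mu i + wt mu j) * Yfun j mu) (sh i j).

Definition Top (i : nat) : A := op (fun mu =>
  qp (- i%:Z) * (qp 1 * Yfun i mu - qp (-1) * Yfun i.+1 mu)) lat0.

(** Up to a power of q depending on mu, [Eop i] and [Fop i] are [Xop i i.+1] and [Xop i.+1 i].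
    Conjugation by [kop i] is the action of q^(h_i). *)
Definition Eop (i : nat) : A := op (fun mu =>
  qp (wt mu i + wt mu i.+1) * Yfun i.+1 mu) (sh i i.+1).

Definition Fop (i : nat) : A := op (fun mu =>
  qp (wt mu i + wt mu i.-1) * Yfun i mu) (sh i.+1 i).

Definition kop (i : nat) : A := op (fun mu =>
  qp (- wt mu i *+ 2 + wt mu i.-1 + wt mu i.+1)) lat0.

Lemma op_ext c d (l m : lattice) : l = m -> c =1 d -> op c l = op d m :> A.
Proof. by move=> -> /opP ->. Qed.

Lemma Yfun_sh j mu a b : (0 < a <= n)%N -> (0 < b <= n)%N -> (0 < j <= n)%N ->
  Yfun j (lat_add mu (sh a b)) = qp (- sh a b j.-1 *+ 2) * Yfun j mu +
    qdiff C (sh a b j) (sh a b j.-1) * Sfun j mu.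
Proof.
move=> ha hb hj; rewrite (Yfun_shift j mu) !wt_sh //; try lia.
by rewrite ![_ + sh _ _ _ - _]addrAC !subrr !add0r.
Qed.

Lemma SfunS j mu : Sfun j.+1 mu = Sfun j mu + (qp 1 - qp (-1)) * Yfun j.+1 mu.
Proof. by rewrite [_ * _]YfunE addrC subrK. Qed.

Lemma Sfun_spar j mu : spar j = Sfun j mu * qp (wt mu j *+ 2).
Proof. by rewrite /Sfun -mulrA -qpowD mulNrn addNr qpow0 mulr1. Qed.

Lemma subr_qp2 e1 e2 e1' e2' (Y Z U V : K) : e1 = e1' -> e2 = e2' ->
  qp e1 * (Y * Z) - qp e2 * U * V = qp e1' * Y * Z - qp e2' * U * V.
Proof. by move=> -> ->; rewrite mulrA. Qed.

Lemma qp_commutator e1 e2 e3 e4 g0 x x' (Y Z U V : K) :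
  e1 + e2 = g0 + x -> e3 + e4 = g0 + x' ->
  qp e1 * Y * (qp e2 * Z) - qp e3 * U * (qp e4 * V) =
  qp g0 * (qp x * Y * Z - qp x' * U * V).
Proof.
by move=> E E'; rewrite (mulrACA (qp e1)) (mulrACA (qp e3)) -!qpowD E E' !qpowD; ring.
Qed.

(** Both products shift mu by the same vector, so the q-commutator is a single operator. Once the
    values of [sh] are known, its coefficient is a polynomial in q, q^-1, the Y and the S; the
    lemmas below go through the possible values. *)
Lemma EX_coef i a b : (0 < i < n)%N -> (0 < a <= n)%N -> (0 < b <= n)%N ->
  Eop i * Xop a b - scal A (qp (- wt_idx i a b)) * (Xop a b * Eop i) =
  op (fun mu => qp (wt mu i + wt mu i.+1 - a%:Z - (a < b)%N%:Z - wt mu a + wt mu b)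
    * (qp (sh i i.+1 b - sh i i.+1 a) * Yfun i.+1 mu *
         (qp (- sh i i.+1 b.-1 *+ 2) * Yfun b mu +
            qdiff C (sh i i.+1 b) (sh i i.+1 b.-1) * Sfun b mu)
       - qp (sh a b i + sh a b i.+1 - wt_idx i a b) * Yfun b mu *
         (qp (- sh a b i *+ 2) * Yfun i.+1 mu +
            qdiff C (sh a b i.+1) (sh a b i) * Sfun i.+1 mu)))
  (lat_add (sh i i.+1) (sh a b)).
Proof.
move=> i0 a0 b0; rewrite /Eop /Xop opM [X in _ - scal _ _ * X]opM opZ.
rewrite [X in _ - op _ X]lat_addC opB; apply: opP => mu.
rewrite !Yfun_sh ?wt_sh; try lia.
move: (Yfun _ _) (Yfun _ _) (Sfun _ _) (Sfun _ _) => Y1 Yb Sb S1.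
rewrite mulrBr mulrACA -qpowD ![in RHS]mulrA -!qpowD.
rewrite mulrACA ![in X in _ - X = _]mulrA -!qpowD.
by apply: subr_qp2; lia.
Qed.

Lemma qp_lit : (qp (Posz 0) = 1) * (qp (Posz 2) = qp (Posz 1) * qp (Posz 1)) *
  (qp (Posz 3) = qp (Posz 1) * qp (Posz 1) * qp (Posz 1)) *
  (qp (Posz 4) = qp (Posz 1) * qp (Posz 1) * (qp (Posz 1) * qp (Posz 1))) *
  (qp (Negz 1) = qp (Negz 0) * qp (Negz 0)) *
  (qp (Negz 2) = qp (Negz 0) * qp (Negz 0) * qp (Negz 0)) *
  (qp (Negz 3) = qp (Negz 0) * qp (Negz 0) * (qp (Negz 0) * qp (Negz 0))).
Proof. by rewrite -!qpowD; do ![split]; rewrite ?qpow0. Qed.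

(** Separates the bookkeeping of exponents, an integer equation for [lia], from a polynomial
    identity in q and q^-1 for [qring]. The integer c is the power of q left in the second part. *)
Lemma qp_scale c e e2 e3 (X S Z : K) : e + c = e2 + e3 -> X = qp c * (S * Z) ->
  qp e * X = (S * qp e2) * (qp e3 * Z).
Proof. by move=> Ee ->; rewrite mulrA -qpowD Ee qpowD; ring. Qed.

Lemma qp_scaleN c e e2 e3 e4 (X S Z : K) : e + c = e2 + e3 + e4 ->
  X = qp c * (S * - Z) -> qp e * X = (S * qp e2) * (- (qp e3 * Z) * qp e4).
Proof. by move=> Ee ->; rewrite mulrA -qpowD Ee !qpowD; ring. Qed.

Lemma qp_scale2 c e e2 e3 (X S Z T : K) : e + c = e2 + e3 ->
  X = qp c * (S * (T * Z)) -> qp e * X = (S * qp e2) * (T * (qp e3 * Z)).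
Proof. by move=> Ee ->; rewrite mulrA -qpowD Ee !qpowD; ring. Qed.

Ltac qring := qpnorm; rewrite ?(qdiff_simp C) ?(qdiffxx C); qpnorm; rewrite ?qp_lit;
  have := qpowK C 1; qpnorm;
  repeat match goal with |- context [qpow C ?e] =>
     let v := fresh "q" in move: (qpow C e) => v end;
  repeat match goal with |- context [Yfun ?a ?b] =>
     let v := fresh "Y" in move: (Yfun a b) => v end;
  repeat match goal with |- context [Sfun ?a ?b] =>
     let v := fresh "S" in move: (Sfun a b) => v end;
  let H := fresh "qq" in move=> H; ring: H.

(** * The q-commutators with [Eop i] and the matrix coefficients of e_i *)

Section EopOnRootVectors.
Variable i : nat.
Hypothesis i0 : (0 < i < n)%N.

Lemma EX_t :
  Eop i * Xop i.+1 i - scal A (qp (- wt_idx i i.+1 i)) * (Xop i.+1 i * Eop i)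
  = scal A (spar i) * Top i.
Proof.
rewrite EX_coef; try lia.
rewrite /Top opZ; apply: op_ext => [|mu]; first by rewrite shD shxx.
shv (sh i i.+1 i) (1 : int); shv (sh i i.+1 i.+1) (0 : int).
shv (sh i i.+1 i.-1) (0 : int); shv (sh i.+1 i i) (-1 : int).
shv (sh i.+1 i i.+1) (0 : int); shv (wt_idx i i.+1 i) (-2 : int).
rewrite (Sfun_spar i mu) SfunS; apply: (@qp_scale 1); first lia.
qring.
Qed.

Lemma EX_bi a : (0 < a <= n)%N -> a != i -> a != i.+1 ->
  Eop i * Xop a i - scal A (qp (- wt_idx i a i)) * (Xop a i * Eop i)
  = scal A (spar i) * - Xop a i.+1.
Proof.
move=> a0 ai aj; rewrite EX_coef; try lia.
rewrite /Xop opN opZ; apply: op_ext => [|mu].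
  by rewrite lat_addC shD.
shv (sh i i.+1 i) (1 : int); shv (sh i i.+1 i.-1) (0 : int).
shv (sh i i.+1 a) (0 : int); shv (wt_idx i a i) (-1 : int).
rewrite (Sfun_spar i mu) -[in RHS]mulrN; apply: (@qp_scale 0); first lia.
(* The two cases are a < i and a > i + 1; they give the same operator, but different powers of q on
   the way. *)
have [[-> ->]|[-> ->]] : (sh a i i = 0 /\ sh a i i.+1 = 0) \/
    (sh a i i = -1 /\ sh a i i.+1 = -1) by rewrite /sh; lia.
  qring.
qring.
Qed.

Lemma EX_aj b : (0 < b <= n)%N -> b != i -> b != i.+1 ->
  Eop i * Xop i.+1 b - scal A (qp (- wt_idx i i.+1 b)) * (Xop i.+1 b * Eop i)
  = scal A (spar i) * Xop i b.
Proof.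
move=> b0 bi bj; rewrite EX_coef; try lia.
rewrite /Xop opZ; apply: op_ext => [|mu]; first by rewrite shD.
shv (sh i i.+1 b) (0 : int); shv (sh i i.+1 b.-1) (0 : int).
shv (sh i i.+1 i.+1) (0 : int); shv (wt_idx i i.+1 b) (-1 : int).
rewrite (Sfun_spar i mu) SfunS; apply: (@qp_scale 1); first lia.
have [[-> ->]|[-> ->]] : (sh i.+1 b i = 0 /\ sh i.+1 b i.+1 = 1) \/
    (sh i.+1 b i = -1 /\ sh i.+1 b i.+1 = 0) by rewrite /sh; lia.
  qring.
qring.
Qed.

Lemma EX_0 a b : (0 < a <= n)%N -> (0 < b <= n)%N -> b != i -> a != i.+1 -> a != b ->
  Eop i * Xop a b - scal A (qp (- wt_idx i a b)) * (Xop a b * Eop i) = 0.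
Proof.
move=> a0 b0 bi aj ab; rewrite EX_coef; try lia.
rewrite -(op0 op (lat_add (sh i i.+1) (sh a b))); apply: opP => mu.
apply: (@eq_trans _ _ (qp 0 * 0)); last by rewrite mulr0.
have E e X : X = 0 -> qp e * X = qp 0 * 0 by move=> ->; rewrite !mulr0.
apply: E; shv (sh i i.+1 b) (0 : int).
have [bj|bj] := eqVneq b i.+1.
  subst b; shv (sh i i.+1 i.+1.-1) (1 : int).
  have [ai|ai] := eqVneq a i.
    subst a; shv (sh i i.+1 i) (1 : int); shv (sh i i.+1 i.+1) (0 : int).
    shv (wt_idx i i i.+1) (2 : int); qring.
  shv (sh i i.+1 a) (0 : int); shv (wt_idx i a i.+1) (1 : int).
  have [[-> ->]|[-> ->]] : (sh a i.+1 i = 1 /\ sh a i.+1 i.+1 = 0) \/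
    (sh a i.+1 i = 0 /\ sh a i.+1 i.+1 = -1) by rewrite /sh; lia.
    qring.
  qring.
shv (sh i i.+1 b.-1) (0 : int).
have [ai|ai] := eqVneq a i.
  subst a; shv (sh i i.+1 i) (1 : int); shv (wt_idx i i b) (1 : int).
  have [[-> ->]|[-> ->]] : (sh i b i = 1 /\ sh i b i.+1 = 1) \/
    (sh i b i = 0 /\ sh i b i.+1 = 0) by rewrite /sh; lia.
    qring.
  qring.
shv (sh i i.+1 a) (0 : int); shv (wt_idx i a b) (0 : int).
have [[-> ->]|[[-> ->]|[-> ->]]] : (sh a b i = 1 /\ sh a b i.+1 = 1) \/
  (sh a b i = 0 /\ sh a b i.+1 = 0) \/ (sh a b i = -1 /\ sh a b i.+1 = -1)
  by rewrite /sh; lia.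
- qring.
- qring.
qring.
Qed.

Lemma ET_coef k : (0 < k < n)%N -> Eop i * Top k - Top k * Eop i =
  op (fun mu => qp (wt mu i + wt mu i.+1 - k%:Z) * (Yfun i.+1 mu *
    (qp 1 * ((qp (- sh i i.+1 k.-1 *+ 2) - 1) * Yfun k mu +
                qdiff C (sh i i.+1 k) (sh i i.+1 k.-1) * Sfun k mu)
     - qp (-1) * ((qp (- sh i i.+1 k *+ 2) - 1) * Yfun k.+1 mu +
           qdiff C (sh i i.+1 k.+1) (sh i i.+1 k) * Sfun k.+1 mu)))) (sh i i.+1).
Proof.
move=> k0; rewrite /Eop /Top opM [X in _ - X]opM lat_addC opB.
apply: op_ext => [|mu]; first by rewrite lat_add0.
rewrite !Yfun_sh; try lia; rewrite lat_addr0 /= [qp (_ - k%:Z)]qpowD.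
ring.
Qed.

Lemma ET_i : Eop i * Top i - Top i * Eop i =
  scal A (spar i) * - (scal A (qn 2) * Xop i i.+1).
Proof.
rewrite ET_coef // opZ opN opZ; apply: op_ext => // mu.
shv (sh i i.+1 i) (1 : int); shv (sh i i.+1 i.+1) (0 : int).
shv (sh i i.+1 i.-1) (0 : int); rewrite SfunS (Sfun_spar i mu) qnum2.
rewrite [in RHS]mulrCA -[in RHS]mulrN; apply: (@qp_scale (-1)); first lia.
qring.
Qed.

Lemma ET_S : (i.+1 < n)%N -> Eop i * Top i.+1 - Top i.+1 * Eop i =
  scal A (spar i) * Xop i i.+1.
Proof.
move=> iS; rewrite ET_coef // opZ; apply: op_ext => // mu.
shv (sh i i.+1 i.+1) (0 : int); shv (sh i i.+1 i.+2) (0 : int).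
shv (sh i i.+1 i.+1.-1) (1 : int); rewrite (Sfun_spar i mu).
apply: (@qp_scale 0); first lia.
rewrite SfunS; qring.
Qed.

Lemma ET_P : (1 < i)%N -> Eop i * Top i.-1 - Top i.-1 * Eop i =
  scal A (spar i) * Xop i i.+1.
Proof.
move=> iS; rewrite ET_coef ?opZ; try lia; apply: op_ext => // mu.
shv (sh i i.+1 i.-1) (0 : int); shv (sh i i.+1 i.-1.-1) (0 : int).
shv (sh i i.+1 i.-1.+1) (1 : int); rewrite prednK; last lia.
rewrite (Sfun_spar i mu); apply: (@qp_scale (-2)); first lia.
qring.
Qed.

Lemma ET_0 k : (0 < k < n)%N -> k != i -> k != i.+1 -> k.+1 != i ->
  Eop i * Top k - Top k * Eop i = 0.
Proof.
move=> k0 ki kj kh; rewrite ET_coef // -(op0 op (sh i i.+1)); apply: opP => mu.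
shv (sh i i.+1 k) (0 : int); shv (sh i i.+1 k.-1) (0 : int).
shv (sh i i.+1 k.+1) (0 : int); rewrite !qdiffxx !mul0r !addr0.
by qpnorm; rewrite qp_lit !subrr !mul0r !mulr0 subrr !mulr0.
Qed.

End EopOnRootVectors.

(** * The commutators with [Fop i] and the matrix coefficients of f_i *)

Lemma FX_coef i a b : (0 < i < n)%N -> (0 < a <= n)%N -> (0 < b <= n)%N ->
  Fop i * Xop a b - Xop a b * Fop i =
  op (fun mu => qp (wt mu i + wt mu i.-1 - a%:Z - (a < b)%N%:Z - wt mu a + wt mu b)
    * (qp (sh i.+1 i b - sh i.+1 i a) * Yfun i mu *
         (qp (- sh i.+1 i b.-1 *+ 2) * Yfun b mu +
            qdiff C (sh i.+1 i b) (sh i.+1 i b.-1) * Sfun b mu)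
       - qp (sh a b i + sh a b i.-1) * Yfun b mu *
         (qp (- sh a b i.-1 *+ 2) * Yfun i mu +
            qdiff C (sh a b i) (sh a b i.-1) * Sfun i mu)))
  (lat_add (sh i.+1 i) (sh a b)).
Proof.
move=> i0 a0 b0; rewrite /Fop /Xop !opM.
rewrite [X in _ - op _ X]lat_addC opB; apply: opP => mu.
rewrite !Yfun_sh ?wt_sh; try lia.
by apply: qp_commutator; lia.
Qed.

Section FopOnGenerators.
Variable i : nat.
Hypothesis i0 : (0 < i < n)%N.

Lemma Xop_kop a b : (0 < a <= n)%N -> (0 < b <= n)%N ->
  Xop a b * kop i = op (fun mu =>
    qp (- a%:Z - (a < b)%N%:Z - wt mu a + wt mu b - wt mu i *+ 2 + wt mu i.-1
        + wt mu i.+1 - sh a b i *+ 2 + sh a b i.-1 + sh a b i.+1) * Yfun b mu)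
  (sh a b).
Proof.
move=> a0 b0; rewrite /Xop /kop opM; apply: op_ext => [|mu].
  by rewrite lat_addr0.
rewrite !wt_sh; try lia; rewrite mulrAC -qpowD.
by have E e e' (Y : K) : e = e' -> qp e * Y = qp e' * Y by [move=> ->];
  apply: E; lia.
Qed.

(** Here the commutator is untwisted. The factor q^(h_i) in the coproduct of f_i shows up as [kop i]
    on the right instead. *)
Lemma FX_t : Fop i * Xop i i.+1 - Xop i i.+1 * Fop i =
  scal A (spar i) * (- Top i * kop i).
Proof.
rewrite FX_coef; try lia.
rewrite /Top /kop opN opM opZ; apply: op_ext => [|mu].
  by rewrite shD shxx lat_addr0.
rewrite lat_addr0.
shv (sh i.+1 i i) (-1 : int); shv (sh i.+1 i i.+1) (0 : int).
shv (sh i.+1 i i.+1.-1) (-1 : int); shv (sh i i.+1 i) (1 : int).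
shv (sh i i.+1 i.-1) (0 : int).
rewrite (Sfun_spar i mu) SfunS; apply: (@qp_scaleN 1); first lia.
qring.
Qed.

Lemma FX_bj a : (0 < a <= n)%N -> a != i -> a != i.+1 ->
  Fop i * Xop a i.+1 - Xop a i.+1 * Fop i
  = scal A (spar i) * (- Xop a i * kop i).
Proof.
move=> a0 ai aj; rewrite FX_coef; try lia.
rewrite mulNr Xop_kop ?opN ?opZ; try lia; apply: op_ext => [|mu].
  by rewrite lat_addC shD.
shv (sh i.+1 i i.+1) (0 : int); shv (sh i.+1 i i.+1.-1) (-1 : int).
shv (sh i.+1 i a) (0 : int).
rewrite (Sfun_spar i mu) SfunS -[in RHS]mulrN.
have [[-> ->]|[-> ->]] : (sh a i.+1 i = 1 /\ sh a i.+1 i.-1 = 1) \/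
    (sh a i.+1 i = 0 /\ sh a i.+1 i.-1 = 0) by rewrite /sh; lia.
  apply: (@qp_scale 1); first by rewrite /sh; lia.
  qring.
apply: (@qp_scale 1); first by rewrite /sh; lia.
qring.
Qed.

Lemma FX_ai b : (0 < b <= n)%N -> b != i -> b != i.+1 ->
  Fop i * Xop i b - Xop i b * Fop i
  = scal A (spar i) * (Xop i.+1 b * kop i).
Proof.
move=> b0 bi bj; rewrite FX_coef; try lia.
rewrite Xop_kop ?opZ; try lia; apply: op_ext => [|mu]; first by rewrite shD.
shv (sh i.+1 i b) (0 : int); shv (sh i.+1 i b.-1) (0 : int).
shv (sh i.+1 i i) (-1 : int); rewrite (Sfun_spar i mu).
have [[-> ->]|[-> ->]] : (sh i b i = 1 /\ sh i b i.-1 = 0) \/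
    (sh i b i = 0 /\ sh i b i.-1 = -1) by rewrite /sh; lia.
  apply: (@qp_scale 0); first by rewrite /sh; lia.
  qring.
apply: (@qp_scale 0); first by rewrite /sh; lia.
qring.
Qed.

Lemma FX_0 a b : (0 < a <= n)%N -> (0 < b <= n)%N -> b != i.+1 -> a != i -> a != b ->
  Fop i * Xop a b - Xop a b * Fop i = 0.
Proof.
move=> a0 b0 bj ai ab; rewrite FX_coef; try lia.
rewrite -(op0 op (lat_add (sh i.+1 i) (sh a b))); apply: opP => mu.
apply: (@eq_trans _ _ (qp 0 * 0)); last by rewrite mulr0.
have E e X : X = 0 -> qp e * X = qp 0 * 0 by move=> ->; rewrite !mulr0.
apply: E; shv (sh i.+1 i b.-1) (0 : int); shv (sh i.+1 i a) (0 : int).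
have [bi|bi] := eqVneq b i.
  subst b; shv (sh i.+1 i i) (-1 : int).
  have [[-> ->]|[-> ->]] : (sh a i i = 0 /\ sh a i i.-1 = 1) \/
    (sh a i i = -1 /\ sh a i i.-1 = 0) by rewrite /sh; lia.
    qring.
  qring.
shv (sh i.+1 i b) (0 : int).
have [[-> ->]|[[-> ->]|[-> ->]]] : (sh a b i = 1 /\ sh a b i.-1 = 1) \/
  (sh a b i = 0 /\ sh a b i.-1 = 0) \/ (sh a b i = -1 /\ sh a b i.-1 = -1)
  by rewrite /sh; lia.
- qring.
- qring.
qring.
Qed.

Lemma FT_coef k : (0 < k < n)%N -> Fop i * Top k - Top k * Fop i =
  op (fun mu => qp (wt mu i + wt mu i.-1 - k%:Z) * (Yfun i mu *
    (qp 1 * ((qp (- sh i.+1 i k.-1 *+ 2) - 1) * Yfun k mu +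
                qdiff C (sh i.+1 i k) (sh i.+1 i k.-1) * Sfun k mu)
     - qp (-1) * ((qp (- sh i.+1 i k *+ 2) - 1) * Yfun k.+1 mu +
           qdiff C (sh i.+1 i k.+1) (sh i.+1 i k) * Sfun k.+1 mu)))) (sh i.+1 i).
Proof.
move=> k0; rewrite /Fop /Top !opM lat_addC opB.
apply: op_ext => [|mu]; first by rewrite lat_add0.
rewrite !Yfun_sh; try lia; rewrite lat_addr0 /= [qp (_ - k%:Z)]qpowD.
ring.
Qed.

Lemma FT_i : Fop i * Top i - Top i * Fop i =
  scal A (spar i) * (scal A (qn 2) * Xop i.+1 i * kop i).
Proof.
rewrite FT_coef // -mulrA Xop_kop ?opZ ?opZ; try lia; apply: op_ext => // mu.
shv (sh i.+1 i i) (-1 : int); shv (sh i.+1 i i.+1) (0 : int).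
shv (sh i.+1 i i.-1) (0 : int); rewrite SfunS (Sfun_spar i mu) qnum2.
apply: (@qp_scale2 1); first lia.
qring.
Qed.

Lemma FT_S : (i.+1 < n)%N -> Fop i * Top i.+1 - Top i.+1 * Fop i =
  scal A (spar i) * (- Xop i.+1 i * kop i).
Proof.
move=> iS; rewrite FT_coef // mulNr Xop_kop ?opN ?opZ; try lia.
apply: op_ext => // mu.
shv (sh i.+1 i i.+1) (0 : int); shv (sh i.+1 i i.+2) (0 : int).
shv (sh i.+1 i i.+1.-1) (-1 : int); shv (sh i.+1 i i) (-1 : int).
shv (sh i.+1 i i.-1) (0 : int).
rewrite (Sfun_spar i mu) SfunS -[in RHS]mulrN.
apply: (@qp_scale 2); first lia.
qring.
Qed.

Lemma FT_P : (1 < i)%N -> Fop i * Top i.-1 - Top i.-1 * Fop i =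
  scal A (spar i) * (- Xop i.+1 i * kop i).
Proof.
move=> iS; rewrite FT_coef ?mulNr ?Xop_kop ?opN ?opZ; try lia.
apply: op_ext => // mu.
shv (sh i.+1 i i.-1.-1) (0 : int).
have E : i.-1.+1 = i by rewrite prednK //; lia.
rewrite !E; shv (sh i.+1 i i.+1) (0 : int); shv (sh i.+1 i i.-1) (0 : int).
shv (sh i.+1 i i) (-1 : int).
rewrite (Sfun_spar i mu) -[in RHS]mulrN; apply: (@qp_scale 0); first lia.
qring.
Qed.

Lemma FT_0 k : (0 < k < n)%N -> k != i -> k != i.+1 -> k.+1 != i ->
  Fop i * Top k - Top k * Fop i = 0.
Proof.
move=> k0 ki kj kh; rewrite FT_coef // -(op0 op (sh i.+1 i)); apply: opP => mu.
shv (sh i.+1 i k) (0 : int); shv (sh i.+1 i k.-1) (0 : int).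
shv (sh i.+1 i k.+1) (0 : int); rewrite !qdiffxx !mul0r !addr0.
by qpnorm; rewrite qp_lit !subrr !mul0r !mulr0 subrr !mulr0.
Qed.

Lemma kop_Xop a b : (0 < a <= n)%N -> (0 < b <= n)%N ->
  kop i * Xop a b = scal A (qp (wt_idx i a b)) * (Xop a b * kop i).
Proof.
move=> a0 b0.
apply: (eq_trans _ (congr1 (fun t => scal A _ * t) (esym (Xop_kop a0 b0)))).
rewrite [RHS]opZ /Xop /kop [LHS]opM lat_add0.
apply: opP => mu; rewrite lat_addr0.
have E e1 e2 e3 e4 (Y : K) : e1 + e2 = e3 + e4 ->
    qp e1 * (qp e2 * Y) = qp e3 * (qp e4 * Y).
  by move=> Ee; rewrite !mulrA -!qpowD Ee.
by apply: E; rewrite /sh /wt_idx; lia.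
Qed.

Lemma kop_Top k : kop i * Top k = Top k * kop i.
Proof.
rewrite /kop /Top [LHS]opM [RHS]opM; apply: opP => mu.
by rewrite !lat_addr0 mulrC.
Qed.

Lemma kop_unit : exists k', kop i * k' = 1 /\ k' * kop i = 1.
Proof.
exists (op (fun mu => qp (- (- wt mu i *+ 2 + wt mu i.-1 + wt mu i.+1))) lat0).
rewrite /kop; split; rewrite opM -(op1 op) lat_addr0; apply: opP => mu.
  by rewrite lat_addr0 qpowK.
by rewrite lat_addr0 mulrC qpowK.
Qed.

End FopOnGenerators.
End ShiftRealization.

(** * The defining relations for the operators *)

(** Proves an identity modulo known equations: the cofactors are supplied by hand and [ring]
    verifies the combination. *)
Lemma lincomb1 (R : pzRingType) (A a a' x y : R) :
  a = a' -> x - y = (a - a') * A -> x = y.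
Proof. by move=> ->; rewrite subrr mul0r => /eqP; rewrite subr_eq0 => /eqP. Qed.

Lemma lincomb2 (R : pzRingType) (A B a a' b b' x y : R) :
  a = a' -> b = b' -> x - y = (a - a') * A + (b - b') * B -> x = y.
Proof.
by move=> -> ->; rewrite !subrr !mul0r addr0 => /eqP; rewrite subr_eq0 => /eqP.
Qed.

Lemma lincomb3 (R : pzRingType) (A B D a a' b b' c c' x y : R) :
  a = a' -> b = b' -> c = c' ->
  x - y = (a - a') * A + (b - b') * B + (c - c') * D -> x = y.
Proof.
by move=> -> -> ->; rewrite !subrr !mul0r !addr0 => /eqP; rewrite subr_eq0 => /eqP.
Qed.

Lemma eq_big_nat_cond (V : nmodType) a b (P : pred nat) (F G : nat -> V) :
  (forall i, (a <= i)%N -> F i = G i) ->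
  \sum_(a <= i < b | P i) F i = \sum_(a <= i < b | P i) G i.
Proof.
move=> FG; rewrite [LHS]big_nat_cond [RHS]big_nat_cond.
by apply: eq_bigr => i /andP[/andP[ai _] _]; apply: FG.
Qed.

Section QuantumIntegers.
Variable C : numFieldType.
Notation qp := (qpow C).
Notation qn := (qnum C).
Notation delta := (delta C).

Lemma qnumS_l m : qn m.+1 = qp 1 * qn m + qp (- m%:Z).
Proof.
apply: (K_mulfI (@delta_neq0 C)); rewrite mulrDr mulrCA !qnumE /delta.
have -> : qp m.+1 = qp 1 * qp m by rewrite -qpowD; congr qpow; lia.
have -> : qp (- m.+1%:Z) = qp (- m%:Z) * qp (-1) by rewrite -qpowD; congr qpow; lia.
ring.
Qed.

Lemma qnumS_r m : qn m.+1 = qp (-1) * qn m + qp m.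
Proof.
apply: (K_mulfI (@delta_neq0 C)); rewrite mulrDr mulrCA !qnumE /delta.
have -> : qp m.+1 = qp 1 * qp m by rewrite -qpowD; congr qpow; lia.
have -> : qp (- m.+1%:Z) = qp (- m%:Z) * qp (-1) by rewrite -qpowD; congr qpow; lia.
ring.
Qed.

End QuantumIntegers.

Section SumsOverQuotients.
Variables (R : comPzRingType) (r : seq nat) (N N' t x : R) (c u : nat -> R).
Hypothesis NN' : N * N' = 1.

Lemma sum_mul_div :
  N * \sum_(j <- r) (x * c j * N') * (t * u j) = t * (x * \sum_(j <- r) c j * u j).
Proof.
rewrite !mulr_sumr; apply: eq_bigr => j _.
have -> : N * (x * c j * N' * (t * u j)) = N * N' * (t * (x * (c j * u j))) by ring.
by rewrite NN' mul1r.
Qed.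

Lemma sum_mul_divC :
  N * \sum_(j <- r) (c j * x * N') * (t * u j) = t * (x * \sum_(j <- r) c j * u j).
Proof.
by rewrite -sum_mul_div; congr (_ * _); apply: eq_bigr => j _; rewrite [c j * x]mulrC.
Qed.

End SumsOverQuotients.

Section DefiningRelations.
Variables (C : numFieldType) (A : alg (K_hn C)) (op : shift_rep A) (n : nat) (alpha0 : C) (q_gt1 : bool) (y : nat -> C).
Hypothesis n_gt3 : (3 < n)%N.
Notation K := (K_hn C).
Notation qp := (qpow C).
Notation qn := (qnum C).
Notation delta := (delta C).
Notation aK := (alpha0_K alpha0).
Notation g := (gamma_h C n q_gt1).
Notation Xop := (Xop op n alpha0 q_gt1 y).
Notation Top := (Top op n alpha0 q_gt1 y).
Notation Yfun := (Yfun n alpha0 q_gt1 y).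
Notation Sfun := (Sfun n alpha0 q_gt1 y).
Notation wt := (wt n).
Notation sc := (scal A).

Lemma qnumB i : (i <= n)%N -> qn (n - i) + qp (- n%:Z) * qn i = qp (- i%:Z) * qn n.
Proof.
move=> le_in; apply: (K_mulfI (@delta_neq0 C)).
rewrite mulrDr [delta * (_ * qn i)]mulrCA [delta * (_ * qn n)]mulrCA !qnumE.
rewrite !mulrBr -!qpowD -subzn //.
have -> : - (n%:Z - i%:Z) = - n%:Z + i%:Z by lia.
have -> : n%:Z - i%:Z = - i%:Z + n%:Z by lia.
have -> : - i%:Z - n%:Z = - n%:Z - i%:Z by lia.
ring.
Qed.

Let Z : K := qp n * aK * g.

Lemma qn_divK : qn n / qn n = 1.
Proof. by rewrite divrr // qnum_unit //; lia. Qed.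

Lemma Sfun0 mu : Sfun 0 mu = aK * ((g - qp n) / qn n).
Proof. by rewrite /Sfun /spar /zpar /wt /= mulr0 addr0 qpow0 mulr1. Qed.

Lemma Sfunn mu : Sfun n mu = Sfun 0 mu + delta * Z.
Proof.
rewrite Sfun0 /Sfun /spar /zpar /wt ltnn andbF oppr0 mul0rn qpow0 mulr1.
by rewrite (_ : (n == 0%N) = false) //; lia.
Qed.

(** The second condition on the end values. It is what makes the scalars [s2_scalar] and
    [Casimir_scalar] come out. *)
Lemma Sfunn_alpha0 mu : qp (- n%:Z *+ 2) * Sfun n mu - Sfun 0 mu = delta * aK.
Proof.
have nn := qn_divK; apply: (@K_mulfI _ (qn n)) => [n0|].
  by move: nn; rewrite n0 mul0r => /eqP; rewrite eq_sym oner_eq0.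
have -> : qp (- n%:Z *+ 2) = qp (- n%:Z) * qp (- n%:Z) by rewrite -qpowD mulr2n.
have E := qnumE C n; have F := qpowK C n.
rewrite Sfunn Sfun0 /Z; move: nn E F.
move: (qnum C n) (qnum C n)^-1 (qpow C n) (qpow C (- n%:Z)) delta aK g.
move=> N N' p p' d a c nn E F.
have -> : N * (d * a) = d * N * a by ring.
have -> : N * (p' * p' * (a * ((c - p) * N') + d * (p * a * c)) - a * ((c - p) * N'))
  = N * N' * (p' * p' * (a * (c - p)) - a * (c - p)) + d * N * (p * p' * p' * a * c).
  by ring.
by rewrite nn E F; ring: F.
Qed.

Lemma sum_Yfun a b mu : (0 < a <= b)%N ->
  delta * (\sum_(a <= k < b) Yfun k mu) = Sfun b.-1 mu - Sfun a.-1 mu.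
Proof.
move=> /andP[a0 ab]; rewrite mulr_sumr.
transitivity (\sum_(a <= k < b) (Sfun k.+1.-1 mu - Sfun k.-1 mu)).
  by apply: eq_bigr => k _; rewrite YfunE.
by rewrite (telescope_sumr (fun k => Sfun k.-1 mu)).
Qed.

(** The deformed trace: the sum telescopes to (S_n - S_0) / delta, which is the same scalar at every
    mu. *)
Lemma sum_Yfun_all mu : \sum_(1 <= k < n.+1) Yfun k mu = Z.
Proof.
apply: (K_mulfI (@delta_neq0 C)); rewrite sum_Yfun // Sfunn.
by rewrite addrC addKr.
Qed.

Definition tfun (k : nat) (mu : lattice) : K :=
  qp (- k%:Z) * (qp 1 * Yfun k mu - qp (-1) * Yfun k.+1 mu).

(** Summation by parts in advance: the weighted t_k is Y_k up to a difference of consecutive terms,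
    so that sums over k telescope. *)
Lemma qnum_tfun k mu : (0 < k)%N -> qn k * tfun k mu =
  Yfun k mu - (qn k * qp (- k.+1%:Z) * Yfun k.+1 mu - qn k.-1 * qp (- k%:Z) * Yfun k mu).
Proof.
case: k => // k _; rewrite /tfun /=.
have -> : qp (- k.+2%:Z) = qp (- k.+1%:Z) * qp (-1) by rewrite -qpowD; congr qpow; lia.
have F : qp (- k.+1%:Z) * qp 1 * qp k = 1.
  by rewrite -!qpowD (_ : _ + _ = 0) ?qpow0 //; lia.
rewrite qnumS_r; have := qpowK C 1; move: F.
move: (qp k) (qp (- k.+1%:Z)) (qp 1) (qp (-1)) (qn k) (Yfun _ _) (Yfun _ _).
move=> p p' q q' N Y1 Y2 F E; apply: (lincomb2 (A := N * p' * Y2) (B := Y2) E F); ring.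
Qed.

Lemma qnum_tfun_rev k mu : (0 < k < n)%N -> qn (n - k) * tfun k mu =
  - qp (- n%:Z) * Yfun k mu - (qn (n - k) * qp (- k.+1%:Z) * Yfun k.+1 mu
     - qn (n - k.-1) * qp (- k%:Z) * Yfun k mu).
Proof.
case: k => // k /andP[_ kn]; rewrite /tfun /=.
have -> : qp (- k.+2%:Z) = qp (- k.+1%:Z) * qp (-1) by rewrite -qpowD; congr qpow; lia.
have -> : (n - k)%N = (n - k.+1).+1 by lia.
have F : qp (- (n - k.+1)%N%:Z) * qp (- k.+1%:Z) = qp (- n%:Z).
  by rewrite -qpowD; congr qpow; lia.
rewrite qnumS_l -F.
move: (qp (- k.+1%:Z)) (qp 1) (qp (-1)) (qn _) (Yfun _ _) (Yfun _ _).
move=> p q q' N Y1 Y2; ring.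
Qed.

Lemma sum_qnum_tfun i mu : (0 < i)%N -> \sum_(1 <= k < i) qn k * tfun k mu =
  \sum_(1 <= k < i) Yfun k mu - qn i.-1 * qp (- i%:Z) * Yfun i mu.
Proof.
move=> i0; rewrite (eq_big_nat _ _ (F2 := fun k => Yfun k mu -
   ((fun k => qn k.-1 * qp (- k%:Z) * Yfun k mu) k.+1
    - (fun k => qn k.-1 * qp (- k%:Z) * Yfun k mu) k))).
  rewrite sumrB telescope_sumr //= /qnum big_ord0 !mul0r subr0.
  by [].
by move=> k /andP[k0 _]; rewrite qnum_tfun.
Qed.

Lemma sum_qnum_tfun_rev i mu : (0 < i < n)%N ->
  \sum_(i <= k < n) qn (n - k) * tfun k mu =
  qn (n - i.-1) * qp (- i%:Z) * Yfun i mu - qp (- n%:Z) * \sum_(i <= k < n.+1) Yfun k mu.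
Proof.
move=> /andP[i0 i_n]; rewrite (eq_big_nat _ _ (F2 := fun k => - qp (- n%:Z) * Yfun k mu -
   ((fun k => qn (n - k.-1) * qp (- k%:Z) * Yfun k mu) k.+1
    - (fun k => qn (n - k.-1) * qp (- k%:Z) * Yfun k mu) k))).
  rewrite sumrB telescope_sumr ?(ltnW i_n) // -mulr_sumr big_nat_recr ?(ltnW i_n) //=.
  have -> : (n - n.-1 = 1)%N by lia.
  by rewrite qnum1; ring.
by move=> k /andP[k0 kn]; rewrite qnum_tfun_rev //; lia.
Qed.

(** At q = 1 the right side is y_1 - alpha0 / n: this combination of the traceless t_k recovers the
    first diagonal entry, and [sum_t_right] does the same for the last one. *)
Lemma sum_t_left mu : \sum_(1 <= k < n) (qn (n - k) / qn n) * tfun k mu =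
  qp (-1) * Yfun 1 mu - qp (- n%:Z) * Z / qn n.
Proof.
rewrite (eq_bigr (fun k => (qn n)^-1 * (qn (n - k) * tfun k mu))) => [|k _]; last first.
  by rewrite [RHS]mulrA [_^-1 * _]mulrC.
rewrite -mulr_sumr sum_qnum_tfun_rev ?sum_Yfun_all /= ?subn0; last lia.
have nn := qn_divK; move: nn; move: (qn n) (qn n)^-1 => N N' nn.
rewrite mulrBr; ring: nn.
Qed.

Lemma sum_t_right mu : \sum_(1 <= k < n) (qn k / qn n) * tfun k mu =
  Z / qn n - qp (1 - n%:Z) * Yfun n mu.
Proof.
rewrite (eq_bigr (fun k => (qn n)^-1 * (qn k * tfun k mu))) => [|k _]; last first.
  by rewrite [RHS]mulrA [_^-1 * _]mulrC.
rewrite -mulr_sumr sum_qnum_tfun; last lia.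
have ZE := sum_Yfun_all mu; rewrite big_nat_recr in ZE; last lia.
have -> : \sum_(1 <= k < n) Yfun k mu = Z - Yfun n mu by rewrite -ZE addrK.
clear ZE.
have nn := qn_divK; move: nn.
have -> : qn n = qp (-1) * qn n.-1 + qp n.-1 by rewrite -qnumS_r prednK //; lia.
have -> : qp (1 - n%:Z) = qp 1 * qp (- n%:Z) by rewrite -qpowD.
have F : qp 1 * qp (- n%:Z) * qp n.-1 = 1.
  by rewrite -!qpowD (_ : _ + _ = 0) ?qpow0 //; lia.
have := qpowK C 1; move: F.
move: (qp n.-1) (qp (- n%:Z)) (qp 1) (qp (-1)) (qn n.-1) (_^-1) (Yfun _ _) Z.
move=> p p' q q' N N' Yn z F E nn.
have -> : z - Yn - N * p' * Yn = z - q * p' * (q' * N + p) * Yn.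
  by apply: (lincomb2 (A := N * p' * Yn) (B := Yn) E F); ring.
move: nn; move: (q' * N + p) => D nn; ring: nn.
Qed.

Lemma XX_coef a b c d : (0 < a <= n)%N -> (0 < b <= n)%N -> (0 < c <= n)%N ->
  (0 < d <= n)%N -> Xop a b * Xop c d = op (fun mu =>
    qp (- a%:Z - (a < b)%N%:Z - wt mu a + wt mu b - c%:Z - (c < d)%N%:Z - wt mu c
        + wt mu d - sh a b c + sh a b d) *
     (Yfun b mu * (qp (- sh a b d.-1 *+ 2) * Yfun d mu +
        qdiff C (sh a b d) (sh a b d.-1) * Sfun d mu))) (lat_add (sh a b) (sh c d)).
Proof.
move=> a0 b0 c0 d0; rewrite /Xop opM; apply: opP => mu.
rewrite Yfun_sh ?wt_sh //; try lia.
have E e1 e2 e3 (Y Y' : K) : e1 + e2 = e3 ->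
    qp e1 * Y * (qp e2 * Y') = qp e3 * (Y * Y').
  by move=> <-; rewrite qpowD mulrACA.
by apply: E; lia.
Qed.

Lemma rel_2w1_wn2 : Xop 1 n * Xop 1 n.-1 = sc (qp (-1)) * (Xop 1 n.-1 * Xop 1 n).
Proof.
rewrite XX_coef; try lia.
rewrite [Xop 1 n.-1 * Xop 1 n]XX_coef; try lia; rewrite opZ lat_addC.
apply: opP => mu.
shv (sh 1 n n.-1) (1 : int); shv (sh 1 n n.-1.-1) (1 : int).
shv (sh 1 n.-1 n) (0 : int); shv (sh 1 n.-1 n.-1) (0 : int).
rewrite !qdiffxx !mul0r !addr0.
have E e1 e2 e3 e4 (Y1 Y2 : K) : e1 + e2 = e3 + e4 ->
  qp e1 * (Y1 * (qp e2 * Y2)) = qp (-1) * (qp e3 * (Y2 * (qp e4 * Y1))) -> True.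
  by [].
have F e1 e2 e3 e4 (Y1 Y2 : K) : e1 + e2 = -1 + e3 + e4 ->
  qp e1 * (Y1 * (qp e2 * Y2)) = qp (-1) * (qp e3 * (Y2 * (qp e4 * Y1))).
  move=> Ee; have -> : qp e1 * (Y1 * (qp e2 * Y2)) = qp (e1 + e2) * Y1 * Y2
    by rewrite qpowD; ring.
  by rewrite Ee !qpowD; ring.
by apply: F; rewrite /sh; lia.
Qed.

Lemma rel_w2_2wn1 : Xop 1 n * Xop 2 n = sc (qp (-1)) * (Xop 2 n * Xop 1 n).
Proof.
rewrite XX_coef; try lia.
rewrite [Xop 2 n * Xop 1 n]XX_coef; try lia; rewrite opZ lat_addC.
apply: opP => mu.
shv (sh 1 n n.-1) (1 : int); shv (sh 1 n n) (0 : int).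
shv (sh 2 n n) (0 : int); shv (sh 2 n n.-1) (1 : int).
have E e1 e2 (Y : K) : e1 = -1 + e2 -> qp e1 * Y = qp (-1) * (qp e2 * Y).
  by move=> ->; rewrite qpowD mulrA.
by apply: E; rewrite /sh; lia.
Qed.

Lemma rel_w2_wn2 : sc (qp 1) * (Xop 1 n * Xop 2 n.-1)
  + sc (qp (-1)) * (Xop 2 n.-1 * Xop 1 n) - Xop 1 n.-1 * Xop 2 n
  - Xop 2 n * Xop 1 n.-1 = 0.
Proof.
rewrite !XX_coef; try lia.
have l0 : lat_add (sh 1 n) (sh 2 n.-1) = lat_add (sh 2 n.-1) (sh 1 n).
  exact: lat_addC.
have l1 : lat_add (sh 1 n.-1) (sh 2 n) = lat_add (sh 2 n.-1) (sh 1 n).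
  by apply/funext => k; rewrite /lat_add /sh; lia.
have l2 : lat_add (sh 2 n) (sh 1 n.-1) = lat_add (sh 2 n.-1) (sh 1 n).
  by apply/funext => k; rewrite /lat_add /sh; lia.
rewrite l0 l1 l2 !opZ opD !opB -(op0 op (lat_add (sh 2 n.-1) (sh 1 n))).
apply: opP => mu.
shv (sh 1 n n.-1) (1 : int); shv (sh 1 n n.-1.-1) (1 : int).
shv (sh 2 n.-1 n) (0 : int); shv (sh 2 n.-1 n.-1) (0 : int).
shv (sh 1 n.-1 n) (0 : int); shv (sh 1 n.-1 n.-1) (0 : int).
shv (sh 2 n n.-1) (1 : int); shv (sh 2 n n.-1.-1) (1 : int).
rewrite !qdiffxx !mul0r !addr0.
have F e1 e2 e3 e4 e5 e6 e7 e8 (Y1 Y2 : K) :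
  1 + e1 + e2 = e5 + e6 -> -1 + e3 + e4 = e5 + e6 -> e7 + e8 = e5 + e6 ->
  qp 1 * (qp e1 * (Y1 * (qp e2 * Y2))) + qp (-1) * (qp e3 * (Y2 * (qp e4 * Y1)))
  - qp e5 * (Y2 * (qp e6 * Y1)) - qp e7 * (Y1 * (qp e8 * Y2)) = 0.
  move=> E1 E2 E3.
  have -> : qp 1 * (qp e1 * (Y1 * (qp e2 * Y2))) = qp (1 + e1 + e2) * Y1 * Y2
    by rewrite !qpowD; ring.
  have -> : qp (-1) * (qp e3 * (Y2 * (qp e4 * Y1))) = qp (-1 + e3 + e4) * Y1 * Y2
    by rewrite !qpowD; ring.
  have -> : qp e7 * (Y1 * (qp e8 * Y2)) = qp (e7 + e8) * Y1 * Y2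
    by rewrite !qpowD; ring.
  by rewrite E1 E2 E3 qpowD; ring.
by apply: F; rewrite /sh; lia.
Qed.

Lemma Top_left :
  \sum_(1 <= k < n) sc (qn (n - k) / qn n) * Top k =
  op (fun mu => qp (-1) * Yfun 1 mu - qp (- n%:Z) * Z / qn n) lat0.
Proof.
under eq_bigr => k _ do rewrite /Top opZ.
by rewrite op_sum; apply: opP => mu; rewrite -sum_t_left.
Qed.

Lemma Top_right :
  \sum_(1 <= k < n) sc (qn k / qn n) * Top k =
  op (fun mu => Z / qn n - qp (1 - n%:Z) * Yfun n mu) lat0.
Proof.
under eq_bigr => k _ do rewrite /Top opZ.
by rewrite op_sum; apply: opP => mu; rewrite -sum_t_right.
Qed.

Lemma sum_XX_left :
  \sum_(2 <= k < n) sc (qp (k%:Z - 2)) * (Xop 1 k * Xop k n) =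
  op (fun mu => qp (- wt mu 1 + wt mu n - 5) *
        ((Z - Yfun 1 mu - Yfun n mu) * Yfun n mu)) (sh 1 n).
Proof.
rewrite (eq_big_nat _ _ (F2 := fun k =>
  op (fun mu => qp (- wt mu 1 + wt mu n - 5) * (Yfun k mu * Yfun n mu)) (sh 1 n))).
  rewrite op_sum; apply: opP => mu; rewrite -mulr_sumr -mulr_suml.
  rewrite -(sum_Yfun_all mu) big_nat_recr; last lia.
  rewrite big_ltn; last lia.
  by rewrite /=; congr (_ * (_ * _)); ring.
move=> k kn; rewrite XX_coef; try lia.
rewrite opZ shD; apply: opP => mu.
shv (sh 1 k n) (0 : int); shv (sh 1 k n.-1) (0 : int).
rewrite qdiffxx mul0r !addr0.
have F e1 e2 e3 e4 (Y1 Y2 : K) : e1 + e2 + e3 = e4 ->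
  qp e1 * (qp e2 * (Y1 * (qp e3 * Y2))) = qp e4 * (Y1 * Y2).
  by move=> <-; rewrite !qpowD; ring.
by apply: F; rewrite /sh; lia.
Qed.

Lemma sum_sc_l (c : nat -> K) (T : nat -> A) (X : A) :
  \sum_(1 <= k < n) sc (c k) * (T k * X) = (\sum_(1 <= k < n) sc (c k) * T k) * X.
Proof. by rewrite big_distrl; apply: eq_bigr => k _; apply: mulrA. Qed.

Lemma sum_sc_r (c : nat -> K) (T : nat -> A) (X : A) :
  \sum_(1 <= k < n) sc (c k) * (X * T k) = X * (\sum_(1 <= k < n) sc (c k) * T k).
Proof.
rewrite big_distrr; apply: eq_bigr => k _.
by rewrite /= [RHS]mulrA -(scalC (c k) X) -mulrA.
Qed.

Lemma qn_pred : qp (-1) * qn n = qn n.-1 + qp (- n%:Z).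
Proof.
have -> : qn n = qn n.-1.+1 by rewrite prednK //; lia.
rewrite qnumS_l mulrDr mulrA -!qpowD addNr qpow0 mul1r.
by congr (_ + qp _); lia.
Qed.

Lemma qn_pred_r : qp 1 * qn n = qn n.-1 + qp n.
Proof.
have -> : qn n = qn n.-1.+1 by rewrite prednK //; lia.
rewrite qnumS_r mulrDr mulrA -!qpowD subrr qpow0 mul1r.
by congr (_ + qp _); lia.
Qed.

Lemma mul_divK (u v : K) : u * qn n = v -> u = v / qn n.
Proof. by move=> <-; rewrite -mulrA qn_divK mulr1. Qed.

(** In s^1 the products of Y_1 with Y_n and the squares of Y_n cancel. This is the scalar that
    remains in front of Y_n, and hence the origin of the constant in that relation. *)
Lemma s1_scalar mu :
  Z * qp (-1) - qp (- n%:Z) * Z / qn n - qp n * Z / qn n + Sfun n mu =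
  aK * qp n * ((qn n.-1 * g - 1) / qn n).
Proof.
rewrite Sfunn Sfun0 /Z (mul_divK qn_pred) (mul_divK (qnumE C n)).
have := qpowK C n.
move: (qp n) (qp (- n%:Z)) (qn n)^-1 (qn n.-1) aK g => p p' i N1 a c pp.
ring: pp.
Qed.

Lemma rel_s1 :
  \sum_(2 <= k < n) sc (qp (k%:Z - 2)) * (Xop 1 k * Xop k n)
  + sc (qp (-2)) * \sum_(1 <= k < n) sc (qn (n - k) / qn n) * (Top k * Xop 1 n)
  - sc (qp (n%:Z - 2)) * \sum_(1 <= k < n) sc (qn k / qn n) * (Xop 1 n * Top k)
  = sc (aK * qp (n%:Z - 2) * ((qn n.-1 * g - 1) / qn n)) * Xop 1 n.
Proof.
rewrite sum_XX_left.
rewrite sum_sc_l sum_sc_r Top_left Top_right /Xop !opM lat_add0 lat_addr0 !opZ opD opB.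
apply: opP => mu; rewrite lat_addr0 Yfun_sh; try lia.
shv (sh 1 n n) (0 : int); shv (sh 1 n n.-1) (1 : int).
have [-> ->] : (1 < n)%N%:Z = 1 /\ qp (- 1%:Z - 1 - wt mu 1 + wt mu n) =
    qp (-2) * qp (- wt mu 1 + wt mu n) by rewrite -qpowD; split; [|congr qpow]; lia.
have -> : qp (- wt mu 1 + wt mu n - 5) = qp (- wt mu 1 + wt mu n) * qp (-5).
  by rewrite -qpowD.
have -> : qp (1 - n%:Z) = qp 1 * qp (- n%:Z) by rewrite -qpowD.
have -> : qp (n%:Z - 2) = qp n%:Z * qp (-2) by rewrite -qpowD.
rewrite (qdiff_simp C) -[qp (-1 *+ 2)]/(qp (-2)).
have -> : qp (-5) = qp (-2) * qp (-2) * qp (-1) by rewrite -!qpowD.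
have -> : qp (-2) = qp (-1) * qp (-1) by rewrite -!qpowD.
have S := s1_scalar mu.
have pq : (qp n * qp (- n%:Z)) * (qp 1 * qp (-1)) = 1 by rewrite !qpowK mulr1.
move: pq S.
move: (qp (- wt mu 1 + wt mu n)) (qp n) (qp (- n%:Z)) (qp 1) (qp (-1)) => G p p' q q'.
move: (Yfun 1 mu) (Yfun n mu) (Sfun n mu) Z (qn n)^-1 (qn n.-1) aK g.
move=> Y1 Yn Sn z i N1 a c pq S.
apply: (lincomb2 (A := G * q' * q' * q' * q' * Yn)
  (B := G * q' * q' * q' * q' * Yn * (q' * Yn + Sn)) S pq); ring.
Qed.

Lemma rel_s2_term k : (1 < k < n)%N ->
  sc (qp (2 - k%:Z)) * (Xop k n * Xop 1 k) =
  op (fun mu => qp (- wt mu 1 + wt mu n) * Yfun n mu *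
     (qp (- k%:Z *+ 2) * (Yfun k mu - qp (-1) * Sfun k mu))) (sh 1 n).
Proof.
move=> kn; rewrite XX_coef; try lia.
rewrite opZ lat_addC shD; apply: opP => mu.
shv (sh k n k) (1 : int); shv (sh k n k.-1) (0 : int); rewrite (qdiff_simp C).
have F e1 e2 e3 e4 (Y1 Y2 S : K) : e1 + e2 = e3 + e4 ->
  qp e1 * (qp e2 * (Y1 * (1 * Y2 + - qp (-1) * S))) =
  qp e3 * Y1 * (qp e4 * (Y2 - qp (-1) * S)).
  by move=> E; rewrite mulrA -qpowD E qpowD; ring.
rewrite -[qp (- 0 *+ 2)]/(qp 0) qpow0.
by apply: F; rewrite /sh; lia.
Qed.

(** Its consecutive differences are, up to [delta] and a power of q, the terms of the products
    [Xop k n * Xop 1 k] and [Xop i j * Xop j i], which makes their sums telescope. *)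
Definition wfun (k : nat) (mu : lattice) : K := qp (- k%:Z *+ 2) * Sfun k mu.

Lemma wfun_step k mu : (0 < k)%N ->
  delta * (qp (- k%:Z *+ 2) * (Yfun k mu - qp (-1) * Sfun k mu)) =
  qp (-2) * (wfun k mu - wfun k.-1 mu).
Proof.
case: k => // k _; rewrite /wfun /=.
have E := YfunE n alpha0 q_gt1 y k.+1 mu.
have -> : qp (- k%:Z *+ 2) = qp 1 * qp 1 * qp (- k.+1%:Z *+ 2).
  by rewrite -!qpowD; congr qpow; lia.
rewrite mulrCA mulrBr E /=.
have -> : qp (-2) = qp (-1) * qp (-1) by rewrite -!qpowD.
have qq := qpowK C 1; rewrite /delta.
move: (qp (- k.+1%:Z *+ 2)) (qp 1) (qp (-1)) (Sfun _ _) (Sfun _ _) qq => r q q' S1 S0 qq.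
by ring: qq.
Qed.

Lemma s2_scalar mu :
  qp (- n%:Z *+ 2) * Sfun n mu - qp (-1) * qp (-1) * Sfun 0 mu
    - (qp (-1) * qp (- n%:Z) * delta * Z / qn n) *+ 2 =
  delta * (aK * qp (-1) * ((qn n.-1 - g) / qn n)).
Proof.
have -> : qp (- n%:Z *+ 2) * Sfun n mu = Sfun 0 mu + delta * aK.
  by rewrite -(Sfunn_alpha0 mu) addrC subrK.
rewrite Sfun0 /Z /delta.
have := qn_pred_r; have := qn_divK; have := qpowK C 1; have := qpowK C n.
move: (qp n) (qp (- n%:Z)) (qn n) (qn n)^-1 (qn n.-1) aK g (qp 1) (qp (-1)).
move=> p p' N i N1 a c q q' pp qq Ni E.
have -> : N1 = q * N - p by rewrite E addrK.
apply: (lincomb3 (A := - (c * (q - q') * a * q' * i) *+ 2)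
  (B := - ((q - q') * a * N * i) - a * (c - p) * i) (D := - ((q - q') * a)) pp qq Ni).
ring.
Qed.

Lemma rel_s2 :
  \sum_(2 <= k < n) sc (qp (2 - k%:Z)) * (Xop k n * Xop 1 k)
  - sc (qp (1 - n%:Z)) * \sum_(1 <= k < n) sc (qn k / qn n) * (Top k * Xop 1 n)
  + sc (qp 1) * \sum_(1 <= k < n) sc (qn (n - k) / qn n) * (Xop 1 n * Top k)
  = sc (aK * qp 1 * ((qn n.-1 - g) / qn n)) * Xop 1 n.
Proof.
rewrite (eq_big_nat _ _ rel_s2_term) op_sum sum_sc_l sum_sc_r Top_left Top_right.
rewrite /Xop !opM lat_add0 lat_addr0 !opZ opB opD.
apply: opP => mu; rewrite lat_addr0 Yfun_sh; try lia.
shv (sh 1 n 1) (1 : int); shv (sh 1 n 1.-1) (0 : int).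
have [-> ->] : (1 < n)%N%:Z = 1 /\ qp (- 1%:Z - 1 - wt mu 1 + wt mu n) =
    qp (-2) * qp (- wt mu 1 + wt mu n) by rewrite -qpowD; split; [|congr qpow]; lia.
rewrite -mulr_sumr; set V := \sum_(2 <= k < n) _.
have VE : delta * V = qp (-2) * (wfun n.-1 mu - wfun 1 mu).
  rewrite mulr_sumr (eq_big_nat _ _ (F2 := fun k => qp (-2) *
     (wfun k.+1.-1 mu - wfun k.-1 mu))) => [|k kn]; last by rewrite wfun_step //; lia.
  rewrite -mulr_sumr (telescope_sumr (fun k => wfun k.-1 mu)) //; lia.
apply: (K_mulfI (@delta_neq0 C)).
have -> : qp (1 - n%:Z) = qp 1 * qp (- n%:Z) by rewrite -qpowD.
rewrite (qdiff_simp C) -[qp (- 0 *+ 2)]/(qp 0) qpow0.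
have S := s2_scalar mu.
have key : delta * V - qp 1 * qp (- n%:Z) * qp (-2) *
     (delta * Z / qn n - qp 1 * qp (- n%:Z) * (delta * Yfun n mu))
   + qp 1 * qp (-2) * (qp (-1) * (delta * Yfun 1 mu - qp (-1) * delta * Sfun 1 mu)
     - qp (- n%:Z) * delta * Z / qn n)
   = delta * aK * qp 1 * qp (-2) * ((qn n.-1 - g) / qn n).
  rewrite VE !YfunE /wfun /=.
  have -> : qp (- n.-1%:Z *+ 2) = qp 1 * qp 1 * (qp (- n%:Z) * qp (- n%:Z)).
    by rewrite -!qpowD; congr qpow; lia.
  move: S.
  have -> : qp (- n%:Z *+ 2) = qp (- n%:Z) * qp (- n%:Z) by rewrite -qpowD mulr2n.
  have -> : qp (- 1%:Z *+ 2) = qp (-1) * qp (-1) by rewrite -qpowD.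
  have := qpowK C 1; rewrite /delta.
  move: (qp (- n%:Z)) (qp 1) (qp (-1)) (qn n)^-1 (qn n.-1) aK g Z => p' q q' i N1 a c z.
  move: (Sfun n mu) (Sfun 0 mu) (Sfun 1 mu) (Sfun n.-1 mu) => Sn S0 S1 Sm qq S.
  by apply: (lincomb1 (A := 1) S); ring: qq.
by apply: (lincomb1 (A := qp (- wt mu 1 + wt mu n) * Yfun n mu) key); ring.
Qed.

Lemma XX_diag i j : (0 < i <= n)%N -> (0 < j <= n)%N -> i != j ->
  sc (qp (j%:Z - i%:Z)) * (Xop i j * Xop j i) =
  op (fun mu => Yfun j mu * (qp (- i%:Z *+ 2) *
     (if (i < j)%N then Yfun i mu - qp (-1) * Sfun i mu
      else qp 2 * Yfun i mu - qp 1 * Sfun i mu))) lat0.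
Proof.
move=> i0 j0 ij; rewrite XX_coef; try lia.
rewrite opZ shD shxx; apply: opP => mu.
have F e1 e2 e4 (Y1 Y2 : K) : e1 + e2 = e4 ->
    qp e1 * (qp e2 * (Y1 * Y2)) = Y1 * (qp e4 * Y2).
  by move=> <-; rewrite qpowD; ring.
have [lij|lij] := ltnP i j.
  shv (sh i j i) (1 : int); shv (sh i j i.-1) (0 : int); rewrite (qdiff_simp C).
  have -> : Yfun i mu - qp (-1) * Sfun i mu =
     qp (- 0 *+ 2) * Yfun i mu + - qp (-1) * Sfun i mu.
    by rewrite -[qp (- 0 *+ 2)]/(qp 0) qpow0 mul1r mulNr.
  by apply: F; rewrite /sh; lia.
shv (sh i j i) (0 : int); shv (sh i j i.-1) (-1 : int); rewrite (qdiff_simp C).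
rewrite -[qp 2]/(qp (- (-1) *+ 2)) -mulNr.
by apply: F; rewrite /sh; lia.
Qed.

Lemma wfun_step_up k mu : (0 < k)%N ->
  delta * (qp (- k%:Z *+ 2) * (qp 2 * Yfun k mu - qp 1 * Sfun k mu)) =
  wfun k mu - wfun k.-1 mu.
Proof.
case: k => // k _; rewrite /wfun /=.
have E := YfunE n alpha0 q_gt1 y k.+1 mu.
have -> : qp (- k%:Z *+ 2) = qp 1 * qp 1 * qp (- k.+1%:Z *+ 2).
  by rewrite -!qpowD; congr qpow; lia.
rewrite mulrCA mulrBr [delta * (qp 2 * _)]mulrCA E /=.
have -> : qp 2 = qp 1 * qp 1 by rewrite -!qpowD.
have qq := qpowK C 1; rewrite /delta.
move: (qp (- k.+1%:Z *+ 2)) (qp 1) (qp (-1)) (Sfun _ _) (Sfun _ _) qq => r q q' S1 S0 qq.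
by ring: qq.
Qed.

(** For fixed j the sum over i telescopes separately below and above j, with an extra factor q^-2
    below. *)
Lemma sum_offdiag mu :
  delta * \sum_(1 <= i < n.+1) \sum_(1 <= j < n.+1 | i != j)
     Yfun j mu * (qp (- i%:Z *+ 2) *
     (if (i < j)%N then Yfun i mu - qp (-1) * Sfun i mu
      else qp 2 * Yfun i mu - qp 1 * Sfun i mu)) =
  \sum_(1 <= j < n.+1) Yfun j mu *
     (qp (-2) * (wfun j.-1 mu - wfun 0 mu) + wfun n mu - wfun j mu).
Proof.
pose h i j := Yfun j mu * (if (i < j)%N then qp (-2) * (wfun i mu - wfun i.-1 mu)
   else wfun i mu - wfun i.-1 mu).
transitivity (\sum_(1 <= j < n.+1) \sum_(1 <= i < n.+1 | i != j) h i j).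
  rewrite (exchange_big_dep_nat xpredT) //= mulr_sumr; apply: eq_big_nat => j j1.
  rewrite mulr_sumr; apply: eq_big_nat_cond => i i1.
  apply: (eq_trans (mulrCA delta (Yfun j mu) _)).
  rewrite /h; have [lij|lij] := ltnP i j.
    by rewrite wfun_step.
  by rewrite wfun_step_up.
apply: eq_big_nat => j /andP[j1 jn].
have low : \sum_(1 <= i < j | i != j) h i j =
    Yfun j mu * (qp (-2) * (wfun j.-1 mu - wfun 0 mu)).
  have T : \sum_(1 <= i < j) (wfun i mu - wfun i.-1 mu) = wfun j.-1 mu - wfun 0 mu.
    exact: (telescope_sumr (fun k => wfun k.-1 mu) j1).
  rewrite -T !mulr_sumr.
  rewrite big_nat_cond [RHS]big_nat_cond; apply: eq_big => [i|i].
    by case: (ltngtP i j) => ij; rewrite ?andbF ?andbT.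
  by move=> /andP[/andP[_ ij] _]; rewrite /h ij.
have up : \sum_(j.+1 <= i < n.+1 | i != j) h i j = Yfun j mu * (wfun n mu - wfun j mu).
  have T : \sum_(j.+1 <= i < n.+1) (wfun i mu - wfun i.-1 mu) = wfun n mu - wfun j mu.
    exact: (telescope_sumr (fun k => wfun k.-1 mu) jn).
  rewrite -T mulr_sumr.
  rewrite big_nat_cond [RHS]big_nat_cond; apply: eq_big => [i|i].
    by case: (ltngtP i j) => ij; rewrite ?andbF ?andbT.
  by move=> /andP[/andP[ij _] _]; rewrite /h ltnNge (ltnW ij).
rewrite (big_cat_nat (n := j)) ?(ltnW jn) //= low.
by rewrite [X in _ + X]big_ltn_cond // eqxx /= up -mulrDr addrA.
Qed.

(** By [Gram_tfun] this is [delta] times the i-th entry of the vector obtained from the t_j by [n]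
    times the coefficient matrix of s_0, the q-analogue of the inverse Cartan matrix. Its vanishing
    at i = 0 and i = n removes the boundary terms below. *)
Definition Hfun (i : nat) (mu : lattice) : K :=
  qp (- i%:Z) * qn n * Sfun i mu - qn (n - i) * Sfun 0 mu
    - qp (- n%:Z) * qn i * Sfun n mu.

Lemma qn0 : qn 0 = 0.
Proof. by rewrite /qnum big_ord0. Qed.

Lemma Hfun0 mu : Hfun 0 mu = 0.
Proof. by rewrite /Hfun subn0 qn0 qpow0 mulr0 mul0r subr0 mul1r subrr. Qed.

Lemma Hfunn mu : Hfun n mu = 0.
Proof. by rewrite /Hfun subnn qn0 mul0r subr0 subrr. Qed.

Lemma qn_step_r i : (0 < i)%N -> qp 1 * qn i = qn i.-1 + qp i.
Proof.
case: i => // i _; rewrite qnumS_r mulrDr mulrA -!qpowD subrr qpow0 mul1r.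
by congr (_ + qp _); lia.
Qed.

(** The q-analogue of i (n - i + 1) - (i - 1) (n - i) = n. *)
Lemma qn_minor i : (0 < i <= n)%N ->
  qn i * qn (n - i.-1) - qn i.-1 * qn (n - i) = qn n.
Proof.
case: i => // i /andP[_ i_n] /=.
have E1 := qnumB (ltnW i_n); have E2 := qnumB i_n.
have -> : qn (n - i) = qp (- i%:Z) * qn n - qp (- n%:Z) * qn i by rewrite -E1 addrK.
have -> : qn (n - i.+1) = qp (- i.+1%:Z) * qn n - qp (- n%:Z) * qn i.+1.
  by rewrite -E2 addrK.
have -> : qp (- i%:Z) = qp 1 * qp (- i.+1%:Z) by rewrite -qpowD; congr qpow; lia.
have F := @qn_step_r i.+1 isT; have G := qpowK C i.+1.
have -> : qn i.+1 * (qp 1 * qp (- i.+1%:Z) * qn n - qp (- n%:Z) * qn i) -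
  qn i * (qp (- i.+1%:Z) * qn n - qp (- n%:Z) * qn i.+1) =
  (qp 1 * qn i.+1 - qn i) * qp (- i.+1%:Z) * qn n by ring.
by rewrite F [qn _ + _]addrC addrK G mul1r.
Qed.

Lemma Gram_tfun i mu : (0 < i < n)%N ->
  delta * (qn i * \sum_(i <= j < n) qn (n - j) * tfun j mu
           + qn (n - i) * \sum_(1 <= j < i) qn j * tfun j mu) = Hfun i mu.
Proof.
move=> /andP[i0 i_n]; rewrite sum_qnum_tfun // sum_qnum_tfun_rev ?i0 //.
have a1 : (0 < 1 <= i)%N by lia.
have a2 : (0 < i <= n.+1)%N by lia.
have a3 : (0 < i <= n)%N by lia.
have E1 := sum_Yfun mu a1; have E2 := sum_Yfun mu a2.
have E3 := YfunE n alpha0 q_gt1 y i mu.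
have M := qn_minor a3.
have B := qnumB (ltnW i_n).
rewrite /Hfun.
move: E1 E2 E3 M B.
move: (\sum_(1 <= k < i) _) (\sum_(i <= k < n.+1) _) (Yfun i mu) => U V Yi /=.
move: (Sfun i mu) (Sfun i.-1 mu) (Sfun 0 mu) (Sfun n mu) (qp (- i%:Z)) (qp (- n%:Z)).
move: (qn i) (qn i.-1) (qn (n - i)) (qn (n - i.-1)) (qn n) delta.
move=> a b c e N d Si Sj S0 Sn r p' E1 E2 E3 M B.
have -> : d * (a * (e * r * Yi - p' * V) + c * (U - b * r * Yi)) =
  (a * e - b * c) * r * (d * Yi) - p' * a * (d * V) + c * (d * U) by ring.
rewrite E1 E2 E3 M.
by apply: (lincomb1 (A := Sj) B); ring.
Qed.

(** Summation by parts, moving the difference of Y_i and Y_(i+1) in t_i onto [Hfun]. *)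
Lemma sum_tfun_Hfun mu :
  \sum_(1 <= i < n) tfun i mu * Hfun i mu =
  \sum_(1 <= i < n.+1) Yfun i mu * (qp (- i%:Z) * (qp 1 * Hfun i mu - Hfun i.-1 mu)).
Proof.
pose r i := qp (- i%:Z) * Yfun i mu * Hfun i.-1 mu.
rewrite (eq_big_nat _ _ (F2 := fun i =>
   Yfun i mu * (qp (- i%:Z) * (qp 1 * Hfun i mu - Hfun i.-1 mu)) - (r i.+1 - r i))).
  rewrite sumrB telescope_sumr; last lia.
  have rn : - (r n - r 1%N) =
      Yfun n mu * (qp (- n%:Z) * (qp 1 * Hfun n mu - Hfun n.-1 mu)).
    by rewrite /r -[1.-1]/0%N Hfun0 Hfunn; ring.
  by rewrite rn [RHS]big_nat_recr; last lia.
move=> i i1; rewrite /r /tfun /=.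
have -> : qp (- i.+1%:Z) = qp (- i%:Z) * qp (-1) by rewrite -qpowD; congr qpow; lia.
move: (qp (- i%:Z)) (qp 1) (qp (-1)) (Yfun i mu) (Yfun i.+1 mu) (Hfun i mu).
move: (Hfun i.-1 mu) => H' rr q q' Y1 Y2 H; ring.
Qed.

Lemma Hfun_step i mu : (0 < i <= n)%N ->
  qp (- i%:Z) * (qp 1 * Hfun i mu - Hfun i.-1 mu) =
  qn n * (qp 1 * wfun i mu - qp (-1) * wfun i.-1 mu) - qp (- n%:Z) * (delta * Z).
Proof.
move=> i0; have E := Sfunn mu; have <- : Sfun n mu - Sfun 0 mu = delta * Z.
  by rewrite E addrC addKr.
case: i i0 => // i /andP[_ i_n] /=; rewrite /Hfun /wfun.
have F := @qn_step_r i.+1 isT.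
have F' := qnumS_l C (n - i.+1)%N.
have Ei : (n - i.+1).+1 = (n - i)%N by lia.
rewrite Ei in F'; rewrite F'.
have G1 : qp (- i.+1%:Z) * qp i.+1 = 1 by rewrite mulrC qpowK.
have G2 : qp (- i.+1%:Z) * qp (- (n - i.+1)%N%:Z) = qp (- n%:Z).
  by rewrite -qpowD; congr qpow; lia.
have -> : qp (- i%:Z) = qp 1 * qp (- i.+1%:Z) by rewrite -qpowD; congr qpow; lia.
have -> : qp (- i.+1%:Z *+ 2) = qp (- i.+1%:Z) * qp (- i.+1%:Z).
  by rewrite -qpowD mulr2n.
have -> : qp (- i%:Z *+ 2) = qp 1 * qp 1 * (qp (- i.+1%:Z) * qp (- i.+1%:Z)).
  by rewrite -!qpowD; congr qpow; lia.
rewrite -G2; move: F G1 (qpowK C 1) => /=.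
move: (qp (- i.+1%:Z)) (qp i.+1) (qp (- (n - i.+1)%N%:Z)) (qp 1) (qp (-1)).
move: (qn i.+1) (qn i) (qn n) (qn (n - i.+1)) (Sfun i.+1 mu) (Sfun i mu) (Sfun 0 mu) (Sfun n mu).
move=> a b N e Si Sj S0 Sn r r' p q q' F G1 qq.
have -> : b = q * a - r' by rewrite F addrK.
by apply: (lincomb2 (A := N * q * r * r * Sj) (B := - (r * p * Sn)) qq G1); ring.
Qed.

Lemma Casimir_scalar mu :
  qn n * (qp 1 * wfun n mu - qp (-1) * Sfun 0 mu) - qp (- n%:Z) * (delta * Z) =
  delta * (aK * qn n.-1).
Proof.
have -> : wfun n mu = Sfun 0 mu + delta * aK.
  by rewrite -(Sfunn_alpha0 mu) addrC subrK.
rewrite Sfun0 /Z /delta.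
have := qn_pred_r; have := qn_divK; have := qpowK C 1; have := qpowK C n.
move: (qp n) (qp (- n%:Z)) (qn n) (qn n)^-1 (qn n.-1) aK g (qp 1) (qp (-1)).
move=> p p' N i N1 a c q q' pp qq Ni E.
have -> : N1 = q * N - p by rewrite E addrK.
apply: (lincomb2 (A := - ((q - q') * a * c)) (B := (q - q') * a * (c - p)) pp Ni).
ring.
Qed.

(** After summation by parts both the Cartan part and the off-diagonal part are sums of Y_j times
    linear expressions in [wfun]. Together the dependence on j drops out, every Y_j carries the
    factor of [Casimir_scalar], and the Y_j add up to Z. *)
Lemma Casimir_sum mu :
  \sum_(1 <= i < n) \sum_(i <= j < n) (qn i * qn (n - j) / qn n) * (tfun i mu * tfun j mu)
  + \sum_(1 <= i < n) \sum_(1 <= j < i)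
      (qn j * qn (n - i) / qn n) * (tfun i mu * tfun j mu)
  + qp 1 * \sum_(1 <= i < n.+1) \sum_(1 <= j < n.+1 | i != j)
     Yfun j mu * (qp (- i%:Z *+ 2) *
     (if (i < j)%N then Yfun i mu - qp (-1) * Sfun i mu
      else qp 2 * Yfun i mu - qp 1 * Sfun i mu)) =
  aK ^+ 2 * qp n * (qn n.-1 / qn n) * g.
Proof.
have N0 : qn n <> 0.
  by move=> n0; move: qn_divK; rewrite n0 mul0r => /eqP; rewrite eq_sym oner_eq0.
apply: (K_mulfI N0); apply: (K_mulfI (@delta_neq0 C)).
set U := (\sum_(1 <= i < n.+1) _); rewrite -big_split /=.
have UE := sum_offdiag mu; rewrite -/U in UE.
have E1 : delta * (qn n * \sum_(1 <= i < n)
    (\sum_(i <= j < n) (qn i * qn (n - j) / qn n) * (tfun i mu * tfun j mu)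
     + \sum_(1 <= j < i) (qn j * qn (n - i) / qn n) * (tfun i mu * tfun j mu))) =
    \sum_(1 <= i < n) tfun i mu * Hfun i mu.
  rewrite [X in delta * X]mulr_sumr mulr_sumr; apply: eq_big_nat => i i1.
  rewrite -(Gram_tfun mu i1) [RHS](mulrCA (tfun i mu)); apply: (congr1 (fun x => delta * x)).
  rewrite [LHS](mulrDr (qn n)) [RHS](mulrDr (tfun i mu)).
  apply: (congr2 +%R).
    exact: (sum_mul_div (index_iota i n) (tfun i mu) (qn i) (fun j => qn (n - j))
      (fun j => tfun j mu) qn_divK).
  exact: (sum_mul_divC (index_iota 1 i) (tfun i mu) (qn (n - i)) qn
    (fun j => tfun j mu) qn_divK).
rewrite mulrDr mulrDr E1 sum_tfun_Hfun.
have -> : delta * (qn n * (qp 1 * U)) = qn n * qp 1 * (delta * U).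
  by clear UE E1; move: (qn n) (qp 1) U delta; move=> *; ring.
rewrite UE mulr_sumr -big_split /=.
rewrite (eq_big_nat _ _ (F2 := fun j => Yfun j mu * (delta * (aK * qn n.-1)))).
  rewrite -mulr_suml sum_Yfun_all.
  have Ni := qn_divK; move: Ni; move: (qn n)^-1 (qn n) => iN N Ni.
  apply: (lincomb1 (A := - (delta * aK * aK * qp n * qn n.-1 * g)) Ni).
  by rewrite /Z; move: (qp n) aK g (qn n.-1) delta; move=> *; ring.
move=> j j1; rewrite Hfun_step // -(Casimir_scalar mu).
have -> : wfun 0 mu = Sfun 0 mu by rewrite /wfun mulNrn oppr0 qpow0 mul1r.
have -> : qp (-2) = qp (-1) * qp (-1) by rewrite -qpowD.
have := qpowK C 1.
move: (qp 1) (qp (-1)) (qn n) (wfun j mu) (wfun j.-1 mu) (wfun n mu) (Sfun 0 mu).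
move: (Yfun j mu) (qp (- n%:Z) * (delta * Z)) => Yj X q q' N wj wi wn S0 qq.
by apply: (lincomb1 (A := Yj * N * q' * (wi - S0)) qq); ring.
Qed.

Lemma rel_s0 :
  \sum_(1 <= i < n) \sum_(i <= j < n) sc (qn i * qn (n - j) / qn n) * (Top i * Top j)
  + \sum_(1 <= i < n) \sum_(1 <= j < i) sc (qn j * qn (n - i) / qn n) * (Top i * Top j)
  + sc (qp 1) * \sum_(1 <= i < n.+1) \sum_(1 <= j < n.+1 | i != j)
       sc (qp (j%:Z - i%:Z)) * (Xop i j * Xop j i)
  = sc (aK ^+ 2 * qp n * (qn n.-1 / qn n) * g).
Proof.
have T i j : Top i * Top j = op (fun mu => tfun i mu * tfun j mu) lat0.
  by rewrite /Top opM lat_addr0; apply: opP => mu; rewrite lat_addr0.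
rewrite [X in X + _ + _](eq_bigr (fun i => op (fun mu => \sum_(i <= j < n)
    (qn i * qn (n - j) / qn n) * (tfun i mu * tfun j mu)) lat0)) => [|i _]; last first.
  by rewrite -op_sum; apply: eq_bigr => j _; rewrite T opZ.
rewrite op_sum.
rewrite [X in _ + X + _](eq_bigr (fun i => op (fun mu => \sum_(1 <= j < i)
    (qn j * qn (n - i) / qn n) * (tfun i mu * tfun j mu)) lat0)) => [|i _]; last first.
  by rewrite -op_sum; apply: eq_bigr => j _; rewrite T opZ.
rewrite op_sum.
rewrite (eq_big_nat _ _ (F2 := fun i => op (fun mu => \sum_(1 <= j < n.+1 | i != j)
   Yfun j mu * (qp (- i%:Z *+ 2) *
     (if (i < j)%N then Yfun i mu - qp (-1) * Sfun i mu
      else qp 2 * Yfun i mu - qp 1 * Sfun i mu))) lat0)) => [|i i1]; last first.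
  rewrite -op_sum big_nat_cond [RHS]big_nat_cond; apply: eq_bigr => j /andP[j1 ij].
  by apply: XX_diag.
rewrite op_sum opZ !opD (op_scal op); apply: opP => mu.
exact: Casimir_sum.
Qed.

End DefiningRelations.

(** * Stability of the kernel *)

Section LinExt.
Variables (C : numFieldType) (n : nat).
Notation K := (K_hn C).
Variable F : seq (label n) -> tens_K C n.

Let H (w : {fmonom (label n)}) (c : K) : tens_K C n := c *: F (fmonom_val w).
Let HB w : {morph H w : x y / x - y}.
Proof. by move=> x y; rewrite /H scalerBl. Qed.

Lemma lin_ext0 : lin_ext F 0 = 0.
Proof.
have := malg_sum_zmod_morphism HB 0 0; rewrite subrr => E.
by rewrite [LHS]E subrr.
Qed.

Lemma lin_extD x y : lin_ext F (x + y) = lin_ext F x + lin_ext F y.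
Proof.
have E a b : lin_ext F (a - b) = lin_ext F a - lin_ext F b.
  exact: (malg_sum_zmod_morphism HB).
have N a : lin_ext F (- a) = - lin_ext F a by rewrite -sub0r E lin_ext0 sub0r.
by rewrite -{1}(opprK y) E N opprK.
Qed.

Lemma lin_extU c w : lin_ext F << c *g w >> = c *: F (fmonom_val w).
Proof. exact: (malg_sumU HB). Qed.

End LinExt.

Section TwistedLeibniz.
Variables (k : comPzRingType) (A : alg k) (s p p' : k) (E X W ex ew K : A).
Notation sc := (scal A).

(** The product rule of a q-commutator has exactly the shape of the coproduct of e_i, with q^(-h_i)
    on the left factor. [twisted_leibniz_r] does the same for f_i, where K stands for q^(h_i). *)
Lemma twisted_leibniz :
  E * X - sc p * (X * E) = sc s * ex -> E * W - sc p' * (W * E) = sc s * ew ->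
  E * (X * W) - sc (p * p') * (X * W * E) = sc s * (ex * W + sc p * (X * ew)).
Proof.
move=> EX EW.
have -> : sc s * (ex * W + sc p * (X * ew)) = sc s * ex * W + sc p * (X * (sc s * ew)).
  by rewrite mulrDr (mulrA X) -(scalC s X) !mulrA (scalC s (sc p)).
rewrite -EX -EW mulrBl !mulrBr rmorphM !mulrA subrKA.
by rewrite -(mulrA (sc p) (sc p')) (scalC p') !mulrA.
Qed.

Lemma twisted_leibniz_r :
  E * X - X * E = sc s * (ex * K) -> E * W - W * E = sc s * (ew * K) ->
  K * W = sc p * (W * K) ->
  E * (X * W) - X * W * E = sc s * ((X * ew + sc p * (ex * W)) * K).
Proof.
move=> EX EW KW.
have -> : sc s * ((X * ew + sc p * (ex * W)) * K) =
    sc s * (ex * K) * W + X * (sc s * (ew * K)).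
  rewrite -(mulrA (sc s) (ex * K)) -(mulrA ex) KW (mulrA ex) -(scalC p ex) (mulrA X).
  by rewrite -(scalC s X) mulrDl mulrDr addrC !mulrA.
by rewrite -EX -EW mulrBl mulrBr !mulrA subrKA.
Qed.

Lemma weight_leibniz : E * X - X * E = sc p * X -> E * W - W * E = sc p' * W ->
  E * (X * W) - X * W * E = sc (p + p') * (X * W).
Proof.
move=> EX EW; rewrite rmorphD mulrDl (mulrA (sc p)) (mulrA (sc p')) (scalC p').
by rewrite -(mulrA X (sc p')) -EX -EW mulrBl mulrBr !mulrA subrKA.
Qed.
End TwistedLeibniz.

Section EquivariantRealization.
Variables (C : numFieldType) (A : alg (K_hn C)) (op : shift_rep A) (n : nat) (alpha0 : C) (q_gt1 : bool) (y : nat -> C).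
Hypothesis n_gt3 : (3 < n)%N.
Notation K := (K_hn C).
Notation qp := (qpow C).
Notation qn := (qnum C).
Notation Xop := (Xop op n alpha0 q_gt1 y).
Notation Top := (Top op n alpha0 q_gt1 y).
Notation Eop := (Eop op n alpha0 q_gt1 y).
Notation Fop := (Fop op n alpha0 q_gt1 y).
Notation spar := (spar n alpha0 q_gt1 y).
Notation kop := (kop op n).
Notation wt := (wt n).
Notation sc := (scal A).

Let n_gt1 : (1 < n)%N. Proof. lia. Qed.

Definition op_gen (x : label n) : A :=
  match x with
  | inl p => Xop (val p).1.+1 (val p).2.+1
  | inr k => Top k.+1
  end.

Definition op_ev : tens_K C n -> A := free_ev op_gen.
HB.instance Definition _ := GRing.RMorphism.on op_ev.

Lemma op_evD x z : op_ev (x + z) = op_ev x + op_ev z. Proof. exact: free_evD. Qed.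
Lemma op_ev0 : op_ev 0 = 0. Proof. exact: free_ev0. Qed.
Lemma op_evN x : op_ev (- x) = - op_ev x.
Proof. exact: (raddfN (free_ev op_gen)). Qed.
Lemma op_evB x z : op_ev (x - z) = op_ev x - op_ev z.
Proof. exact: (raddfB (free_ev op_gen)). Qed.
Lemma op_evZ c x : op_ev (c *: x) = sc c * op_ev x.
Proof. exact: free_evZ. Qed.
Lemma op_evM x z : op_ev (x * z) = op_ev x * op_ev z.
Proof. exact: (rmorphM (free_ev op_gen)). Qed.
Lemma op_ev1 : op_ev 1 = 1.
Proof. exact: (rmorph1 (free_ev op_gen)). Qed.
Lemma op_ev_sum (I : Type) (r : seq I) (P : pred I) (G : I -> tens_K C n) :
  op_ev (\sum_(i <- r | P i) G i) = \sum_(i <- r | P i) op_ev (G i).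
Proof. exact: (raddf_sum (free_ev op_gen)). Qed.
Lemma op_ev_gen x : op_ev (gq_gen C x) = op_gen x.
Proof. exact: free_ev_gen. Qed.

Lemma op_ev_word w : op_ev (word C w) = \prod_(x <- w) op_gen x.
Proof. exact: free_ev_word. Qed.

Lemma op_ev_gq i j : (0 < i <= n)%N -> (0 < j <= n)%N -> i != j ->
  op_ev (gq C n i j) = Xop i j.
Proof.
case: i j => [|i] [|j] //= i_n j_n ij; rewrite eqSS in ij.
have ij' : (Ordinal i_n, Ordinal j_n).1 != (Ordinal i_n, Ordinal j_n).2 by [].
rewrite /gq (big_pred1 (exist (fun p : 'I_n * 'I_n => p.1 != p.2) _ ij')) => [|p].
  by rewrite op_ev_gen.
case: p => [[a b] ab] /=; apply/andP/eqP => [[/eqP[ea] /eqP[eb]]|[-> ->]].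
  by apply: val_inj => /=; congr pair; apply: val_inj.
by rewrite /= !eqxx.
Qed.

Lemma op_ev_tq k : (0 < k < n)%N -> op_ev (tq C n k) = Top k.
Proof.
case: k => // k /andP[_ kn].
have k_n : (k < n.-1)%N by lia.
rewrite /tq (big_pred1 (Ordinal k_n)) => [|m]; first by rewrite op_ev_gen.
by apply/eqP/eqP => [[E]|->]; first exact: val_inj.
Qed.

Section Generators.
Variable i : nat.
Hypothesis i0 : (0 < i < n)%N.

Lemma Eop_gen x :
  Eop i * op_gen x - sc (qp (- wt_gen i x)) * (op_gen x * Eop i) =
  sc (spar i) * op_ev (e_gen C i x).
Proof.
have iSn : (0 < i.+1 <= n)%N by lia.
have i_n : (0 < i <= n)%N by lia.
have iiS : i != i.+1 by rewrite neq_ltn ltnSn.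
case: x => [p|k] /=.
  have k0 : (0 < (val p).1.+1 <= n)%N by exact: ltn_ord.
  have l0 : (0 < (val p).2.+1 <= n)%N by exact: ltn_ord.
  have kl : (val p).1.+1 != (val p).2.+1 by exact: (valP p).
  move: k0 l0 kl; move: ((val p).1.+1) ((val p).2.+1) => k l k0 l0 kl.
  rewrite -/(wt_idx i k l).
  have [E|li] := eqVneq l i.
    subst l; rewrite andbT; have [E|kS] := eqVneq k i.+1.
      by subst k; rewrite op_ev_tq ?(EX_t op alpha0 q_gt1 y n_gt1 i0) //; lia.
    rewrite op_evN op_ev_gq //.
    exact: (EX_bi op alpha0 q_gt1 y n_gt1 i0).
  rewrite andbF; have [E|kS] := eqVneq k i.+1.
    subst k; rewrite op_ev_gq //; last by rewrite eq_sym.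
    by apply: (EX_aj op alpha0 q_gt1 y n_gt1 i0) => //; rewrite eq_sym.
  by rewrite op_ev0 mulr0; apply: (EX_0 op alpha0 q_gt1 y n_gt1 i0).
have k0 : (0 < k.+1 < n)%N by case: k => k /=; lia.
move: (k.+1) k0 => {}k k0; rewrite oppr0 qpow0 rmorph1 mul1r.
have [E|ki] := eqVneq k i.
  subst k; rewrite op_evN op_evZ op_ev_gq //.
  exact: (ET_i op alpha0 q_gt1 y n_gt1 i0).
have [E|kS] := eqVneq k i.+1.
  subst k; rewrite op_ev_gq //=.
  by apply: (ET_S op alpha0 q_gt1 y n_gt1 i0); lia.
have [E|kP] := eqVneq k.+1 i.
  have -> : k = i.-1 by lia.
  rewrite op_ev_gq //=.
  by apply: (ET_P op alpha0 q_gt1 y n_gt1 i0); lia.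
by rewrite op_ev0 mulr0; apply: (ET_0 op alpha0 q_gt1 y n_gt1 i0).
Qed.

Lemma Fop_gen x :
  Fop i * op_gen x - op_gen x * Fop i =
  sc (spar i) * (op_ev (f_gen C i x) * kop i).
Proof.
have iSn : (0 < i.+1 <= n)%N by lia.
have i_n : (0 < i <= n)%N by lia.
have iSi : i.+1 != i by rewrite neq_ltn ltnSn orbT.
case: x => [p|k] /=.
  have k0 : (0 < (val p).1.+1 <= n)%N by exact: ltn_ord.
  have l0 : (0 < (val p).2.+1 <= n)%N by exact: ltn_ord.
  have kl : (val p).1.+1 != (val p).2.+1 by exact: (valP p).
  move: k0 l0 kl; move: ((val p).1.+1) ((val p).2.+1) => k l k0 l0 kl.
  have [E|li] := eqVneq l i.+1.
    subst l; rewrite andbT; have [E|kS] := eqVneq k i.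
      by subst k; rewrite op_evN op_ev_tq ?(FX_t op alpha0 q_gt1 y n_gt1 i0).
    rewrite op_evN op_ev_gq //.
    exact: (FX_bj op alpha0 q_gt1 y n_gt1 i0).
  rewrite andbF; have [E|kS] := eqVneq k i.
    subst k; rewrite op_ev_gq //; last by rewrite eq_sym.
    by apply: (FX_ai op alpha0 q_gt1 y n_gt1 i0) => //; rewrite eq_sym.
  by rewrite op_ev0 mul0r mulr0; apply: (FX_0 op alpha0 q_gt1 y n_gt1 i0).
have k0 : (0 < k.+1 < n)%N by case: k => k /=; lia.
move: (k.+1) k0 => {}k k0.
have [E|ki] := eqVneq k i.
  subst k; rewrite op_evZ op_ev_gq //.
  exact: (FT_i op alpha0 q_gt1 y n_gt1 i0).
have [E|kS] := eqVneq k i.+1.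
  subst k; rewrite op_evN op_ev_gq //=.
  by apply: (FT_S op alpha0 q_gt1 y n_gt1 i0); lia.
have [E|kP] := eqVneq k.+1 i.
  have -> : k = i.-1 by lia.
  rewrite op_evN op_ev_gq //=.
  by apply: (FT_P op alpha0 q_gt1 y n_gt1 i0); lia.
by rewrite op_ev0 mul0r mulr0; apply: (FT_0 op alpha0 q_gt1 y n_gt1 i0).
Qed.

Lemma kop_gen x : kop i * op_gen x = sc (qp (wt_gen i x)) * (op_gen x * kop i).
Proof.
case: x => [p|k] /=.
  have k0 : (0 < (val p).1.+1 <= n)%N by exact: ltn_ord.
  have l0 : (0 < (val p).2.+1 <= n)%N by exact: ltn_ord.
  exact: (kop_Xop op alpha0 q_gt1 y n_gt1 i0).
by rewrite qpow0 rmorph1 mul1r; apply: kop_Top.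
Qed.

(** The logarithm of [kop i]. The module structure is given by h_i itself and not by q^(h_i), so an
    operator with commutators of weight [wt_gen] is required. *)
Definition hop : A := op (fun mu =>
  (- wt mu i *+ 2 + wt mu i.-1 + wt mu i.+1)%:~R) lat0.

Lemma hop_gen x :
  hop * op_gen x - op_gen x * hop = sc (wt_gen i x)%:~R * op_gen x.
Proof.
case: x => [p|k] /=; last first.
  rewrite rmorph0 mul0r /hop /Top !opM opB.
  rewrite -(op0 op (lat_add lat0 lat0)); apply: opP => mu.
  by rewrite !lat_addr0 [X in X - _]mulrC subrr.
have k0 : (0 < (val p).1.+1 <= n)%N by exact: ltn_ord.
have l0 : (0 < (val p).2.+1 <= n)%N by exact: ltn_ord.
move: k0 l0; move: ((val p).1.+1) ((val p).2.+1) => a b a0 b0.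
rewrite /hop /Xop !opM lat_add0 lat_addr0 opB.
rewrite opZ; apply: opP => mu; rewrite lat_addr0 !wt_sh //; try lia.
rewrite mulrC -mulrBr [RHS]mulrC -rmorphB /=; congr (_ * _%:~R).
rewrite -/(wt_idx i a b) /wt_idx /sh; lia.
Qed.

End Generators.

Section Words.
Variable i : nat.
Hypothesis i0 : (0 < i < n)%N.

Lemma kop_word w :
  kop i * op_ev (word C w) = sc (qp (wt_word i w)) * (op_ev (word C w) * kop i).
Proof.
rewrite op_ev_word /wt_word; elim: w => [|x w IH].
  by rewrite !big_nil qpow0 rmorph1 mulr1 !mul1r.
rewrite !big_cons mulrA kop_gen // qpowD rmorphM -!mulrA IH /=.
by congr (_ * _); rewrite !mulrA scalC.
Qed.

Lemma Eop_word w :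
  Eop i * op_ev (word C w) - sc (qp (- wt_word i w)) * (op_ev (word C w) * Eop i) =
  sc (spar i) * op_ev (e_word C i w).
Proof.
elim: w => [|x w IH].
  rewrite /= op_ev0 mulr0 /word big_nil op_ev1 /wt_word big_nil oppr0 qpow0 rmorph1.
  by rewrite !mul1r mulr1 subrr.
rewrite /= op_evD op_evM op_evZ op_evM op_ev_gen /word big_cons op_evM op_ev_gen.
rewrite /wt_word big_cons opprD qpowD.
by apply: twisted_leibniz; [apply: Eop_gen | apply: IH].
Qed.

Lemma Fop_word w :
  Fop i * op_ev (word C w) - op_ev (word C w) * Fop i =
  sc (spar i) * (op_ev (f_word C i w) * kop i).
Proof.
elim: w => [|x w IH].
  by rewrite /= op_ev0 mul0r mulr0 /word big_nil op_ev1 mulr1 mul1r subrr.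
rewrite /= op_evD op_evM op_evZ op_evM op_ev_gen /word big_cons op_evM op_ev_gen.
by apply: twisted_leibniz_r; [apply: Fop_gen | apply: IH | apply: kop_word].
Qed.

Lemma hop_word w :
  hop i * op_ev (word C w) - op_ev (word C w) * hop i = op_ev (h_word C i w).
Proof.
rewrite /h_word op_evZ; elim: w => [|x w IH].
  by rewrite /word big_nil op_ev1 /wt_word big_nil mulr1 mul1r subrr rmorph0 mul0r.
rewrite /word big_cons op_evM op_ev_gen -/(word C w) /wt_word big_cons -/(wt_word i w).
by rewrite rmorphD; apply: weight_leibniz; [apply: hop_gen | apply: IH].
Qed.

End Words.

Hypothesis tfA : torsion_free A.
Hypothesis spar_neq0 : forall i, (0 < i < n)%N -> spar i <> 0.

Lemma spar_mul_eq0 i x : (0 < i < n)%N -> sc (spar i) * x = 0 -> x = 0.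
Proof. by move=> /spar_neq0 s0 /tfA[/s0|]. Qed.

Lemma lin_ext_eq (G H : tens_K C n -> A) (F : seq (label n) -> tens_K C n) :
  {morph G : x z / x + z} -> {morph H : x z / x + z} ->
  (forall c x, G (c *: x) = sc c * G x) -> (forall c x, H (c *: x) = sc c * H x) ->
  (forall w, G (word C w) = H (F w)) -> forall z, G z = H (lin_ext F z).
Proof.
move=> GD HD GZ HZ GH; elim/free_ind => [|x z IHx IHz|c w].
- by rewrite lin_ext0 -(scale0r 0) GZ HZ !rmorph0 !mul0r.
- by rewrite GD lin_extD HD IHx IHz.
by rewrite lin_extU HZ malgU_word GZ -GH.
Qed.

(** If z acts as 0, so do both terms of its q-commutator with [Eop i]; hence [spar i] times the
    image of e_i z vanishes, and [spar i] can be cancelled. For f_i the invertible [kop i] is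
    removed first. *)
Lemma op_ev_ker_submodule : Uq_submodule (fun z => op_ev z = 0).
Proof.
split=> [|x z x0 z0|c z z0|i z i0 z0|i z i0 z0|i z i0 z0].
- exact: op_ev0.
- by rewrite op_evD x0 z0 addr0.
- by rewrite op_evZ z0 mulr0.
- rewrite -(@lin_ext_eq (fun x => hop i * op_ev x - op_ev x * hop i) op_ev (h_word C i)).
  + by rewrite z0 mulr0 mul0r subrr.
  + by move=> a b; rewrite op_evD mulrDl mulrDr opprD addrACA.
  + exact: op_evD.
  + by move=> c x; rewrite op_evZ mulrBr !mulrA (scalC c (hop i)).
  + exact: op_evZ.
  + exact: hop_word.
- have [k' [kk' k'k]] := kop_unit op n i.
  (* The words of z may have different weights, so no single scalar q^(-h_i) is available;
     conjugation by [kop i] produces the right power of q on each word. *)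
  apply: (spar_mul_eq0 i0); rewrite -(@lin_ext_eq (fun x => Eop i * op_ev x - k' * op_ev x * kop i * Eop i)
    (fun x => sc (spar i) * op_ev x)).
  + by rewrite z0 !mulr0 !mul0r subrr.
  + by move=> a b; rewrite op_evD !mulrDr !mulrDl opprD addrACA.
  + by move=> a b; rewrite op_evD mulrDr.
  + by move=> c x; rewrite op_evZ mulrBr !mulrA (scalC c (Eop i)) (scalC c k').
  + by move=> c x; rewrite op_evZ !mulrA (scalC c).
  move=> w; rewrite -Eop_word //; congr (_ - _).
  rewrite mulrA; congr (_ * _).
  have this : op_ev (word C w) * kop i =
     sc (qp (- wt_word i w)) * (kop i * op_ev (word C w)).
    by rewrite kop_word // !mulrA -rmorphM -qpowD addNr qpow0 rmorph1 mul1r.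
  by rewrite -(mulrA k') this (mulrA k') -scalC -mulrA (mulrA k') k'k mul1r.
- have [k' [kk' k'k]] := kop_unit op n i.
  suff Fk : op_ev (lin_ext (f_word C i) z) * kop i = 0.
    by rewrite -[LHS]mulr1 -kk' mulrA Fk mul0r.
  apply: (spar_mul_eq0 i0); rewrite -(@lin_ext_eq (fun x => Fop i * op_ev x - op_ev x * Fop i)
    (fun x => sc (spar i) * (op_ev x * kop i))).
  + by rewrite z0 mulr0 mul0r subrr.
  + by move=> a b; rewrite op_evD !mulrDr !mulrDl opprD addrACA.
  + by move=> a b; rewrite op_evD mulrDl mulrDr.
  + by move=> c x; rewrite op_evZ mulrBr !mulrA (scalC c (Fop i)).
  + by move=> c x; rewrite op_evZ -(mulrA (sc c)) (mulrA (sc (spar i))) (scalC (spar i)) -mulrA.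
  by move=> w; apply: Fop_word.
Qed.

End EquivariantRealization.

Lemma fcoefM0 (A : pzRingType) (x z : fps A) : fcoef (x * z) 0 = fcoef x 0 * fcoef z 0.
Proof. by rewrite fcoefM big_ord1. Qed.

Lemma fcoefM1 (A : pzRingType) (x z : fps A) :
  fcoef (x * z) 1 = fcoef x 0 * fcoef z 1 + fcoef x 1 * fcoef z 0.
Proof. by rewrite fcoefM big_ord_recl big_ord1. Qed.

Lemma fcoef_sum_fpsC (A : pzRingType) (d : nat -> nat -> A) i j :
  \sum_(a < i.+1) \sum_(b < j.+1) fcoef (fcoef (fpsC (fpsC (d a b))) (i - a)) (j - b) =
  d i j.
Proof.
have z a m : (a < m)%N -> (m - a == 0)%N = false by move=> am; rewrite subn_eq0 leqNgt am.
rewrite big_ord_recr /= [X in X + _]big1 ?add0r => [|a _]; last first.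
  by rewrite big1 // => b _; rewrite z // mulr0n.
rewrite subnn big_ord_recr /= [X in X + _]big1 ?add0r => [|b _]; last first.
  by rewrite z // mulr0n.
by rewrite subnn.
Qed.

Section DefiningIdealKernel.
Variables (C : numFieldType) (n : nat) (alpha0 : C) (q_gt1 : bool) (y : nat -> C).
Hypothesis n_gt3 : (3 < n)%N.
Notation K := (K_hn C).
Notation qp := (qpow C).
Notation qn := (qnum C).
Notation delta := (delta C).
Notation aK := (alpha0_K alpha0).
Notation g := (gamma_h C n q_gt1).
Notation spar := (spar n alpha0 q_gt1 y).

Lemma fcoefS_qnum m i : fcoef (qn m) i.+1 = 0.
Proof.
rewrite /qnum [LHS]fcoef_sum big1 // => j _; exact: fcoefS_qpow.
Qed.

Lemma fcoefS_delta i : fcoef delta i.+1 = 0.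
Proof.
change (fcoef (qp 1) i.+1 - fcoef (qp (-1)) i.+1 = 0).
by rewrite !fcoefS_qpow subrr.
Qed.

Lemma fcoefS_gamma_q i : fcoef (gamma_q C n q_gt1) i.+1 = 0.
Proof. by rewrite /gamma_q; case: q_gt1; apply: fcoefS_qpow. Qed.

(** After multiplication by [n] the coefficient of h is alpha0: the deformation parameter occurs
    only in [spar0], and the term with [zpar] is free of h in this range. *)
Lemma spar_neq0 : alpha0 != 0 -> forall i, (0 < i < n)%N -> spar i <> 0.
Proof.
move=> a0 i /andP[i0 i_n] s0.
have E : aK * (g - qp n) + qn n * (delta * zpar n alpha0 q_gt1 y i) = 0.
  have qq : qn n / qn n = 1 by apply: qn_divK.
  have := congr1 (fun x => qn n * x) s0; rewrite mulr0 /spar mulrDr => <-.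
  congr (_ + _); rewrite /spar0 mulrCA; congr (_ * _).
  by rewrite [RHS]mulrCA qq mulr1.
have := congr1 (fun x : K => fcoef (fcoef x 1) 0) E.
rewrite [X in fcoef X 0 = _]fcoefD [LHS]fcoefD.
have -> : zpar n alpha0 q_gt1 y i = fpsC (fpsC (\sum_(1 <= j < i.+1) y j)).
  by rewrite /zpar i_n; case: i i0 {i_n s0 E}.
have -> : fcoef (qn n * (delta * fpsC (fpsC (\sum_(1 <= j < i.+1) y j)))) 1 = 0.
  rewrite [LHS]fcoefM1 fcoefS_qnum mul0r addr0 [X in _ * X]fcoefM1 fcoefS_delta.
  by rewrite mul0r addr0 fcoef_fpsCS mulr0 mulr0.
have -> : fcoef (aK * (g - qp n)) 1 = fpsC alpha0.
  rewrite [LHS]fcoefM1 /alpha0_K fcoef_fpsC0 fcoef_fpsCS mul0r addr0.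
  have -> : fcoef (g - qp n) 1 = 1; last exact: mulr1.
  rewrite fcoefD fcoefN fcoefS_qpow oppr0 addr0 /gamma_h fcoefD fcoefS_gamma_q add0r.
  by [].
rewrite addr0 fcoef_fpsC0 => /eqP.
by rewrite (negPf a0).
Qed.

Section Relations.
Variables (A : alg K) (op : shift_rep A).
Local Opaque gq tq qnum qpow alpha0_K gamma_h op_ev.
Notation op_ev := (@op_ev C A op n alpha0 q_gt1 y).
Notation sc := (scal A).

Lemma op_ev_relation r : defining_relation alpha0 q_gt1 r -> op_ev r = 0.
Proof.
have n1 : (0 < 1 <= n)%N by lia.
have nn : (0 < n <= n)%N by lia.
have n2 : (0 < 2 <= n)%N by lia.
have nP : (0 < n.-1 <= n)%N by lia.
have ne1 : 1%N != n by lia.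
have ne2 : 1%N != n.-1 by lia.
have ne3 : 2%N != n by lia.
have ne4 : 2%N != n.-1 by lia.
have G1n := op_ev_gq op alpha0 q_gt1 y n1 nn ne1.
have G1P := op_ev_gq op alpha0 q_gt1 y n1 nP ne2.
have G2n := op_ev_gq op alpha0 q_gt1 y n2 nn ne3.
have G2P := op_ev_gq op alpha0 q_gt1 y n2 nP ne4.
have T k : (0 < k < n)%N -> op_ev (tq C n k) = Top op n alpha0 q_gt1 y k.
  by apply: op_ev_tq.
have MM u v U V : op_ev u = U -> op_ev v = V -> op_ev (u * v) = U * V.
  by move=> <- <-; apply: op_evM.
case=> [->|->|->|[->|->|->]].
- apply: (eq_trans (op_evB _ _ _ _ _ _)); apply/eqP; rewrite subr_eq0; apply/eqP.
  apply: (eq_trans (MM _ _ _ _ G1n G1P)); apply: (eq_trans (rel_2w1_wn2 op alpha0 q_gt1 y n_gt3)).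
  apply: esym; apply: (eq_trans (op_evZ _ _ _ _ _ _)).
  by apply: (congr1 (fun x => sc _ * x)); apply: MM.
- apply: (eq_trans (op_evB _ _ _ _ _ _)); apply/eqP; rewrite subr_eq0; apply/eqP.
  apply: (eq_trans (MM _ _ _ _ G1n G2n)); apply: (eq_trans (rel_w2_2wn1 op alpha0 q_gt1 y n_gt3)).
  apply: esym; apply: (eq_trans (op_evZ _ _ _ _ _ _)).
  by apply: (congr1 (fun x => sc _ * x)); apply: MM.
- rewrite -[RHS](rel_w2_wn2 op alpha0 q_gt1 y n_gt3) /s_w2_wn2.
  apply: (eq_trans (op_evB _ _ _ _ _ _)).
  apply: (congr2 (fun u v => u - v)); last exact: MM.
  apply: (eq_trans (op_evB _ _ _ _ _ _)).
  apply: (congr2 (fun u v => u - v)); last exact: MM.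
  apply: (eq_trans (op_evD _ _ _ _ _ _)).
  apply: (congr2 +%R); apply: (eq_trans (op_evZ _ _ _ _ _ _));
    apply: (congr1 (fun x => sc _ * x)); exact: MM.
- apply: (eq_trans (op_evB _ _ _ _ _ _)); apply/eqP; rewrite subr_eq0; apply/eqP.
  apply: esym; apply: (eq_trans (op_evZ _ _ _ _ _ _)); rewrite G1n; apply: esym.
  apply: (eq_trans _ (rel_s1 op alpha0 q_gt1 y n_gt3)).
  apply: (eq_trans (op_evB _ _ _ _ _ _)); apply: (congr2 (fun u v => u - v)).
    apply: (eq_trans (op_evD _ _ _ _ _ _)); apply: (congr2 +%R).
    apply: (eq_trans (op_ev_sum _ _ _ _ _ _ _)); apply: eq_big_nat => k k1.
    apply: (eq_trans (op_evZ _ _ _ _ _ _)); apply: (congr1 (fun x => sc _ * x)).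
    by apply: MM; apply: op_ev_gq; lia.
    apply: (eq_trans (op_evZ _ _ _ _ _ _)); apply: (congr1 (fun x => sc _ * x)).
    apply: (eq_trans (op_ev_sum _ _ _ _ _ _ _)); apply: eq_big_nat => k k1.
    apply: (eq_trans (op_evZ _ _ _ _ _ _)); apply: (congr1 (fun x => sc _ * x)).
    by apply: MM => //; apply: T.
  apply: (eq_trans (op_evZ _ _ _ _ _ _)); apply: (congr1 (fun x => sc _ * x)).
    apply: (eq_trans (op_ev_sum _ _ _ _ _ _ _)); apply: eq_big_nat => k k1.
    apply: (eq_trans (op_evZ _ _ _ _ _ _)); apply: (congr1 (fun x => sc _ * x)).
    by apply: MM => //; apply: T.
- apply: (eq_trans (op_evB _ _ _ _ _ _)); apply/eqP; rewrite subr_eq0; apply/eqP.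
  apply: esym; apply: (eq_trans (op_evZ _ _ _ _ _ _)); rewrite G1n; apply: esym.
  apply: (eq_trans _ (rel_s2 op alpha0 q_gt1 y n_gt3)).
  apply: (eq_trans (op_evD _ _ _ _ _ _)); apply: (congr2 +%R).
    apply: (eq_trans (op_evB _ _ _ _ _ _)); apply: (congr2 (fun u v => u - v)).
    apply: (eq_trans (op_ev_sum _ _ _ _ _ _ _)); apply: eq_big_nat => k k1.
    apply: (eq_trans (op_evZ _ _ _ _ _ _)); apply: (congr1 (fun x => sc _ * x)).
    by apply: MM; apply: op_ev_gq; lia.
    apply: (eq_trans (op_evZ _ _ _ _ _ _)); apply: (congr1 (fun x => sc _ * x)).
    apply: (eq_trans (op_ev_sum _ _ _ _ _ _ _)); apply: eq_big_nat => k k1.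
    apply: (eq_trans (op_evZ _ _ _ _ _ _)); apply: (congr1 (fun x => sc _ * x)).
    by apply: MM => //; apply: T.
  apply: (eq_trans (op_evZ _ _ _ _ _ _)); apply: (congr1 (fun x => sc _ * x)).
    apply: (eq_trans (op_ev_sum _ _ _ _ _ _ _)); apply: eq_big_nat => k k1.
    apply: (eq_trans (op_evZ _ _ _ _ _ _)); apply: (congr1 (fun x => sc _ * x)).
    by apply: MM => //; apply: T.
- apply: (eq_trans (op_evB _ _ _ _ _ _)); apply/eqP; rewrite subr_eq0; apply/eqP.
  apply: esym; apply: (eq_trans (op_evZ _ _ _ _ _ _)); rewrite op_ev1 mulr1; apply: esym.
  apply: (eq_trans _ (rel_s0 op alpha0 q_gt1 y n_gt3)).
  apply: (eq_trans (op_evD _ _ _ _ _ _)); apply: (congr2 +%R).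
    apply: (eq_trans (op_evD _ _ _ _ _ _)); apply: (congr2 +%R).
    apply: (eq_trans (op_ev_sum _ _ _ _ _ _ _)); apply: eq_big_nat => k k1.
    apply: (eq_trans (op_ev_sum _ _ _ _ _ _ _)); apply: eq_big_nat => j j1.
    apply: (eq_trans (op_evZ _ _ _ _ _ _)); apply: (congr1 (fun x => sc _ * x)).
    by apply: MM; apply: T; lia.
    apply: (eq_trans (op_ev_sum _ _ _ _ _ _ _)); apply: eq_big_nat => k k1.
    apply: (eq_trans (op_ev_sum _ _ _ _ _ _ _)); apply: eq_big_nat => j j1.
    apply: (eq_trans (op_evZ _ _ _ _ _ _)); apply: (congr1 (fun x => sc _ * x)).
    by apply: MM; apply: T; lia.
  apply: (eq_trans (op_evZ _ _ _ _ _ _)); apply: (congr1 (fun x => sc _ * x)).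
  apply: (eq_trans (op_ev_sum _ _ _ _ _ _ _)); apply: eq_big_nat => k k1.
  apply: (eq_trans (op_ev_sum _ _ _ _ _ _ _)).
  rewrite big_nat_cond [RHS]big_nat_cond; apply: eq_bigr => j /andP[j1 kj].
  apply: (eq_trans (op_evZ _ _ _ _ _ _)); apply: (congr1 (fun x => sc _ * x)).
  by apply: MM; apply: op_ev_gq; rewrite // eq_sym.
Qed.

Lemma op_ev_relation_module z : alpha0 != 0 -> torsion_free A ->
  relation_module alpha0 q_gt1 z -> op_ev z = 0.
Proof.
move=> a0 tfA /(_ (fun x => op_ev x = 0)); apply; last exact: op_ev_relation.
exact: (op_ev_ker_submodule op n_gt3 tfA (spar_neq0 a0)).
Qed.

End Relations.

Notation T := (tens_C C n).

Definition const_hn : {rmorphism C -> K} := @fpsC (fps C) \o @fpsC C.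
Definition op_algC : alg C := restrict_scalars const_hn (op_alg C).

Definition op_ev_const : T -> op_algC :=
  free_ev (op_gen (std_rep C) alpha0 q_gt1 y : label n -> op_algC).
HB.instance Definition _ := GRing.RMorphism.on op_ev_const.

Definition op_hat : tens_hat C n -> op_alg C := fps_ext (op_ev_const : {rmorphism T -> op_alg C}).
HB.instance Definition _ := GRing.RMorphism.on op_hat.

Lemma op_hatD x z : op_hat (x + z) = op_hat x + op_hat z.
Proof. exact: (raddfD op_hat). Qed.
Lemma op_hat0 : op_hat 0 = 0. Proof. exact: (raddf0 op_hat). Qed.
Lemma op_hatM x z : op_hat (x * z) = op_hat x * op_hat z.
Proof. exact: (rmorphM op_hat). Qed.
Lemma op_hat1 : op_hat 1 = 1. Proof. exact: (rmorph1 op_hat). Qed.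

Lemma fcoef_op_hat z i j : fcoef (fcoef (op_hat z) i) j =
  \sum_(a < i.+1) \sum_(b < j.+1)
     fcoef (fcoef (op_ev_const (fcoef (fcoef z a) b)) (i - a)) (j - b).
Proof. exact: fcoef_fps_ext. Qed.

Lemma op_hat_const (x : T) : op_hat (fpsC (fpsC x)) = op_ev_const x.
Proof.
apply: fpsP => i; apply: fpsP => j; rewrite fcoef_op_hat big_ord_recl [X in _ + X]big1.
  rewrite addr0 big_ord_recl [X in _ + X]big1 ?addr0 ?subn0 // => b _.
  by rewrite [X in op_ev_const X]mulr0n [op_ev_const _]raddf0.
move=> a _; rewrite big1 // => b _.
by rewrite [fcoef (fpsC (fpsC x)) _]fcoef_fpsCS [op_ev_const _]raddf0.
Qed.

Lemma op_hat_gen x : op_hat (gen_hat C x) = op_gen (std_rep C) alpha0 q_gt1 y x.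
Proof.
rewrite op_hat_const.
exact: (@free_ev_gen C (label n) op_algC (op_gen (std_rep C) alpha0 q_gt1 y)).
Qed.

Lemma op_hat_scal c : op_hat (scal (tens_hat C n) c) = scal (op_alg C) c.
Proof.
apply: fpsP => i; apply: fpsP => j; rewrite fcoef_op_hat.
have E a b : op_ev_const (fcoef (fcoef (scal (tens_hat C n) c) a) b) =
    fpsC (fpsC (scal (endo_alg C) (fcoef (fcoef c a) b))).
  have -> : op_ev_const (fcoef (fcoef (scal (tens_hat C n) c) a) b) =
    scal op_algC (fcoef (fcoef c a) b) by exact: free_evC.
  move: (fcoef (fcoef c a) b) => d; apply: fpsP => u; apply: fpsP => v.
  change (scal (endo_alg C) (fcoef (fcoef (fpsC (fpsC d)) u) v) =
    fcoef (fcoef (fpsC (fpsC (scal (endo_alg C) d))) u) v).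
  case: u => [|u]; last by rewrite !fcoef_fpsCS [LHS]raddf0.
  rewrite !fcoef_fpsC0; case: v => [|v]; first by rewrite !fcoef_fpsC0.
  by rewrite !fcoef_fpsCS [LHS]raddf0.
rewrite (eq_bigr (fun a : 'I_i.+1 => \sum_(b < j.+1) fcoef (fcoef (fpsC (fpsC
  (scal (endo_alg C) (fcoef (fcoef c a) b)))) (i - a)) (j - b))) => [|a _].
  exact: (fcoef_sum_fpsC (fun a b => scal (endo_alg C) (fcoef (fcoef c a) b))).
by apply: eq_bigr => b _; rewrite E.
Qed.

Lemma op_hat_to_tens z : op_hat (to_tens_hat z) = op_ev (std_rep C) alpha0 q_gt1 y z.
Proof.
rewrite /to_tens_hat (big_morph op_hat op_hatD op_hat0); apply: eq_bigr => w _.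
rewrite op_hatM op_hat_scal; congr (_ * _).
by rewrite (big_morph op_hat op_hatM op_hat1); apply: eq_bigr => x _; apply: op_hat_gen.
Qed.

Fact op_hat_ker_is_ideal : is_ideal (fun z => op_hat z = 0).
Proof.
split=> [|x z x0 z0|a z z0|a z z0]; first exact: op_hat0.
- by rewrite op_hatD x0 z0 addr0.
- by rewrite op_hatM z0 mulr0.
- by rewrite op_hatM z0 mul0r.
Qed.

Lemma op_hat_defining_ideal z : alpha0 != 0 ->
  in_defining_ideal alpha0 q_gt1 z -> op_hat z = 0.
Proof.
move=> a0 Jz; apply: (Jz (Ideal op_hat_ker_is_ideal)) => /= [x|r rr].
  (* The kernel is closed: a coefficient of the image involves only finitely many coefficients of x,
     so x may be replaced with an element of the kernel that agrees with it up to degree i + j. *)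
  move=> xN; apply: fpsP => i; apply: fpsP => j.
  have [u u0 xu] := xN (i + j).+1.
  have -> : x = u + (x - u) by rewrite addrC subrK.
  rewrite op_hatD u0 add0r fcoef_op_hat big1 // => a _.
  rewrite big1 // => b _; rewrite xu ?raddf0 //.
  by move: (ltn_ord a) (ltn_ord b); lia.
rewrite op_hat_to_tens.
exact: (op_ev_relation_module (std_rep C) a0 (@op_alg_torsion_free C) rr).
Qed.

End DefiningIdealKernel.

(** * The ideal at h = nu = 0 *)

Lemma alg_mulrn_eq0 (k : numFieldType) (Q : alg k) (u : Q) m :
  (0 < m)%N -> u *+ m = 0 -> u = 0.
Proof.
move=> m0 um; have mk : m%:R != 0 :> k by rewrite pnatr_eq0 -lt0n.
rewrite -[u]mul1r -(rmorph1 (scal Q)) -(mulVf mk) rmorphM rmorph_nat -mulrA.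
by rewrite mulr_natl um mulr0.
Qed.

Lemma addrB_swap (V : zmodType) (a b c d : V) : (a - b) + (c - d) = (a - d) + (c - b).
Proof. by rewrite addrACA [RHS]addrACA [- d - b]addrC. Qed.

Lemma sub_cancel (V : zmodType) (a b c d : V) :
  - a + b - (c - d) = 0 -> b - c = 0 -> a - d = 0.
Proof.
move=> H /eqP; rewrite subr_eq0 => /eqP bc; move: H.
rewrite bc opprB addrACA subrr addr0 => H.
by rewrite -opprB [d - a]addrC H oppr0.
Qed.

Section Transport.
Variable n : nat.
Hypothesis n_gt3 : (3 < n)%N.

Lemma fresh3 (i a b : 'I_n) : exists j, [/\ j != i, j != a & j != b].
Proof.
have : (0 < #|~: [set i; a; b]|)%N.
  rewrite cardsCs finset.setCK card_ord subn_gt0 (leq_ltn_trans _ n_gt3) //.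
  apply: leq_trans (leq_card_setU _ _) _; rewrite cards1 cards2.
  by case: (_ != _).
move=> /card_gt0P[j]; rewrite !inE !negb_or => /andP[/andP[? ?] ?].
by exists j.
Qed.

(* With a spare index available, one index can be moved at a time. *)
Lemma transport3 (P : 'I_n -> 'I_n -> 'I_n -> Prop) i0 a0 b0 :
  (forall i a b j, [/\ i != a, i != b & a != b] -> [/\ j != i, j != a & j != b] ->
    P i a b -> [/\ P j a b, P i j b & P i a j]) ->
  [/\ i0 != a0, i0 != b0 & a0 != b0] -> P i0 a0 b0 ->
  forall i a b, [/\ i != a, i != b & a != b] -> P i a b.
Proof.
move=> step d0 P0 i a b [ia ib ab].
(* The first index is brought to its target value, then the second, then the third. If the target
   value is occupied by another index, that index first steps aside to a spare value. *)
have [a1 [b1 [d1 P1]]] : exists a1 b1, [/\ i != a1, i != b1 & a1 != b1] /\ P i a1 b1.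
  have [E|n1] := eqVneq i i0; first by subst i0; exists a0, b0.
  have [j dj] := fresh3 i0 a0 b0; have [P1 P2 P3] := step _ _ _ _ d0 dj P0.
  case: d0 dj => [e1 e2 e3] [f1 f2 f3].
  have [E|n2] := eqVneq i a0.
    subst a0; exists j, b0; split; first by split; rewrite // eq_sym.
    have [] // := step i0 j b0 i _ _ P2; first by split; rewrite // eq_sym.
    by split; rewrite // eq_sym.
  have [E|n3] := eqVneq i b0.
    subst b0; exists a0, j; split; first by split; rewrite // eq_sym.
    have [] // := step i0 a0 j i _ _ P3; first by split; rewrite // eq_sym.
    by split; rewrite // eq_sym.
  exists a0, b0; split; first by split.
  by have [] := step i0 a0 b0 i _ _ P0.
have [b2 [d2 P2]] : exists b2, [/\ i != a, i != b2 & a != b2] /\ P i a b2.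
  have [E|n1] := eqVneq a a1; first by subst a1; exists b1.
  have [j dj] := fresh3 i a1 b1; have [Q1 Q2 Q3] := step _ _ _ _ d1 dj P1.
  case: d1 dj => [e1 e2 e3] [f1 f2 f3].
  have [E|n2] := eqVneq a b1.
    subst b1; exists j; split; first by split; rewrite // eq_sym.
    have [] // := step i a1 j a _ _ Q3; first by split; rewrite // eq_sym.
    by split; rewrite // eq_sym.
  exists b1; split; first by split.
  by have [] := step i a1 b1 a _ _ P1; rewrite // eq_sym.
have [E|n1] := eqVneq b b2; first by subst b2.
have [] // := step i a b2 b _ _ P2; by split; rewrite // eq_sym.
Qed.

End Transport.

(** * Commutativity and vanishing minors, spread by the adjoint action from one instance *)

Section RankOne.
Variables (k : numFieldType) (Q : alg k) (n : nat) (alpha0 : k).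
Variables (x : 'I_n -> 'I_n -> Q) (D : 'I_n -> 'I_n -> Q -> Q) (o1 o2 om on : 'I_n).
Hypothesis n_gt3 : (3 < n)%N.
Hypothesis DB : forall p q u v, D p q (u - v) = D p q u - D p q v.
Hypothesis DM : forall p q u v, D p q (u * v) = D p q u * v + u * D p q v.
Hypothesis D_scal : forall p q c, D p q (scal Q c) = 0.
Hypothesis Dx : forall p q i j, p != q ->
  D p q (x i j) = x p j *+ (q == i) - x i q *+ (j == p).
Hypotheses (d12 : o1 != o2) (d1m : o1 != om) (d1n : o1 != on).
Hypotheses (d2m : o2 != om) (d2n : o2 != on) (dmn : om != on).

Definition com (u v : Q) : Q := u * v - v * u.

Hypothesis rel_row : com (x o1 on) (x o1 om) = 0.
Hypothesis rel_col : com (x o1 on) (x o2 on) = 0.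
Hypothesis rel_minor : x o1 on * x o2 om + x o2 om * x o1 on
  - x o1 om * x o2 on - x o2 on * x o1 om = 0.
Hypothesis rel_sq : \sum_m x o1 m * x m on = scal Q alpha0 * x o1 on.
Hypothesis rel_sq' : \sum_m x m on * x o1 m = scal Q alpha0 * x o1 on.
Hypothesis rel_norm : \sum_i \sum_j x i j * x j i = scal Q (alpha0 ^+ 2).
Hypothesis rel_trace : \sum_i x i i = scal Q alpha0.

Lemma D0 p q : D p q 0 = 0.
Proof. by rewrite -{1}(subrr 0) DB subrr. Qed.
Lemma DN p q u : D p q (- u) = - D p q u.
Proof. by rewrite -sub0r DB D0 sub0r. Qed.
Lemma DD p q u v : D p q (u + v) = D p q u + D p q v.
Proof. by rewrite -{1}(opprK v) DB DN opprK. Qed.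
Lemma D_sum p q (I : Type) (r : seq I) (F : I -> Q) :
  D p q (\sum_(i <- r) F i) = \sum_(i <- r) D p q (F i).
Proof. exact: (big_morph (D p q) (DD p q) (D0 p q)). Qed.
Lemma Dcom p q u v : D p q (com u v) = com (D p q u) v + com u (D p q v).
Proof. by rewrite /com DB !DM; rewrite opprD addrACA [X in _ + X]addrC -!addrA;
  congr (_ + _); rewrite addrC addrA addrAC -!addrA; congr (_ + _); rewrite addrC. Qed.

Lemma com0 u : com 0 u = 0. Proof. by rewrite /com mul0r mulr0 subrr. Qed.
Lemma comr0 u : com u 0 = 0. Proof. by rewrite /com mul0r mulr0 subrr. Qed.
Lemma comN u v : com (- u) v = - com u v.
Proof. by rewrite /com mulNr mulrN opprB opprK addrC. Qed.
Lemma comrN u v : com u (- v) = - com u v.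
Proof. by rewrite /com mulNr mulrN opprB opprK addrC. Qed.
Lemma comD u v w : com (u + v) w = com u w + com v w.
Proof. by rewrite /com mulrDl mulrDr opprD addrACA. Qed.
Lemma comrD u v w : com w (u + v) = com w u + com w v.
Proof. by rewrite /com mulrDl mulrDr opprD addrACA. Qed.
Lemma comB u v w : com (u - v) w = com u w - com v w.
Proof. by rewrite comD comN. Qed.
Lemma com_anti u v : com u v = - com v u.
Proof. by rewrite /com opprB. Qed.
Lemma comxx u : com u u = 0. Proof. exact: subrr. Qed.
Lemma com_sum (I : Type) (r : seq I) (F : I -> Q) u :
  com (\sum_(i <- r) F i) u = \sum_(i <- r) com (F i) u.
Proof. exact: (big_morph (fun v => com v u) (fun a b => comD a b u) (com0 u)). Qed.

Lemma com_scal c u : com (scal Q c) u = 0.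
Proof. by rewrite /com scalC subrr. Qed.

Lemma com_eq0 u v : com u v = 0 -> u * v = v * u.
Proof. by move=> /eqP; rewrite subr_eq0 => /eqP. Qed.

Lemma sum_comE (F G : 'I_n -> Q) :
  \sum_m com (F m) (G m) = \sum_m F m * G m - \sum_m G m * F m.
Proof. by rewrite -sumrB. Qed.

Lemma comE u v : com u v = u * v - v * u. Proof. by []. Qed.

Local Opaque com.

Ltac neq := repeat match goal with
  | H : is_true (?a != ?b) |- context [?a == ?b] => rewrite (negPf H)
  | H : is_true (?a != ?b) |- context [?b == ?a] => rewrite (eq_sym b a) (negPf H)
  end; rewrite ?eqxx ?mulr1n ?mulr0n ?subr0 ?sub0r ?subrr.
Ltac Dsimp := rewrite ?Dcom ?DB ?DD ?DM ?DN ?Dx //; try (by rewrite // eq_sym); neq;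
  rewrite ?(oppr0, com0, comr0, mul0r, mulr0, add0r, addr0, subr0, sub0r).

(** One derivation moves one column index. To move the common row index the derivation is applied
    twice, which yields twice the new relation. *)
Lemma com_row i a b : [/\ i != a, i != b & a != b] -> com (x i a) (x i b) = 0.
Proof.
move: i a b; apply: (@transport3 n n_gt3 (fun i a b => com (x i a) (x i b) = 0) o1 on om) => //.
  move=> i a b j [ia ib ab] [ji ja jb] H; split.
  - have H1 := congr1 (D j i) H; rewrite D0 in H1.
    have H2 := congr1 (D j i) H1; rewrite D0 in H2; move: H2.
    do 3 Dsimp. rewrite -mulr2n => H2; exact: (alg_mulrn_eq0 _ H2).
  - have := congr1 (D a j) H; rewrite D0; Dsimp.
    by rewrite comN => /eqP; rewrite oppr_eq0 => /eqP.
  - have := congr1 (D b j) H; rewrite D0; Dsimp.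
    by rewrite comrN => /eqP; rewrite oppr_eq0 => /eqP.
by split=> //; rewrite eq_sym.
Qed.

Lemma com_col i j a : [/\ i != j, i != a & j != a] -> com (x i a) (x j a) = 0.
Proof.
move: i j a; apply: (@transport3 n n_gt3 (fun i j a => com (x i a) (x j a) = 0) o1 o2 on) => //.
move=> i a b j [ia ib ab] [ji ja jb] H; split.
- by have := congr1 (D j i) H; rewrite D0; Dsimp.
- by have := congr1 (D j a) H; rewrite D0; Dsimp.
- have H1 := congr1 (D b j) H; rewrite D0 in H1.
  have H2 := congr1 (D b j) H1; rewrite D0 in H2; move: H2.
  do 3 Dsimp.
  by rewrite !mulrNN -mulr2n => /(alg_mulrn_eq0 (ltn0Sn 1)); rewrite -comE.
Qed.

(** For distinct rows and columns, moving a row index and moving a column index give the sum and the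
    difference of [x_ja, x_ib] and [x_ia, x_jb], so both vanish. *)
Lemma com_disjoint i a j b : i != a -> i != b -> j != a -> j != b ->
  com (x i a) (x j b) = 0.
Proof.
move=> ia ib ja jb; have [E|ij] := eqVneq i j.
  subst j; have [->|ab] := eqVneq a b; first exact: comxx.
  exact: com_row.
have [E|ab] := eqVneq a b; first by subst b; apply: com_col.
have H1 := congr1 (D j i) (com_row (And3 ia ib ab)); rewrite D0 in H1.
have H2 := congr1 (D a b) (com_col (And3 ij ia ja)); rewrite D0 in H2.
move: H1 H2; Dsimp; Dsimp; rewrite [com (x j a) _]com_anti comN comrN => H1 H2.
apply: (@alg_mulrn_eq0 _ _ _ 2) => //.
move: (com _ _) (com _ _) H1 H2 => P R H1 H2.
have := congr2 (fun u v => u - v) H1 H2.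
by rewrite subr0 opprD !opprK addrACA addNr add0r mulr2n.
Qed.

Definition sq i j := \sum_m x i m * x m j.
Definition sq' i j := \sum_m x m j * x i m.

Lemma D_sq p q i j : p != q ->
  D p q (sq i j) = sq p j *+ (q == i) - sq i q *+ (j == p).
Proof.
move=> pq; rewrite /sq D_sum.
rewrite (eq_bigr (fun m => (x p m * x m j *+ (q == i) - x i m * x m q *+ (j == p)) +
  (x i m * x p j *+ (q == m) - x i q * x m j *+ (m == p)))) => [|m _]; last first.
  by rewrite DM !Dx // mulrBl mulrBr !mulrnAl !mulrnAr; apply: addrB_swap.
rewrite big_split /= [X in _ + X]sumrB.
have -> : \sum_m x i m * x p j *+ (q == m) = x i q * x p j.
  rewrite (bigD1 q) //= eqxx mulr1n big1 ?addr0 // => m mq.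
  by rewrite eq_sym (negPf mq).
have -> : \sum_m x i q * x m j *+ (m == p) = x i q * x p j.
  rewrite (bigD1 p) //= eqxx mulr1n big1 ?addr0 // => m mq.
  by rewrite (negPf mq).
by rewrite subrr addr0 sumrB -!sumrMnl.
Qed.

Lemma D_sq' p q i j : p != q ->
  D p q (sq' i j) = sq' p j *+ (q == i) - sq' i q *+ (j == p).
Proof.
move=> pq; rewrite /sq' D_sum.
rewrite (eq_bigr (fun m => (x m j * x p m *+ (q == i) - x m q * x i m *+ (j == p)) +
  (x p j * x i m *+ (q == m) - x m j * x i q *+ (m == p)))) => [|m _]; last first.
  by rewrite DM !Dx // mulrBl mulrBr !mulrnAl !mulrnAr addrC; apply: addrB_swap.
rewrite big_split /= [X in _ + X]sumrB.
have -> : \sum_m x p j * x i m *+ (q == m) = x p j * x i q.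
  rewrite (bigD1 q) //= eqxx mulr1n big1 ?addr0 // => m mq.
  by rewrite eq_sym (negPf mq).
have -> : \sum_m x m j * x i q *+ (m == p) = x p j * x i q.
  rewrite (bigD1 p) //= eqxx mulr1n big1 ?addr0 // => m mq.
  by rewrite (negPf mq).
by rewrite subrr addr0 sumrB -!sumrMnl.
Qed.

(** Elements that transform like the x_ij are carried by the derivations from the corner, the
    highest weight vector, to every off-diagonal position. *)
Lemma adjoint_transport (f : 'I_n -> 'I_n -> Q) :
  (forall p q i j, p != q -> D p q (f i j) = f p j *+ (q == i) - f i q *+ (j == p)) ->
  f o1 on = 0 -> forall i j, i != j -> f i j = 0.
Proof.
move=> Df f0 i j ij; have [b [bi bj _]] := fresh3 n_gt3 i j j.
apply: (transport3 n_gt3 (P := fun i j _ => f i j = 0) (i0 := o1) (a0 := on) (b0 := om)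
  _ _ f0 (i := i) (a := j) (b := b)).
- move=> {i j ij b bi bj} i a b j [ia ib ab] [ji ja jb] H; split=> //.
    by have := congr1 (D j i) H; rewrite D0 Df //; neq.
  have := congr1 (D a j) H; rewrite D0 Df; last by rewrite eq_sym.
  by neq => /eqP; rewrite oppr_eq0 => /eqP.
- by split=> //; rewrite eq_sym.
- by split=> //; rewrite eq_sym.
Qed.

Lemma sum_com i j : i != j -> \sum_m com (x i m) (x m j) = 0.
Proof.
move=> ij; rewrite sum_comE -/(sq i j) -/(sq' i j).
apply: (adjoint_transport (f := fun i j => sq i j - sq' i j)) => // [p q a b pq|].
  by rewrite DB D_sq // D_sq' // !mulrnBl !opprB; apply: addrB_swap.
by rewrite /sq /sq' rel_sq rel_sq' subrr.
Qed.

(** The commutator w does not depend on the middle index. The two remaining terms of [sum_com], with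
    a diagonal factor, add up to 2 w, so that [sum_com] becomes n w = 0. *)
Lemma com_mid i m j : [/\ i != m, i != j & m != j] -> com (x i m) (x m j) = 0.
Proof.
move=> [im ij mj]; set w := com (x i m) (x m j).
have W m' : m' != i -> m' != j -> com (x i m') (x m' j) = w.
  move=> m'i m'j; have [->//|mm'] := eqVneq m' m.
  have jm : j != m by rewrite eq_sym.
  have im' : i != m' by rewrite eq_sym.
  have := congr1 (D m m') (com_disjoint m'j mm' ij im); rewrite D0; Dsimp.
  rewrite comrN => /eqP; rewrite subr_eq0 => /eqP H.
  by rewrite com_anti -H /w [RHS]com_anti.
have jm : j != m by rewrite eq_sym.
have mi : m != i by rewrite eq_sym.
have H1 : com (x j j - x m m) (x i j) = - w.
  have := congr1 (D j m) (com_col (And3 mi mj ij)); rewrite D0; Dsimp.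
  by rewrite comrN => /eqP; rewrite subr_eq0 => /eqP ->; rewrite com_anti.
have H2 : com (x m m - x i i) (x i j) = - w.
  have := congr1 (D m i) (com_row (And3 ij im jm)); rewrite D0; Dsimp.
  rewrite addrC => /eqP; rewrite addr_eq0 => /eqP H.
  by rewrite com_anti H opprK com_anti.
have H4 : com (x i i) (x i j) + com (x i j) (x j j) = w *+ 2.
  rewrite [com (x i j) _]com_anti -comB -(subrKA (x m m)) comD -[x i i - _]opprB comN H2.
  by rewrite -[x m m - _]opprB comN H1 opprK mulr2n.
have : \sum_m' (com (x i m') (x m' j) - w) = 0.
  rewrite (bigD1 i) //= (bigD1 j) 1?eq_sym //= big1 ?addr0 => [|m' /andP[m'i m'j]].
    by rewrite addrACA H4 mulr2n -opprD subrr.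
  by rewrite W // subrr.
rewrite sumrB sum_com // sumr_const card_ord sub0r => /eqP.
rewrite oppr_eq0 => /eqP; apply: alg_mulrn_eq0; exact: leq_trans n_gt3.
Qed.

Lemma com_diagB i j m m' : i != j -> com (x m m - x m' m') (x i j) = 0.
Proof.
move=> ij.
have D1 l : l != i -> l != j -> com (x l l - x j j) (x i j) = 0.
  move=> li lj; have il : i != l by rewrite eq_sym.
  have := congr1 (D j l) (com_col (And3 li lj ij)); rewrite D0; Dsimp.
  rewrite comrN [com (x l j) _]com_anti com_mid // !oppr0 addr0 -[x j j - _]opprB comN => /eqP.
  by rewrite oppr_eq0 => /eqP.
have D2 l : l != i -> l != j -> com (x l l - x i i) (x i j) = 0.
  move=> li lj; have il : i != l by rewrite eq_sym.
  have jl : j != l by rewrite eq_sym.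
  have := congr1 (D l i) (com_row (And3 ij il jl)); rewrite D0; Dsimp.
  by rewrite [com (x l j) _]com_anti com_mid // oppr0 add0r com_anti => /eqP;
    rewrite oppr_eq0 => /eqP.
have [l [li lj _]] := fresh3 n_gt3 i j j.
have E u : com (x u u - x l l) (x i j) = 0.
  have [->|ui] := eqVneq u i; first by rewrite -opprB comN D2 ?oppr0.
  have [->|uj] := eqVneq u j; first by rewrite -opprB comN D1 ?oppr0.
  by rewrite -(subrKA (x j j)) comD D1 // -opprB comN D1 // oppr0 addr0.
by rewrite -(subrKA (x l l)) comD E -opprB comN E oppr0 addr0.
Qed.

(** Differences of diagonal entries commute with x_ij. Summing over m' turns the subtracted entries
    into the trace, a scalar, and leaves n times the claim. *)
Lemma com_diag i j m : i != j -> com (x m m) (x i j) = 0.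
Proof.
move=> ij; apply: (@alg_mulrn_eq0 _ _ _ n); first exact: leq_trans n_gt3.
have : \sum_m' com (x m m - x m' m') (x i j) = 0.
  by rewrite big1 // => m' _; apply: com_diagB.
rewrite -com_sum sumrB rel_trace comB com_scal subr0 sumr_const card_ord => <-.
elim: n => [|l IH]; first by rewrite !mulr0n com0.
by rewrite !mulrS comD IH.
Qed.

Lemma com_transpose i j : i != j -> com (x i j) (x j i) = 0 /\ com (x i i) (x j j) = 0.
Proof.
move=> ij; have ji : j != i by rewrite eq_sym.
have := congr1 (D j i) (com_diag i ij); rewrite D0; Dsimp; rewrite comrD ?comrN comxx subr0 => H1.
have := congr1 (D j i) (com_diag j ij); rewrite D0; Dsimp; rewrite comrD ?comrN comxx add0r comN => H2.
have E : com (x i i) (x j j) = 0.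
  apply: (@alg_mulrn_eq0 _ _ _ 2) => //.
  have := congr2 +%R H1 H2; rewrite [com (x j j) _]com_anti opprK addr0.
  by rewrite addrACA subrr add0r mulr2n.
by split=> //; rewrite com_anti; move: H1; rewrite E addr0 => ->; rewrite oppr0.
Qed.

Lemma all_com i j a b : com (x i j) (x a b) = 0.
Proof.
have [E|ij] := eqVneq i j.
  subst j; have [E|ab] := eqVneq a b; last exact: com_diag.
  subst b; have [->|ia] := eqVneq i a; first exact: comxx.
  by case: (com_transpose ia).
have [E|ab] := eqVneq a b; first by subst b; rewrite com_anti com_diag ?oppr0.
have [E|ja] := eqVneq j a.
  subst a; have [E|ib] := eqVneq i b; last exact: com_mid.
  by subst b; case: (com_transpose ij).
have [E|ib] := eqVneq i b.
  by subst b; rewrite com_anti com_mid ?oppr0 //; split; rewrite // eq_sym.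
by apply: com_disjoint => //; rewrite eq_sym.
Qed.

Lemma gen_comm i j a b : x i j * x a b = x a b * x i j.
Proof. exact/com_eq0/all_com. Qed.

Lemma minor_o l : [/\ l != o1, l != om & l != on] -> x o1 on * x l om - x o1 om * x l on = 0.
Proof.
have M2 : x o1 on * x o2 om - x o1 om * x o2 on = 0.
  apply: (@alg_mulrn_eq0 _ _ _ 2) => //; rewrite -rel_minor.
  by rewrite [x o2 om * _]gen_comm [x o2 on * _]gen_comm mulr2n addrACA addrA.
move=> [l1 lm ln]; have [->//|l2] := eqVneq l o2.
by have := congr1 (D l o2) M2; rewrite D0; do 2 Dsimp.
Qed.

(** These minors are independent of l, and the quadratic relation together with the trace relation
    says that they add up to 0. *)
Lemma minor_mid_o l : l != o1 -> l != on -> x o1 l * x l on - x o1 on * x l l = 0.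
Proof.
have E l' : l' != o1 -> l' != on ->
    x o1 l' * x l' on - x o1 on * x l' l' = x o1 om * x om on - x o1 on * x om om.
  move=> l1 ln; have [->//|lm] := eqVneq l' om.
  have := congr1 (D om l') (minor_o (And3 l1 lm ln)); rewrite D0; do 2 Dsimp.
  rewrite mulrBr mulNr opprD opprK => /eqP H; apply/eqP; rewrite eq_sym -subr_eq0.
  rewrite -oppr_eq0 -(eqP H); apply/eqP.
  by rewrite opprB opprB addrC addrA addrAC -!addrA; congr (_ + _); rewrite addrC addrA.
move=> l1 ln; rewrite E //; set m0 := (X in X = 0).
have [l' [a1 a2 a3]] := fresh3 n_gt3 o1 on om.
have : \sum_l (x o1 l * x l on - x o1 on * x l l) = 0.
  by rewrite sumrB rel_sq -mulr_sumr rel_trace -scalC subrr.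
rewrite (bigD1 o1) //= (bigD1 on) 1?eq_sym //= gen_comm subrr add0r subrr add0r.
rewrite (eq_bigr (fun=> m0)) => [|j /andP[j1 jn]]; last exact: E.
rewrite sumr_const; apply: alg_mulrn_eq0; apply/card_gt0P; exists om.
by rewrite unfold_in /= eq_sym d1m dmn.
Qed.

Lemma minor_mid j m a : [/\ j != m, j != a & m != a] -> x j m * x m a - x j a * x m m = 0.
Proof.
move: j m a; apply: (@transport3 n n_gt3 (fun j m a => x j m * x m a - x j a * x m m = 0) o1 om on) => //.
  move=> i a b j [ia ib ab] [ji ja jb] H; split.
  - by have := congr1 (D j i) H; rewrite D0; do 2 Dsimp.
  - have H1 := congr1 (D j a) H; rewrite D0 in H1; move: H1; do 2 Dsimp; move=> H1.
    have H2 := congr1 (D a j) H1; rewrite D0 in H2; move: H2; do 2 Dsimp.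
    rewrite mulNr mulrBr => H2; exact: (sub_cancel H2 H).
  - have := congr1 (D b j) H; rewrite D0; do 2 Dsimp.
    rewrite mulrN mulNr opprK addrC => /eqP; rewrite -oppr_eq0 opprD opprK => /eqP <-.
    by rewrite addrC.
by apply: minor_mid_o => //; rewrite eq_sym.
Qed.

Definition det2 i j := x i j * x j i - x i i * x j j.
Lemma det2C i j : det2 i j = det2 j i.
Proof. by rewrite /det2 gen_comm [x i i * _]gen_comm. Qed.

Lemma det2_row a j m : [/\ j != m, j != a & m != a] -> det2 a m = det2 j m.
Proof.
move=> [jm ja ma]; have := congr1 (D a j) (minor_mid (And3 jm ja ma)); rewrite D0; do 2 Dsimp.
rewrite mulrN mulrBl opprB addrB_swap -[X in _ + X]opprB => /eqP.
by rewrite subr_eq0 => /eqP.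
Qed.

Lemma det2_const i j a b : i != j -> a != b -> det2 i j = det2 a b.
Proof.
have R i' j' a' : i' != j' -> a' != j' -> det2 i' j' = det2 a' j'.
  move=> ij aj; have [->//|ia] := eqVneq i' a'.
  by apply: det2_row; split; rewrite // eq_sym.
move=> ij ab; have [E|aj] := eqVneq a j.
  by subst j; rewrite [RHS]det2C; apply: R => //; rewrite eq_sym.
rewrite (R i j a) // det2C [RHS]det2C; apply: R; rewrite // eq_sym //.
Qed.

(** All principal minors coincide up to the common sign, and their sum is tr(x^2) - (tr x)^2 =
    alpha0^2 - alpha0^2. *)
Lemma det2_eq0 i j : i != j -> det2 i j = 0.
Proof.
move=> ij.
have : \sum_a \sum_b det2 a b = 0.
  rewrite /det2 (eq_bigr _ (fun a _ => sumrB _ _ _ _)) sumrB rel_norm.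
  rewrite (eq_bigr (fun a => x a a * scal Q alpha0)) => [|a _].
    by rewrite -mulr_suml rel_trace -rmorphM subrr.
  by rewrite -mulr_sumr rel_trace.
rewrite (eq_bigr (fun a => det2 i j *+ n.-1)) => [|a _].
  rewrite sumr_const card_ord -mulrnA; apply: alg_mulrn_eq0.
  by move: n_gt3; case: n => [|[|m]].
rewrite (bigD1 a) //= {1}/det2 subrr add0r (eq_bigr (fun=> det2 i j)) => [|b ba].
  by rewrite sumr_const cardC1 card_ord.
by apply: det2_const => //; rewrite eq_sym.
Qed.

Lemma rank_one i j m : x i m * x m j = x m m * x i j.
Proof.
have [->|im] := eqVneq i m; first by [].
have [->|mj] := eqVneq m j; first by rewrite gen_comm.
have [E|ij] := eqVneq i j.
  by subst j; have := det2_eq0 im; rewrite /det2 [x i i * _]gen_comm => /eqP; rewrite subr_eq0 => /eqP.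
by rewrite [RHS]gen_comm; apply/eqP; rewrite -subr_eq0; apply/eqP/minor_mid.
Qed.

End RankOne.

Lemma scal_natrl (k : comPzRingType) (Q : alg k) m (u : Q) : scal Q m%:R * u = u *+ m.
Proof.
elim: m => [|m IH]; first by rewrite rmorph0 mul0r.
by rewrite !mulrS rmorphD rmorph1 mulrDl mul1r IH.
Qed.

Section DiagonalCoordinates.
Variables (k : numFieldType) (Q : alg k) (n : nat) (alpha0 : k) (t : nat -> Q).
Hypothesis n_gt1 : (1 < n)%N.
Notation sc := (scal Q).

(* The diagonal coordinates recovered from their differences and their sum. *)
Definition diag_coord (i : nat) : Q :=
  sc (alpha0 / n%:R) + \sum_(1 <= j < n) sc ((n - j)%N%:R / n%:R) * t j
  - \sum_(1 <= j < i) t j.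

Let n0 : n%:R != 0 :> k.
Proof. by rewrite pnatr_eq0 -lt0n; apply: leq_trans n_gt1. Qed.

Lemma diag_coord_sub i : (0 < i)%N -> diag_coord i - diag_coord i.+1 = t i.
Proof.
move=> i0; rewrite /diag_coord [in X in _ - X]big_nat_recr //= opprB [LHS]addrC addrA subrK.
by rewrite [X in X - _]addrC addrK.
Qed.

Lemma sum_partial_sums m :
  \sum_(1 <= i < m.+1) \sum_(1 <= j < i) t j = \sum_(1 <= j < m.+1) t j *+ (m - j).
Proof.
elim: m => [|m IH]; first by rewrite !big_geq.
rewrite big_nat_recr //= IH [RHS]big_nat_recr //= subnn mulr0n addr0 -big_split /=.
by apply: eq_big_nat => j /andP[_ jm]; rewrite -mulrSr subSn.
Qed.

Lemma scal_divn_mulrn m u : sc (m%:R / n%:R) * u *+ n = u *+ m.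
Proof.
rewrite -mulrnAl -(raddfMn (scal Q)) -[_ / _ *+ n]mulr_natr mulfVK //.
exact: scal_natrl.
Qed.

Lemma sum_diag_coord : \sum_(1 <= i < n.+1) diag_coord i = sc alpha0.
Proof.
rewrite sumrB sum_partial_sums sumr_const_nat subn1 /= mulrnDl.
rewrite -(raddfMn (scal Q)) -[_ / _ *+ n]mulr_natr mulfVK //.
rewrite -addrA -[RHS]addr0; congr (_ + _); apply/eqP; rewrite subr_eq0; apply/eqP.
rewrite [RHS]big_nat_recr /=; last by apply: leq_trans n_gt1.
by rewrite subnn mulr0n addr0 -sumrMnl; apply: eq_bigr => j _; apply: scal_divn_mulrn.
Qed.

Lemma sum_coord_first :
  \sum_(1 <= j < n) sc ((n - j)%N%:R / n%:R) * t j = diag_coord 1 - sc (alpha0 / n%:R).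
Proof. by rewrite /diag_coord [X in _ - X - _]big_geq // subr0 addrC addKr. Qed.

Lemma sum_coord_last :
  \sum_(1 <= j < n) sc (j%:R / n%:R) * t j = sc (alpha0 / n%:R) - diag_coord n.
Proof.
rewrite /diag_coord opprB opprD addrCA addNKr -sumrB; apply: eq_big_nat => j /andP[_ jn].
rewrite -[X in X - _]mul1r -(rmorph1 sc) -mulrBl -rmorphB natrB ?(ltnW jn) //.
by congr (sc _ * _); rewrite mulrBl mulfV // opprB addrCA subrr addr0.
Qed.

(** The inverse of the Cartan matrix of type A_(n-1). *)
Definition gram (i j : nat) : k := (minn i j * (n - maxn i j))%N%:R / n%:R.
Definition gram_sum i := \sum_(1 <= j < n) sc (gram i j) * t j.

Lemma gramS i j : (0 < j < n)%N -> (i < n)%N ->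
  gram i.+1 j - gram i j = (n - j)%N%:R / n%:R - (j <= i)%N%:R.
Proof.
move=> /andP[j0 jn] i_n; rewrite /gram.
have [ji|ij] := leqP j i.
  have -> : minn i.+1 j = j by lia.
  have -> : maxn i.+1 j = i.+1 by lia.
  have -> : (n - i = (n - i.+1).+1)%N by lia.
  move: (n - i.+1)%N => m; rewrite !natrM natrB ?(ltnW jn) // [m.+1%:R]mulrSr /=; field.
  exact: n0.
have -> : minn i.+1 j = i.+1 by lia.
have -> : maxn i.+1 j = j by lia.
by rewrite subr0 -mulrBl !natrM -mulrBl -natr1 addrAC subrr add0r mul1r.
Qed.

Lemma gram_sumS i : (i < n)%N ->
  gram_sum i.+1 - gram_sum i = diag_coord i.+1 - sc (alpha0 / n%:R).
Proof.
move=> i_n; rewrite /diag_coord -sumrB.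
rewrite (eq_big_nat _ _ (F2 := fun j => sc ((n - j)%N%:R / n%:R) * t j - t j *+ (j <= i)%N)).
  rewrite sumrB [RHS]addrAC [X in _ = X - _]addrC addKr; congr (_ - _).
  rewrite [LHS](big_cat_nat (n := i.+1)) //= [X in _ + X]big_nat_cond [X in _ + X]big1 ?addr0.
    by apply: eq_big_nat => j /andP[_ ji]; rewrite -ltnS ji.
  by move=> j /andP[/andP[ij _] _]; rewrite leqNgt ij.
move=> j j1; rewrite -mulrBl -rmorphB gramS //.
by rewrite rmorphB mulrBl; congr (_ - _); apply: scal_natrl.
Qed.

Lemma gram_sum0 : gram_sum 0 = 0.
Proof.
by rewrite /gram_sum big1 // => j _; rewrite /gram min0n mul0n mul0r rmorph0 mul0r.
Qed.

Lemma gram_sumn : gram_sum n = 0.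
Proof.
rewrite /gram_sum big_nat_cond big1 // => j /andP[/andP[_ jn] _].
by rewrite /gram (maxn_idPl (ltnW jn)) subnn muln0 mul0r rmorph0 mul0r.
Qed.

(** Summation by parts: the increments of [gram_sum] are the diagonal coordinates minus their mean,
    and the boundary values are 0. This turns the Cartan part of s_0 at q = 1 into a sum of
    squares. *)
Lemma gram_form : \sum_(1 <= i < n) t i * gram_sum i =
  \sum_(1 <= i < n.+1) diag_coord i * diag_coord i - sc (alpha0 ^+ 2 / n%:R).
Proof.
pose r i := diag_coord i * gram_sum i.-1.
transitivity (\sum_(1 <= i < n.+1) diag_coord i * (gram_sum i - gram_sum i.-1)).
  rewrite big_nat_recr /=; last by lia.
  rewrite gram_sumn sub0r mulrN.
  have -> : - (diag_coord n * gram_sum n.-1) = - (r n - r 1%N).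
    by rewrite /r /= gram_sum0 mulr0 subr0.
  rewrite -(telescope_sumr r) // -?sumrB; last by lia.
  apply: eq_big_nat => i /andP[i0 _]; rewrite /r -(diag_coord_sub i0) /=.
  by rewrite mulrBl mulrBr opprB addrC addrA subrK addrC.
rewrite (eq_big_nat _ _ (F2 := fun i => diag_coord i * diag_coord i - diag_coord i * sc (alpha0 / n%:R))).
  rewrite sumrB -mulr_suml sum_diag_coord -rmorphM; congr (_ - sc _).
  by rewrite expr2 mulrA.
by case=> // i /andP[_ i_n] /=; rewrite gram_sumS ?mulrBr.
Qed.

End DiagonalCoordinates.

Section DerivationTheory.
Variables (k : comPzRingType) (T : alg k).

Record derivation (E : T -> T) : Prop := Derivation {
  drvB : forall x y, E (x - y) = E x - E y;
  drvM : forall x y, E (x * y) = E x * y + x * E y;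
  drv_scal : forall c, E (scal T c) = 0 }.

Section OneDerivation.
Variables (E : T -> T).
Hypothesis dE : derivation E.
Lemma drv0 : E 0 = 0. Proof. by rewrite -{1}(subrr 0) (drvB dE) subrr. Qed.
Lemma drvN x : E (- x) = - E x.
Proof. by rewrite -sub0r (drvB dE) drv0 sub0r. Qed.
Lemma drvD x y : E (x + y) = E x + E y.
Proof. by rewrite -{1}(opprK y) (drvB dE) drvN opprK. Qed.
Lemma drv_mul_scal c x : E (scal T c * x) = scal T c * E x.
Proof. by rewrite (drvM dE) (drv_scal dE) mul0r add0r. Qed.
Lemma drv_sum (I : Type) (r : seq I) (F : I -> T) :
  E (\sum_(i <- r) F i) = \sum_(i <- r) E (F i).
Proof. exact: (big_morph E drvD drv0). Qed.
Lemma drvMn x m : E (x *+ m) = E x *+ m.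
Proof. by elim: m => [|m IH]; rewrite ?mulr0n ?drv0 // !mulrS drvD IH. Qed.
End OneDerivation.

Lemma derivation_com (E E' : T -> T) : derivation E -> derivation E' ->
  derivation (fun x => E (E' x) - E' (E x)).
Proof.
move=> dE dE'; split=> [x y|x y|c].
- rewrite (drvB dE') (drvB dE x) (drvB dE) (drvB dE') [in LHS]opprB.
  by rewrite addrB_swap -[_ - E (E' y)]opprB.
- rewrite (drvM dE') (drvM dE x) (drvD dE) (drvD dE') !(drvM dE) !(drvM dE').
  rewrite mulrBl mulrBr.
  move: (E (E' x) * y) (E' x * E y) (E x * E' y) (x * E (E' y)) (E' (E x) * y)
    (x * E' (E y)) => a b c d e f.
  by rewrite [e + c + _]addrACA opprD addrACA [e + b]addrC addrKA [c + d]addrC addrKA.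
- by rewrite (drv_scal dE') (drv_scal dE) (drv0 dE) (drv0 dE') subrr.
Qed.
End DerivationTheory.

Section Derivations.
Variables (C : numFieldType) (n : nat).
Notation T := (tens_C C n).
Notation gen x := (<< fmu x >> : T).

Definition fps_const_alg : alg C := restrict_scalars (@fpsC C) (fps_alg T).

Lemma malgU_scal (c : C) (w : {fmonom (label n)}) :
  << c *g w >> = scal T c * \prod_(x <- fmonom_val w) gen x.
Proof. exact: (eq_trans (malgU_word c w) (esym (mul_malgC _ _))). Qed.

Lemma tens_ind (P : T -> Prop) : (forall x y, P x -> P y -> P (x + y)) ->
  (forall c x, P x -> P (scal T c * x)) -> P 1 -> (forall x u, P u -> P (gen x * u)) ->
  forall z, P z.
Proof.
move=> PD PZ P1 PX z.
have PU c w : P << c *g w >>.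
  rewrite malgU_scal; apply: PZ; elim: (fmonom_val w) => [|x v IH].
    by rewrite big_nil.
  by rewrite big_cons; apply: PX.
elim/free_ind: z => [|x y Px Py|c w]; [|exact: PD|exact: PU].
by have := PZ 0 _ P1; rewrite rmorph0 mul0r.
Qed.

Section Derivation.
Variable G : label n -> T.

(* The first-order coefficient of the homomorphism x |-> x + e G x. *)
Definition der_gen (x : label n) : fps_const_alg :=
  FPS (fun j => if j is 0%N then gen x else if j is 1%N then G x else 0).
Definition der_ev : T -> fps_const_alg := free_ev der_gen.
Definition der (z : T) : T := fcoef (der_ev z) 1.

Lemma der_evD x y : der_ev (x + y) = der_ev x + der_ev y.
Proof. exact: free_evD. Qed.
Lemma der_evB x y : der_ev (x - y) = der_ev x - der_ev y.
Proof. exact: (raddfB (free_ev der_gen)). Qed.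
Lemma der_evM x y : der_ev (x * y) = der_ev x * der_ev y.
Proof. exact: (rmorphM (free_ev der_gen)). Qed.
Lemma der_ev1 : der_ev 1 = 1.
Proof. exact: (rmorph1 (free_ev der_gen)). Qed.
Lemma der_ev_scal c : der_ev (scal T c) = fpsC (scal T c).
Proof.
apply: (eq_trans (free_evC der_gen c)); apply: fpsP => -[|j].
  by rewrite [RHS]fcoef_fpsC0; apply: (congr1 (scal T)); apply: fcoef_fpsC0.
rewrite [RHS]fcoef_fpsCS; apply: (eq_trans (congr1 (scal T) (fcoef_fpsCS _ _))).
exact: rmorph0.
Qed.
Lemma der_ev_gen x : der_ev (gen x) = der_gen x.
Proof. exact: free_ev_gen. Qed.

Lemma der_ev_coef0 z : fcoef (der_ev z) 0 = z.
Proof.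
elim/tens_ind: z => [x y IHx IHy|c x IH||x u IH].
- exact: (eq_trans (congr1 (fun u => fcoef u 0) (der_evD x y)) (congr2 +%R IHx IHy)).
- apply: (eq_trans (congr1 (fun u => fcoef u 0) (der_evM _ x))).
  apply: (eq_trans (fcoefM0 _ _)); apply: (congr2 *%R _ IH).
  by rewrite der_ev_scal fcoef_fpsC0.
- by rewrite der_ev1.
- apply: (eq_trans (congr1 (fun u => fcoef u 0) (der_evM _ u))).
  apply: (eq_trans (fcoefM0 _ _)); apply: (congr2 *%R _ IH).
  by rewrite der_ev_gen.
Qed.

Lemma der_derivation : derivation der.
Proof.
split=> [x y|x y|c].
- exact: (congr1 (fun u => fcoef u 1) (der_evB x y)).
- apply: (eq_trans (congr1 (fun u => fcoef u 1) (der_evM x y))).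
  apply: (eq_trans (fcoefM1 _ _)); apply: (eq_trans (addrC _ _)); apply: (congr2 +%R).
    exact: (congr1 (fun u => _ * u) (der_ev_coef0 y)).
  exact: (congr1 (fun u => u * _) (der_ev_coef0 x)).
- by rewrite /der der_ev_scal fcoef_fpsCS.
Qed.

Lemma der_genE x : der (gen x) = G x.
Proof. by rewrite /der der_ev_gen. Qed.

End Derivation.

Lemma derivation_eq (E E' : T -> T) : derivation E -> derivation E' ->
  (forall x, E (gen x) = E' (gen x)) -> E =1 E'.
Proof.
move=> dE dE' EE; elim/tens_ind => [x y IHx IHy|c x IH||x u IH].
- apply: (eq_trans (drvD dE _ _)); apply: (eq_trans (congr2 +%R IHx IHy)).
  exact: (esym (drvD dE' _ _)).
- apply: (eq_trans (drv_mul_scal dE _ _)).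
  apply: (eq_trans (congr1 (fun v => _ * v) IH)).
  exact: (esym (drv_mul_scal dE' _ _)).
- by rewrite -(rmorph1 (scal T)) !drv_scal.
- apply: (eq_trans (drvM dE _ _)); apply: (eq_trans _ (esym (drvM dE' _ _))).
  apply: (congr2 +%R); first exact: (congr1 (fun v => v * _) (EE x)).
  exact: (congr1 (fun v => _ * v) IH).
Qed.

End Derivations.

Section AdjointFormula.
Variables (k : numFieldType) (Q : alg k) (n : nat) (alpha0 : k) (t : nat -> Q).
Variables (x : nat -> nat -> Q).
Hypothesis n_gt1 : (1 < n)%N.
Hypothesis x_diag : forall i, x i i = diag_coord n alpha0 t i.

Definition adj_diag p q m : Q := x p q *+ (q == m) - x p q *+ (m == p).

Section OneField.
Variables (p q : nat) (E : Q -> Q).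
Hypotheses (p0 : (0 < p <= n)%N) (q0 : (0 < q <= n)%N).
Hypothesis dE : derivation E.
Hypothesis E_t : forall m, (0 < m < n)%N -> E (t m) = adj_diag p q m - adj_diag p q m.+1.
Hypothesis E_off : forall i j, (0 < i <= n)%N -> (0 < j <= n)%N -> i != j ->
  E (x i j) = x p j *+ (q == i) - x i q *+ (j == p).

Lemma sum_adj_diag : \sum_(1 <= m < n.+1) adj_diag p q m = 0.
Proof.
have S r : (0 < r <= n)%N -> \sum_(1 <= m < n.+1) x p q *+ (r == m) = x p q.
  move=> r0; rewrite (bigD1_seq r) /= ?iota_uniq ?mem_index_iota; try lia.
  rewrite eqxx mulr1n big1 ?addr0 // => m mr.
  by rewrite eq_sym (negPf mr) mulr0n.
rewrite sumrB S // [X in _ - X](eq_bigr (fun m => x p q *+ (p == m))) ?S ?subrr //.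
by move=> m _; rewrite eq_sym.
Qed.

(** The values on the t_m give the differences of consecutive diagonal entries, so the error is the
    same for all m. It is 0 because the sum of the x_mm is a scalar, which E kills. *)
Lemma adj_xdiag m : (0 < m <= n)%N -> E (x m m) = adj_diag p q m.
Proof.
have step i : (0 < i < n)%N ->
    E (x i.+1 i.+1) - adj_diag p q i.+1 = E (x i i) - adj_diag p q i.
  move=> i0; have := E_t i0; rewrite -(diag_coord_sub n alpha0); last by case/andP: i0.
  rewrite -!x_diag (drvB dE).
  move: (E (x i i)) (E (x i.+1 i.+1)) (adj_diag p q i) (adj_diag p q i.+1) => a b c d H.
  by apply/eqP; rewrite eq_sym -subr_eq0 opprB addrB_swap -[d - c]opprB -H subrr.
have cst i : (0 < i <= n)%N -> E (x i i) - adj_diag p q i = E (x 1 1) - adj_diag p q 1.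
  elim: i => // i IH i_n; case: i IH i_n => [//|i] IH i_n.
  by rewrite step ?IH //; lia.
have : \sum_(1 <= i < n.+1) (E (x i i) - adj_diag p q i) = 0.
  rewrite sumrB sum_adj_diag subr0 -(drv_sum dE).
  rewrite (eq_bigr _ (fun i _ => x_diag i)) (sum_diag_coord _ _ n_gt1).
  exact: (drv_scal dE).
rewrite (eq_big_nat _ _ (F2 := fun=> E (x 1 1) - adj_diag p q 1)); last first.
  by move=> i /andP[i0 i_n]; apply: cst; rewrite i0.
rewrite sumr_const_nat subn1 /= => H m0.
apply/eqP; rewrite -subr_eq0 cst //; apply/eqP; apply: alg_mulrn_eq0 H.
by apply: leq_trans n_gt1.
Qed.

Lemma adj_formula i j : (0 < i <= n)%N -> (0 < j <= n)%N ->
  E (x i j) = x p j *+ (q == i) - x i q *+ (j == p).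
Proof.
move=> i0 j0; have [E_ij|ij] := eqVneq i j; last exact: E_off.
rewrite -E_ij adj_xdiag // /adj_diag; congr (_ - _).
  by have [<-//|_] := eqVneq q i.
by have [->|_] := eqVneq i p.
Qed.

End OneField.

Lemma adj_com_identity (V : zmodType) (a b c d : V) (A B E G : nat) :
  a *+ A - b *+ B = (a - c *+ B) *+ A - (d *+ E) *+ G
    - ((- (d *+ G)) *+ E - (c *+ A - b) *+ B).
Proof.
rewrite !mulrnBl mulNrn -!mulrnA [(B * A)%N]mulnC [(G * E)%N]mulnC.
by rewrite opprB opprK [_ + d *+ _]addrC addrA subrK subrKA.
Qed.

Lemma adj_com_formula p q r (E E' : Q -> Q) :
  (0 < p <= n)%N -> (0 < q <= n)%N -> (0 < r <= n)%N -> p != r ->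
  derivation E -> derivation E' ->
  (forall i j, (0 < i <= n)%N -> (0 < j <= n)%N ->
    E (x i j) = x p j *+ (q == i) - x i q *+ (j == p)) ->
  (forall i j, (0 < i <= n)%N -> (0 < j <= n)%N ->
    E' (x i j) = x q j *+ (r == i) - x i r *+ (j == q)) ->
  forall i j, (0 < i <= n)%N -> (0 < j <= n)%N ->
    x p j *+ (r == i) - x i r *+ (j == p) = E (E' (x i j)) - E' (E (x i j)).
Proof.
move=> p0 q0 r0 pr dE dE' Ex E'x i j i0 j0.
rewrite E'x // Ex // (drvB dE) (drvB dE') !(drvMn dE) !(drvMn dE').
rewrite !Ex // !E'x // !eqxx [r == p]eq_sym (negPf pr) !mulr1n !mulr0n subr0 sub0r.
exact: adj_com_identity.
Qed.

End AdjointFormula.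

Section Specialization.
Variables (C : numFieldType) (n : nat).
Notation T := (tens_C C n).
Notation K := (K_hn C).
Notation gen x := (<< fmu x >> : T).

Definition coef00 (c : K) : C := fcoef (fcoef c 0) 0.
Lemma coef00D x y : coef00 (x + y) = coef00 x + coef00 y. Proof. by []. Qed.
Lemma coef00B x y : coef00 (x - y) = coef00 x - coef00 y. Proof. by []. Qed.
Lemma coef00M x y : coef00 (x * y) = coef00 x * coef00 y.
Proof. by rewrite /coef00 !fcoefM0. Qed.
Lemma coef00_1 : coef00 1 = 1. Proof. by []. Qed.
Lemma coef00_qpow m : coef00 (qpow C m) = 1. Proof. exact: fcoef00_qpow. Qed.
Lemma coef00_qnum m : coef00 (qnum C m) = m%:R. Proof. exact: fcoef00_qnum. Qed.
Lemma coef00_div x m : (0 < m)%N -> coef00 (x / qnum C m) = coef00 x / m%:R.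
Proof.
move=> m0; have mN : m%:R != 0 :> C by rewrite pnatr_eq0 -lt0n.
apply: (mulIf mN); rewrite mulfVK // -(coef00_qnum m) -coef00M mulrVK //.
exact: qnum_unit.
Qed.

(** Reduction to h = nu = 0, from the uncompleted tensor algebra over C[[h, nu]] to T(g) over C. *)
Definition spec (z : tens_K C n) : T := fcoef (fcoef (to_tens_hat z) 0) 0.

Lemma to_tens_hatE (z : tens_K C n) :
  to_tens_hat z = free_ev (@gen_hat C n : label n -> tens_hat C n) z.
Proof. by []. Qed.
Lemma specD x y : spec (x + y) = spec x + spec y.
Proof. by rewrite /spec !to_tens_hatE free_evD. Qed.
Lemma spec0 : spec 0 = 0.
Proof. by rewrite /spec !to_tens_hatE free_ev0. Qed.
Lemma specB x y : spec (x - y) = spec x - spec y.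
Proof.
rewrite /spec !to_tens_hatE.
by rewrite [free_ev _ (x - y)](raddfB (free_ev (@gen_hat C n : label n -> tens_hat C n))).
Qed.
Lemma specN x : spec (- x) = - spec x.
Proof. by rewrite -sub0r specB spec0 sub0r. Qed.
Lemma specM x y : spec (x * y) = spec x * spec y.
Proof.
have E : to_tens_hat (x * y) = to_tens_hat x * to_tens_hat y.
  exact: (rmorphM (free_ev (@gen_hat C n : label n -> tens_hat C n))).
rewrite /spec E; apply: (eq_trans (congr1 (fun u => fcoef u 0) (fcoefM0 _ _))).
exact: fcoefM0.
Qed.
Lemma spec1 : spec 1 = 1.
Proof.
have E : to_tens_hat (1 : tens_K C n) = 1.
  exact: (rmorph1 (free_ev (@gen_hat C n : label n -> tens_hat C n))).
by rewrite /spec E.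
Qed.
Lemma specZ c x : spec (c *: x) = scal T (coef00 c) * spec x.
Proof.
have E : to_tens_hat (c *: x) = scal (tens_hat C n) c * to_tens_hat x.
  exact: (free_evZ (@gen_hat C n : label n -> tens_hat C n)).
rewrite /spec E; apply: (eq_trans (congr1 (fun u => fcoef u 0) (fcoefM0 _ _))).
exact: fcoefM0.
Qed.
Lemma spec_sum (I : Type) (r : seq I) (P : pred I) (F : I -> tens_K C n) :
  spec (\sum_(i <- r | P i) F i) = \sum_(i <- r | P i) spec (F i).
Proof. exact: (big_morph spec specD spec0). Qed.
Lemma spec_gen x : spec (gq_gen C x) = gen x.
Proof.
have E : to_tens_hat (gq_gen C x) = gen_hat C x.
  exact: (free_ev_gen (@gen_hat C n : label n -> tens_hat C n)).
by rewrite /spec E /gen_hat !fcoef_fpsC0.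
Qed.

Variable alpha0 : C.
Hypothesis n_gt3 : (3 < n)%N.
Let n_gt1 : (1 < n)%N. Proof. lia. Qed.

Fact coord_key : unit. Proof. by []. Qed.
Definition tC : nat -> T := locked_with coord_key (fun i => spec (tq C n i)).
(** Entries of a full n x n matrix in T(g): the diagonal is reconstructed from the differences t_i
    and the prescribed trace alpha0. *)
Definition xC : nat -> nat -> T := locked_with coord_key (fun i j =>
  if i == j then diag_coord n alpha0 tC i else spec (gq C n i j)).

Lemma tC_def i : tC i = spec (tq C n i).
Proof. by rewrite /tC unlock. Qed.

Lemma xC_neq i j : i != j -> xC i j = spec (gq C n i j).
Proof. by rewrite /xC unlock => /negPf ->. Qed.

Lemma xC_diag i : xC i i = diag_coord n alpha0 tC i.
Proof. by rewrite /xC unlock eqxx. Qed.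

Lemma tCE i : (0 < i)%N -> tC i = xC i i - xC i.+1 i.+1.
Proof. by move=> i0; rewrite !xC_diag diag_coord_sub. Qed.

Lemma gen_xC (p : {p : 'I_n * 'I_n | p.1 != p.2}) :
  gen (inl p) = xC (val p).1.+1 (val p).2.+1.
Proof.
have pp : (val p).1.+1 != (val p).2.+1 by exact: (valP p).
by rewrite xC_neq // /gq (big_pred1 p) ?spec_gen.
Qed.

Lemma gen_tC (m : 'I_n.-1) : gen (inr m) = tC m.+1.
Proof.
by rewrite tC_def /tq (big_pred1 m) ?spec_gen.
Qed.

Lemma gq_gen_label i j : (0 < i <= n)%N -> (0 < j <= n)%N -> i != j ->
  exists p, spec (gq C n i j) = gen (inl p) /\ ((val p).1.+1 = i /\ (val p).2.+1 = j).
Proof.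
case: i j => [|i] [|j] //= i_n j_n ij; rewrite eqSS in ij.
have ij' : (Ordinal i_n, Ordinal j_n).1 != (Ordinal i_n, Ordinal j_n).2 by [].
exists (exist (fun p : 'I_n * 'I_n => p.1 != p.2) _ ij'); split=> //.
by rewrite gen_xC /= xC_neq.
Qed.

Lemma tq_label i : (0 < i < n)%N -> exists m, tC i = gen (inr m) /\ m.+1 = i.
Proof.
case: i => // i /andP[_ i_n]; have i_n' : (i < n.-1)%N by lia.
by exists (Ordinal i_n'); rewrite gen_tC.
Qed.

(** The adjoint action of the matrix unit E_pq. For neighbouring p and q it is what e_i and f_i
    become at q = 1, by [spec_e_gen] and [spec_f_gen]. *)
Definition adj_gen p q (x : label n) : T :=
  match x with
  | inl r => let i := (val r).1.+1 in let j := (val r).2.+1 in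
     xC p j *+ (q == i) - xC i q *+ (j == p)
  | inr m => adj_diag xC p q m.+1 - adj_diag xC p q m.+2
  end.
Definition adj : nat -> nat -> T -> T :=
  locked_with coord_key (fun p q => der (adj_gen p q)).

Lemma adj_derivation p q : derivation (adj p q).
Proof. by rewrite /adj unlock; apply: der_derivation. Qed.

Lemma adj_genE p q x : adj p q (gen x) = adj_gen p q x.
Proof. by rewrite /adj unlock; apply: der_genE. Qed.

Lemma adj_tC p q m : (0 < m < n)%N ->
  adj p q (tC m) = adj_diag xC p q m - adj_diag xC p q m.+1.
Proof. by move=> /tq_label[r [-> <-]]; apply: adj_genE. Qed.

Lemma adj_xC p q i j : (0 < p <= n)%N -> (0 < q <= n)%N ->
  (0 < i <= n)%N -> (0 < j <= n)%N ->
  adj p q (xC i j) = xC p j *+ (q == i) - xC i q *+ (j == p).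
Proof.
move=> p0 q0; apply: (adj_formula n_gt1 xC_diag p0 q0 (adj_derivation p q)).
  exact: adj_tC.
move=> {}i {}j i0 j0 ij; rewrite [X in adj p q X]xC_neq //.
have [r [-> [<- <-]]] := gq_gen_label i0 j0 ij; exact: adj_genE.
Qed.

Lemma tens_derivation_eq (E E' : T -> T) : derivation E -> derivation E' ->
  (forall i j, (0 < i <= n)%N -> (0 < j <= n)%N -> E (xC i j) = E' (xC i j)) -> E =1 E'.
Proof.
move=> dE dE' EE; apply: derivation_eq => // -[s|m].
  by rewrite gen_xC; apply: EE; apply: ltn_ord.
have m0 : (0 < m.+1 < n)%N by case: m => m /=; lia.
rewrite gen_tC tCE //; apply: (eq_trans (drvB dE _ _)).
apply: (eq_trans _ (esym (drvB dE' _ _))).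
by apply: (congr2 (fun u v => u - v)); apply: EE; lia.
Qed.

(** The relation [E_pq, E_qr] = E_pr; it reduces all roots to the simple ones, which are the only
    ones that e_i and f_i provide. *)
Lemma adj_com p q r z : (0 < p <= n)%N -> (0 < q <= n)%N -> (0 < r <= n)%N -> p != r ->
  adj p r z = adj p q (adj q r z) - adj q r (adj p q z).
Proof.
move=> p0 q0 r0 pr.
apply: (tens_derivation_eq (adj_derivation p r)
  (derivation_com (adj_derivation p q) (adj_derivation q r)) _ z) => i j i0 j0.
apply: (eq_trans (adj_xC p0 r0 i0 j0)).
apply: (@adj_com_formula C T n xC p q r (adj p q) (adj q r) p0 q0 r0 pr
  (adj_derivation _ _) (adj_derivation _ _)) => //.
  by move=> *; apply: adj_xC.
by move=> *; apply: adj_xC.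
Qed.

Lemma spec_word w : spec (word C w) = \prod_(x <- w) gen x.
Proof.
rewrite /word; elim: w => [|x w IH]; first by rewrite !big_nil spec1.
by rewrite !big_cons specM spec_gen IH.
Qed.

Lemma spec_lin_ext (F : seq (label n) -> tens_K C n) (E : T -> T) : derivation E ->
  (forall w, spec (F w) = E (spec (word C w))) ->
  forall z, spec (lin_ext F z) = E (spec z).
Proof.
move=> dE FE; elim/free_ind => [|x y IHx IHy|c w].
- by rewrite lin_ext0 spec0 (drv0 dE).
- apply: (eq_trans (congr1 spec (lin_extD F x y))); apply: (eq_trans (specD _ _)).
  apply: (eq_trans (congr2 +%R IHx IHy)).
  exact: (esym (eq_trans (congr1 E (specD x y)) (drvD dE _ _))).
apply: (eq_trans (congr1 spec (lin_extU F c w))); apply: (eq_trans (specZ c _)).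
apply: (eq_trans (congr1 (fun u => scal T _ * u) (FE _))); apply: esym.
apply: (eq_trans (congr1 (E \o spec) (malgU_word c w))).
apply: (eq_trans (congr1 E (specZ c _))); exact: (drv_mul_scal dE).
Qed.

Lemma spec_qnum2 u : spec (qnum C 2 *: u) = spec u *+ 2.
Proof. by rewrite specZ coef00_qnum; apply: scal_natrl. Qed.

Lemma spec_e_gen i x : (0 < i < n)%N -> spec (e_gen C i x) = adj i i.+1 (gen x).
Proof.
move=> i0; rewrite adj_genE; case: x => [r|m] /=.
  have kl : (val r).1.+1 != (val r).2.+1 by exact: (valP r).
  move: kl; move: ((val r).1.+1) ((val r).2.+1) => k l kl.
  have [E|li] := eqVneq l i.
    rewrite andbT; have [E'|ki] := eqVneq k i.+1.
      by rewrite E E' -tC_def tCE //; case/andP: i0.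
    by rewrite [_ *+ false]mulr0n sub0r specN xC_neq.
  rewrite andbF; have [E'|ki] := eqVneq k i.+1.
    by rewrite [_ *+ false]mulr0n subr0 xC_neq // eq_sym.
  by rewrite ![_ *+ false]mulr0n spec0 subr0.
have ii : i != i.+1 by rewrite neq_ltn ltnSn.
rewrite /adj_diag; move: (m.+1) => k.
have U : spec (gq C n i i.+1) = xC i i.+1 by rewrite xC_neq.
have [E|ki] := eqVneq k i.
  have [-> ->] : (i.+1 == k = false) /\ (i.+1 == k.+1) by split; lia.
  have -> : (k.+1 == i) = false by lia.
  rewrite specN spec_qnum2 U; move: (xC i i.+1) => u.
  by rewrite [_ *+ false]mulr0n sub0r subr0 -opprD mulr2n.
have -> : (i.+1 == k.+1) = false by lia.
have [E|kS] := eqVneq k i.+1.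
  have -> : (k.+1 == i) = false by lia.
  by rewrite /= U ![_ *+ false]mulr0n !subr0.
have [E|kP] := eqVneq k.+1 i.
  by rewrite /= U ![_ *+ false]mulr0n subrr !sub0r opprK.
by rewrite /= spec0 ![_ *+ false]mulr0n !subr0.
Qed.

Lemma spec_f_gen i x : (0 < i < n)%N -> spec (f_gen C i x) = adj i.+1 i (gen x).
Proof.
move=> i0; rewrite adj_genE; case: x => [r|m] /=.
  have kl : (val r).1.+1 != (val r).2.+1 by exact: (valP r).
  move: kl; move: ((val r).1.+1) ((val r).2.+1) => k l kl.
  have [E|li] := eqVneq l i.+1.
    rewrite andbT; have [E'|ki] := eqVneq k i.
      by rewrite E E' specN -tC_def tCE ?opprB //; case/andP: i0.
    by rewrite [_ *+ false]mulr0n sub0r specN xC_neq.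
  rewrite andbF; have [E'|ki] := eqVneq k i.
    by rewrite [_ *+ false]mulr0n subr0 xC_neq // eq_sym.
  by rewrite ![_ *+ false]mulr0n spec0 subr0.
have ii : i.+1 != i by rewrite neq_ltn ltnSn orbT.
rewrite /adj_diag; move: (m.+1) => k.
have U : spec (gq C n i.+1 i) = xC i.+1 i by rewrite xC_neq.
have [E|ki] := eqVneq k i.
  have [-> ->] : (k == i.+1 = false) /\ (k.+1 == i.+1) by split; lia.
  have -> : (i == k.+1) = false by lia.
  rewrite spec_qnum2 U; move: (xC i.+1 i) => u.
  by rewrite [_ *+ false]mulr0n sub0r subr0 opprK mulr2n.
have -> : (k.+1 == i.+1) = false by lia.
have [E|kS] := eqVneq k i.+1.
  have -> : (i == k.+1) = false by lia.
  by rewrite /= specN U ![_ *+ false]mulr0n !subr0 sub0r.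
have [E|kP] := eqVneq k.+1 i.
  by rewrite /= specN U ![_ *+ false]mulr0n subrr subr0 sub0r.
by rewrite /= spec0 ![_ *+ false]mulr0n !subr0.
Qed.

Lemma spec_wordS x w : spec (word C (x :: w)) = gen x * spec (word C w).
Proof.
rewrite /word big_cons; apply: (eq_trans (specM _ _)).
exact: (congr1 (fun u => u * _) (spec_gen x)).
Qed.

(** At q = 1 the powers of q in the coproduct become 1 and the twisted product rule becomes the
    Leibniz rule. *)
Lemma spec_e_word i w : (0 < i < n)%N -> spec (e_word C i w) = adj i i.+1 (spec (word C w)).
Proof.
move=> i0; have dE := adj_derivation i i.+1; elim: w => [|x w IH].
  rewrite /= spec0 spec_word big_nil -(rmorph1 (scal T)); apply: esym.
  exact: (drv_scal dE).
rewrite [LHS]specD; apply: esym.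
apply: (eq_trans (congr1 _ (spec_wordS x w))); apply: (eq_trans (drvM dE _ _)).
apply: (congr2 +%R); apply: esym.
  apply: (eq_trans (specM _ _)); exact: (congr1 (fun u => u * _) (spec_e_gen x i0)).
apply: (eq_trans (specZ _ _)); rewrite coef00_qpow rmorph1 mul1r.
apply: (eq_trans (specM _ _)); exact: (congr2 *%R (spec_gen x) IH).
Qed.

Lemma spec_f_word i w : (0 < i < n)%N -> spec (f_word C i w) = adj i.+1 i (spec (word C w)).
Proof.
move=> i0; have dE := adj_derivation i.+1 i; elim: w => [|x w IH].
  rewrite /= spec0 spec_word big_nil -(rmorph1 (scal T)); apply: esym.
  exact: (drv_scal dE).
rewrite [LHS]specD; apply: esym.
apply: (eq_trans (congr1 _ (spec_wordS x w))); apply: (eq_trans (drvM dE _ _)).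
apply: (eq_trans (addrC _ _)); apply: (congr2 +%R); apply: esym.
  apply: (eq_trans (specM _ _)); exact: (congr2 *%R (spec_gen x) IH).
apply: (eq_trans (specZ _ _)); rewrite coef00_qpow rmorph1 mul1r.
apply: (eq_trans (specM _ _)); exact: (congr1 (fun u => u * _) (spec_f_gen x i0)).
Qed.

End Specialization.

Section RelationIdentities.
Variables (k : numFieldType) (Q : alg k) (n : nat) (alpha0 : k) (t : nat -> Q).
Variables (x : nat -> nat -> Q).
Hypothesis n_gt1 : (1 < n)%N.
Hypothesis x_diag : forall i, x i i = diag_coord n alpha0 t i.
Notation sc := (scal Q).

Let n1_neq0 : n%:R != 0 :> k.
Proof. by rewrite pnatr_eq0 -lt0n; apply: leq_trans n_gt1. Qed.

Lemma scal_mulrCA c (u v : Q) : u * (sc c * v) = sc c * (u * v).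
Proof. by rewrite mulrA -scalC mulrA. Qed.

Lemma gram_form_x : \sum_(1 <= i < n) t i * gram_sum n t i =
  \sum_(1 <= i < n.+1) x i i * x i i - sc (alpha0 ^+ 2 / n%:R).
Proof.
rewrite (gram_form alpha0 t n_gt1); congr (_ - _).
by apply: eq_bigr => i _; rewrite x_diag.
Qed.

Lemma zmod_s1 (V : zmodType) (S A U B W : V) :
  S + (A - U) - (U - B) - W = A + S + B - (U + U + W).
Proof.
have -> : S + (A - U) - (U - B) = A + S + B - (U + U).
  by rewrite opprB [S + (A - U)]addrA [LHS]addrACA opprD [S + A]addrC.
by rewrite -addrA -opprD.
Qed.

Lemma scal_split (u : Q) : sc (alpha0 / n%:R) * u + sc (alpha0 / n%:R) * u
  + sc (alpha0 * (n.-1%:R - 1) / n%:R) * u = sc alpha0 * u.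
Proof.
rewrite -!mulrDl -!rmorphD; congr (sc _ * _).
have -> : n.-1%:R = n%:R - 1 :> k by rewrite -subn1 natrB // ltnW.
by field; apply: n1_neq0.
Qed.

(** With the t_k expressed through diagonal entries, s^1 at q = 1 is the relation (x^2)_1n = alpha0
    x_1n: the two terms alpha0 / n complete the constant n - 2 over n to 1. In the same way s_0
    becomes tr(x^2) = alpha0^2. *)
Lemma s1_identity :
  \sum_(2 <= m < n) x 1 m * x m n + (x 1 1 - sc (alpha0 / n%:R)) * x 1 n
    - x 1 n * (sc (alpha0 / n%:R) - x n n)
    - sc (alpha0 * (n.-1%:R - 1) / n%:R) * x 1 n =
  \sum_(1 <= m < n.+1) x 1 m * x m n - sc alpha0 * x 1 n.
Proof.
rewrite [in RHS]big_nat_recr 1?ltnW //= [in RHS]big_ltn //= mulrBl mulrBr -scalC -scal_split.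
exact: zmod_s1.
Qed.

Lemma s2_identity :
  \sum_(2 <= m < n) x m n * x 1 m - (sc (alpha0 / n%:R) - x n n) * x 1 n
    + x 1 n * (x 1 1 - sc (alpha0 / n%:R))
    - sc (alpha0 * (n.-1%:R - 1) / n%:R) * x 1 n =
  \sum_(1 <= m < n.+1) x m n * x 1 m - sc alpha0 * x 1 n.
Proof.
rewrite [in RHS]big_nat_recr 1?ltnW //= [in RHS]big_ltn //= mulrBl mulrBr -scalC -scal_split.
rewrite [X in X - _ = _]addrAC; exact: zmod_s1.
Qed.

Lemma s0_identity :
  \sum_(1 <= i < n.+1) x i i * x i i - sc (alpha0 ^+ 2 / n%:R)
  + \sum_(1 <= i < n.+1) \sum_(1 <= j < n.+1 | i != j) x i j * x j i
  - sc (alpha0 ^+ 2 * (n.-1%:R / n%:R)) =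
  \sum_(1 <= i < n.+1) \sum_(1 <= j < n.+1) x i j * x j i - sc (alpha0 ^+ 2).
Proof.
have -> : sc (alpha0 ^+ 2) = sc (alpha0 ^+ 2 / n%:R) + sc (alpha0 ^+ 2 * (n.-1%:R / n%:R)).
  rewrite -rmorphD; congr (sc _).
  have -> : n.-1%:R = n%:R - 1 :> k by rewrite -subn1 natrB // ltnW.
  by field; apply: n1_neq0.
rewrite opprD [in RHS]addrA; congr (_ - _); rewrite [LHS]addrAC; congr (_ - _).
rewrite -big_split; apply: eq_big_nat => i i1 /=.
rewrite [RHS](bigD1_seq i) ?iota_uniq ?mem_index_iota //=; congr (_ + _).
by apply: eq_bigl => j; rewrite eq_sym.
Qed.

End RelationIdentities.

Section ClassicalIdeal.
Variables (C : numFieldType) (n : nat) (alpha0 : C) (q_gt1 : bool).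
Hypothesis n_gt3 : (3 < n)%N.
Let n_gt1 : (1 < n)%N. Proof. lia. Qed.
Notation T := (tens_C C n).
Notation K := (K_hn C).
Notation xC := (xC n alpha0).
Notation tC := (tC C n).
Notation adj := (adj (n := n) alpha0).
Notation rel := (@relation_module C n alpha0 q_gt1).
Notation sc := (scal T).

Definition in_cl (z : T) : Prop :=
  forall I : ideal T, (forall r, rel r -> I (spec r)) -> I z.

Lemma in_cl_rel r : rel r -> in_cl (spec r).
Proof. by move=> rr I; apply. Qed.

Fact in_cl_is_ideal : is_ideal in_cl.
Proof.
split=> [|x y Ix Iy|a x Ix|a x Ix] I rI; have [I0 ID IMl IMr] := idealP I.
- exact: I0.
- by apply: ID; [apply: Ix | apply: Iy].
- by apply: IMl; apply: Ix.
- by apply: IMr; apply: Ix.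
Qed.
Definition cl_ideal : ideal T := Ideal in_cl_is_ideal.

Lemma in_cl0 : in_cl 0. Proof. exact: ideal0 in_cl_is_ideal. Qed.
Lemma in_clD x y : in_cl x -> in_cl y -> in_cl (x + y).
Proof. exact: idealD in_cl_is_ideal x y. Qed.
Lemma in_clMl a x : in_cl x -> in_cl (a * x).
Proof. exact: idealMl in_cl_is_ideal a x. Qed.
Lemma in_clMr a x : in_cl x -> in_cl (x * a).
Proof. exact: Defs.idealMr in_cl_is_ideal a x. Qed.
Lemma in_clN x : in_cl x -> in_cl (- x).
Proof. by move=> /(in_clMl (- 1)); rewrite mulN1r. Qed.

Lemma rel_submodule : Uq_submodule rel.
Proof.
split=> [S US _|x z xr zr S US dS|c z zr S US dS|i z i0 zr S US dS|i z i0 zr S US dS|i z i0 zr S US dS].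
- exact: (Uq_sub0 US).
- by apply: (Uq_subD US); [apply: xr | apply: zr].
- by apply: (Uq_subZ US); apply: zr.
- by apply: (Uq_subh US) => //; apply: zr.
- by apply: (Uq_sube US) => //; apply: zr.
- by apply: (Uq_subf US) => //; apply: zr.
Qed.

(** The elements z for which both z and E z lie in the ideal form an ideal themselves, so checking
    the generators suffices. *)
Lemma in_cl_stable (E : T -> T) : derivation E -> (forall r, rel r -> in_cl (E (spec r))) ->
  forall z, in_cl z -> in_cl (E z).
Proof.
move=> dE Er z Iz.
pose S (u : T) := in_cl u /\ in_cl (E u).
have SI : is_ideal S.
  split=> [|x y [x1 x2] [y1 y2]|a x [x1 x2]|a x [x1 x2]]; rewrite /S.
  - by rewrite (drv0 dE); split; apply: in_cl0.
  - by rewrite (drvD dE); split; apply: in_clD.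
  - rewrite (drvM dE); split; first exact: in_clMl.
    by apply: in_clD; apply: in_clMl.
  - rewrite (drvM dE); split; first exact: in_clMr.
    by apply: in_clD; apply: in_clMr.
suff [] : S z by [].
by apply: (Iz (Ideal SI)) => r rr; split; [apply: in_cl_rel | apply: Er].
Qed.

(** For neighbouring indices the derivation comes from e_i or f_i, under which the relation module
    is stable; the others are iterated commutators of these. *)
Lemma in_cl_adj p q z : (0 < p <= n)%N -> (0 < q <= n)%N -> p != q ->
  in_cl z -> in_cl (adj p q z).
Proof.
have [_ _ _ _ relE relF] := rel_submodule.
have base i : (0 < i < n)%N -> forall z, in_cl z ->
    in_cl (adj i i.+1 z) /\ in_cl (adj i.+1 i z).
  move=> i0 u Iu; split; apply: in_cl_stable Iu; try exact: adj_derivation.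
    move=> r rr; rewrite -(spec_lin_ext (adj_derivation _ _ i i.+1) (fun w => spec_e_word alpha0 n_gt3 w i0)).
    by apply: in_cl_rel; apply: relE.
  move=> r rr; rewrite -(spec_lin_ext (adj_derivation _ _ i.+1 i) (fun w => spec_f_word alpha0 n_gt3 w i0)).
  by apply: in_cl_rel; apply: relF.
have up d : forall p, (0 < p)%N -> (p + d.+1 <= n)%N -> forall z, in_cl z ->
    in_cl (adj p (p + d.+1) z) /\ in_cl (adj (p + d.+1) p z).
  elim: d => [|d IH] {}p p0 pn u Iu; first by rewrite addn1; apply: base => //; lia.
  have a1 : (0 < p <= n)%N by lia.
  have a2 : (0 < p + d.+1 <= n)%N by lia.
  have a3 : (0 < p + d.+2 <= n)%N by lia.
  have a4 : (0 < p + d.+1 < n)%N by lia.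
  have a5 : (p + d.+1 <= n)%N by lia.
  have a6 : p != (p + d.+2)%N by lia.
  have a7 : (p + d.+2)%N != p by lia.
  have e : (p + d.+2 = (p + d.+1).+1)%N by lia.
  have J v := IH p p0 a5 v; have J' v := base _ a4 v; rewrite -e in J'.
  split.
    rewrite (adj_com _ n_gt3 u a1 a2 a3 a6); apply: in_clD.
      by case: (J _ (J' _ Iu).1).
    by apply: in_clN; case: (J' _ (J _ Iu).1).
  rewrite (adj_com _ n_gt3 u a3 a2 a1 a7); apply: in_clD.
    by case: (J' _ (J _ Iu).2).
  by apply: in_clN; case: (J _ (J' _ Iu).2).
move=> p0 q0 pq Iz; have [lpq|lqp] := ltnP p q.
  have e : q = (p + (q - p).-1.+1)%N by lia.
  by rewrite e; case: (up (q - p).-1 p _ _ z Iz) => //; lia.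
have e : p = (q + (p - q).-1.+1)%N by lia.
by rewrite e; case: (up (p - q).-1 q _ _ z Iz) => //; lia.
Qed.

Definition cl_alg : alg C := quot_alg cl_ideal.
Definition cl_pr : {rmorphism T -> cl_alg} := quot_pr cl_ideal.

Lemma cl_prP x y : cl_pr x = cl_pr y <-> in_cl (x - y).
Proof. exact: to_quotP. Qed.

Lemma cl_pr0 x : in_cl x -> cl_pr x = 0.
Proof. by move=> Ix; rewrite -(rmorph0 cl_pr); apply/cl_prP; rewrite subr0. Qed.

Lemma cl_pr_surj (u : cl_alg) : exists x, cl_pr x = u.
Proof. by exists (repr u); apply: to_quot_repr. Qed.

Lemma cl_pr_scal c : cl_pr (sc c) = scal cl_alg c. Proof. by []. Qed.

Fact cl_key : unit. Proof. by []. Qed.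
Definition cl_adj : nat -> nat -> cl_alg -> cl_alg :=
  locked_with cl_key (fun p q u => cl_pr (adj p q (repr u))).

Lemma cl_adjE p q x : (0 < p <= n)%N -> (0 < q <= n)%N -> p != q ->
  cl_adj p q (cl_pr x) = cl_pr (adj p q x).
Proof.
move=> p0 q0 pq; rewrite /cl_adj unlock; apply/cl_prP.
rewrite -(drvB (adj_derivation n alpha0 p q)); apply: in_cl_adj => //.
by apply/cl_prP; apply: to_quot_repr.
Qed.

Lemma cl_adj_derivation p q : (0 < p <= n)%N -> (0 < q <= n)%N -> p != q ->
  derivation (cl_adj p q).
Proof.
move=> p0 q0 pq; have A := adj_derivation n alpha0 p q; split=> [u v|u v|c].
- have [x <-] := cl_pr_surj u; have [y <-] := cl_pr_surj v.
  rewrite -(rmorphB cl_pr) !cl_adjE // (drvB A); exact: (rmorphB cl_pr).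
- have [x <-] := cl_pr_surj u; have [y <-] := cl_pr_surj v.
  rewrite -(rmorphM cl_pr) !cl_adjE // (drvM A).
  apply: (eq_trans (rmorphD cl_pr _ _)); apply: (congr2 +%R); exact: (rmorphM cl_pr).
- by rewrite -cl_pr_scal cl_adjE // (drv_scal A) rmorph0.
Qed.

Definition x_cl : 'I_n -> 'I_n -> cl_alg :=
  locked_with cl_key (fun i j => cl_pr (xC i.+1 j.+1)).
Lemma x_clE i j : x_cl i j = cl_pr (xC i.+1 j.+1).
Proof. by rewrite /x_cl unlock. Qed.

Definition D_cl (p q : 'I_n) : cl_alg -> cl_alg :=
  if p == q then fun=> 0 else cl_adj p.+1 q.+1.

Lemma D_cl_derivation p q : derivation (D_cl p q).
Proof.
rewrite /D_cl; have [_|pq] := eqVneq p q.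
  by split=> *; rewrite ?subrr ?mul0r ?mulr0 ?addr0.
by apply: cl_adj_derivation; rewrite ?ltn_ord.
Qed.

Lemma D_cl_x p q i j : p != q ->
  D_cl p q (x_cl i j) = x_cl p j *+ (q == i) - x_cl i q *+ (j == p).
Proof.
move=> pq; rewrite /D_cl (negPf pq) !x_clE cl_adjE ?ltn_ord //.
rewrite (adj_xC alpha0 n_gt3) ?ltn_ord //.
apply: (eq_trans (rmorphB cl_pr _ _)); apply: (congr2 (fun u v => u - v));
  exact: (raddfMn cl_pr).
Qed.

Lemma spec_tq i : spec (tq C n i) = tC i. Proof. by rewrite tC_def. Qed.

Lemma def_spec r : defining_relation alpha0 q_gt1 r -> in_cl (spec r).
Proof. by move=> dr; apply: in_cl_rel => S _; apply. Qed.

Let spMM (u v : tens_K C n) U V : spec u = U -> spec v = V -> spec (u * v) = U * V.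
Proof. by move=> <- <-; apply: specM. Qed.

Let n1 : (0 < 1 <= n)%N. Proof. lia. Qed.
Let ne1 : 1%N != n. Proof. lia. Qed.
Let ne2 : 1%N != n.-1. Proof. lia. Qed.
Let ne3 : 2%N != n. Proof. lia. Qed.
Let ne4 : 2%N != n.-1. Proof. lia. Qed.
Let S1n : spec (gq C n 1 n) = xC 1 n. Proof. by rewrite xC_neq. Qed.
Let S1m : spec (gq C n 1 n.-1) = xC 1 n.-1. Proof. by rewrite xC_neq. Qed.
Let S2n : spec (gq C n 2 n) = xC 2 n. Proof. by rewrite xC_neq. Qed.
Let S2m : spec (gq C n 2 n.-1) = xC 2 n.-1. Proof. by rewrite xC_neq. Qed.

Let spZ1 m (u : tens_K C n) U : spec u = U -> spec (qpow C m *: u) = U.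
Proof. by move=> <-; rewrite specZ coef00_qpow rmorph1 mul1r. Qed.

(** * The six highest weight vectors at h = nu = 0 *)

Lemma cl_rel1 : in_cl (xC 1 n * xC 1 n.-1 - xC 1 n.-1 * xC 1 n).
Proof.
have := def_spec (Or41 _ _ _ (erefl (s_2w1_wn2 C n))).
rewrite (_ : spec _ = xC 1 n * xC 1 n.-1 - xC 1 n.-1 * xC 1 n) //.
apply: (eq_trans (specB _ _)); apply: (congr2 (fun u v => u - v)); first exact: spMM.
by apply: spZ1; apply: spMM.
Qed.

Lemma cl_rel2 : in_cl (xC 1 n * xC 2 n - xC 2 n * xC 1 n).
Proof.
have := def_spec (Or42 _ _ _ (erefl (s_w2_2wn1 C n))).
rewrite (_ : spec _ = xC 1 n * xC 2 n - xC 2 n * xC 1 n) //.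
apply: (eq_trans (specB _ _)); apply: (congr2 (fun u v => u - v)); first exact: spMM.
by apply: spZ1; apply: spMM.
Qed.

Lemma cl_rel3 : in_cl (xC 1 n * xC 2 n.-1 + xC 2 n.-1 * xC 1 n
  - xC 1 n.-1 * xC 2 n - xC 2 n * xC 1 n.-1).
Proof.
have := def_spec (Or43 _ _ _ (erefl (s_w2_wn2 C n))).
rewrite (_ : spec _ = xC 1 n * xC 2 n.-1 + xC 2 n.-1 * xC 1 n
  - xC 1 n.-1 * xC 2 n - xC 2 n * xC 1 n.-1) //.
apply: (eq_trans (specB _ _)); apply: (congr2 (fun u v => u - v)); last exact: spMM.
apply: (eq_trans (specB _ _)); apply: (congr2 (fun u v => u - v)); last exact: spMM.
apply: (eq_trans (specD _ _)); apply: (congr2 +%R); apply: spZ1; exact: spMM.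
Qed.

Let coef_gamma : coef00 (gamma_h C n q_gt1) = 1.
Proof.
have h0 : coef00 (hbar C) = 0 by [].
rewrite /gamma_h coef00D h0 addr0 /gamma_q.
by case: q_gt1; apply: coef00_qpow.
Qed.

Let coef_alpha0 : coef00 (alpha0_K alpha0) = alpha0. Proof. exact: mulr1n. Qed.

Let n_gt0 : (0 < n)%N. Proof. lia. Qed.

Let coef_frac m : coef00 (qnum C m / qnum C n) = m%:R / n%:R.
Proof. by rewrite coef00_div // coef00_qnum. Qed.

Let sp_frac m (u : tens_K C n) U : spec u = U ->
  spec ((qnum C m / qnum C n) *: u) = sc (m%:R / n%:R) * U.
Proof. by move=> <-; rewrite specZ coef_frac. Qed.

Let sum_t_l (u : T) : \sum_(1 <= k < n) sc ((n - k)%N%:R / n%:R) * (tC k * u) =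
  (xC 1 1 - sc (alpha0 / n%:R)) * u.
Proof.
rewrite xC_diag -(sum_coord_first n alpha0 tC) mulr_suml.
by apply: eq_bigr => j _; rewrite mulrA.
Qed.
Let sum_t_r (u : T) : \sum_(1 <= k < n) sc (k%:R / n%:R) * (tC k * u) =
  (sc (alpha0 / n%:R) - xC n n) * u.
Proof.
rewrite xC_diag -(sum_coord_last alpha0 tC n_gt1) mulr_suml.
by apply: eq_bigr => j _; rewrite mulrA.
Qed.
Let sum_t_l' (u : T) : \sum_(1 <= k < n) sc ((n - k)%N%:R / n%:R) * (u * tC k) =
  u * (xC 1 1 - sc (alpha0 / n%:R)).
Proof.
rewrite xC_diag -(sum_coord_first n alpha0 tC) mulr_sumr.
by apply: eq_bigr => j _; rewrite !mulrA scalC.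
Qed.
Let sum_t_r' (u : T) : \sum_(1 <= k < n) sc (k%:R / n%:R) * (u * tC k) =
  u * (sc (alpha0 / n%:R) - xC n n).
Proof.
rewrite xC_diag -(sum_coord_last alpha0 tC n_gt1) mulr_sumr.
by apply: eq_bigr => j _; rewrite !mulrA scalC.
Qed.

Let spec_lin1 (u : tens_K C n) m : spec u = xC 1 n ->
  spec ((alpha0_K alpha0 * qpow C m * ((qnum C n.-1 * gamma_h C n q_gt1 - 1) / qnum C n)) *: u)
  = sc (alpha0 * (n.-1%:R - 1) / n%:R) * xC 1 n.
Proof.
move=> <-; rewrite specZ; apply: (congr1 (fun c => sc c * _)).
rewrite coef00M coef00_div // coef00B !coef00M coef_alpha0 coef00_qpow mulr1.
by rewrite coef00_qnum coef_gamma mulr1 coef00_1 mulrA.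
Qed.

Let spec_lin2 (u : tens_K C n) m : spec u = xC 1 n ->
  spec ((alpha0_K alpha0 * qpow C m * ((qnum C n.-1 - gamma_h C n q_gt1) / qnum C n)) *: u)
  = sc (alpha0 * (n.-1%:R - 1) / n%:R) * xC 1 n.
Proof.
move=> <-; rewrite specZ; apply: (congr1 (fun c => sc c * _)).
rewrite coef00M coef00_div // coef00B !coef00M coef_alpha0 coef00_qpow mulr1.
by rewrite coef00_qnum coef_gamma mulrA.
Qed.

Lemma cl_rel4 : in_cl (\sum_(1 <= m < n.+1) xC 1 m * xC m n - sc alpha0 * xC 1 n).
Proof.
have := def_spec (Or44 _ _ _ (Or31 _ _ (erefl _))).
set r := (X in spec X); rewrite (_ : spec r =
  \sum_(1 <= m < n.+1) xC 1 m * xC m n - sc alpha0 * xC 1 n) // {}/r.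
apply: (eq_trans (specB _ _)); apply: (eq_trans (congr2 (fun u v => u - v) (_ : _ =
   \sum_(2 <= k < n) xC 1 k * xC k n + (xC 1 1 - sc (alpha0 / n%:R)) * xC 1 n -
   xC 1 n * (sc (alpha0 / n%:R) - xC n n)) (spec_lin1 _ S1n))).
  apply: (eq_trans (specB _ _)); apply: (congr2 (fun u v => u - v)).
    apply: (eq_trans (specD _ _)); apply: (congr2 +%R).
      apply: (eq_trans (spec_sum _ _ _)); apply: eq_big_nat => k k1.
      by apply: spZ1; apply: spMM; rewrite xC_neq //; lia.
    apply: spZ1; apply: (eq_trans (spec_sum _ _ _)); rewrite -sum_t_l.
    by apply: eq_big_nat => k k1; apply: sp_frac; apply: spMM => //; apply: spec_tq.
  apply: spZ1; apply: (eq_trans (spec_sum _ _ _)); rewrite -sum_t_r'.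
  by apply: eq_big_nat => k k1; apply: sp_frac; apply: spMM => //; apply: spec_tq.
exact: (@s1_identity C T n alpha0 xC n_gt1).
Qed.

Lemma cl_rel5 : in_cl (\sum_(1 <= m < n.+1) xC m n * xC 1 m - sc alpha0 * xC 1 n).
Proof.
have := def_spec (Or44 _ _ _ (Or32 _ _ (erefl _))).
set r := (X in spec X); rewrite (_ : spec r =
  \sum_(1 <= m < n.+1) xC m n * xC 1 m - sc alpha0 * xC 1 n) // {}/r.
apply: (eq_trans (specB _ _)); apply: (eq_trans (congr2 (fun u v => u - v) (_ : _ =
   \sum_(2 <= k < n) xC k n * xC 1 k - (sc (alpha0 / n%:R) - xC n n) * xC 1 n +
   xC 1 n * (xC 1 1 - sc (alpha0 / n%:R))) (spec_lin2 _ S1n))).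
  apply: (eq_trans (specD _ _)); apply: (congr2 +%R).
    apply: (eq_trans (specB _ _)); apply: (congr2 (fun u v => u - v)).
      apply: (eq_trans (spec_sum _ _ _)); apply: eq_big_nat => k k1.
      by apply: spZ1; apply: spMM; rewrite xC_neq //; lia.
    apply: spZ1; apply: (eq_trans (spec_sum _ _ _)); rewrite -sum_t_r.
    by apply: eq_big_nat => k k1; apply: sp_frac; apply: spMM => //; apply: spec_tq.
  apply: spZ1; apply: (eq_trans (spec_sum _ _ _)); rewrite -sum_t_l'.
  by apply: eq_big_nat => k k1; apply: sp_frac; apply: spMM => //; apply: spec_tq.
exact: (@s2_identity C T n alpha0 xC n_gt1).
Qed.

Let coef_gram i j : (0 < i <= j)%N -> (j < n)%N ->
  coef00 (qnum C i * qnum C (n - j) / qnum C n) = gram C n i j /\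
  coef00 (qnum C i * qnum C (n - j) / qnum C n) = gram C n j i.
Proof.
move=> /andP[i0 ij] jn; rewrite coef00_div // coef00M !coef00_qnum /gram.
by rewrite (minn_idPl ij) (maxn_idPr ij) (minn_idPr ij) (maxn_idPl ij) natrM.
Qed.

Lemma cl_rel6 : in_cl (\sum_(1 <= i < n.+1) \sum_(1 <= j < n.+1) xC i j * xC j i
  - sc (alpha0 ^+ 2)).
Proof.
have := def_spec (Or44 _ _ _ (Or33 _ _ (erefl _))).
set r := (X in spec X); rewrite (_ : spec r =
  \sum_(1 <= i < n.+1) \sum_(1 <= j < n.+1) xC i j * xC j i - sc (alpha0 ^+ 2)) // {}/r.
pose O := \sum_(1 <= i < n.+1) \sum_(1 <= j < n.+1 | i != j) xC i j * xC j i.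
apply: (eq_trans (specB _ _)); apply: (eq_trans (congr2 (fun u v => u - v) (_ : _ =
   \sum_(1 <= i < n.+1) xC i i * xC i i - sc (alpha0 ^+ 2 / n%:R) + O)
   (_ : _ = sc (alpha0 ^+ 2 * (n.-1%:R / n%:R))))).
- apply: (eq_trans (specD _ _)); apply: (congr2 +%R); last first.
    apply: spZ1; apply: (eq_trans (spec_sum _ _ _)); apply: eq_big_nat => i i1.
    apply: (eq_trans (spec_sum _ _ _)); rewrite big_nat_cond [RHS]big_nat_cond.
    apply: eq_bigr => j /andP[j1 ij]; apply: spZ1.
    by apply: spMM; rewrite xC_neq // eq_sym.
  apply: (eq_trans _ (gram_form_x n_gt1 (xC_diag n alpha0))).
  apply: (eq_trans (specD _ _)).
  apply: (eq_trans (congr2 +%R (spec_sum _ _ _) (spec_sum _ _ _))).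
  rewrite -big_split; apply: eq_big_nat => i i1 /=.
  rewrite /gram_sum [in RHS](big_cat_nat (n := i)) /=; try lia.
  rewrite mulrDr addrC; apply: (congr2 +%R).
    apply: (eq_trans (spec_sum _ _ _)); rewrite mulr_sumr; apply: eq_big_nat => j j1.
    rewrite specZ; apply: (eq_trans _ (esym (scal_mulrCA _ _ _))); apply: (congr2 (fun u v => sc u * v)).
      by case: (@coef_gram j i) => //; lia.
    by apply: spMM; apply: spec_tq.
  apply: (eq_trans (spec_sum _ _ _)); rewrite mulr_sumr; apply: eq_big_nat => j j1.
  rewrite specZ; apply: (eq_trans _ (esym (scal_mulrCA _ _ _))); apply: (congr2 (fun u v => sc u * v)).
    by case: (@coef_gram i j) => //; lia.
  by apply: spMM; apply: spec_tq.
- rewrite specZ spec1 mulr1; congr (sc _).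
  rewrite [LHS]coef00M coef_gamma mulr1 [LHS]coef00M coef_frac coef00M coef00_qpow mulr1.
  by rewrite [alpha0_K alpha0 ^+ 2]expr2 coef00M coef_alpha0 expr2.
exact: (s0_identity alpha0 xC n_gt1).
Qed.

Lemma n_pred : n.-1.+1 = n. Proof. by rewrite prednK. Qed.

Let big_ord1 (F : nat -> cl_alg) : \sum_(i < n) F i.+1 = \sum_(1 <= i < n.+1) F i.
Proof. by rewrite big_add1 big_mkord. Qed.

Let l1 : (0 < n)%N := n_gt0.
Let l2 : (1 < n)%N := n_gt1.
Let l3 : (n.-2 < n)%N. Proof. lia. Qed.
Let l4 : (n.-1 < n)%N. Proof. lia. Qed.
Let o1 := Ordinal l1.
Let o2 := Ordinal l2.
Let om := Ordinal l3.
Let on := Ordinal l4.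
Let n_pred2 : n.-2.+1 = n.-1. Proof. lia. Qed.
Let X1n : x_cl o1 on = cl_pr (xC 1 n). Proof. by rewrite x_clE /= n_pred. Qed.
Let X1m : x_cl o1 om = cl_pr (xC 1 n.-1). Proof. by rewrite x_clE /= n_pred2. Qed.
Let X2n : x_cl o2 on = cl_pr (xC 2 n). Proof. by rewrite x_clE /= n_pred. Qed.
Let X2m : x_cl o2 om = cl_pr (xC 2 n.-1). Proof. by rewrite x_clE /= n_pred2. Qed.
Let prM u v : cl_pr (u * v) = cl_pr u * cl_pr v. Proof. exact: (rmorphM cl_pr). Qed.
Let prD u v : cl_pr (u + v) = cl_pr u + cl_pr v. Proof. exact: (rmorphD cl_pr). Qed.
Let prB u v : cl_pr (u - v) = cl_pr u - cl_pr v. Proof. exact: (rmorphB cl_pr). Qed.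
Let pr_sum (r : seq nat) (F : nat -> T) : cl_pr (\sum_(i <- r) F i) = \sum_(i <- r) cl_pr (F i).
Proof. exact: (big_morph cl_pr prD (rmorph0 cl_pr)). Qed.

Lemma cl_trace : \sum_i x_cl i i = scal cl_alg alpha0.
Proof.
rewrite (eq_bigr (fun i : 'I_n => cl_pr (xC i.+1 i.+1))) => [|i _]; last exact: x_clE.
rewrite (big_ord1 (fun i => cl_pr (xC i i))) -pr_sum -cl_pr_scal; congr (cl_pr _).
rewrite (eq_bigr _ (fun i _ => xC_diag _ _ i)); exact: sum_diag_coord.
Qed.

Let r1 : com (x_cl o1 on) (x_cl o1 om) = 0.
Proof.
rewrite /com X1n X1m.
apply: (eq_trans _ (cl_pr0 cl_rel1)); apply: esym; apply: (eq_trans (prB _ _)).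
exact: (congr2 (fun u v => u - v) (prM _ _) (prM _ _)).
Qed.
Let r2 : com (x_cl o1 on) (x_cl o2 on) = 0.
Proof.
rewrite /com X1n X2n.
apply: (eq_trans _ (cl_pr0 cl_rel2)); apply: esym; apply: (eq_trans (prB _ _)).
exact: (congr2 (fun u v => u - v) (prM _ _) (prM _ _)).
Qed.
Let r3 : x_cl o1 on * x_cl o2 om + x_cl o2 om * x_cl o1 on
  - x_cl o1 om * x_cl o2 on - x_cl o2 on * x_cl o1 om = 0.
Proof.
rewrite X1n X1m X2n X2m; apply: (eq_trans _ (cl_pr0 cl_rel3)); apply: esym.
apply: (eq_trans (prB _ _)); apply: (congr2 (fun u v => u - v)); last exact: prM.
apply: (eq_trans (prB _ _)); apply: (congr2 (fun u v => u - v)); last exact: prM.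
apply: (eq_trans (prD _ _)); apply: (congr2 +%R); exact: prM.
Qed.
Let r4 : \sum_m x_cl o1 m * x_cl m on = scal cl_alg alpha0 * x_cl o1 on.
Proof.
rewrite X1n -cl_pr_scal -prM; apply: (eq_trans _ (proj2 (cl_prP _ _) cl_rel4)).
rewrite [RHS]pr_sum -big_ord1; apply: eq_bigr => m _.
by rewrite !x_clE /= n_pred; apply: esym; apply: prM.
Qed.
Let r5 : \sum_m x_cl m on * x_cl o1 m = scal cl_alg alpha0 * x_cl o1 on.
Proof.
rewrite X1n -cl_pr_scal -prM; apply: (eq_trans _ (proj2 (cl_prP _ _) cl_rel5)).
rewrite [RHS]pr_sum -big_ord1; apply: eq_bigr => m _.
by rewrite !x_clE /= n_pred; apply: esym; apply: prM.
Qed.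
Let r6 : \sum_i \sum_j x_cl i j * x_cl j i = scal cl_alg (alpha0 ^+ 2).
Proof.
rewrite -cl_pr_scal; apply: (eq_trans _ (proj2 (cl_prP _ _) cl_rel6)).
rewrite [RHS]pr_sum -big_ord1; apply: eq_bigr => i _.
rewrite [RHS]pr_sum -big_ord1; apply: eq_bigr => j _.
by rewrite !x_clE; apply: esym; apply: prM.
Qed.

Let d12 : o1 != o2. Proof. by []. Qed.
Let d1m : o1 != om. Proof. by rewrite -val_eqE /=; lia. Qed.
Let d1n : o1 != on. Proof. by rewrite -val_eqE /=; lia. Qed.
Let d2m : o2 != om. Proof. by rewrite -val_eqE /=; lia. Qed.
Let d2n : o2 != on. Proof. by rewrite -val_eqE /=; lia. Qed.
Let dmn : om != on. Proof. by rewrite -val_eqE /=; lia. Qed.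
Let DBx p q u v : D_cl p q (u - v) = D_cl p q u - D_cl p q v.
Proof. exact: (drvB (D_cl_derivation p q)). Qed.
Let DMx p q u v : D_cl p q (u * v) = D_cl p q u * v + u * D_cl p q v.
Proof. exact: (drvM (D_cl_derivation p q)). Qed.
Let Dscx p q c : D_cl p q (scal cl_alg c) = 0.
Proof. exact: (drv_scal (D_cl_derivation p q)). Qed.

Lemma cl_commute i j a b : x_cl i j * x_cl a b = x_cl a b * x_cl i j.
Proof.
exact: (gen_comm n_gt3 DBx DMx D_cl_x d12 d1m d1n d2n dmn r1 r2 r4 r5 cl_trace).
Qed.

Lemma cl_rank_one i j m : x_cl i m * x_cl m j = x_cl m m * x_cl i j.
Proof.
exact: (rank_one n_gt3 DBx DMx D_cl_x d12 d1m d1n d2n dmn r1 r2 r3 r4 r5 r6 cl_trace).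
Qed.

End ClassicalIdeal.

Lemma scal_mul_eq0 (k : fieldType) (Q : alg k) (c : k) (u : Q) :
  c != 0 -> scal Q c * u = 0 -> u = 0.
Proof.
move=> c0 H; rewrite -[LHS]mul1r -(rmorph1 (scal Q)) -(mulVf c0) rmorphM -mulrA H.
by rewrite mulr0.
Qed.

(** * Polynomial identities evaluated in commuting elements of an algebra *)

Section CommutingProducts.
Variables (Q : pzRingType) (I : eqType) (u : I -> Q).
Hypothesis uC : forall i j, u i * u j = u j * u i.

Lemma commute_prod i w : u i * \prod_(x <- w) u x = \prod_(x <- w) u x * u i.
Proof.
elim: w => [|x w IH]; first by rewrite big_nil mulr1 mul1r.
by rewrite big_cons mulrA uC -mulrA IH mulrA.
Qed.

Lemma prod_perm w w' : perm_eq w w' -> \prod_(x <- w) u x = \prod_(x <- w') u x.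
Proof.
elim: w w' => [|x w IH] w' pw.
  by rewrite perm_sym in pw; move/perm_nilP: pw => ->.
have xw' : x \in w' by rewrite -(perm_mem pw) mem_head.
case/splitPr: xw' pw => p1 p2; rewrite perm_sym -cat1s perm_catCA /= perm_cons perm_sym => pw.
by rewrite big_cons (IH _ pw) !big_cat big_cons /= mulrA commute_prod -mulrA.
Qed.
End CommutingProducts.

Lemma digits_inj B m (f g : nat -> nat) :
  (forall i, f i < B)%N -> (forall i, g i < B)%N ->
  (\sum_(i < m) f i * B ^ i = \sum_(i < m) g i * B ^ i)%N ->
  forall i, (i < m)%N -> f i = g i.
Proof.
elim: m f g => // m IH f g fB gB; rewrite !big_ord_recl !expn0 !muln1 /=.
have E (h : nat -> nat) : (\sum_(i < m) h (bump 0 i) * B ^ bump 0 i =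
    (\sum_(i < m) h i.+1 * B ^ i) * B)%N.
  by rewrite big_distrl /=; apply: eq_bigr => i _; rewrite expnSr mulnA.
rewrite !E => H.
have fg0 : f 0%N = g 0%N.
  move: H; move: (\sum_(i < m) _)%N (\sum_(i < m) _)%N => s t /(congr1 (modn^~ B)).
  by rewrite ![(_ + _ * B)%N]addnC !modnMDl !modn_small.
have B0 : (0 < B)%N by apply: leq_ltn_trans (fB 0%N).
have H' : (\sum_(i < m) f i.+1 * B ^ i = \sum_(i < m) g i.+1 * B ^ i)%N.
  by move: H; rewrite fg0 => /addnI /eqP; rewrite eqn_pmul2r // => /eqP.
by case=> [//|i]; rewrite ltnS => im; apply: (IH (fun i => f i.+1) (fun i => g i.+1)).
Qed.

(** The terms are collected by the value of e: U is constant on each class, and the coefficients of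
    a class add up to 0. The induction removes one class at a time, with m bounding the number of
    terms left. *)
Lemma vanish_group (k : comPzRingType) (Q : alg k) (W : eqType) (c : W -> k)
    (U : W -> Q) (e : W -> nat) m (r : seq W) : (size r < m)%N ->
  (forall w w', w \in r -> w' \in r -> e w = e w' -> U w = U w') ->
  (forall d, \sum_(w <- r | e w == d) c w = 0) ->
  \sum_(w <- r) scal Q (c w) * U w = 0.
Proof.
elim: m r => // m IH [|w0 r] sz eU c0; first by rewrite big_nil.
set r0 := w0 :: r; rewrite (bigID (fun w => e w == e w0)) /=.
rewrite -big_filter -[X in _ + X]big_filter.
rewrite (eq_big_seq (fun w => scal Q (c w) * U w0)) => [|w]; last first.
  rewrite mem_filter => /andP[/eqP ew wr]; congr (_ * _).
  by apply: eU => //; rewrite mem_head.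
have c00 : \sum_(w <- [seq w <- r0 | e w == e w0]) c w = 0 by rewrite big_filter c0.
rewrite -mulr_suml -(raddf_sum (scal Q)) c00 (raddf0 (scal Q)) mul0r add0r.
apply: IH => [|w w'|d].
- have sz' : (size r < m)%N by [].
  rewrite /r0 /= eqxx /= size_filter; exact: leq_ltn_trans (count_size _ _) sz'.
- by rewrite !mem_filter => /andP[_ wr] /andP[_ wr']; apply: eU.
rewrite big_filter_cond; have [->|dw] := eqVneq d (e w0).
  by rewrite big_pred0 // => w; apply: andNb.
rewrite -[RHS](c0 d); apply: eq_bigl => w.
by have [->|] := eqVneq (e w) d; rewrite ?andbF // dw.
Qed.

Section CommutativeEvaluation.
Variables (C : numFieldType) (I : finType).
Notation T2 := {malg C[{fmonom I}]}.

Lemma free_scalC (c : C) (x : T2) : malgC c * x = x * malgC c.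
Proof.
rewrite !malgM_def fgmulUg fgmulgU.
by apply: eq_bigr => v _; rewrite mul1m mulm1 mulrC.
Qed.
Definition free_alg : alg C := @Alg C T2 _ free_scalC.

Lemma poly_eq0_nat (p : {poly C}) : (forall m, p.[m.+1%:R] = 0) -> p = 0.
Proof.
move=> p0; apply/eqP/negPn/negP => pn0.
have := @max_poly_roots _ p [seq i.+1%:R | i <- iota 0 (size p)] pn0.
rewrite size_map size_iota ltnn => H; suff: false by []; apply: H.
  by apply/allP => z /mapP[i _ ->]; apply/eqP/p0.
rewrite map_inj_uniq ?iota_uniq // => i j /eqP.
by rewrite eqr_nat => /eqP[].
Qed.

(* Kronecker substitution turns a word into a power of one variable that records
   how often each letter occurs. *)
Lemma commutative_eval_eq0 (P : T2) :
  (forall v : I -> C, (forall i, 0 < v i) -> free_ev (v : I -> regular_alg C) P = 0) ->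
  forall (Q : alg C) (u : I -> Q), (forall i j, u i * u j = u j * u i) ->
  free_ev u P = 0.
Proof.
move=> P0 Q u uC.
(* B exceeds the length of each word of P, hence all letter counts, which are therefore the digits
   of [e w] in base B. *)
pose B := (\max_(w <- msupp P) size (fmonom_val w)).+1.
pose e (w : seq I) := (\sum_(x <- w) B ^ enum_rank x)%N.
have eE w : e w = (\sum_(i < #|I|) count_mem (enum_val i) w * B ^ i)%N.
  rewrite /e; elim: w => [|x w IH]; first by rewrite big_nil big1.
  rewrite big_cons IH.
  have -> : (B ^ enum_rank x = \sum_(i < #|I|) (x == enum_val i) * B ^ i)%N.
    rewrite (bigD1 (enum_rank x)) //= enum_rankK eqxx mul1n big1 ?addn0 // => i ix.
    case: eqP => // xi; case/eqP: ix; by rewrite xi enum_valK.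
  by rewrite -big_split /=; apply: eq_bigr => i _; rewrite mulnDl.
have szB w : w \in msupp P -> (size (fmonom_val w) < B)%N.
  by move=> wP; rewrite /B ltnS; apply: leq_bigmax_seq.
have e_perm w w' : w \in msupp P -> w' \in msupp P ->
    e (fmonom_val w) = e (fmonom_val w') -> perm_eq (fmonom_val w) (fmonom_val w').
  move=> wP w'P; rewrite !eE => H.
  pose f (v : seq I) (j : nat) := if insub j is Some o then count_mem (enum_val (o : 'I_#|I|)) v else 0%N.
  have fE v (o : 'I_#|I|) : f v o = count_mem (enum_val o) v by rewrite /f valK.
  have fB v j : v \in msupp P -> (f (fmonom_val v) j < B)%N.
    move=> vP; rewrite /f; case: insubP => [o _ _|_] //.
    by apply: leq_ltn_trans (szB v vP); apply: count_size.
  have D := @digits_inj B #|I| (f (fmonom_val w)) (f (fmonom_val w')) (fun j => fB w j wP) (fun j => fB w' j w'P).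
  apply/allP => x _ /=; rewrite -(enum_rankK x) -!fE; apply/eqP/D => //.
  by rewrite (eq_bigr _ (fun i _ => congr1 (fun z => z * _)%N (fE _ i)))
    [RHS](eq_bigr _ (fun i _ => congr1 (fun z => z * _)%N (fE _ i))).
pose p : {poly C} := \sum_(w <- msupp P) mcoeff w P *: 'X^(e (fmonom_val w)).
have p0 : p = 0.
  apply: poly_eq0_nat => m; rewrite /p horner_sum.
  (* Evaluating P where the letter of rank i has the value (m + 1)^(B^i) gives the value of the
     polynomial p at m + 1. These points are positive, as the hypothesis on P requires. *)
  have vpos (i : I) : 0 < (m.+1%:R : C) ^+ (B ^ enum_rank i) by rewrite exprn_gt0 // ltr0Sn.
  rewrite -[RHS](P0 _ vpos) /free_ev; apply: eq_bigr => w _.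
  rewrite hornerZ hornerXn; congr (_ * _); rewrite /e.
  by elim: (fmonom_val w) => [|x v IH]; rewrite ?big_nil ?big_cons ?expr0 // exprD IH.
apply: (@vanish_group _ Q _ (fun w => mcoeff w P) (fun w => \prod_(x <- fmonom_val w) u x)
  (fun w => e (fmonom_val w)) _ _ (ltnSn _)) => [w w' wP w'P ee|d].
  by apply: prod_perm => //; apply: e_perm.
have pd := congr1 (fun q : {poly C} => q`_d) p0; rewrite /p coef_sum coef0 in pd.
rewrite -[RHS]pd.
rewrite [LHS]big_mkcond; apply: eq_bigr => w _; rewrite coefZ coefXn eq_sym.
by case: eqP => _; rewrite ?mulr1 ?mulr0.
Qed.

End CommutativeEvaluation.

Section HomogeneousEvaluation.
Variables (C : numFieldType) (n : nat).
Notation T := (tens_C C n).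

Lemma cart_hi_lt (m : 'I_n.-1) : (m.+1 < n)%N.
Proof. by case: m => m /=; lia. Qed.
Definition cart_lo (m : 'I_n.-1) : 'I_n := widen_ord (leq_pred n) m.
Definition cart_hi (m : 'I_n.-1) : 'I_n := Ordinal (cart_hi_lt m).

(* The values of the generators at a matrix of values of the matrix units. *)
Definition label_val (A : pzRingType) (y : 'I_n -> 'I_n -> A) (x : label n) : A :=
  match x with
  | inl p => y (val p).1 (val p).2
  | inr m => y (cart_lo m) (cart_lo m) - y (cart_hi m) (cart_hi m)
  end.

(** Words shorter than N are filled up with powers of S, so that the evaluation is homogeneous. The
    subtraction in the exponent is truncated, so N is later assumed to bound the lengths of the
    words of F. *)
Definition hom_ev (A : alg C) (S : A) (G : label n -> A) N (F : T) : A :=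
  \sum_(w <- msupp F) scal A (mcoeff w F) * (S ^+ (N - size (fmonom_val w)) *
    \prod_(x <- fmonom_val w) G x).

Lemma hom_ev_morph (A B : alg C) (f : {rmorphism A -> B}) S G N F :
  (forall c, f (scal A c) = scal B c) ->
  f (hom_ev S G N F) = hom_ev (f S) (f \o G) N F.
Proof.
move=> fs; rewrite /hom_ev rmorph_sum; apply: eq_bigr => w _.
rewrite !rmorphM rmorphXn /= fs; congr (_ * (_ * _)).
by rewrite rmorph_prod.
Qed.

Lemma eq_hom_ev (A : alg C) (S : A) (G G' : label n -> A) N F : G =1 G' ->
  hom_ev S G N F = hom_ev S G' N F.
Proof.
move=> GG; apply: eq_bigr => w _; congr (_ * (_ * _)); exact: eq_bigr.
Qed.

Lemma hom_ev_scale (A : alg C) (s : A) (xi : label n -> A) N F :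
  (forall x, s * xi x = xi x * s) ->
  (forall w, w \in msupp F -> (size (fmonom_val w) <= N)%N) ->
  hom_ev s (fun x => s * xi x) N F = s ^+ N * free_ev xi F.
Proof.
move=> sC szN; rewrite /hom_ev /free_ev mulr_sumr; apply: eq_big_seq => w wF.
rewrite [RHS]mulrA -scalC -mulrA; congr (_ * _).
have -> : \prod_(x <- fmonom_val w) (s * xi x) =
    s ^+ size (fmonom_val w) * \prod_(x <- fmonom_val w) xi x.
  elim: (fmonom_val w) => [|x v IH]; first by rewrite !big_nil expr0 mulr1.
  rewrite !big_cons IH /= exprS -!mulrA; congr (s * _).
  rewrite !mulrA; congr (_ * _).
  by elim: (size v) => [|m IHm]; rewrite ?expr0 ?mulr1 ?mul1r // exprSr mulrA IHm -!mulrA sC.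
by rewrite mulrA -exprD subnK //; apply: szN.
Qed.

Lemma hom_bound (F : T) : exists N, forall w, w \in msupp F -> (size (fmonom_val w) <= N)%N.
Proof.
exists (\max_(w <- msupp F) size (fmonom_val w)) => w wF.
exact: leq_bigmax_seq.
Qed.

Variable alpha0 : C.
Hypothesis a0 : alpha0 != 0.
Hypothesis n_gt1 : (1 < n)%N.

(** Vanishing at the rank-one matrices b_i a_j rescaled to trace alpha0. Positive coordinates keep
    the denominator nonzero, and they are still enough points to detect a polynomial identity. *)
Definition vanishes_generically (F : T) := forall b a : 'I_n -> C,
  (forall i, 0 < b i) -> (forall i, 0 < a i) ->
  free_ev (label_val (fun i j => b i * a j * (alpha0 / \sum_m b m * a m))
    : label n -> regular_alg C) F = 0.

Lemma label_val_scale (A : pzRingType) (s : A) (y y' : 'I_n -> 'I_n -> A) x :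
  (forall i j, y i j = s * y' i j) -> label_val y x = s * label_val y' x.
Proof. by move=> yy; case: x => [p|m] /=; rewrite !yy ?mulrBr. Qed.

(** At positive values the homogenized tensor is a power of the scaling factor times the value at a
    point of trace alpha0, hence 0. Being free of denominators, this is a polynomial identity and so
    holds for any commuting elements. *)
Lemma hom_ev_eq0 (F : T) N : vanishes_generically F ->
  (forall w, w \in msupp F -> (size (fmonom_val w) <= N)%N) ->
  forall (Q : alg C) (b a : 'I_n -> Q),
  (forall i j, b i * b j = b j * b i) -> (forall i j, a i * a j = a j * a i) ->
  (forall i j, b i * a j = a j * b i) ->
  hom_ev (scal Q alpha0^-1 * \sum_i b i * a i) (label_val (fun i j => b i * a j)) N F = 0.
Proof.
move=> F0 szN Q b a bC aC baC.
pose I2 := ('I_n + 'I_n)%type.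
pose T2 := free_alg C I2.
pose B i : T2 := << fmu (inl i : I2) >>; pose A i : T2 := << fmu (inr i : I2) >>.
pose P : T2 := hom_ev (scal T2 alpha0^-1 * \sum_i B i * A i)
  (label_val (fun i j => B i * A j)) N F.
have ev (Q' : alg C) (u : I2 -> Q') : free_ev u P =
    hom_ev (scal Q' alpha0^-1 * \sum_i u (inl i) * u (inr i))
      (label_val (fun i j => u (inl i) * u (inr j))) N F.
  pose f : {rmorphism T2 -> Q'} := free_ev u.
  have fs c : f (scal T2 c) = scal Q' c by apply: free_evC.
  have fB i : f (B i) = u (inl i) by apply: free_ev_gen.
  have fA i : f (A i) = u (inr i) by apply: free_ev_gen.
  have fS : f (scal T2 alpha0^-1 * \sum_i B i * A i) =
      scal Q' alpha0^-1 * \sum_i u (inl i) * u (inr i).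
    rewrite (rmorphM f) fs (raddf_sum f); congr (_ * _); apply: eq_bigr => i _.
    exact: (eq_trans (rmorphM f _ _) (congr2 *%R (fB i) (fA i))).
  apply: (eq_trans (@hom_ev_morph T2 Q' f _ _ N F fs)); rewrite fS.
  have fBA i j : f (B i * A j) = u (inl i) * u (inr j).
    exact: (eq_trans (rmorphM f _ _) (congr2 *%R (fB i) (fA j))).
  apply: eq_hom_ev => -[p|m] /=; first exact: fBA.
  exact: (eq_trans (rmorphB f _ _) (congr2 (fun v w => v - w) (fBA _ _) (fBA _ _))).
pose u (i : I2) : Q := match i with inl j => b j | inr j => a j end.
rewrite -[LHS](ev Q u); apply: commutative_eval_eq0; last by case=> i [] j /=.
move=> v v0; rewrite (ev (regular_alg C)) -[scal _ _]/(alpha0^-1).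
set s := alpha0^-1 * _.
have S0 : \sum_i v (inl i) * v (inr i) != 0.
  apply: lt0r_neq0; rewrite (bigD1 (Ordinal n_gt1)) //= ltr_pwDl ?mulr_gt0 //.
  by apply: sumr_ge0 => i _; rewrite mulr_ge0 ?ltW.
rewrite (@eq_hom_ev (regular_alg C) _ _ (fun x => s * label_val (fun i j => v (inl i) * v (inr j) *
    (alpha0 / \sum_m v (inl m) * v (inr m))) x)) => [|x]; last first.
  apply: label_val_scale => i j; rewrite /s.
  by move: S0 => /=; move: (\sum_i _) => S S0; field; rewrite S0 a0.
rewrite (@hom_ev_scale (regular_alg C)) // => [|x]; last exact: mulrC.
by rewrite F0 ?mulr0 // => i; apply: v0.
Qed.

Lemma generic_vanish_point (F : T) : vanishes_generically F ->
  forall b a : 'I_n -> C, \sum_i b i * a i = alpha0 ->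
  free_ev (label_val (fun i j => b i * a j) : label n -> regular_alg C) F = 0.
Proof.
move=> F0 b a ba; have [N szN] := hom_bound F.
have := @hom_ev_eq0 F N F0 szN (regular_alg C) b a (fun _ _ => mulrC _ _)
  (fun _ _ => mulrC _ _) (fun _ _ => mulrC _ _).
rewrite ba -[scal _ _]/(alpha0^-1) mulVf //.
rewrite (@eq_hom_ev (regular_alg C) _ _ (fun x => 1 * label_val (fun i j => b i * a j) x)) => [|x].
  rewrite (@hom_ev_scale (regular_alg C)) // => [|x]; last exact: mulrC.
  by rewrite expr1n mul1r.
by rewrite mul1r.
Qed.

End HomogeneousEvaluation.

Section Nilpotent.
Variables (Q : pzRingType) (I : Type) (z : I -> Q) (f : Q).
Hypothesis zC : forall i j, z i * z j = z j * z i.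

(** The binomial argument for sums of commuting nilpotents: in every term of the expansion one of
    the two exponents is large enough to kill f. *)
Lemma sum_pow_mul_eq0 (r : seq I) : (forall i, exists N, z i ^+ N * f = 0) ->
  exists N, (\sum_(i <- r) z i) ^+ N * f = 0.
Proof.
move=> zf; elim: r => [|i r [N IH]]; first by exists 1%N; rewrite big_nil expr1 mul0r.
have [M zM] := zf i; exists (M + N)%N; rewrite big_cons.
set y := \sum_(j <- r) z j in IH *.
have cy : GRing.comm (z i) y.
  by rewrite /GRing.comm mulr_sumr mulr_suml; apply: eq_bigr => j _; apply: zC.
rewrite exprDn_comm // mulr_suml big1 // => j _; rewrite mulrnAl.
have [le|lt] := leqP N j.
  by rewrite -mulrA -(subnK le) exprD -(mulrA (y ^+ _)) IH !mulr0 mul0rn.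
have cc : GRing.comm (z i ^+ (M + N - j)) (y ^+ j) by apply: commrX; apply/commr_sym/commrX/commr_sym.
have le : (M <= M + N - j)%N by lia.
by rewrite cc -mulrA -(subnK le) exprD -(mulrA (z i ^+ _)) zM !mulr0 mul0rn.
Qed.
End Nilpotent.

Section ClassicalVanishing.
Variables (C : numFieldType) (n : nat) (alpha0 : C) (q_gt1 : bool).
Hypothesis n_gt3 : (3 < n)%N.
Hypothesis a0 : alpha0 != 0.
Notation T := (tens_C C n).
Notation cl_alg := (@cl_alg C n alpha0 q_gt1).
Notation cl_pr := (@cl_pr C n alpha0 q_gt1).
Notation x_cl := (@x_cl C n alpha0 q_gt1).

Lemma cl_pr_gen x : cl_pr (<< fmu x >> : T) = label_val x_cl x.
Proof.
case: x => [p|m] /=; first by rewrite (gen_xC alpha0) x_clE.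
rewrite gen_tC (tCE _ alpha0) // (rmorphB cl_pr) !x_clE //.
Qed.

Lemma cl_pr_free_ev (F : T) : cl_pr F = free_ev (label_val x_cl : label n -> cl_alg) F.
Proof.
apply: free_ev_unique => [c|x]; last exact: cl_pr_gen.
exact: cl_pr_scal.
Qed.

Lemma cl_vanish (F : T) : vanishes_generically alpha0 F -> in_cl alpha0 q_gt1 F.
Proof.
move=> F0; suff : cl_pr F = 0.
  by rewrite -(rmorph0 cl_pr) => /cl_prP; rewrite subr0.
have cC := @cl_commute C n alpha0 q_gt1 n_gt3.
have R1 := @cl_rank_one C n alpha0 q_gt1 n_gt3.
have tr := @cl_trace C n alpha0 q_gt1 n_gt3.
have [N szN] := hom_bound F.
have n_gt1 : (1 < n)%N by lia.
(* With b_i = x_ik and a_j = x_kj the rank-one relations give b_i a_j = x_kk x_ij, and the trace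
   relation makes S equal to x_kk. The homogenized value is thus x_kk^N times the class of F. *)
have zk k : x_cl k k ^+ N * cl_pr F = 0.
  have := @hom_ev_eq0 C n alpha0 a0 n_gt1 F N F0 szN cl_alg (fun i => x_cl i k) (fun j => x_cl k j)
    (fun _ _ => cC _ _ _ _) (fun _ _ => cC _ _ _ _) (fun _ _ => cC _ _ _ _).
  rewrite (eq_bigr (fun i => x_cl k k * x_cl i i)) => [|i _]; last exact: R1.
  rewrite -mulr_sumr tr -scalC mulrA -rmorphM mulVf // rmorph1 mul1r.
  rewrite (@eq_hom_ev _ _ cl_alg _ _ (fun x => x_cl k k * label_val x_cl x)) => [|x]; last first.
    by apply: label_val_scale => i j; apply: R1.
  have sC x : x_cl k k * label_val x_cl x = label_val x_cl x * x_cl k k.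
    case: x => [p|m] /=; first exact: cC.
    apply: (eq_trans (mulrBr _ _ _)); apply: (eq_trans _ (esym (mulrBl _ _ _))).
    by apply: (congr2 (fun u v => u - v)); apply: cC.
  by rewrite (@hom_ev_scale C n cl_alg (x_cl k k) (label_val x_cl) N F sC szN) cl_pr_free_ev.
have [M] := @sum_pow_mul_eq0 cl_alg 'I_n (fun k => x_cl k k) (cl_pr F) (fun _ _ => cC _ _ _ _)
  (index_enum _) (fun k => ex_intro _ N (zk k)).
rewrite tr -rmorphXn => H.
exact: (scal_mul_eq0 (expf_neq0 M a0) H).
Qed.

End ClassicalVanishing.

(** * Evaluation at points of the orbit *)

Section FirstOrderCoefficients.
Variables (C : numFieldType).
Notation K := (K_hn C).
Notation qp := (qpow C).

Definition coef10 (c : K) : C := fcoef (fcoef c 1) 0.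
Definition coef01 (c : K) : C := fcoef (fcoef c 0) 1.

Lemma coef10D x y : coef10 (x + y) = coef10 x + coef10 y. Proof. by []. Qed.
Lemma coef10B x y : coef10 (x - y) = coef10 x - coef10 y. Proof. by []. Qed.
Lemma coef01D x y : coef01 (x + y) = coef01 x + coef01 y. Proof. by []. Qed.
Lemma coef01B x y : coef01 (x - y) = coef01 x - coef01 y. Proof. by []. Qed.
Lemma coef10M x y : coef10 (x * y) = coef00 x * coef10 y + coef10 x * coef00 y.
Proof. by rewrite /coef10 fcoefM1 fcoefD !fcoefM0. Qed.
Lemma coef01M x y : coef01 (x * y) = coef00 x * coef01 y + coef01 x * coef00 y.
Proof. by rewrite /coef01 fcoefM0 fcoefM1. Qed.
Lemma coef10_qpow m : coef10 (qp m) = 0.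
Proof. by rewrite /coef10 fcoefS_qpow. Qed.
Lemma coef01_qpow m : coef01 (qp m) = m%:~R.
Proof. exact: fcoef01_qpow. Qed.

(** The quotient by [delta], of order one in nu, is read off from the coefficients of nu on both
    sides of [qdiffE]. *)
Lemma coef00_qdiff x y : coef00 (qdiff C x y) = (y - x)%:~R.
Proof.
have := congr1 coef01 (qdiffE C x y).
have D0 : coef00 (delta C) = 0 by rewrite coef00B !coef00_qpow subrr.
have D1 : coef01 (delta C) = 2%:R.
  by rewrite coef01B !coef01_qpow mulrN1z opprK.
rewrite coef01M D0 mul0r add0r D1 coef01B !coef01_qpow => H.
have two : (2%:R : C) != 0 by rewrite pnatr_eq0.
apply: (mulfI two); rewrite H -[2%:R]/(2%:~R) -intrM -rmorphB /=.
by congr (_%:~R); lia.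
Qed.
End FirstOrderCoefficients.

Section PointEvaluation.
Variables (C : numFieldType) (n : nat) (alpha0 : C) (q_gt1 : bool) (w y : nat -> C).
Hypothesis n_gt3 : (3 < n)%N.
Hypothesis w0 : forall k, (0 < k <= n)%N -> w k != 0.
Hypothesis sum_y : \sum_(1 <= k < n.+1) y k = alpha0.
Notation K := (K_hn C).
Notation qp := (qpow C).
Notation T := (tens_C C n).
Notation Yfun := (Yfun n alpha0 q_gt1 y).
Notation wt := (wt n).
Notation zpar := (zpar n alpha0 q_gt1 y).
Notation spar0 := (spar0 n alpha0 q_gt1).

(** The multiplicative character of the lattice that sends eps_i - eps_j to w_i / w_j, see
    [character_shift]. It is a common eigenvector of the shifts. *)
Definition character (mu : lattice) : C :=
  \prod_(1 <= k < n) (w k / w k.+1) ^ (mu k).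

Lemma ratio_neq0 k : (0 < k < n)%N -> w k / w k.+1 != 0.
Proof. by move=> k0; rewrite mulf_neq0 ?invr_eq0 ?w0 //; lia. Qed.

Lemma character0 : character lat0 = 1.
Proof. by rewrite /character big1. Qed.

Lemma character_step i : (0 < i <= n)%N ->
  \prod_(1 <= k < n) (w k / w k.+1) ^ ((i <= k)%N%:Z) = w i / w n.
Proof.
move=> i0; rewrite (big_cat_nat (n := i)) /=; try lia.
rewrite [X in X * _]big_nat_cond big1 ?mul1r => [|k /andP[/andP[_ ki] _]]; last first.
  by rewrite leqNgt ki.
rewrite (eq_big_nat _ _ (F2 := fun k => w k / w k.+1)) => [|k /andP[ik _]]; last by rewrite ik expr1z.
have [d e] : exists d, n = (i + d)%N by exists (n - i)%N; lia.
have : forall d, (i + d <= n)%N -> \prod_(i <= k < i + d) (w k / w k.+1) = w i / w (i + d)%N.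
  elim=> [|m IH] im; first by rewrite addn0 big_geq // mulfV // w0.
  have nz : w (i + m)%N != 0 by apply: w0; lia.
  rewrite addnS big_nat_recr ?leq_addr //= IH; last lia.
  by rewrite mulrA mulfVK.
by move/(_ d); rewrite -e; apply.
Qed.

Lemma character_shift mu i j : (0 < i <= n)%N -> (0 < j <= n)%N ->
  character (lat_add mu (sh i j)) = (w i / w j) * character mu.
Proof.
move=> i0 j0; rewrite /character mulrC.
rewrite (eq_big_nat _ _ (F2 := fun k => (w k / w k.+1) ^ (mu k) *
   ((w k / w k.+1) ^ ((i <= k)%N%:Z) / (w k / w k.+1) ^ ((j <= k)%N%:Z)))) => [|k k0].
  rewrite big_split /= prodf_div !character_step //.
  have nj := w0 j0; have nn : w n != 0 by apply: w0; lia.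
  by congr (_ * _); rewrite invf_div mulrA mulfVK.
have nz := ratio_neq0 k0.
by rewrite /lat_add /sh expfzDr // expfzDr // -invr_expz.
Qed.

Definition gen_coef (x : label n) (mu : lattice) : K :=
  match x with
  | inl p => let i := (val p).1.+1 in let j := (val p).2.+1 in
     qp (- i%:Z - (i < j)%N%:Z - wt mu i + wt mu j) * Yfun j mu
  | inr m => qp (- m.+1%:Z) * (qp 1 * Yfun m.+1 mu - qp (-1) * Yfun m.+2 mu)
  end.
Definition gen_shift (x : label n) : lattice :=
  match x with inl p => sh (val p).1.+1 (val p).2.+1 | inr _ => lat0 end.

Lemma op_gen_std x :
  op_gen (std_rep C) alpha0 q_gt1 y x = std_op (gen_coef x) (gen_shift x).
Proof. by case: x. Qed.

Definition psum k : C := \sum_(1 <= i < k.+1) y i.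

Lemma coef00_gamma : coef00 (gamma_h C n q_gt1) = 1.
Proof.
have h0 : coef00 (hbar C) = 0 by [].
rewrite /gamma_h coef00D h0 addr0 /gamma_q.
by case: q_gt1; apply: coef00_qpow.
Qed.

Lemma coef00_zpar k : (k <= n)%N -> coef00 (zpar k) = psum k.
Proof.
rewrite /zpar /psum; have [->|k0 kn] := eqVneq k 0%N; first by rewrite big_geq.
have [lt|le] := ltnP k n.
  by rewrite /coef00 !fcoef_fpsC0.
have -> : k = n by lia.
by rewrite !coef00M coef00_qpow mul1r coef00_gamma mulr1 sum_y; apply: mulr1n.
Qed.

Lemma coef00_spar0 : coef00 spar0 = 0.
Proof.
have n0 : (0 < n)%N by lia.
by rewrite /spar0 coef00M coef00_div // coef00B coef00_gamma coef00_qpow subrr mul0r mulr0.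
Qed.

Lemma coef10_spar0 : coef10 spar0 = alpha0 / n%:R.
Proof.
have n0 : (0 < n)%N by lia.
have nN : n%:R != 0 :> C by rewrite pnatr_eq0 -lt0n.
have D0 : coef00 (gamma_h C n q_gt1 - qp n) = 0.
  by rewrite coef00B coef00_gamma coef00_qpow subrr.
have D1 : coef10 (gamma_h C n q_gt1 - qp n) = 1.
  rewrite coef10B coef10_qpow subr0 /gamma_h coef10D.
  have -> : coef10 (gamma_q C n q_gt1) = 0 by rewrite /coef10 fcoefS_gamma_q.
  by rewrite add0r.
have V : coef00 (qnum C n)^-1 = n%:R^-1.
  apply: (mulIf nN); rewrite mulVf // -(coef00_qnum C n) -coef00M mulVr ?qnum_unit //.
rewrite /spar0 coef10M coef10M D0 mul0r add0r D1 mul1r V.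
have -> : coef00 ((gamma_h C n q_gt1 - qp n) / qnum C n) = 0 by rewrite coef00_div // D0 mul0r.
by rewrite mulr0 addr0; congr (_ / _); apply: mulr1n.
Qed.

(** The coefficient of nu in S_0, on which the choice of gamma(q) has an effect. It is kept as a
    symbol, since it only adds a multiple of the bracket in h to the bracket in nu and so does not
    change the pencil. *)
Definition s01 : C := coef01 spar0.

Lemma coef00_Yfun j mu : (0 < j <= n)%N -> coef00 (Yfun j mu) = y j.
Proof.
move=> j0; rewrite /Yfun; have S0 := coef00_spar0; move: spar0 S0 => sp S0.
rewrite coef00D coef00B !coef00M !coef00_qpow !mul1r S0 mul0r addr0 !coef00_zpar; try lia.
case: j j0 => // j j0; rewrite /psum /= big_nat_recr //= addrAC subrr add0r //.
Qed.

Lemma coef10_Yfun j mu : (0 < j <= n)%N -> coef10 (Yfun j mu) =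
  coef10 (zpar j) - coef10 (zpar j.-1) + alpha0 / n%:R * (wt mu j.-1 - wt mu j)%:~R.
Proof.
move=> j0; rewrite /Yfun -coef10_spar0 -coef00_qdiff.
have S0 := coef00_spar0; move: spar0 (qdiff _ _ _) S0 => sp qd S0.
rewrite coef10D coef10B !coef10M !coef10_qpow !coef00_qpow !mul1r.
by rewrite !mul0r !addr0 S0 mul0r add0r.
Qed.

Lemma coef01_Yfun j mu : (0 < j <= n)%N -> coef01 (Yfun j mu) =
  coef01 (zpar j) - coef01 (zpar j.-1) + (- wt mu j *+ 2)%:~R * psum j
  - (- wt mu j.-1 *+ 2)%:~R * psum j.-1 + s01 * (wt mu j.-1 - wt mu j)%:~R.
Proof.
move=> j0; rewrite /Yfun /s01 -coef00_qdiff.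
have S0 := coef00_spar0; move: spar0 (qdiff _ _ _) S0 => sp qd S0.
rewrite coef01D coef01B !coef01M !coef01_qpow !coef00_qpow !mul1r.
rewrite S0 mul0r add0r !coef00_zpar; try lia.
by rewrite opprD addrACA !addrA.
Qed.

(* The eigenvalues of the leading coefficients of the operators on [character]. *)
Definition torus_point i j : C := w i * y j / w j.

Definition at_point (A : Type) (f : nat -> nat -> A) (i j : 'I_n) : A := f i.+1 j.+1.

Definition gen_scale (x : label n) : C :=
  match x with inl p => w (val p).1.+1 / w (val p).2.+1 | inr _ => 1 end.

Lemma character_gen_shift mu x :
  character (lat_add mu (gen_shift x)) = gen_scale x * character mu.
Proof.
case: x => [p|m] /=; first by apply: character_shift; apply: ltn_ord.
by rewrite lat_addr0 mul1r.
Qed.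

Lemma coef00_gen x mu : gen_scale x * coef00 (gen_coef x mu) =
  label_val (at_point torus_point) x.
Proof.
case: x => [p|m] /=.
  rewrite coef00M coef00_qpow mul1r coef00_Yfun; last exact: ltn_ord.
  by rewrite /at_point /torus_point mulrAC.
have m0 : (0 < m.+1 <= n)%N by have := cart_hi_lt m; lia.
have m1 : (0 < m.+2 <= n)%N by have := cart_hi_lt m; lia.
rewrite mul1r coef00M coef00_qpow mul1r coef00B !coef00M !coef00_qpow !mul1r !coef00_Yfun //.
by rewrite /at_point /torus_point /= ![w _ * _]mulrC !mulfK // w0.
Qed.

(** The coefficients at h = nu = 0 no longer depend on mu: the generators become pure shifts with
    constant factors, and a character turns them into numbers. *)
Lemma op_coef00_character (t : T) :
  lin_endo_val (fcoef (fcoef (op_ev_const alpha0 q_gt1 y t) 0) 0) character =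
  (fun mu => (free_ev (label_val (at_point torus_point) : label n -> regular_alg C) t : C)
     * character mu).
Proof.
have scE c : fcoef (fcoef (scal (op_algC C) c : op_alg C) 0) 0 = scal (endo_alg C) c.
  change (scal (endo_alg C) (fcoef (fcoef (fpsC (fpsC c)) 0) 0) = scal (endo_alg C) c).
  by rewrite !fcoef_fpsC0.
elim/tens_ind: t => [t1 t2 IH1 IH2|c t IH||x t IH].
- have -> : op_ev_const alpha0 q_gt1 y (t1 + t2) =
    op_ev_const alpha0 q_gt1 y t1 + op_ev_const alpha0 q_gt1 y t2 by apply: free_evD.
  apply/funext => mu; rewrite !fcoefD.
  have E := congr1 (fun f => f mu) IH1; have E' := congr1 (fun f => f mu) IH2.
  apply: (eq_trans (congr2 +%R E E')); rewrite -mulrDl; congr (_ * _).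
  by rewrite free_evD.
- have -> : op_ev_const alpha0 q_gt1 y (scal T c * t) =
    scal (op_algC C) c * op_ev_const alpha0 q_gt1 y t.
    by apply: (eq_trans (rmorphM (free_ev _) _ _)); congr (_ * _); apply: free_evC.
  apply/funext => mu.
  rewrite (_ : fcoef (fcoef _ 0) 0 = scal (endo_alg C) c *
    fcoef (fcoef (op_ev_const alpha0 q_gt1 y t) 0) 0); last first.
    apply: (eq_trans (congr1 (fun u => fcoef u 0) (fcoefM0 _ _))).
    apply: (eq_trans (fcoefM0 _ _)); apply: (congr1 (fun u => u * _)).
    exact: scE.
  have E := congr1 (fun f => c * f (lat_add mu lat0)) IH.
  apply: (eq_trans E); rewrite lat_addr0 mulrA; congr (_ * _).
  by rewrite (rmorphM (free_ev (label_val (at_point torus_point) : label n -> regular_alg C))) /= free_evC.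
- have -> : op_ev_const alpha0 q_gt1 y (1 : T) = 1 by apply: (rmorph1 (free_ev _)).
  apply/funext => mu; rewrite (rmorph1 (free_ev _)) mul1r //.
- have -> : op_ev_const alpha0 q_gt1 y (<< fmu x >> * t) =
    std_op (gen_coef x) (gen_shift x) * op_ev_const alpha0 q_gt1 y t.
    apply: (eq_trans (rmorphM (free_ev _) _ _)); rewrite -op_gen_std.
    by apply: (congr1 (fun u => u * _)); apply: free_ev_gen.
  apply/funext => mu.
  rewrite (_ : fcoef (fcoef _ 0) 0 =
    shift_op (fun mu => fcoef (fcoef (gen_coef x mu) 0) 0) (gen_shift x) *
    fcoef (fcoef (op_ev_const alpha0 q_gt1 y t) 0) 0); last first.
    apply: (eq_trans (congr1 (fun u => fcoef u 0) (fcoefM0 _ _))).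
    apply: (eq_trans (fcoefM0 _ _)); congr (_ * _); exact: fcoef_std_op.
  have E := congr1 (fun f => coef00 (gen_coef x mu) * f (lat_add mu (gen_shift x))) IH.
  apply: (eq_trans E); rewrite character_gen_shift.
  rewrite (rmorphM (free_ev (label_val (at_point torus_point) : label n -> regular_alg C))) /= free_ev_gen.
  rewrite -(coef00_gen x mu).
  by rewrite [gen_scale x * coef00 _]mulrC -!mulrA [X in _ = _ * X]mulrCA.
Qed.

(* The coefficient of an element acting as zero which is leading for the
   lexicographic order vanishes at the point. *)
Lemma op_hat_eq0_point z i j : op_hat alpha0 q_gt1 y z = 0 ->
  (forall a, (a < i)%N -> fcoef z a = 0) ->
  (forall b, (b < j)%N -> fcoef (fcoef z i) b = 0) ->
  free_ev (label_val (at_point torus_point) : label n -> regular_alg C) (fcoef (fcoef z i) j) = 0.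
Proof.
move=> z0 zi zj; have := op_coef00_character (fcoef (fcoef z i) j).
(* All other terms in the coefficient of h^i nu^j of the image contain a coefficient of z that
   vanishes by assumption. *)
have -> : fcoef (fcoef (op_ev_const alpha0 q_gt1 y (fcoef (fcoef z i) j)) 0) 0 = 0.
  have op0 : op_ev_const alpha0 q_gt1 y (0 : T) = 0 by apply: free_ev0.
  have := fcoef_op_hat alpha0 q_gt1 y z i j; rewrite z0 big_ord_recr /=.
  rewrite big1 => [|a _]; last first.
    by rewrite zi // big1 // => b _; rewrite op0.
  rewrite add0r big_ord_recr /= big1 => [|b _]; last by rewrite zj // op0.
  by rewrite add0r !subnn => <-.
move=> /(congr1 (fun f => f lat0)) /=; rewrite character0 mulr1 => <-.
by [].
Qed.

End PointEvaluation.

Section DefiningIdealVanishes.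
Variables (C : numFieldType) (n : nat) (alpha0 : C) (q_gt1 : bool).
Hypothesis n_gt3 : (3 < n)%N.
Hypothesis a0 : alpha0 != 0.

Definition nat_ext (f : 'I_n -> C) (k : nat) : C := oapp f 0 (insub k.-1).
Lemma nat_extE f (i : 'I_n) : nat_ext f i.+1 = f i.
Proof. by rewrite /nat_ext /= valK. Qed.
Lemma sum_nat_ext f : \sum_(1 <= k < n.+1) nat_ext f k = \sum_i f i.
Proof. by rewrite big_add1 big_mkord; apply: eq_bigr => i _; apply: nat_extE. Qed.
Lemma nat_ext_ord (P : C -> Prop) f : (forall i, P (f i)) ->
  forall k, (0 < k <= n)%N -> P (nat_ext f k).
Proof. by move=> Pf [|k] // kn; rewrite (nat_extE f (Ordinal kn)). Qed.

Lemma defining_ideal_vanishes z i j : in_defining_ideal alpha0 q_gt1 z ->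
  (forall a, (a < i)%N -> fcoef z a = 0) ->
  (forall b, (b < j)%N -> fcoef (fcoef z i) b = 0) ->
  @vanishes_generically C n alpha0 (fcoef (fcoef z i) j).
Proof.
move=> Jz zi zj b a b0 c0; set s := \sum_m b m * a m.
have s0 : s != 0.
  have n1 : (0 < n)%N by lia.
  apply: lt0r_neq0; rewrite /s (bigD1 (Ordinal n1)) //= ltr_pwDl ?mulr_gt0 //.
  by apply: sumr_ge0 => k _; rewrite mulr_ge0 ?ltW.
(* With w = b, the entry w_i y_j / w_j is the given point exactly when y_j is its j-th diagonal
   entry. *)
pose yf := nat_ext (fun i => b i * a i * (alpha0 / s)).
have w0 k : (0 < k <= n)%N -> nat_ext b k != 0.
  by apply: (nat_ext_ord (P := fun c => c != 0)) => l; apply: lt0r_neq0.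
have sy : \sum_(1 <= k < n.+1) yf k = alpha0.
  by rewrite sum_nat_ext -mulr_suml -/s mulrCA mulfV // mulr1.
have := op_hat_eq0_point n_gt3 w0 sy (op_hat_defining_ideal yf n_gt3 a0 Jz) zi zj.
move=> H; rewrite -[RHS]H; congr (free_ev _ _); apply/funext => x.
have E : at_point (n := n) (torus_point (nat_ext b) yf) = (fun i j => b i * a j * (alpha0 / s)).
  apply/funext => k; apply/funext => l; rewrite /at_point /torus_point /yf !nat_extE.
  have bl := lt0r_neq0 (b0 l).
  by move: (alpha0 / s) => c; field.
by rewrite E.
Qed.

End DefiningIdealVanishes.

Lemma free_ev_comp (k : comNzRingType) (I : choiceType) (A B : alg k) (G : I -> A)
    (f : {rmorphism A -> B}) : (forall c, f (scal A c) = scal B c) ->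
  forall z, f (free_ev G z) = free_ev (f \o G) z.
Proof.
move=> fs z; rewrite /free_ev rmorph_sum; apply: eq_bigr => w _.
by rewrite rmorphM fs; congr (_ * _); rewrite rmorph_prod.
Qed.

(** * Points of the orbit as matrices of rank one, and functions on it *)

Section OrbitPoints.
Variables (C : numFieldType) (n : nat) (alpha0 : C).
Hypothesis n_gt1 : (1 < n)%N.
Hypothesis a0 : alpha0 != 0.
Notation T := (tens_C C n).
Notation orbit := (coadjoint_orbit (n := n) alpha0).
Notation FunO := (FunO n alpha0).

Let i0 : 'I_n := Ordinal (ltnW n_gt1).

Lemma omega1_to_sl (M : 'M[C]_n) : \tr M = 0 -> omega1 (to_sl M) = M i0 i0.
Proof.
move=> trM; by rewrite /omega1 to_slK // (big_pred1 i0).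
Qed.

Lemma tr_conj (u M : 'M[C]_n) : u \in unitmx -> \tr (invmx u *m M *m u) = \tr M.
Proof. by move=> uu; rewrite mxtrace_mulC mulmxA mulmxV // mul1mx. Qed.

Lemma orbit_value (x : sl_dual C n) (u : 'M[C]_n) : u \in unitmx ->
  (forall z : sl C n, x z = alpha0 * omega1 (to_sl (invmx u *m mx_of z *m u))) ->
  forall M, \tr M = 0 -> x (to_sl M) =
    \sum_i \sum_j invmx u i0 i * M i j * (alpha0 * u j i0).
Proof.
move=> uu xE M trM; rewrite xE omega1_to_sl ?to_slK ?tr_conj //.
rewrite mxE mulr_sumr exchange_big; apply: eq_bigr => j _.
rewrite mxE mulrCA mulr_suml; apply: eq_bigr => i _.
by rewrite mulrCA.
Qed.

Lemma tr_mxunit (i j : 'I_n) : \tr (mxunit C n i.+1 j.+1) = (i == j)%:R.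
Proof.
rewrite /mxtrace (bigD1 i) //= mxE !eqSS !eqxx /= big1 ?addr0 => [|k ki].
  by [].
by rewrite mxE !eqSS; have -> : (k == i :> nat) = false by apply/negbTE; exact: ki.
Qed.

Lemma sum_mxunit (f g : 'I_n -> C) (i j : 'I_n) :
  \sum_a \sum_b f a * mxunit C n i.+1 j.+1 a b * g b = f i * g j.
Proof.
rewrite (bigD1 i) //= [X in _ + X]big1 ?addr0 => [|a ai]; last first.
  rewrite big1 // => b _; rewrite mxE !eqSS.
  have -> : (a == i :> nat) = false by apply/negbTE; exact: ai.
  by rewrite mulr0 mul0r.
rewrite (bigD1 j) //= [X in _ + X]big1 ?addr0 => [|b bj]; last first.
  rewrite mxE !eqSS; have -> : (b == j :> nat) = false by apply/negbTE; exact: bj.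
  by rewrite andbF mulr0 mul0r.
by rewrite mxE !eqSS !eqxx mulr1.
Qed.

Definition label_mx (l : label n) : 'M[C]_n :=
  match l with
  | inl p => mxunit C n (val p).1.+1 (val p).2.+1
  | inr k => mxunit C n k.+1 k.+1 - mxunit C n k.+2 k.+2
  end.

Lemma sl_basisE l : sl_basis C l = to_sl (label_mx l). Proof. by case: l. Qed.

Lemma tr_label_mx l : \tr (label_mx l) = 0.
Proof.
case: l => [p|k] /=; first by rewrite tr_mxunit (negPf (valP p)).
by rewrite (raddfB (@mxtrace _ _)) /= (tr_mxunit (cart_lo k) (cart_lo k))
  (tr_mxunit (cart_hi k) (cart_hi k)) !eqxx subrr.
Qed.

Lemma sum_label_mx (f g : 'I_n -> C) l :
  \sum_a \sum_b f a * label_mx l a b * g b = label_val (fun i j => f i * g j) l.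
Proof.
case: l => [p|k] /=; first exact: sum_mxunit.
rewrite -(sum_mxunit f g (cart_lo k)) -(sum_mxunit f g (cart_hi k)) -sumrB.
apply: eq_bigr => a _; rewrite -sumrB; apply: eq_bigr => b _.
by rewrite !mxE mulrBr mulrBl.
Qed.

Definition rank_one_point (b a : 'I_n -> C) (x : sl_dual C n) :=
  forall M, \tr M = 0 -> x (to_sl M) = \sum_i \sum_j b i * M i j * a j.

Lemma rank_one_label b a x l : rank_one_point b a x ->
  x (sl_basis C l) = label_val (fun i j => b i * a j) l.
Proof. by move=> xE; rewrite sl_basisE xE ?tr_label_mx // sum_label_mx. Qed.

Lemma orbit_rank_one (x : sl_dual C n) : orbit x ->
  exists b a, \sum_i b i * a i = alpha0 /\ rank_one_point b a x.
Proof.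
move=> [u du xE]; have uu : u \in unitmx by rewrite unitmxE du unitr1.
exists (fun i => invmx u i0 i), (fun j => alpha0 * u j i0); split; last exact: orbit_value.
have := congr1 (fun M : 'M_n => M i0 i0) (mulVmx uu); rewrite !mxE eqxx => H.
rewrite -[RHS]mulr1 -[X in _ = _ * X]H mulr_sumr.
by apply: eq_bigr => i _; rewrite mulrCA.
Qed.

(** The point is the conjugate of the base point by a matrix u of determinant 1 with first column
    proportional to a, whose inverse has first row proportional to b. After b is scaled to first
    entry 1, u is an upper times a lower unitriangular matrix: the first sends the row r to the
    first unit row, the second carries the column v. *)
Lemma rank_one_orbit b a : b i0 != 0 -> \sum_i b i * a i = alpha0 ->
  exists2 x, orbit x & rank_one_point b a x.
Proof.
move=> b0 ba.
pose r i := b i / b i0; pose v i := a i * b i0 / alpha0.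
have r0 : r i0 = 1 by rewrite /r mulfV.
have rv : \sum_i r i * v i = 1.
  apply: (mulfI a0); rewrite mulr1 -[RHS]ba mulr_sumr; apply: eq_bigr => i _.
  by rewrite /r /v; field; rewrite a0 b0.
pose N1 : 'M[C]_n := \matrix_(i, j) ((i == j)%:R - ((i == i0) && (j != i0))%:R * r j).
pose N2 : 'M[C]_n := \matrix_(i, j) (if j == i0 then (if i == i0 then 1 else v i) else (i == j)%:R).
have lt0 (i : 'I_n) : (i < i0)%N = false by [].
have d1 : \det N1 = 1.
  rewrite -det_tr det_trig.
    by rewrite big1 // => i _; rewrite !mxE eqxx andbN mul0r subr0.
  apply/is_trig_mxP => i j ij; rewrite !mxE.
  have -> : (j == i) = false by apply/negbTE; rewrite neq_ltn ij orbT.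
  case: eqP ij => [->|_ _]; first by rewrite lt0.
  by rewrite mul0r subr0.
have d2 : \det N2 = 1.
  rewrite det_trig.
    by rewrite big1 // => i _; rewrite !mxE; case: eqP => // _; rewrite eqxx.
  apply/is_trig_mxP => i j ij; rewrite !mxE.
  case: eqP ij => [->|_ ij]; first by rewrite lt0.
  by have -> : (i == j) = false by apply/negbTE; rewrite neq_ltn ij.
pose u := N1 *m N2.
have du : \det u = 1 by rewrite det_mulmx d1 d2 mulr1.
have uu : u \in unitmx by rewrite unitmxE du unitr1.
have uc i : u i i0 = v i.
  rewrite mxE (bigD1 i) //= !mxE eqxx.
  have [->|ii0] := eqVneq i i0.
    have rv' := rv; rewrite (bigD1 i0) //= r0 mul1r in rv'.
    rewrite eqxx /= mul0r subr0 mul1r -[RHS](addrK (\sum_(j | j != i0) r j * v j)) rv'; congr (_ + _).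
    rewrite -sumrN; apply: eq_bigr => j ji0; rewrite !mxE eqxx [i0 == j]eq_sym (negPf ji0) /=.
    by rewrite sub0r mul1r mulNr.
  rewrite /= mul0r subr0 mul1r big1 ?addr0 // => j ji.
  by rewrite !mxE eq_sym (negPf ji) (negPf ii0) /= mul0r subr0 mul0r.
have ru : (\row_j r j) *m u = delta_mx 0 i0.
  have rN1 : (\row_j r j) *m N1 = delta_mx 0 i0.
    apply/rowP => j; rewrite !mxE eqxx /= (bigD1 j) //= !mxE eqxx.
    have [->|ji0] := eqVneq j i0.
      rewrite andbF mul0r subr0 mulr1 r0 big1 ?addr0 // => i ii0.
      by rewrite !mxE (negPf ii0) /= mul0r subr0 mulr0.
    rewrite /= mul0r subr0 mulr1 (bigD1 i0) 1?eq_sym //= !mxE eqxx [i0 == j]eq_sym (negPf ji0).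
    rewrite r0 mul1r sub0r mul1r big1 ?addr0 ?subrr // => i /andP[ij ii0].
    by rewrite !mxE (negPf ij) (negPf ii0) mul0r subr0 mulr0.
  rewrite mulmxA rN1; apply/rowP => j; rewrite -rowE !mxE eqxx /=.
  by case: eqVneq.
have ri i : invmx u i0 i = r i.
  have := congr1 (mulmx^~ (invmx u)) ru; rewrite -mulmxA mulmxV // mulmx1 -rowE.
  by move=> /rowP/(_ i); rewrite !mxE.
pose f (z : sl C n) : C^o := alpha0 * (invmx u *m mx_of z *m u) i0 i0.
have flin : linear f.
  move=> c z z'; have -> : f (c *: z + z') = alpha0 * (invmx u *m (c *: mx_of z + mx_of z') *m u) i0 i0.
    by congr (_ * (_ *m _ *m _) _ _); exact: linearP.
  rewrite /f mulmxDr mulmxDl -scalemxAr -scalemxAl !mxE.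
  by rewrite mulrDr mulrCA.
pose fl : {linear sl C n -> C^o} := HB.pack f (GRing.isLinear.Build _ _ _ _ f flin).
have xE (z : sl C n) : linfun fl z = alpha0 * omega1 (to_sl (invmx u *m mx_of z *m u)).
  by rewrite lfunE /= /f omega1_to_sl // tr_conj // mxtrace_mx_of.
exists (linfun fl); first by exists u.
move=> M trM; rewrite (orbit_value uu xE trM).
apply: eq_bigr => i _; apply: eq_bigr => j _; rewrite ri uc /r /v.
by field; rewrite a0 b0.
Qed.

Definition fun_gen (l : label n) : FunO := restrict_orbit alpha0 'X_(enum_rank l).

Lemma fun_genE l x : fun_val (fun_gen l) x = val x (sl_basis C l).
Proof. by rewrite /= /pf_eval mevalXU /lin_coord enum_rankK. Qed.

Definition eval_at (x : orbit) (f : FunO) : regular_alg C := fun_val f x.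
Fact eval_at_zmod x : zmod_morphism (eval_at x). Proof. by []. Qed.
Fact eval_at_monoid x : monoid_morphism (eval_at x). Proof. by []. Qed.
HB.instance Definition _ x := GRing.isZmodMorphism.Build FunO (regular_alg C) (eval_at x) (eval_at_zmod x).
HB.instance Definition _ x := GRing.isMonoidMorphism.Build FunO (regular_alg C) (eval_at x) (eval_at_monoid x).

Lemma eval_at_scal x c : eval_at x (scal FunO c) = c.
Proof. by rewrite /eval_at /= /pf_eval mevalC. Qed.

Lemma funO_eq (f g : FunO) : (forall x, fun_val f x = fun_val g x) -> f = g.
Proof. by move=> fg; apply: val_inj; apply/funext. Qed.

Definition fun_ev : T -> FunO := free_ev fun_gen.

Lemma fun_ev_val F (x : orbit) b a : rank_one_point b a (val x) ->
  fun_val (fun_ev F) x = free_ev (label_val (fun i j => b i * a j) : label n -> regular_alg C) F.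
Proof.
move=> xE; apply: (eq_trans (free_ev_comp fun_gen (f := eval_at x) (eval_at_scal x) F)).
congr (free_ev _ _); apply/funext => l.
by apply: (eq_trans (fun_genE l x)); apply: rank_one_label.
Qed.

Lemma fun_ev_eq0 F : fun_ev F = 0 <-> vanishes_generically alpha0 F.
Proof.
split=> [F0 b a bp ap|F0].
  set s := \sum_m b m * a m.
  have s0 : s != 0.
    apply: lt0r_neq0; rewrite /s (bigD1 i0) //= ltr_pwDl ?mulr_gt0 //.
    by apply: sumr_ge0 => i _; rewrite mulr_ge0 ?ltW.
  have ba : \sum_i b i * (a i * (alpha0 / s)) = alpha0.
    by rewrite (eq_bigr _ (fun i _ => mulrA _ _ _)) -mulr_suml -/s mulrCA mulfV // mulr1.
  have [x Ox xE] := rank_one_orbit (lt0r_neq0 (bp i0)) ba.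
  have := fun_ev_val F (x := exist _ x (mem_set Ox)) xE; rewrite F0 => H.
  rewrite [LHS](_ : _ = free_ev (label_val (fun i j => b i * (a j * (alpha0 / s))) : label n -> regular_alg C) F).
    exact: esym H.
  congr (free_ev (label_val _) _).
  by apply/funext => i; apply/funext => j; rewrite -mulrA.
apply: funO_eq => x.
have [b [a [ba xE]]] := orbit_rank_one (set_mem (valP x)).
by rewrite (fun_ev_val F xE) (generic_vanish_point a0 n_gt1 F0 ba).
Qed.

Lemma fun_ev_surj (f : FunO) : exists F, fun_ev F = f.
Proof.
case: f => f fP; have /asboolP[G GE] := fP.
suff [F FE] : exists F, fun_ev F = restrict_orbit alpha0 G.
  exists F; rewrite FE; apply: funO_eq => x /=; by rewrite GE.
elim/mpolyind: G {f fP GE} => [|c m p _ _ [F FE]].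
  exists 0; rewrite /fun_ev free_ev0; apply: funO_eq => x.
  by rewrite /= /pf_eval meval0.
exists (scal T c * \prod_(i < #|label n|) (<< fmu (enum_val i) >> : T) ^+ m i + F).
apply: funO_eq => x; rewrite /= /pf_eval mevalD mevalZ mevalX.
have -> : fun_val (fun_ev (scal T c * \prod_(i < #|label n|) (<< fmu (enum_val i) >> : T) ^+ m i + F)) x =
  eval_at x (fun_ev (scal T c * \prod_(i < #|label n|) (<< fmu (enum_val i) >> : T) ^+ m i)) + eval_at x (fun_ev F).
  by rewrite /fun_ev free_evD.
congr (_ + _); last by rewrite FE.
rewrite /fun_ev (rmorphM (free_ev fun_gen)) (rmorphM (eval_at x)).
apply: congr2.
  by apply: (eq_trans (congr1 (eval_at x) (free_evC fun_gen c))); exact: eval_at_scal.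
rewrite (rmorph_prod (free_ev fun_gen)) (rmorph_prod (eval_at x)); apply: eq_bigr => i _.
rewrite (rmorphXn (free_ev fun_gen)) (rmorphXn (eval_at x)); congr (_ ^+ _).
by rewrite /= free_ev_gen /eval_at fun_genE.
Qed.

End OrbitPoints.

(** * Flatness *)

Section LinearSection.
Variables (k : fieldType) (K : choiceType) (rk : K -> nat) (A : zmodType).
Variable f : {malg k[K]} -> A.
Hypothesis rk_inj : injective rk.
Hypothesis fD : forall x y, f (x + y) = f x + f y.
Hypothesis fZ : forall c x, f x = 0 -> f (c *: x) = 0.
Notation T := {malg k[K]}.

Let f0 : f 0 = 0. Proof. by apply: (addrI (f 0)); rewrite -fD !addr0. Qed.
Let fN x : f (- x) = - f x.
Proof. by apply: (addrI (f x)); rewrite -fD !subrr f0. Qed.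
Let fB x y : f (x - y) = f x - f y. Proof. by rewrite fD fN. Qed.

Let below m (G : T) := forall w, w \in msupp G -> (rk w < m)%N.
(** Standard words, as for a Groebner basis: words whose image is not already the image of a
    combination of words of smaller rank. Their span is a complement of the kernel. *)
Let std w := ~ exists2 G, below (rk w) G & f G = f << w >>.
Let stdG (G : T) := forall w, w \in msupp G -> std w.

Let stdD G H : stdG G -> stdG H -> stdG (G + H).
Proof.
move=> sG sH w /(fsubsetP (msuppD_le G H)).
by rewrite in_fsetU => /orP[/sG|/sH].
Qed.
Let stdZ c G : stdG G -> stdG (c *: G).
Proof. by move=> sG w /(fsubsetP (msuppZ_le c G)) /sG. Qed.

(** The word of largest rank in a nonzero kernel element could be expressed by the others, all of
    smaller rank, and would not be standard. *)
Let std_ker G : stdG G -> f G = 0 -> G = 0.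
Proof.
move=> sG G0; apply: contrapT => /eqP G_neq0.
have /fset0Pn[w0 w0G] : msupp G != fset0.
  apply/eqP => G0'; case/eqP: G_neq0; apply/malgP => v.
  by rewrite mcoeff0 mcoeff_outdom // G0'.
pose P m := [exists w : msupp G, rk (val w) == m].
have exP : exists m, P m by exists (rk w0); apply/existsP; exists [` w0G]%fset.
have ubP m : P m -> (m <= \max_(w : msupp G) rk (val w))%N.
  by move=> /existsP[w /eqP <-]; apply: leq_bigmax.
case: (ex_maxnP exP ubP) => m /existsP[[w wG] /= /eqP wm] mP.
have cw : mcoeff w G != 0 by rewrite mcoeff_neq0.
apply: (sG w wG); exists (<< w >> - (mcoeff w G)^-1 *: G); last first.
  by rewrite fB fZ // subr0.
move=> v; rewrite -mcoeff_neq0 mcoeffB mcoeffZ mcoeffU.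
have [<-|wv] := eqVneq w v; first by rewrite mulVf // subrr eqxx.
rewrite sub0r oppr_eq0 mulf_eq0 invr_eq0 (negPf cw) /= mcoeff_neq0 => vG.
rewrite ltn_neqAle wm mP ?andbT; last by apply/existsP; exists [` vG]%fset.
by rewrite -wm; apply: contra_neq wv => /rk_inj ->.
Qed.

Let std_ex G : exists2 H, stdG H & f H = f G.
Proof.
have [m] : exists m, below m G.
  exists (\max_(w : msupp G) rk (val w)).+1 => w wG.
  exact: (leq_bigmax (F := fun w : msupp G => rk (val w)) [` wG]%fset).
elim/ltn_ind: m G => m IH G Gm.
rewrite [G]monalgE big_seq.
elim/big_ind: _ => [|x y [X sX EX] [Y sY EY]|w wG].
- by exists 0 => // w; rewrite msupp0.
- by exists (X + Y); [apply: stdD | rewrite !fD EX EY].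
suff [H sH HE] : exists2 H, stdG H & f H = f << w >>.
  exists (mcoeff w G *: H); first exact: stdZ.
  apply/eqP; rewrite -subr_eq0 -fB; apply/eqP.
  have -> : << mcoeff w G *g w >> = mcoeff w G *: << w >>
    by apply/malgP => v; rewrite mcoeffZ !mcoeffU mulrnAr mulr1.
  by rewrite -scalerBr fZ // fB HE subrr.
have [sw|/contrapT[H Hw HE]] := pselect (std w).
  by exists << w >> => // v; rewrite msuppU oner_eq0 in_fset1 => /eqP ->.
by have [H' sH' H'E] := IH _ (Gm w wG) H Hw; exists H'; rewrite // H'E.
Qed.

Lemma linear_section : (forall a, exists x, f x = a) ->
  exists s : A -> T, [/\ cancel s f, {morph s : a b / a + b} &
    forall c x, s (f (c *: x)) = c *: s (f x)].
Proof.
move=> surj.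
have ex a : exists G, stdG G /\ f G = a.
  by have [x <-] := surj a; have [H sH HE] := std_ex x; exists H.
have [s /all_and2[ss sK]] := choice ex.
have uniq G H : stdG G -> stdG H -> f G = f H -> G = H.
  move=> sG sH E; apply/eqP; rewrite -subr_eq0; apply/eqP; apply: std_ker.
    by apply: stdD => //; rewrite -scaleN1r; apply: stdZ.
  by rewrite fB E subrr.
exists s; split=> // [a b|c x].
  by apply: uniq => //; [apply: stdD | rewrite fD !sK].
apply: uniq => //; first exact: stdZ.
rewrite sK; apply/eqP; rewrite -subr_eq0 -fB -scalerBr; apply/eqP.
by apply: fZ; rewrite fB sK subrr.
Qed.

End LinearSection.

Section TwoVariableSeries.
Variables (k : comNzRingType) (A : alg k).
Notation A2 := (fps_alg (fps_alg A)).

Definition mon2 i j : fps (fps k) := hbar k ^+ i * nu k ^+ j.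

Lemma fcoef_hbarM (z : A2) i : fcoef (scal A2 (hbar k) * z) i = if i is i'.+1 then fcoef z i' else 0.
Proof.
have h0 : fcoef (scal A2 (hbar k)) 0 = 0 by apply: (rmorph0 (scal (fps_alg A))).
have h1 : fcoef (scal A2 (hbar k)) 1 = 1 by apply: (rmorph1 (scal (fps_alg A))).
have hS m : fcoef (scal A2 (hbar k)) m.+2 = 0 by apply: (rmorph0 (scal (fps_alg A))).
rewrite fcoefM big_ord_recl h0 mul0r add0r; case: i => [|i]; first by rewrite big_ord0.
rewrite big_ord_recl h1 mul1r subSS subn0 big1 ?addr0 // => m _.
by rewrite lift0 hS mul0r.
Qed.

Lemma fcoef_nuM (z : A2) i j : fcoef (fcoef (scal A2 (nu k) * z) i) j =
  if j is j'.+1 then fcoef (fcoef z i) j' else 0.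
Proof.
have n0 : fcoef (scal A2 (nu k)) 0 = scal (fps_alg A) fpsX by [].
have nS m : fcoef (scal A2 (nu k)) m.+1 = 0 by apply: (rmorph0 (scal (fps_alg A))).
rewrite fcoefM big_ord_recl n0 subn0 big1 ?addr0 => [|m _]; last by rewrite lift0 nS mul0r.
have x0 : fcoef (scal (fps_alg A) fpsX) 0 = 0 by apply: (rmorph0 (scal A)).
have x1 : fcoef (scal (fps_alg A) fpsX) 1 = 1 by apply: (rmorph1 (scal A)).
have xS m : fcoef (scal (fps_alg A) fpsX) m.+2 = 0 by apply: (rmorph0 (scal A)).
rewrite fcoefM big_ord_recl x0 mul0r add0r; case: j => [|j]; first by rewrite big_ord0.
rewrite big_ord_recl x1 mul1r subSS subn0 big1 ?addr0 // => m _.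
by rewrite !lift0 xS mul0r.
Qed.

Lemma fcoef_mon2M (z : A2) i j a b : fcoef (fcoef (scal A2 (mon2 i j) * z) a) b =
  if (i <= a)%N && (j <= b)%N then fcoef (fcoef z (a - i)) (b - j) else 0.
Proof.
rewrite /mon2 (rmorphM (scal A2)) (rmorphXn (scal A2)) (rmorphXn (scal A2)) -mulrA.
elim: i a => [|i IH] a; last first.
  by rewrite exprS -mulrA fcoef_hbarM; case: a => [|a] //; rewrite IH.
rewrite expr0 mul1r subn0 [(0 <= a)%N]leq0n andTb; elim: j b => [|j IH] b.
  by rewrite expr0 mul1r subn0.
by rewrite exprS -mulrA fcoef_nuM; case: b => [|b] //; rewrite IH.
Qed.

Lemma fps2_split (z : A2) : fcoef (fcoef z 0) 0 = 0 ->
  exists x y : A2, z = scal A2 (hbar k) * x + scal A2 (nu k) * y.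
Proof.
move=> z0; exists (FPS (fun i => fcoef z i.+1)), (fpsC (FPS (fun j => fcoef (fcoef z 0) j.+1))).
apply: fpsP => i; apply: fpsP => j.
rewrite !fcoefD fcoef_hbarM fcoef_nuM; case: i => [|i]; case: j => [|j] /=.
- by rewrite z0 addr0.
- by rewrite add0r.
- by rewrite addr0.
- by rewrite addr0.
Qed.

Lemma fcoef2M00 (x y : A2) : fcoef (fcoef (x * y) 0) 0 = fcoef (fcoef x 0) 0 * fcoef (fcoef y 0) 0.
Proof. by rewrite !fcoefM0. Qed.

End TwoVariableSeries.

(** * Flatness of the quotient by a closed ideal, from its leading coefficients *)

Section FlatQuotient.
Variables (k : fieldType) (T A : alg k) (f : {rmorphism T -> A}) (s : A -> T).
Hypothesis f_scal : forall c, f (scal T c) = scal A c.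
Hypothesis sK : cancel s f.
Hypothesis sD : {morph s : a b / a + b}.
Hypothesis sZ : forall c a, s (scal A c * a) = scal T c * s a.
Notation T2 := (fps_alg (fps_alg T)).
Notation A2 := (fps_alg (fps_alg A)).
Variable J : ideal T2.
Hypothesis J_closed : forall z : T2,
  (forall N, exists2 y : T2, J y & forall i j, (i + j < N)%N -> fcoef (fcoef (z - y) i) j = 0) -> J z.
Hypothesis J_lead : forall (z : T2) i j, J z ->
  (forall a, (a < i)%N -> fcoef z a = 0) -> (forall b, (b < j)%N -> fcoef (fcoef z i) b = 0) ->
  f (fcoef (fcoef z i) j) = 0.
Hypothesis J_ker : forall F, f F = 0 -> exists2 z : T2, J z & fcoef (fcoef z 0) 0 = F.
Notation B := (quot_alg J).
Notation cls := (quot_pr J).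

Let JD := idealD (idealP J).
Let J0 := ideal0 (idealP J).
Let JMl := idealMl (idealP J).

Let J_sum (I : Type) (r : seq I) (P : pred I) (F : I -> T2) :
  (forall i, J (F i)) -> J (\sum_(i <- r | P i) F i).
Proof. by move=> JF; elim/big_ind: _ => //; apply: JD. Qed.

Let clsP (x y : T2) : cls x = cls y <-> J (x - y). Proof. exact: to_quotP. Qed.

Definition quot_special (b : B) : A := f (fcoef (fcoef (repr b : T2) 0) 0).

Lemma quot_specialE (z : T2) : quot_special (cls z) = f (fcoef (fcoef z 0) 0).
Proof.
apply/eqP; rewrite -subr_eq0 -(raddfB f); apply/eqP.
have Jz : J (repr (cls z : B) - z) by apply/clsP; exact: to_quot_repr.
exact: (J_lead (i := 0) (j := 0) Jz).
Qed.

Let cls_ex (b : B) : exists z, b = cls z.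
Proof. by exists (repr b); rewrite -[LHS]to_quot_repr. Qed.

Fact quot_special_zmod : zmod_morphism quot_special.
Proof.
move=> x y; have [x' ->] := cls_ex x; have [y' ->] := cls_ex y.
rewrite -(raddfB cls) !quot_specialE !fcoefD !fcoefN; exact: (raddfB f).
Qed.
Fact quot_special_monoid : monoid_morphism quot_special.
Proof.
split=> [|x y].
  by rewrite -(rmorph1 cls) quot_specialE; apply: (rmorph1 f).
have [x' ->] := cls_ex x; have [y' ->] := cls_ex y.
by rewrite -(rmorphM cls) !quot_specialE fcoef2M00; apply: (rmorphM f).
Qed.
HB.instance Definition _ := GRing.isZmodMorphism.Build B A quot_special quot_special_zmod.
HB.instance Definition _ := GRing.isMonoidMorphism.Build B A quot_special quot_special_monoid.

Definition lift2 (g : A2) : T2 := FPS (fun i => FPS (fun j => s (fcoef (fcoef g i) j))).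

Let s0 : s 0 = 0. Proof. by apply: (addrI (s 0)); rewrite -sD !addr0. Qed.
Let s_sum (I : Type) (r : seq I) (P : pred I) (F : I -> A) :
  s (\sum_(i <- r | P i) F i) = \sum_(i <- r | P i) s (F i).
Proof. by apply: (big_morph s sD s0). Qed.

Lemma lift2D g g' : lift2 (g + g') = lift2 g + lift2 g'.
Proof. by apply: fpsP => i; apply: fpsP => j; rewrite /= sD. Qed.

Lemma lift2Z c g : lift2 (scal A2 c * g) = scal T2 c * lift2 g.
Proof.
apply: fpsP => i; apply: fpsP => j; rewrite [LHS]/= !fcoef_sum s_sum.
apply: eq_bigr => a _; rewrite !fcoefM s_sum.
by apply: eq_bigr => b _; rewrite -sZ.
Qed.

(** If g were nonzero, its lexicographically first coefficient would be the image under f of the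
    leading coefficient of an element of J, hence 0. *)
Lemma lift2_inj g : J (lift2 g) -> g = 0.
Proof.
move=> Jg; apply: contrapT => /fcoef_neq0[i /fcoef_neq0[j gij gj] gi].
apply: gij; rewrite -[LHS]sK.
apply: (J_lead (i := i) (j := j) Jg) => [a /gi|b /gj] /= ->.
  by apply: fpsP => b /=.
exact: s0.
Qed.

(** Successive approximation by total degree: a coefficient F of the remainder is replaced with
    [s (f F)], and the difference F - s (f F) is the constant coefficient of an element of J. The
    limit is reached because J is closed. *)
Lemma lift2_surj (z : T2) : exists g, J (z - lift2 g).
Proof.
have ker F : exists d : T2, J d /\ fcoef (fcoef d 0) 0 = F - s (f F).
  have [|d Jd dE] := J_ker (F := F - s (f F)); first last.
    by exists d.
  by apply: (eq_trans (raddfB f F (s (f F)))); apply/eqP; rewrite subr_eq0; apply/eqP; symmetry; exact: sK.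
have [d /all_and2[Jd dE]] := choice ker.
pose coef (z : T2) i j := fcoef (fcoef z i) j.
pose corr F : T2 := fpsC (fpsC (s (f F))) + d F.
have corrE F : coef (corr F) 0 0 = F.
  by rewrite /coef /corr !fcoefD dE /= !mulr1n addrC subrK.
(* Clears all coefficients of total degree N, one monomial h^i nu^(N-i) at a time; the coefficients
   of lower degree are not touched. *)
pose step N (x : T2) : T2 := x - \sum_(i < N.+1) scal T2 (mon2 k i (N - i)%N) * corr (coef x i (N - i)%N).
pose fix res N : T2 := if N is M.+1 then step M (res M) else z.
have coef_sum (I : Type) (r : seq I) (P : pred I) (F : I -> T2) a b :
    coef (\sum_(i <- r | P i) F i) a b = \sum_(i <- r | P i) coef (F i) a b.
  by rewrite /coef !fcoef_sum.
have coefB x y a b : coef (x - y) a b = coef x a b - coef y a b by [].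
have diag (F : nat -> nat -> T2) N a b : (a + b <= N)%N ->
    coef (\sum_(i < N.+1) scal T2 (mon2 k i (N - i)%N) * F i (N - i)%N) a b =
    if a + b == N then coef (F a b) 0 0 else 0.
  move=> abN; rewrite coef_sum; have [abE|abN'] := eqVneq (a + b)%N N.
    have aN : (a < N.+1)%N by rewrite ltnS -abE leq_addr.
    rewrite (bigD1 (Ordinal aN)) //= big1 ?addr0 => [|i ia].
      have -> : (N - a)%N = b by rewrite -abE addKn.
      by rewrite /coef fcoef_mon2M !leqnn !subnn.
    rewrite /coef fcoef_mon2M; case: ifP => // /andP[ia' ib].
    by case/eqP: ia; apply: val_inj => /=; move: (ltn_ord i) ia' ib; lia.
  rewrite big1 // => i _; rewrite /coef fcoef_mon2M; case: ifP => // /andP[ia' ib].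
  by case/eqP: abN'; move: (ltn_ord i) ia' ib abN; lia.
have res_adic N a b : (a + b < N)%N -> coef (res N) a b = 0.
  elim: N a b => [|N IH] a b //; rewrite ltnS => abN.
  rewrite -[LHS]/(coef (step N (res N)) a b) /step coefB.
  apply: (eq_trans (congr1 (fun u => coef (res N) a b - u) (diag (fun i j => corr (coef (res N) i j)) N a b abN))).
  have [abE|abN'] := eqVneq (a + b)%N N; first by rewrite corrE subrr.
  by rewrite IH ?subr0 // ltn_neqAle abN'.
pose g : A2 := FPS (fun i => FPS (fun j => f (coef (res (i + j)) i j))).
exists g; apply: J_closed => N.
(* The part in J of the first N corrections. The other part, [e], agrees with [lift2 g] in all
   degrees below N. *)
pose y := \sum_(M < N) \sum_(i < M.+1) scal T2 (mon2 k i (M - i)%N) * d (coef (res M) i (M - i)%N).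
exists y.
  by apply: J_sum => M; apply: J_sum => i; apply: JMl; apply: Jd.
move=> a b abN; rewrite -/(coef _ a b).
pose e := \sum_(M < N) \sum_(i < M.+1) scal T2 (mon2 k i (M - i)%N) * fpsC (fpsC (s (f (coef (res M) i (M - i)%N)))).
pose U M : T2 := \sum_(i < M.+1) scal T2 (mon2 k i (M - i)%N) * corr (coef (res M) i (M - i)%N).
have tel M : z = res M + \sum_(i < M) U i.
  elim: M => [|M IH]; first by rewrite big_ord0 addr0.
  rewrite {1}IH big_ord_recr /= -[X in _ = X + _]/(res M - U M).
  by move: (res M) (U M) (\sum_(i < M) _) => r u S; rewrite addrACA addNr addr0.
have resE : z = res N + (e + y).
  rewrite {1}(tel N) /e /y -big_split /=; congr (_ + _); apply: eq_bigr => M _.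
  by rewrite -big_split /=; apply: eq_bigr => i _; rewrite -mulrDr.
rewrite {1}resE.
have -> : res N + (e + y) - lift2 g - y = res N + (e - lift2 g).
  by rewrite addrA -!addrA [y + _]addrCA subrr addr0 addrA.
rewrite [LHS](_ : _ = coef (res N) a b + (coef e a b - coef (lift2 g) a b)) // res_adic // add0r.
rewrite coef_sum (bigD1 (Ordinal abN)) //= [X in _ + X - _]big1 ?addr0 => [|M Mab].
  have E := diag (fun i j => fpsC (fpsC (s (f (coef (res (a + b)) i j))))) (a + b)%N a b (leqnn _).
  apply: (eq_trans (congr1 (fun u => u - coef (lift2 g) a b) E)); rewrite eqxx.
  by rewrite /coef /= !mulr1n subrr.
rewrite coef_sum big1 // => i _; rewrite /coef fcoef_mon2M; case: ifP => // /andP[ia ib].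
case ai: (a - i)%N => [|m]; last by rewrite fcoef_fpsCS.
rewrite fcoef_fpsC0; case bi: (b - (M - i))%N => [|m]; last by rewrite fcoef_fpsCS.
case/eqP: Mab; apply: val_inj => /=; move: (ltn_ord i) ai bi ia ib; lia.
Qed.

Lemma quot_flat : flat_deformation2 (quot_special : {rmorphism B -> A}).
Proof.
set p : {rmorphism B -> A} := quot_special.
have pE z : p (cls z) = f (fcoef (fcoef z 0) 0) := quot_specialE z.
have surj a : exists b, p b = a.
  exists (cls (fpsC (fpsC (s a)))); rewrite pE /= !mulr1n; exact: sK.
split=> // [c|b|].
- have -> : scal B c = cls (scal T2 c) by [].
  by apply: (eq_trans (quot_specialE _)); apply: f_scal.
- have [z ->] := cls_ex b; rewrite pE; split=> [z0|[x [y E]]].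
    have [w Jw wE] := J_ker z0.
    have [|x [y E]] := @fps2_split _ _ (z - w); first by rewrite !fcoefD !fcoefN wE subrr.
    exists (cls x), (cls y).
    rewrite [LHS](_ : _ = cls (z - w)); last first.
      by apply/clsP; rewrite subKr.
    by rewrite E; apply: (eq_trans (raddfD cls _ _)); congr (_ + _); apply: (rmorphM cls).
  have [x' xE] := cls_ex x; have [y' yE] := cls_ex y.
  have {}E : cls z = cls (scal T2 (hbar k) * x' + scal T2 (nu k) * y').
    rewrite E xE yE; apply: (eq_trans _ (esym (raddfD cls _ _))); congr (_ + _); symmetry; apply: (rmorphM cls).
  have := pE z; rewrite E pE => <-.
  by rewrite !fcoefD fcoef_hbarM fcoef_nuM addr0; apply: (raddf0 f).
- have ex b : exists g, cls (lift2 g) = b.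
    have [z ->] := cls_ex b; have [g Jg] := lift2_surj z; exists g.
    by symmetry; apply/clsP.
  have [phi phiE] := choice ex.
  have inj g g' : cls (lift2 g) = cls (lift2 g') -> g = g'.
    move=> /clsP E; apply/eqP; rewrite -subr_eq0; apply/eqP/lift2_inj.
    suff -> : lift2 (g - g') = lift2 g - lift2 g' by [].
    by apply: (addIr (lift2 g')); rewrite -lift2D !subrK.
  exists phi; split=> [|x y|c x].
  + by exists (fun g => cls (lift2 g)) => [b|g] //; apply: inj; rewrite phiE.
  + by apply: inj; apply: (eq_trans (phiE _)); rewrite lift2D; apply: (eq_trans _ (esym (raddfD cls _ _))); congr (_ + _); symmetry; exact: phiE.
  + by apply: inj; apply: (eq_trans (phiE _)); rewrite lift2Z; apply: (eq_trans _ (esym (rmorphM cls _ _))); congr (_ * _); symmetry; exact: phiE.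
Qed.

Lemma quot_flat_exists : exists p : {rmorphism B -> A},
  (forall z : T2, p (cls z) = f (fcoef (fcoef z 0) 0)) /\ flat_deformation2 p.
Proof.
by exists (quot_special : {rmorphism B -> A}); split; [exact: quot_specialE | exact: quot_flat].
Qed.

End FlatQuotient.

Section ModuloHbar.
Variables (k : comNzRingType) (A : alg k) (B : alg (fps (fps k))) (p : {rmorphism B -> A}).
Hypothesis flat : flat_deformation2 p.
Notation I := (scal_ideal B (hbar k)).
Notation Bq := (restrict_scalars (@fpsC (fps k)) (quot_alg I)).
Notation cls := (quot_pr I : {rmorphism B -> Bq}).

Let clsP (x y : B) : cls x = cls y <-> exists z, x - y = scal B (hbar k) * z.
Proof. exact: to_quotP. Qed.
Let cls_ex (b : Bq) : exists z, b = cls z.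
Proof. by exists (repr b); rewrite -[LHS]to_quot_repr. Qed.

Let p_hbar z : p (scal B (hbar k) * z) = 0.
Proof.
by apply/(flat2_ker flat); exists z, 0; rewrite mulr0 addr0.
Qed.

Definition mod_hbar (b : Bq) : A := p (repr b).

Lemma mod_hbarE z : mod_hbar (cls z) = p z.
Proof.
apply/eqP; rewrite -subr_eq0 -(raddfB p).
have /clsP[w ->] : cls (repr (cls z)) = cls z by exact: to_quot_repr.
by apply/eqP; exact: p_hbar.
Qed.

Fact mod_hbar_zmod : zmod_morphism mod_hbar.
Proof.
move=> x y; have [x' ->] := cls_ex x; have [y' ->] := cls_ex y.
by rewrite -(raddfB cls) !mod_hbarE (raddfB p).
Qed.
Fact mod_hbar_monoid : monoid_morphism mod_hbar.
Proof.
split=> [|x y]; first by rewrite -(rmorph1 cls) mod_hbarE (rmorph1 p).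
have [x' ->] := cls_ex x; have [y' ->] := cls_ex y.
by rewrite -(rmorphM cls) !mod_hbarE (rmorphM p).
Qed.
HB.instance Definition _ := GRing.isZmodMorphism.Build Bq A mod_hbar mod_hbar_zmod.
HB.instance Definition _ := GRing.isMonoidMorphism.Build Bq A mod_hbar mod_hbar_monoid.

(** The isomorphism is the coefficient of h^0 of the two-parameter one. It does not depend on
    representatives, since [phi] is linear over h and multiples of h have coefficient 0 there. *)
Lemma mod_hbar_flat : flat_deformation (mod_hbar : {rmorphism Bq -> A}).
Proof.
set p' : {rmorphism Bq -> A} := mod_hbar.
have pE z : p' (cls z) = p z := mod_hbarE z.
have [phi [[psi phiK psiK] phiD phiZ]] := flat2_free flat.
have clsZ c z : scal Bq c * cls z = cls (scal B (fpsC c) * z).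
  by rewrite (rmorphM cls).
split=> [c|a|b|].
- have -> : scal Bq c = cls (scal B (fpsC c)) by [].
  apply: (eq_trans (mod_hbarE _)); apply: (eq_trans (flat2_scal flat _)).
  by rewrite fcoef_fpsC0.
- by have [b <-] := flat2_surj flat a; exists (cls b); rewrite pE.
- have [z ->] := cls_ex b; rewrite pE; split=> [/(flat2_ker flat)[x [y ->]]|[x]].
    exists (cls y); rewrite clsZ; apply/clsP; exists x.
    by rewrite addrK.
  have [y ->] := cls_ex x; rewrite clsZ => /clsP[w E].
  apply/(flat2_ker flat); exists w, y; by rewrite -E subrK.
- have phiB x y : phi (x - y) = phi x - phi y.
    by apply: (addIr (phi y)); rewrite -phiD !subrK.
  have phi_h x : fcoef (phi (scal B (hbar k) * x)) 0 = 0 by rewrite phiZ fcoef_hbarM.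
  have qE z : fcoef (phi (repr (cls z))) 0 = fcoef (phi z) 0.
    apply/eqP; rewrite -subr_eq0 -fcoefN -fcoefD -phiB.
    have /clsP[w ->] : cls (repr (cls z)) = cls z by exact: to_quot_repr.
    by rewrite phi_h.
  exists (fun b : Bq => fcoef (phi (repr b)) 0); split=> [|x y|c x].
  + exists (fun g => cls (psi (fpsC g))) => [b|g]; last first.
      by rewrite qE psiK fcoef_fpsC0.
    have [z ->] := cls_ex b; rewrite qE; apply/clsP.
    exists (psi (FPS (fun i => - fcoef (phi z) i.+1))).
    apply: (can_inj phiK); rewrite phiB phiZ !psiK; apply: fpsP => i.
    rewrite fcoef_hbarM; case: i => [|i]; first by rewrite fcoefD fcoefN fcoef_fpsC0 subrr.
    by rewrite fcoefD fcoefN fcoef_fpsCS sub0r.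
  + have [x' ->] := cls_ex x; have [y' ->] := cls_ex y.
    by rewrite -(raddfD cls) !qE phiD.
  + by have [x' ->] := cls_ex x; rewrite clsZ !qE phiZ fcoefM0.
Qed.

Lemma mod_hbar_flat_exists : exists2 pq : {rmorphism Bq -> A},
  forall a, pq (cls a) = p a & flat_deformation pq.
Proof.
by exists (mod_hbar : {rmorphism Bq -> A}); [exact: mod_hbarE | exact: mod_hbar_flat].
Qed.

End ModuloHbar.

(** * First-order brackets *)

Lemma add3_transpose (V : nmodType) (X Y Z X' Y' Z' X'' Y'' Z'' : V) :
  X + Y + Z + (X' + Y' + Z') + (X'' + Y'' + Z'') = X + X' + X'' + (Y + Y' + Y'') + (Z + Z' + Z'').
Proof.
by rewrite (addrACA (X + Y)) (addrACA X) (addrACA (X + X' + _)) (addrACA (X + X')).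
Qed.

Section Commutator.
Variables (k : comPzRingType) (Q : alg k).
Implicit Types x y z : Q.

Lemma scal_mulCA c d x : scal Q c * (scal Q d * x) = scal Q d * (scal Q c * x).
Proof. by rewrite mulrA scalC -mulrA (scalC c x). Qed.

Definition cm x y := x * y - y * x.

Lemma cm_anti x y : cm x y = - cm y x. Proof. by rewrite /cm opprB. Qed.
Lemma cmDr x y z : cm x (y + z) = cm x y + cm x z.
Proof. by rewrite /cm mulrDr mulrDl opprD addrACA. Qed.
Lemma cmZr c x y : cm x (scal Q c * y) = scal Q c * cm x y.
Proof. by rewrite /cm mulrBr !mulrA -(scalC c x). Qed.
Lemma cmMr x y z : cm x (y * z) = cm x y * z + y * cm x z.
Proof. by rewrite /cm mulrBl mulrBr !mulrA addrA subrK. Qed.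
Lemma cmNr x y : cm x (- y) = - cm x y.
Proof. by rewrite /cm mulrN mulNr opprB opprK addrC. Qed.
Lemma cmNl x y : cm (- x) y = - cm x y.
Proof. by rewrite cm_anti cmNr cm_anti !opprK. Qed.
Lemma cmDl x y z : cm (x + y) z = cm x z + cm y z.
Proof. by rewrite cm_anti cmDr opprD -!cm_anti. Qed.
Lemma cmZl c x y : cm (scal Q c * x) y = scal Q c * cm x y.
Proof. by rewrite cm_anti cmZr [cm y x]cm_anti mulrN opprK. Qed.

Lemma cm_jacobi x y z : cm x (cm y z) + cm y (cm z x) + cm z (cm x y) = 0.
Proof.
have -> : cm x (cm y z) = cm (cm x y) z + cm y (cm x z).
  have -> : cm x (cm y z) = cm x (y * z) - cm x (z * y) by rewrite -cmNr -cmDr.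
  rewrite !cmMr; move: (cm x y) (cm x z) => a b; rewrite /cm.
  by rewrite opprD [- _ - _]addrC addrACA.
rewrite (cm_anti z x) cmNr (cm_anti z (cm x y)).
by rewrite addrK subrr.
Qed.

End Commutator.

Lemma order2_coef (k : comNzRingType) (A : alg k) (X Y Z : fps_alg (fps_alg A)) :
  let h := scal (fps_alg (fps_alg A)) (hbar k) in let v := scal (fps_alg (fps_alg A)) (nu k) in
  let E := h * (h * X) + h * (v * Y) + v * (v * Z) in
  [/\ fcoef (fcoef E 2) 0 = fcoef (fcoef X 0) 0, fcoef (fcoef E 1) 1 = fcoef (fcoef Y 0) 0 &
      fcoef (fcoef E 0) 2 = fcoef (fcoef Z 0) 0].
Proof.
move=> h v E.
have EE i j : fcoef (fcoef E i) j = fcoef (fcoef (h * (h * X)) i) j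
  + fcoef (fcoef (h * (v * Y)) i) j + fcoef (fcoef (v * (v * Z)) i) j by [].
have hM U i j : fcoef (fcoef (h * U) i) j = if i is i'.+1 then fcoef (fcoef U i') j else 0.
  by rewrite fcoef_hbarM; case: i.
have vM U i j : fcoef (fcoef (v * U) i) j = if j is j'.+1 then fcoef (fcoef U i) j' else 0.
  exact: fcoef_nuM.
rewrite !{}EE {E}; clearbody h v; split; rewrite (hM (h * X)) (hM (v * Y)) (vM (v * Z)).
- by rewrite hM vM !addr0.
- by rewrite hM !vM add0r addr0.
- by rewrite vM !add0r.
Qed.

Section FirstOrderBrackets.
Variables (k : comNzRingType) (A : alg k) (B : alg (fps (fps k))) (p : {rmorphism B -> A}).
Hypothesis flat : flat_deformation2 p.
Hypothesis mulAC : forall a b : A, a * b = b * a.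
Notation h := (scal B (hbar k)).
Notation v := (scal B (nu k)).

Let pM (x y : B) : p (x * y) = p x * p y := rmorphM p x y.
Let pD (x y : B) : p (x + y) = p x + p y := raddfD p x y.
Let pB (x y : B) : p (x - y) = p x - p y := raddfB p x y.
Let pc x y : p (cm x y) = 0. Proof. by rewrite /cm pB !pM mulAC subrr. Qed.

(** Freeness allows comparing coefficients: h and nu are independent modulo (h, nu)^2, and
    [flat_order2] says the same for the three monomials of degree two. *)
Lemma flat_order1 x y : h * x + v * y = 0 -> p x = 0 /\ p y = 0.
Proof.
have [phi [[psi phiK psiK] phiD phiZ]] := flat2_free flat.
have phi00 b : fcoef (fcoef (phi b) 0) 0 = 0 -> p b = 0.
  move=> /fps2_split[X [Y E]]; apply/(flat2_ker flat); exists (psi X), (psi Y).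
  by apply: (can_inj phiK); rewrite phiD !phiZ !psiK.
have phi0 : phi 0 = 0 by apply: (addrI (phi 0)); rewrite -phiD !addr0.
move=> E; have {}E : scal _ (hbar k) * phi x + scal _ (nu k) * phi y = 0.
  by rewrite -!phiZ -phiD E.
split; apply: phi00.
  have := congr1 (fun z => fcoef (fcoef z 1) 0) E.
  by rewrite !fcoefD fcoef_hbarM fcoef_nuM addr0.
have := congr1 (fun z => fcoef (fcoef z 0) 1) E.
by rewrite !fcoefD fcoef_hbarM fcoef_nuM add0r.
Qed.

Lemma flat_order2 x y z : h * (h * x) + h * (v * y) + v * (v * z) = 0 ->
  [/\ p x = 0, p y = 0 & p z = 0].
Proof.
have [phi [[psi phiK psiK] phiD phiZ]] := flat2_free flat.
have phi00 b : fcoef (fcoef (phi b) 0) 0 = 0 -> p b = 0.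
  move=> /fps2_split[X [Y E]]; apply/(flat2_ker flat); exists (psi X), (psi Y).
  by apply: (can_inj phiK); rewrite phiD !phiZ !psiK.
have phi0 : phi 0 = 0 by apply: (addrI (phi 0)); rewrite -phiD !addr0.
move=> E; have {}E : scal _ (hbar k) * (scal _ (hbar k) * phi x)
  + scal _ (hbar k) * (scal _ (nu k) * phi y) + scal _ (nu k) * (scal _ (nu k) * phi z) = 0.
  by rewrite -!phiZ -!phiD E.
have [cx cy cz] := order2_coef (phi x) (phi y) (phi z).
by split; apply: phi00; rewrite -?cx -?cy -?cz E.
Qed.

Let brk x y u w := cm x y = h * u + v * w.

Let brk_ex x y : exists u w, brk x y u w.
Proof. by have /(flat2_ker flat) := pc x y. Qed.

(** Changing x or y by an element of (h, nu) changes u and w by commutators, which are 0 in the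
    commutative algebra A. So the first-order terms depend only on the images of x and y. *)
Let brk_uniq x y u w x' y' u' w' : brk x y u w -> brk x' y' u' w' -> p x = p x' -> p y = p y' ->
  p u = p u' /\ p w = p w'.
Proof.
move=> E E' xx yy.
have /(flat2_ker flat)[a [b ab]] : p (x - x') = 0 by rewrite pB xx subrr.
have /(flat2_ker flat)[c [d cd]] : p (y - y') = 0 by rewrite pB yy subrr.
have F : cm x y - cm x' y' = h * (cm a y + cm x' c) + v * (cm b y + cm x' d).
  have -> : cm x y - cm x' y' = cm (x - x') y + cm x' (y - y').
    by rewrite cmDl cmDr cmNl cmNr addrA subrK.
  by rewrite ab cd cmDl cmDr !cmZl !cmZr !mulrDr addrACA.
have [] := @flat_order1 (u - u' - (cm a y + cm x' c)) (w - w' - (cm b y + cm x' d)).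
  move: F; rewrite E E'; move: (cm a y + _) (cm b y + _) => s t F.
  rewrite 4!mulrBr addrACA -opprD -F; apply/eqP; rewrite subr_eq0; apply/eqP.
  by rewrite opprD addrACA.
have : p (cm a y + cm x' c) = 0 by rewrite pD !pc addr0.
have : p (cm b y + cm x' d) = 0 by rewrite pD !pc addr0.
move: (cm a y + _) (cm b y + _) => s t ps pt.
by rewrite !pB ps pt !subr0 => /eqP; rewrite subr_eq0 => /eqP-> /eqP; rewrite subr_eq0 => /eqP->.
Qed.

Lemma first_order_exists : exists P1 P2, first_order_brackets p P1 P2.
Proof.
have [t tK] := choice (flat2_surj flat).
have [U UE] := choice (fun xy : A * A => brk_ex (t xy.1) (t xy.2)).
have [W WE] := choice UE.
exists (fun f g => p (U (f, g))), (fun f g => p (W (f, g))) => x y.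
have [u [w E]] := brk_ex x y; exists u, w; split=> //.
  by have [] := brk_uniq E (WE (p x, p y)) (esym (tK _)) (esym (tK _)).
by have [] := brk_uniq E (WE (p x, p y)) (esym (tK _)) (esym (tK _)).
Qed.

Variables P1 P2 : A -> A -> A.
Hypothesis fob : first_order_brackets p P1 P2.

Lemma first_order_val x y u w : x * y - y * x = h * u + v * w ->
  P1 (p x) (p y) = p u /\ P2 (p x) (p y) = p w.
Proof.
move=> E; have [u' [w' [E' <- <-]]] := fob x y.
exact: (brk_uniq E' E).
Qed.

(** Every identity of the bracket a P1 + b P2 is read off from the same identity for commutators.
    The Jacobi identity sits in second order, where the coefficients of h^2, h nu and nu^2 vanish
    separately and are weighted with a^2, a b and b^2. *)
Lemma pencil_poisson Q : in_pencil P1 P2 Q -> is_poisson Q.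
Proof.
move=> [a [b QE]].
have QP x y u w : brk x y u w -> Q (p x) (p y) = scal A a * p u + scal A b * p w.
  by move=> /first_order_val[E1 E2]; rewrite QE E1 E2.
have [t tK] := choice (flat2_surj flat).
have QDr f g g' : Q f (g + g') = Q f g + Q f g'.
  rewrite -(tK f) -(tK g) -(tK g') -pD.
  have [u [w E]] := brk_ex (t f) (t g); have [u' [w' E']] := brk_ex (t f) (t g').
  rewrite (QP _ _ _ _ E) (QP _ _ _ _ E') (QP _ _ (u + u') (w + w')); last first.
    by rewrite /brk cmDr E E' !mulrDr addrACA.
  by rewrite !pD !mulrDr addrACA.
have Qskew f g : Q f g = - Q g f.
  rewrite -(tK f) -(tK g); have [u [w E]] := brk_ex (t f) (t g).
  rewrite (QP _ _ _ _ E) (QP _ _ (- u) (- w)); last first.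
    by rewrite /brk cm_anti E !mulrN opprD.
  by rewrite !(raddfN p) !mulrN opprD !opprK.
have QM f g g' : Q f (g * g') = Q f g * g' + g * Q f g'.
  rewrite -(tK f) -(tK g) -(tK g') -pM.
  have [u [w E]] := brk_ex (t f) (t g); have [u' [w' E']] := brk_ex (t f) (t g').
  rewrite (QP _ _ _ _ E) (QP _ _ _ _ E').
  rewrite (QP _ _ (u * t g' + t g * u') (w * t g' + t g * w')); last first.
    rewrite /brk cmMr E E' !mulrDl !mulrDr !mulrA.
    by rewrite -!(scalC (hbar k) (t g)) -!(scalC (nu k) (t g)) addrACA.
  rewrite !pD !pM !mulrDl !mulrDr !mulrA.
  by rewrite -!(scalC a (p (t g))) -!(scalC b (p (t g))) addrACA.
have scal_p c : p (scal B (fpsC (fpsC c))) = scal A c.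
  by rewrite (flat2_scal flat) !fcoef_fpsC0.
have QZ f c g : Q f (scal A c * g) = scal A c * Q f g.
  rewrite -(tK f) -(tK g) -scal_p -pM; have [u [w E]] := brk_ex (t f) (t g).
  rewrite (QP _ _ _ _ E) (QP _ _ (scal B (fpsC (fpsC c)) * u) (scal B (fpsC (fpsC c)) * w)); last first.
    rewrite /brk cmZr E mulrDr; congr (_ + _); apply: scal_mulCA.
  by rewrite !pM scal_p mulrDr !mulrA !(mulAC (scal A c)).
split=> //.
- by move=> f g g'; rewrite !(Qskew _ g') QDr opprD.
- by move=> c f g; rewrite !(Qskew _ g) QZ mulrN.
- by move=> f g g'; rewrite Qskew QM opprD !(Qskew g') mulNr mulrN !opprK addrC.
move=> f g g'; rewrite -(tK f) -(tK g) -(tK g').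
move: (t f) (t g) (t g') => x y z.
(* The coefficient of h nu has two contributions: the nu-part of the bracket with u and the h-part
   of the bracket with w. *)
have step x' y' z' : exists u w1 w2 w,
    cm x' (cm y' z') = h * (h * u) + h * (v * (w1 + w2)) + v * (v * w) /\
    Q (p x') (Q (p y') (p z')) = scal A a * (scal A a * p u)
      + scal A a * (scal A b * p (w1 + w2)) + scal A b * (scal A b * p w).
  have [u [w E]] := brk_ex y' z'.
  have [u1 [w1 E1]] := brk_ex x' u; have [u2 [w2 E2]] := brk_ex x' w.
  exists u1, w1, u2, w2; split.
    rewrite E cmDr !cmZr E1 E2 !mulrDr !addrA; congr (_ + _ + _).
    exact: scal_mulCA.
  rewrite (QP _ _ _ _ E) QDr !QZ (QP _ _ _ _ E1) (QP _ _ _ _ E2) pD !mulrDr !addrA; congr (_ + _ + _).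
  exact: scal_mulCA.
have [u1 [a1 [b1 [w1 [J1 ->]]]]] := step x y z.
have [u2 [a2 [b2 [w2 [J2 ->]]]]] := step y z x.
have [u3 [a3 [b3 [w3 [J3 ->]]]]] := step z x y.
move: (cm_jacobi x y z); rewrite J1 J2 J3.
move: (a1 + b1) (a2 + b2) (a3 + b3) => m1 m2 m3 J.
have [] := @flat_order2 (u1 + u2 + u3) (m1 + m2 + m3) (w1 + w2 + w3).
  by rewrite !mulrDr -add3_transpose; exact: J.
rewrite !pD => Eu Em Ew.
rewrite add3_transpose.
have fac (c d x1 x2 x3 : A) : c * (d * x1) + c * (d * x2) + c * (d * x3) = c * (d * (x1 + x2 + x3)).
  by rewrite !mulrDr.
by rewrite !fac Eu Em Ew !mulr0 !addr0.
Qed.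

End FirstOrderBrackets.

Section LabelVal.
Variables (A : pzRingType) (n : nat).
Implicit Types f g : 'I_n -> 'I_n -> A.

Lemma eq_label_val f g (x : label n) : (forall i j, f i j = g i j) -> label_val f x = label_val g x.
Proof. by move=> fg; case: x => [p|m] /=; rewrite !fg. Qed.
Lemma label_valB f g x : label_val (fun i j => f i j - g i j) x = label_val f x - label_val g x.
Proof. by case: x => [p|m] //=; rewrite !opprD !opprK addrACA. Qed.
Lemma label_valD f g x : label_val (fun i j => f i j + g i j) x = label_val f x + label_val g x.
Proof. by case: x => [p|m] //=; rewrite !opprD addrACA. Qed.
Lemma label_valZ c f x : label_val (fun i j => c * f i j) x = c * label_val f x.
Proof. by case: x => [p|m] //=; rewrite mulrBr. Qed.
Lemma label_valZr c f x : label_val (fun i j => f i j * c) x = label_val f x * c.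
Proof. by case: x => [p|m] //=; rewrite mulrBl. Qed.
(** Extends a function of two matrix units bilinearly to two basis elements of sl(n), the Cartan
    ones being differences of matrix units. *)
Definition label_val2 (F : 'I_n -> 'I_n -> 'I_n -> 'I_n -> A) (x x' : label n) : A :=
  label_val (fun i j => label_val (F i j) x') x.

Lemma eq_label_val2 F G x x' : (forall i j k l, F i j k l = G i j k l) ->
  label_val2 F x x' = label_val2 G x x'.
Proof. by move=> FG; apply: eq_label_val => i j; apply: eq_label_val => k l. Qed.

Lemma label_val2C F x x' : label_val2 F x x' = label_val2 (fun k l i j => F i j k l) x' x.
Proof.
case: x => [p|m]; case: x' => [p'|m'] //=; rewrite /label_val2 /=.
by rewrite !opprD !opprK addrACA.
Qed.

Lemma label_val2B F G x x' : label_val2 (fun i j k l => F i j k l - G i j k l) x x' =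
  label_val2 F x x' - label_val2 G x x'.
Proof. by rewrite -label_valB; apply: eq_label_val => i j; apply: label_valB. Qed.
Lemma label_val2D F G x x' : label_val2 (fun i j k l => F i j k l + G i j k l) x x' =
  label_val2 F x x' + label_val2 G x x'.
Proof. by rewrite -label_valD; apply: eq_label_val => i j; apply: label_valD. Qed.
Lemma label_val2Z c F x x' : label_val2 (fun i j k l => c * F i j k l) x x' =
  c * label_val2 F x x'.
Proof. by rewrite -label_valZ; apply: eq_label_val => i j; apply: label_valZ. Qed.
Lemma label_val2M f g x x' : label_val2 (fun i j k l => f i j * g k l) x x' =
  label_val f x * label_val g x'.
Proof. by rewrite -label_valZr; apply: eq_label_val => i j; apply: label_valZ. Qed.
End LabelVal.

Lemma label_val_morph (A B : pzRingType) n (f : {rmorphism A -> B}) y (x : label n) :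
  f (label_val y x) = label_val (fun i j => f (y i j)) x.
Proof. by case: x => [p|m] //=; rewrite rmorphB. Qed.

(* The brackets of matrix coordinates [X i j], indices counted from 1, under the
   Lie bracket and under [2 n] times the R-matrix. *)
Definition kks_coord (A : pzRingType) (X : nat -> nat -> A) (i j k l : nat) : A :=
  X i l * (j == k)%:R - X k j * (i == l)%:R.

Definition r_coord (A : pzRingType) n (X : nat -> nat -> A) (i j k l : nat) : A :=
  \sum_(1 <= p < n.+1) \sum_(p.+1 <= q < n.+1)
   ((X p j *+ (q == i) - X i q *+ (j == p)) * (X q l *+ (p == k) - X k p *+ (l == q))
   - (X q j *+ (p == i) - X i p *+ (j == q)) * (X p l *+ (q == k) - X k q *+ (l == p))).

Section RankOneRMatrix.
Variables (A : comNzRingType) (n : nat) (b a : nat -> A).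
Let X i j := b i * a j.
Let y i := b i * a i.
Let lo i := \sum_(1 <= p < n.+1) y p *+ (p < i)%N.
Let hi i := \sum_(1 <= p < n.+1) y p *+ (i < p)%N.

Let sum_delta (F : nat -> A) i : (0 < i <= n)%N -> \sum_(1 <= q < n.+1) F q *+ (q == i) = F i.
Proof.
move=> i0; rewrite (bigD1_seq i) ?mem_index_iota ?iota_uniq //=.
rewrite eqxx mulr1n big1 ?addr0 // => q /negPf ->.
by rewrite mulr0n.
Qed.

Let upper (F : nat -> nat -> A) : \sum_(1 <= p < n.+1) \sum_(p.+1 <= q < n.+1) F p q =
  \sum_(1 <= p < n.+1) \sum_(1 <= q < n.+1) F p q *+ (p < q)%N.
Proof.
apply: eq_big_nat => p p0; rewrite [RHS](big_cat_nat (n := p.+1)) //=; last by lia.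
rewrite [X in _ = X + _]big_nat [X in _ = X + _]big1 ?add0r => [|q /andP[_ qp]]; last first.
  by rewrite ltnNge -ltnS qp.
by apply: eq_big_nat => q /andP[pq _]; rewrite pq.
Qed.

Let sum2_delta (F : nat -> nat -> A) i j : (0 < i <= n)%N -> (0 < j <= n)%N ->
  \sum_(1 <= p < n.+1) \sum_(1 <= q < n.+1) F p q *+ (p == i) *+ (q == j) = F i j.
Proof.
move=> i0 j0; rewrite -(sum_delta (fun p => F p j) i0); apply: eq_bigr => p _.
exact: (sum_delta (fun q => F p q *+ (p == i))).
Qed.

Let expand (m : bool) (c d e f c' d' e' f' : A) :
  ((c - d) * (e - f) - (c' - d') * (e' - f')) *+ m =
  c * e *+ m - c * f *+ m - d * e *+ m + d * f *+ m
   - (c' * e' *+ m - c' * f' *+ m - d' * e' *+ m + d' * f' *+ m).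
Proof.
have E (r u v t : A) : (r - u) * (v - t) = r * v - r * t - u * v + u * t.
  by rewrite mulrBl !mulrBr opprD opprK addrA.
by case: m; rewrite ?mulr1n ?E // !mulr0n !(subr0, addr0, oppr0).
Qed.

Let prod_delta (u v : A) (m b1 b2 c1 c2 : bool) : b1 && b2 = c1 && c2 ->
  (u *+ b1) * (v *+ b2) *+ m = u * v *+ m *+ c1 *+ c2.
Proof.
by case: b1 b2 c1 c2 => [] [] [] [] //= _; rewrite ?mulr1n ?mulr0n ?mul0r ?mulr0 ?mul0rn.
Qed.

(** The products expand into eight double sums. In four of them the Kronecker symbols fix both p and
    q; in the others one index remains, and rank one gives X_pj X_kp = X_kj y_p, so that the partial
    sums of y below and above an index appear. *)
Lemma r_coord_rank_one i j k l : (0 < i <= n)%N -> (0 < j <= n)%N -> (0 < k <= n)%N -> (0 < l <= n)%N ->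
  r_coord n X i j k l = X i l * X k j * ((k < i)%N%:R - (i < k)%N%:R + (j < l)%N%:R - (l < j)%N%:R)
   - X k j * (lo i - hi i) * (i == l)%:R + X i l * (lo j - hi j) * (j == k)%:R.
Proof.
move=> i0 j0 k0 l0; rewrite /r_coord upper.
pose G1 p q := X p j * X q l *+ (p < q)%N *+ (p == k) *+ (q == i).
pose G2 p q := X p j * X k p *+ (p < q)%N *+ (i == l) *+ (q == i).
pose G3 p q := X i q * X q l *+ (p < q)%N *+ (j == k) *+ (p == j).
pose G4 p q := X i q * X k p *+ (p < q)%N *+ (p == j) *+ (q == l).
pose H1 p q := X q j * X p l *+ (p < q)%N *+ (p == i) *+ (q == k).
pose H2 p q := X q j * X k q *+ (p < q)%N *+ (i == l) *+ (p == i).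
pose H3 p q := X i p * X p l *+ (p < q)%N *+ (j == k) *+ (q == j).
pose H4 p q := X i p * X k q *+ (p < q)%N *+ (p == l) *+ (q == j).
rewrite (eq_bigr (fun p => \sum_(1 <= q < n.+1) (G1 p q - G2 p q - G3 p q + G4 p q
    - (H1 p q - H2 p q - H3 p q + H4 p q)))) => [|p _]; last first.
  by apply: eq_bigr => q _; rewrite expand /G1 /G2 /G3 /G4 /H1 /H2 /H3 /H4;
    congr (_ - _ - _ + _ - (_ - _ - _ + _)); apply: prod_delta;
    apply/andP/andP => -[/eqP ? /eqP ?]; split; apply/eqP; congruence.
pose S (F : nat -> nat -> A) := \sum_(1 <= p < n.+1) \sum_(1 <= q < n.+1) F p q.
have SB F G : S (fun p q => F p q - G p q) = S F - S G.
  by rewrite /S -sumrB; apply: eq_bigr => p _; rewrite sumrB.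
have SD F G : S (fun p q => F p q + G p q) = S F + S G.
  by rewrite /S -big_split; apply: eq_bigr => p _; rewrite big_split.
have SC F : S F = S (fun p q => F q p) by rewrite /S exchange_big.
transitivity (S G1 - S G2 - S G3 + S G4 - (S H1 - S H2 - S H3 + S H4)).
  by rewrite -(SB G1) -(SB _ G3) -(SD _ G4) -(SB H1) -(SB _ H3) -(SD _ H4) -SB.
have S1 : S G1 = X k j * X i l *+ (k < i)%N by rewrite /S sum2_delta.
have S4 : S G4 = X i l * X k j *+ (j < l)%N by rewrite /S sum2_delta.
have S5 : S H1 = X k j * X i l *+ (i < k)%N by rewrite /S sum2_delta.
have S8 : S H4 = X i l * X k j *+ (l < j)%N by rewrite /S sum2_delta.
have fac u v (F : nat -> A) (c : pred nat) (e : bool) : (forall p, F p = X u v * y p) ->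
    \sum_(1 <= p < n.+1) F p *+ c p *+ e = X u v * (\sum_(1 <= p < n.+1) y p *+ c p) *+ e.
  move=> FE; rewrite sumrMnl mulr_sumr; congr (_ *+ _); apply: eq_bigr => p _.
  by rewrite FE mulrnAr.
have S2 : S G2 = X k j * lo i *+ (i == l).
  rewrite -(@fac k j (fun p => X p j * X k p) (fun p => p < i)%N) => [|p]; last by rewrite /X /y; ring.
  by apply: eq_bigr => p _; rewrite (sum_delta (fun q => X p j * X k p *+ (p < q)%N *+ (i == l))).
have S7 : S H3 = X i l * lo j *+ (j == k).
  rewrite -(@fac i l (fun p => X i p * X p l) (fun p => p < j)%N) => [|p]; last by rewrite /X /y; ring.
  by apply: eq_bigr => p _; rewrite (sum_delta (fun q => X i p * X p l *+ (p < q)%N *+ (j == k))).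
have S3 : S G3 = X i l * hi j *+ (j == k).
  rewrite SC -(@fac i l (fun p => X i p * X p l) (fun p => j < p)%N) => [|p]; last by rewrite /X /y; ring.
  by apply: eq_bigr => p _; rewrite (sum_delta (fun q => X i p * X p l *+ (q < p)%N *+ (j == k))).
have S6 : S H2 = X k j * hi i *+ (i == l).
  rewrite SC -(@fac k j (fun p => X p j * X k p) (fun p => i < p)%N) => [|p]; last by rewrite /X /y; ring.
  by apply: eq_bigr => p _; rewrite (sum_delta (fun q => X p j * X k p *+ (q < p)%N *+ (i == l))).
transitivity (X k j * X i l * (k < i)%N%:R - X k j * lo i * (i == l)%:R - X i l * hi j * (j == k)%:R
    + X i l * X k j * (j < l)%N%:R - (X k j * X i l * (i < k)%N%:R - X k j * hi i * (i == l)%:R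
    - X i l * lo j * (j == k)%:R + X i l * X k j * (l < j)%N%:R)).
  rewrite !mulr_natr.
  by congr (_ - _ - _ + _ - (_ - _ - _ + _)); [exact: S1 | exact: S2 | exact: S3 | exact: S4 |
    exact: S5 | exact: S6 | exact: S7 | exact: S8].
clear; move: (X k j) (X i l) (lo i) (hi i) (lo j) (hi j) => x1 x2 c1 c2 c3 c4.
move: ((k < i)%N%:R : A) ((i < k)%N%:R : A) ((j < l)%N%:R : A) ((l < j)%N%:R : A) ((i == l)%:R : A) ((j == k)%:R : A).
by move=> d1 d2 d3 d4 d5 d6; clear; ring.
Qed.

End RankOneRMatrix.

Lemma order1_coef (k : comNzRingType) (A : alg k) (X Y : fps_alg (fps_alg A)) :
  let E := scal (fps_alg (fps_alg A)) (hbar k) * X + scal (fps_alg (fps_alg A)) (nu k) * Y in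
  fcoef (fcoef E 1) 0 = fcoef (fcoef X 0) 0 /\ fcoef (fcoef E 0) 1 = fcoef (fcoef Y 0) 0.
Proof.
move=> E; rewrite /E !fcoefD !fcoef_hbarM !fcoef_nuM.
by split; rewrite ?addr0 ?add0r.
Qed.

Lemma kks_identity (F : fieldType) (w y : nat -> F) c i j k l :
  w i != 0 -> w j != 0 -> w k != 0 -> w l != 0 ->
  w i * y j / w j * (w k / w l * (c * ((j == l)%:R - (i == l)%:R)))
  - w k * y l / w l * (w i / w j * (c * ((l == j)%:R - (k == j)%:R))) =
  c * (w i * y l / w l * (j == k)%:R - w k * y j / w j * (i == l)%:R).
Proof.
move=> wi wj wk wl; rewrite [l == j]eq_sym [k == j]eq_sym.
have [E|_] := eqVneq j l; have [E'|_] := eqVneq i l; have [E''|_] := eqVneq j k; subst => //=.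
all: by field; rewrite ?wi ?wj ?wk ?wl.
Qed.

(** Here P i is the sum of the y below i and a the sum of all y, while t1, ..., t6 stand for the
    comparisons i < l, l < j, k < i, j < k, j < l and i < k. The identity is checked for each
    pattern of equal indices. *)
Lemma r_identity (F : fieldType) (w y P : nat -> F) (a s t1 t2 t3 t4 t5 t6 : F) i j k l :
  w i != 0 -> w j != 0 -> w k != 0 -> w l != 0 ->
  w i * y j / w j * (w k / w l * (- (1 - (1 - (i == l)%:R - t1) - (1 - t2)
      + (1 - t3 - (1 - (1 - (j == k)%:R - t4)))) * y l
      + (P l *+ 2 + s) * ((j == l)%:R - (i == l)%:R)))
  - w k * y l / w l * (w i / w j * (- (1 - t4 - (1 - t5) + (1 - t6 - (1 - t1))) * y j
      + (P j *+ 2 + s) * ((l == j)%:R - (k == j)%:R))) =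
  (s + a) * (w i * y l / w l * (j == k)%:R - w k * y j / w j * (i == l)%:R)
  + (w i * (y l / w l) * (w k * (y j / w j)) * (t3 - t6 + t5 - t2)
     - w k * (y j / w j) * (P i - (a - (P i + y i))) * (i == l)%:R
     + w i * (y l / w l) * (P j - (a - (P j + y j))) * (j == k)%:R).
Proof.
move=> wi wj wk wl; rewrite [l == j]eq_sym [k == j]eq_sym.
have [E|_] := eqVneq j l; have [E'|_] := eqVneq i l; have [E''|_] := eqVneq j k; subst => //=.
all: by field; rewrite ?wi ?wj ?wk ?wl.
Qed.

Section FirstOrderValues.
Variables (C : numFieldType) (n : nat) (alpha0 : C) (q_gt1 : bool) (w y : nat -> C).
Hypothesis n_gt3 : (3 < n)%N.
Hypothesis w0 : forall k, (0 < k <= n)%N -> w k != 0.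
Hypothesis sum_y : \sum_(1 <= k < n.+1) y k = alpha0.
Notation K := (K_hn C).
Notation T := (tens_C C n).
Notation That := (tens_hat C n).
Notation Yfun := (Yfun n alpha0 q_gt1 y).
Notation wt := (wt n).
Notation gen_coef := (@gen_coef C n alpha0 q_gt1 y).
Notation gen_shift := (@gen_shift n).
Notation gen_scale := (@gen_scale C n w).
Notation character := (@character C n w).
Notation point := (@torus_point C w y).
Notation psum := (@psum C y).
Notation s01 := (@s01 C n alpha0 q_gt1).
Notation opg x := (op_gen (std_rep C) alpha0 q_gt1 y x).
Notation at_pt F := (free_ev (label_val (at_point point) : label n -> regular_alg C) F : C).

Lemma op_gen_mul_character i j x x' :
  lin_endo_val (fcoef (fcoef (opg x * opg x' : op_alg C) i) j) character lat0 =
  fcoef (fcoef (gen_coef x lat0 * gen_coef x' (gen_shift x)) i) j * (gen_scale x * gen_scale x').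
Proof.
have -> : opg x * opg x' = std_op (fun mu => gen_coef x mu * gen_coef x' (lat_add mu (gen_shift x)))
    (lat_add (gen_shift x) (gen_shift x')).
  by rewrite !op_gen_std std_opM.
rewrite fcoef_std_op.
have -> : gen_scale x * gen_scale x' = character (lat_add lat0 (lat_add (gen_shift x) (gen_shift x'))).
  rewrite lat_add0 (character_gen_shift n_gt3 w0) -[gen_shift x]lat_add0 (character_gen_shift n_gt3 w0).
  by rewrite character0 mulr1 mulrC.
have -> : gen_coef x' (gen_shift x) = gen_coef x' (lat_add lat0 (gen_shift x)) by rewrite lat_add0.
by [].
Qed.

Lemma op_hat_character_point (u : That) :
  lin_endo_val (fcoef (fcoef (op_hat alpha0 q_gt1 y u) 0) 0) character lat0 = at_pt (fcoef (fcoef u 0) 0).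
Proof.
have := op_coef00_character q_gt1 n_gt3 w0 sum_y (fcoef (fcoef u 0) 0).
have -> : fcoef (fcoef (op_hat alpha0 q_gt1 y u) 0) 0 =
    fcoef (fcoef (op_ev_const alpha0 q_gt1 y (fcoef (fcoef u 0) 0)) 0) 0.
  by rewrite fcoef_op_hat !big_ord1.
by move=> /(congr1 (fun f => f lat0)) ->; rewrite character0 mulr1.
Qed.

Let lin_endo_valB (U V : op_alg C) i j :
  lin_endo_val (fcoef (fcoef (U - V) i) j) character lat0 =
  lin_endo_val (fcoef (fcoef U i) j) character lat0 - lin_endo_val (fcoef (fcoef V i) j) character lat0.
Proof.
have vB (P Q : endo_alg C) : lin_endo_val (P - Q) character lat0 =
  lin_endo_val P character lat0 - lin_endo_val Q character lat0 by [].
exact: vB.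
Qed.

Let add5 (c d e f t : C) : c + e - (d - f) + t = c - d + (e + f + t).
Proof. by ring. Qed.

Let sub4 (s c d e f : C) : s * (c - e - (d - f)) = s * (c - d - (e - f)).
Proof. by rewrite opprD addrACA -opprD. Qed.
Let sub4r (c d e f t : C) : (c - e + t) - (d - f + t) = c - d - (e - f).
Proof. by rewrite [_ + t]addrC [d - f + t]addrC opprD addrACA subrr add0r opprD addrACA -opprD. Qed.
Let sub5 (u v t : C) (c a b : int) : u + (c - a + b)%:~R * t - (v + c%:~R * t) = u - v + (b - a)%:~R * t.
Proof. by rewrite !intrD !intrN; move: (c%:~R) (a%:~R) (b%:~R) => ? ? ?; ring. Qed.

Lemma commutator_point x x' (u v : That) :
  op_hat alpha0 q_gt1 y (gen_hat C x * gen_hat C x' - gen_hat C x' * gen_hat C x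
    - (scal That (hbar C) * u + scal That (nu C) * v)) = 0 ->
  at_pt (fcoef (fcoef u 0) 0) = (coef10 (gen_coef x lat0 * gen_coef x' (gen_shift x))
     - coef10 (gen_coef x' lat0 * gen_coef x (gen_shift x'))) * (gen_scale x * gen_scale x') /\
  at_pt (fcoef (fcoef v 0) 0) = (coef01 (gen_coef x lat0 * gen_coef x' (gen_shift x))
     - coef01 (gen_coef x' lat0 * gen_coef x (gen_shift x'))) * (gen_scale x * gen_scale x').
Proof.
move=> z0.
have E : opg x * opg x' - opg x' * opg x =
    scal (op_alg C) (hbar C) * op_hat alpha0 q_gt1 y u + scal (op_alg C) (nu C) * op_hat alpha0 q_gt1 y v.
  apply/eqP; rewrite -subr_eq0; apply/eqP; rewrite -[RHS]z0.
  symmetry; apply: (eq_trans (raddfB (op_hat alpha0 q_gt1 y) _ _)); congr (_ - _).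
    apply: (eq_trans (raddfB (op_hat alpha0 q_gt1 y) _ _)).
    by congr (_ - _); apply: (eq_trans (rmorphM (op_hat alpha0 q_gt1 y) _ _)); congr (_ * _); exact: op_hat_gen.
  apply: (eq_trans (raddfD (op_hat alpha0 q_gt1 y) _ _)).
  by congr (_ + _); apply: (eq_trans (rmorphM (op_hat alpha0 q_gt1 y) _ _)); congr (_ * _); exact: op_hat_scal.
have val i j : lin_endo_val (fcoef (fcoef (opg x * opg x' - opg x' * opg x : op_alg C) i) j) character lat0
   = (fcoef (fcoef (gen_coef x lat0 * gen_coef x' (gen_shift x)) i) j
     - fcoef (fcoef (gen_coef x' lat0 * gen_coef x (gen_shift x')) i) j) * (gen_scale x * gen_scale x').
  apply: (eq_trans (lin_endo_valB _ _ _ _)); apply: (eq_trans (congr2 (fun u v => u - v) (op_gen_mul_character i j x x') (op_gen_mul_character i j x' x))).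
  by rewrite mulrBl; congr (_ - _ * _); exact: mulrC.
have [cu cv] := order1_coef (op_hat alpha0 q_gt1 y u) (op_hat alpha0 q_gt1 y v).
pose L (Z : endo_alg C) := lin_endo_val Z character lat0.
split.
  apply: (eq_trans (esym (op_hat_character_point u))); apply: (eq_trans (congr1 L (esym cu))).
  apply: (eq_trans (congr1 (fun Z : op_alg C => L (fcoef (fcoef Z 1) 0)) (esym E))); exact: val.
apply: (eq_trans (esym (op_hat_character_point v))); apply: (eq_trans (congr1 L (esym cv))).
apply: (eq_trans (congr1 (fun Z : op_alg C => L (fcoef (fcoef Z 0) 1)) (esym E))); exact: val.
Qed.

(** The change of the h-coefficient of the (i, j) operator coefficient when the weight moves from 0
    to mu, and [lin01] that of the nu-coefficient. At first order a commutator sees nothing else. *)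
Definition lin10 (i j : nat) (mu : lattice) : C := alpha0 / n%:R * (wt mu j.-1 - wt mu j)%:~R.
Definition lin01 (i j : nat) (mu : lattice) : C :=
  (wt mu j - wt mu i)%:~R * y j + ((- wt mu j *+ 2)%:~R * psum j
  - (- wt mu j.-1 *+ 2)%:~R * psum j.-1 + s01 * (wt mu j.-1 - wt mu j)%:~R).

Let wt0 k : wt lat0 k = 0. Proof. by rewrite /wt if_same. Qed.

Lemma lin10_0 i j : lin10 i j lat0 = 0. Proof. by rewrite /lin10 !wt0 subr0 mulr0. Qed.
Lemma lin01_0 i j : lin01 i j lat0 = 0.
Proof. by rewrite /lin01 !wt0 !mulr0z /= !mul0r mulr0 subrr addr0 add0r. Qed.

Lemma coef10_phase c (Y : K) : coef10 (qpow C c * Y) = coef10 Y.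
Proof. by rewrite coef10M coef10_qpow coef00_qpow mul1r mul0r addr0. Qed.
Lemma coef01_phase c (Y : K) : coef01 (qpow C c * Y) = coef01 Y + c%:~R * coef00 Y.
Proof. by rewrite coef01M coef01_qpow coef00_qpow mul1r. Qed.

Let wij i j := w i / w j.

Let coefY10 j mu : (0 < j <= n)%N -> coef10 (Yfun j mu) - coef10 (Yfun j lat0) = lin10 j j mu.
Proof.
move=> j0.
apply: (eq_trans (congr2 (fun u v => u - v) (coef10_Yfun alpha0 q_gt1 y n_gt3 mu j0) (coef10_Yfun alpha0 q_gt1 y n_gt3 lat0 j0))).
move: (coef10 (zpar _ _ _ _ j)) (coef10 (zpar _ _ _ _ j.-1)) => u v.
by rewrite !wt0 subr0 /lin10 mulr0 addr0 [LHS]addrC addKr.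
Qed.
Let coefY01 j mu : (0 < j <= n)%N -> coef01 (Yfun j mu) - coef01 (Yfun j lat0) = lin01 j j mu.
Proof.
move=> j0.
apply: (eq_trans (congr2 (fun u v => u - v) (coef01_Yfun q_gt1 n_gt3 sum_y mu j0) (coef01_Yfun q_gt1 n_gt3 sum_y lat0 j0))).
move: (coef01 (zpar _ _ _ _ j)) (coef01 (zpar _ _ _ _ j.-1)) => u v.
rewrite !wt0 subrr /lin01 subrr !mul0r !mulr0 add0r.
move: (_ * psum _) (_ * psum _) (s01 * _) => ? ? ?; ring.
Qed.

Let m1P (m : 'I_n.-1) : (0 < m.+1 <= n)%N. Proof. by have := cart_hi_lt m; lia. Qed.
Let m2P (m : 'I_n.-1) : (0 < m.+2 <= n)%N. Proof. by have := cart_hi_lt m; lia. Qed.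

Let wii i : (0 < i <= n)%N -> wij i i = 1. Proof. by move=> i0; rewrite /wij divff ?w0. Qed.

Let label_inr (f : nat -> nat -> C) (m : 'I_n.-1) :
  label_val (at_point (fun i j => wij i j * f i j)) (inr m) = f m.+1 m.+1 - f m.+2 m.+2.
Proof. by rewrite /label_val /at_point /= !wii ?m1P ?m2P // !mul1r. Qed.

Lemma gen_coef10 x mu : gen_scale x * (coef10 (gen_coef x mu) - coef10 (gen_coef x lat0)) =
  label_val (at_point (fun i j => wij i j * lin10 i j mu)) x.
Proof.
case: x => [p|m].
  have c10 mu' : coef10 (gen_coef (inl p) mu') = coef10 (Yfun (val p).2.+1 mu') := coef10_phase _ _.
  apply: (eq_trans (congr2 (fun u v => gen_scale (inl p) * (u - v)) (c10 mu) (c10 lat0))).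
  by apply: (eq_trans (congr1 (fun u => gen_scale (inl p) * u) (@coefY10 (val p).2.+1 mu (ltn_ord _)))).
have c10 mu' : coef10 (gen_coef (inr m) mu') = coef10 (Yfun m.+1 mu') - coef10 (Yfun m.+2 mu').
  apply: (eq_trans (coef10_phase _ _)); apply: (eq_trans (coef10B _ _)).
  by congr (_ - _); exact: coef10_phase.
apply: (eq_trans (congr2 (fun u v => gen_scale (inr m) * (u - v)) (c10 mu) (c10 lat0))).
rewrite label_inr; apply: (eq_trans _ (congr2 (fun u v => u - v) (coefY10 mu (m1P m)) (coefY10 mu (m2P m)))).
by apply: (eq_trans (sub4 _ _ _ _ _)); exact: mul1r.
Qed.

Let lin01E i j mu : lin01 i j mu = lin01 j j mu + (wt mu j - wt mu i)%:~R * y j.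
Proof. by rewrite /lin01 subrr mul0r add0r addrC. Qed.

Lemma gen_coef01 x mu : gen_scale x * (coef01 (gen_coef x mu) - coef01 (gen_coef x lat0)) =
  label_val (at_point (fun i j => wij i j * lin01 i j mu)) x.
Proof.
case: x => [p|m].
  pose i := (val p).1.+1; pose j := (val p).2.+1.
  pose c : int := - i%:Z - (i < j)%N%:Z.
  have c01 mu' : coef01 (gen_coef (inl p) mu') =
      coef01 (Yfun j mu') + (c - wt mu' i + wt mu' j)%:~R * y j.
    apply: (eq_trans (coef01_phase _ _)); apply: congr1.
    by apply: (congr1 (fun u => _ * u)); apply: (coef00_Yfun q_gt1 n_gt3 sum_y); apply: ltn_ord.
  apply: (eq_trans (congr2 (fun u v => gen_scale (inl p) * (u - v)) (c01 mu) (c01 lat0))).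
  have l01 : lin01 i j mu = coef01 (Yfun j mu) - coef01 (Yfun j lat0) + (wt mu j - wt mu i)%:~R * y j.
    by rewrite lin01E -(@coefY01 j mu (ltn_ord _)).
  apply: (eq_trans _ (congr1 (fun u => wij i j * u) (esym l01))).
  rewrite !wt0 subr0 addr0; apply: (congr1 (fun u => _ * u)); exact: sub5.
have c01 mu' : coef01 (gen_coef (inr m) mu') = coef01 (Yfun m.+1 mu') - coef01 (Yfun m.+2 mu')
    + (y m.+1 + y m.+2 + (- m.+1%:Z)%:~R * (y m.+1 - y m.+2)).
  have e1 : coef01 (qpow C 1 * Yfun m.+1 mu') = coef01 (Yfun m.+1 mu') + y m.+1.
    by apply: (eq_trans (coef01_phase _ _)); rewrite (coef00_Yfun q_gt1 n_gt3 sum_y mu' (m1P m)) mul1r.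
  have e2 : coef01 (qpow C (-1) * Yfun m.+2 mu') = coef01 (Yfun m.+2 mu') - y m.+2.
    by apply: (eq_trans (coef01_phase _ _)); rewrite (coef00_Yfun q_gt1 n_gt3 sum_y mu' (m2P m)) mulN1r.
  have e3 : coef00 (qpow C 1 * Yfun m.+1 mu' - qpow C (-1) * Yfun m.+2 mu') = y m.+1 - y m.+2.
    apply: (eq_trans (coef00B _ _)); apply: congr2.
      by apply: (eq_trans (coef00M _ _)); rewrite coef00_qpow mul1r (coef00_Yfun q_gt1 n_gt3 sum_y mu' (m1P m)).
    apply: congr1.
    by apply: (eq_trans (coef00M _ _)); rewrite coef00_qpow mul1r (coef00_Yfun q_gt1 n_gt3 sum_y mu' (m2P m)).
  apply: (eq_trans (coef01_phase _ _)).
  apply: (eq_trans (congr2 (fun u v => u + _ * v) (eq_trans (coef01B _ _) (congr2 (fun u v => u - v) e1 e2)) e3)).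
  exact: add5.
apply: (eq_trans (congr2 (fun u v => gen_scale (inr m) * (u - v)) (c01 mu) (c01 lat0))).
rewrite label_inr; apply: (eq_trans _ (congr2 (fun u v => u - v) (coefY01 mu (m1P m)) (coefY01 mu (m2P m)))).
by apply: (eq_trans (mul1r _)); exact: sub4r.
Qed.

Lemma wt_shift_step i j k : (0 < i <= n)%N -> (0 < j <= n)%N -> (k <= n)%N ->
  wt (sh i j) k = (i <= k)%N%:Z - (j <= k)%N%:Z.
Proof.
move=> /andP[i1 iN] /andP[j1 jN] kn; rewrite /wt /sh; case: ifP => // kn'.
have [k0|k0] : k = 0%N \/ k = n by lia.
  by rewrite k0 leqNgt i1 leqNgt j1.
by rewrite k0 iN jN subrr.
Qed.

Let leC (i k : nat) : C := (i <= k)%N%:R.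
Let ltC (i k : nat) : C := (i < k)%N%:R.
Let eqC (i k : nat) : C := (i == k)%:R.

Let wt_shC i j k : (0 < i <= n)%N -> (0 < j <= n)%N -> (k <= n)%N ->
  (wt (sh i j) k)%:~R = leC i k - leC j k :> C.
Proof. by move=> i0 j0 kn; rewrite wt_shift_step // intrB. Qed.

Let le_pred i k : (0 < i)%N -> (0 < k)%N -> leC i k.-1 = leC i k - eqC i k.
Proof.
move=> i0 k0; rewrite /leC /eqC.
have [->|ik] := eqVneq i k.
  have -> : (k <= k.-1)%N = false by lia.
  by rewrite leqnn subrr.
have -> : (i <= k.-1)%N = (i <= k)%N by lia.
by rewrite subr0.
Qed.

Let psum_pred k : (0 < k)%N -> psum k = psum k.-1 + y k.
Proof. by case: k => // k _; rewrite /psum big_nat_recr. Qed.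

Lemma lin10_sh i j k l : (0 < i <= n)%N -> (0 < j <= n)%N -> (0 < l <= n)%N ->
  lin10 k l (sh i j) = alpha0 / n%:R * (eqC j l - eqC i l).
Proof.
move=> i0 j0 l0; rewrite /lin10 intrB !wt_shC ?le_pred //; try lia.
by congr (_ * _); ring.
Qed.

Lemma lin01_sh i j k l : (0 < i <= n)%N -> (0 < j <= n)%N -> (0 < k <= n)%N -> (0 < l <= n)%N ->
  lin01 k l (sh i j) = - (leC i l - leC j l + (leC i k - leC j k)) * y l
    + (psum l.-1 *+ 2 + s01) * (eqC j l - eqC i l).
Proof.
move=> i0 j0 k0 l0; rewrite /lin01 !mulr2n !intrD !intrN !wt_shC ?le_pred //; try lia.
rewrite (@psum_pred l); last lia.
move: (leC i l) (leC j l) (leC i k) (leC j k) (eqC j l) (eqC i l) s01 (psum l.-1) (y l) => *; ring.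
Qed.

Let order1_alg (a a' b b' p0 p1 q0 q1 s t : C) : s * a = s * a' -> t * b = t * b' ->
  (a * q1 + p0 * b' - (b * p1 + q0 * a')) * (s * t) =
  s * a * (t * (q1 - q0)) - t * b * (s * (p1 - p0)).
Proof.
move=> aa bb; transitivity ((s * a) * t * q1 + (t * b') * s * p0 - (t * b) * s * p1 - (s * a') * t * q0).
  by ring.
by rewrite -aa -bb; ring.
Qed.

Lemma label_val_at_point0 (x : label n) : label_val (at_point (fun _ _ => 0 : C)) x = 0.
Proof. by case: x => [p|m] //=; rewrite /at_point subrr. Qed.

(** A Cartan label does not shift the weight, so for it both sides are 0; for a root label the shift
    is the one written on the right. *)
Let shift_expand (L : nat -> nat -> lattice -> C) x x' : (forall i j, L i j lat0 = 0) ->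
  label_val (at_point point) x * label_val (at_point (fun k l => wij k l * L k l (gen_shift x))) x' =
  label_val2 (fun i j k l : 'I_n => point i.+1 j.+1 * (wij k.+1 l.+1 * L k.+1 l.+1 (sh i.+1 j.+1))) x x'.
Proof.
move=> L0; case: x => [p|m].
  by rewrite /label_val2 [RHS]/= label_valZ.
have z (x'' : label n) : label_val (at_point (fun k l => wij k l * L k l lat0)) x'' = 0.
  rewrite -(label_val_at_point0 x''); apply: eq_label_val => i j.
  by rewrite /at_point L0 mulr0.
have shii i : sh i i = lat0 by apply/funext => k; rewrite /sh subrr.
rewrite /gen_shift z mulr0 /label_val2 /=; symmetry; apply/eqP; rewrite subr_eq0; apply/eqP.
by rewrite !label_valZ !shii -/(at_point _) (z x') !mulr0.
Qed.

(** In the commutator of two shift operators the first-order terms at weight 0 cancel. What survives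
    is the change of each coefficient under the shift of the other factor, times the value of that
    factor. *)
Let order1_point (L : nat -> nat -> lattice -> C) (co : K -> C) x x' :
  (forall c d, co (c * d) = coef00 c * co d + co c * coef00 d) ->
  (forall x mu, gen_scale x * (co (gen_coef x mu) - co (gen_coef x lat0)) =
    label_val (at_point (fun i j => wij i j * L i j mu)) x) ->
  (forall i j, L i j lat0 = 0) ->
  (co (gen_coef x lat0 * gen_coef x' (gen_shift x))
     - co (gen_coef x' lat0 * gen_coef x (gen_shift x'))) * (gen_scale x * gen_scale x') =
  label_val2 (fun i j k l : 'I_n => point i.+1 j.+1 * (wij k.+1 l.+1 * L k.+1 l.+1 (sh i.+1 j.+1))
     - point k.+1 l.+1 * (wij i.+1 j.+1 * L i.+1 j.+1 (sh k.+1 l.+1))) x x'.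
Proof.
move=> coM coE L0.
apply: (eq_trans (congr2 (fun u v => (u - v) * _) (coM _ _) (coM _ _))).
have c00 x1 mu mu' : gen_scale x1 * coef00 (gen_coef x1 mu) = gen_scale x1 * coef00 (gen_coef x1 mu').
  by apply: (eq_trans (coef00_gen q_gt1 n_gt3 w0 sum_y _ _)); symmetry; apply: coef00_gen.
apply: (eq_trans (order1_alg _ _ _ _ (c00 x lat0 (gen_shift x')) (c00 x' lat0 (gen_shift x)))).
rewrite (coE x') (coE x).
rewrite (coef00_gen q_gt1 n_gt3 w0 sum_y x lat0) (coef00_gen q_gt1 n_gt3 w0 sum_y x' lat0).
by rewrite !shift_expand // label_val2B [X in _ - X]label_val2C.
Qed.

Let kks_point i j k l : (0 < i <= n)%N -> (0 < j <= n)%N -> (0 < k <= n)%N -> (0 < l <= n)%N ->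
  point i j * (wij k l * lin10 k l (sh i j)) - point k l * (wij i j * lin10 i j (sh k l)) =
  alpha0 / n%:R * kks_coord point i j k l.
Proof.
move=> i0 j0 k0 l0; rewrite (lin10_sh _ i0 j0 l0) (lin10_sh _ k0 l0 j0).
by apply: kks_identity; apply: w0.
Qed.

Let lo_sum i : (0 < i <= n)%N -> \sum_(1 <= p < n.+1) y p *+ (p < i)%N = psum i.-1.
Proof.
move=> /andP[i0 iN]; rewrite (big_cat_nat (n := i)) //=; last exact: leqW.
rewrite [X in _ + X]big_nat [X in _ + X]big1 ?addr0 => [|p /andP[ip _]]; last first.
  by rewrite ltnNge ip.
by rewrite /psum prednK //; apply: eq_big_nat => p /andP[_ ->].
Qed.

Let hi_sum i : (0 < i <= n)%N -> \sum_(1 <= p < n.+1) y p *+ (i < p)%N = alpha0 - psum i.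
Proof.
move=> /andP[i0 iN]; rewrite -sum_y (big_cat_nat (n := i.+1)) //=.
rewrite [X in X + _]big_nat [X in X + _]big1 ?add0r => [|p /andP[_ pi]]; last first.
  by rewrite ltnNge -ltnS pi.
rewrite [in RHS](big_cat_nat (n := i.+1)) //= addrAC subrr add0r.
by apply: eq_big_nat => p /andP[-> _].
Qed.

Let lt_total i l : ltC l i = 1 - eqC i l - ltC i l.
Proof.
by rewrite /ltC /eqC; case: ltngtP => _; rewrite !(subr0, subrr).
Qed.

Let le_lt i l : leC i l = 1 - ltC l i.
Proof. by rewrite /leC /ltC ltnNge; case: (i <= l)%N; rewrite ?subr0 ?subrr. Qed.

Let r_point i j k l : (0 < i <= n)%N -> (0 < j <= n)%N -> (0 < k <= n)%N -> (0 < l <= n)%N ->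
  point i j * (wij k l * lin01 k l (sh i j)) - point k l * (wij i j * lin01 i j (sh k l)) =
  (s01 + alpha0) * kks_coord point i j k l + r_coord n point i j k l.
Proof.
move=> i0 j0 k0 l0; rewrite (lin01_sh i0 j0 k0 l0) (lin01_sh k0 l0 i0 j0).
have pE : point = (fun i j => w i * (y j / w j)).
  by apply/funext => p; apply/funext => q; rewrite /torus_point mulrA.
have -> : r_coord n point i j k l = r_coord n (fun i j => w i * (y j / w j)) i j k l by rewrite pE.
rewrite (@r_coord_rank_one _ n w (fun j => y j / w j)) //.
have yE (c : pred nat) : \sum_(1 <= p < n.+1) w p * (y p / w p) *+ c p = \sum_(1 <= p < n.+1) y p *+ c p.
  by apply: eq_big_nat => p p0; rewrite mulrC mulfVK // w0.
rewrite !yE !lo_sum // !hi_sum // !le_lt.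
rewrite (lt_total i l) (lt_total j k) (@psum_pred i); last by case/andP: i0.
rewrite (@psum_pred j); last by case/andP: j0.
exact: (r_identity y (fun i => psum i.-1) alpha0 s01 (ltC i l) (ltC l j) (ltC k i) (ltC j k) (ltC j l) (ltC i k)
  (w0 i0) (w0 j0) (w0 k0) (w0 l0)).
Qed.

Lemma commutator_point_values x x' (u v : That) :
  op_hat alpha0 q_gt1 y (gen_hat C x * gen_hat C x' - gen_hat C x' * gen_hat C x
    - (scal That (hbar C) * u + scal That (nu C) * v)) = 0 ->
  at_pt (fcoef (fcoef u 0) 0) =
    alpha0 / n%:R * label_val2 (fun i j k l : 'I_n => kks_coord point i.+1 j.+1 k.+1 l.+1) x x' /\
  at_pt (fcoef (fcoef v 0) 0) =
    (s01 + alpha0) * label_val2 (fun i j k l : 'I_n => kks_coord point i.+1 j.+1 k.+1 l.+1) x x'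
     + label_val2 (fun i j k l : 'I_n => r_coord n point i.+1 j.+1 k.+1 l.+1) x x'.
Proof.
have oP (i : 'I_n) : (0 < i.+1 <= n)%N by apply: ltn_ord.
move=> /commutator_point[-> ->]; split.
  have E := @order1_point lin10 (@coef10 C) x x' (@coef10M C) gen_coef10 lin10_0.
  apply: (eq_trans E).
  by rewrite -label_val2Z; apply: eq_label_val2 => i j k l; apply: kks_point.
have E := @order1_point lin01 (@coef01 C) x x' (@coef01M C) gen_coef01 lin01_0.
apply: (eq_trans E).
rewrite -label_val2Z -label_val2D; apply: eq_label_val2 => i j k l; exact: r_point.
Qed.

End FirstOrderValues.

Section Flatness.
Variables (C : numFieldType) (n : nat) (alpha0 : C) (q_gt1 : bool).
Hypothesis n_gt3 : (3 < n)%N.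
Hypothesis a0 : alpha0 != 0.
Let n_gt1 : (1 < n)%N. Proof. lia. Qed.
Notation T := (tens_C C n).
Notation That := (tens_hat C n).
Notation I := (Ideal (@defining_is_ideal C n alpha0 q_gt1)).
Notation FunO := (FunO n alpha0).
Notation fun_ev := (@fun_ev C n alpha0).
Notation orbit := (coadjoint_orbit (n := n) alpha0).

(** The constant coefficients of elements of the defining ideal form an ideal of T(g) that contains
    the specialized relations, hence the whole classical ideal. *)
Lemma fun_ev_ker_lift F : fun_ev F = 0 -> exists2 z : That, I z & fcoef (fcoef z 0) 0 = F.
Proof.
move=> /(fun_ev_eq0 n_gt1 a0)/(@cl_vanish C n alpha0 q_gt1 n_gt3 a0 F) F0.
pose S (F : T) := exists2 z : That, I z & fcoef (fcoef z 0) 0 = F.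
have [I0 ID IMl IMr] := idealP I.
have SI : is_ideal S.
  split=> [|x y [x' Ix <-] [y' Iy <-]|a x [x' Ix <-]|a x [x' Ix <-]].
  - by exists 0.
  - by exists (x' + y'); first exact: ID.
  - exists (fpsC (fpsC a) * x'); first exact: IMl.
    by rewrite fcoef2M00 !fcoef_fpsC0.
  - exists (x' * fpsC (fpsC a)); first exact: IMr.
    by rewrite fcoef2M00 !fcoef_fpsC0.
apply: (F0 (Ideal SI)) => r rr; exists (to_tens_hat r) => // J' cJ rJ; exact: rJ.
Qed.

Lemma fun_ev_section : exists s : FunO -> T, [/\ cancel s fun_ev, {morph s : a b / a + b} &
  forall c a, s (scal FunO c * a) = scal T c * s a].
Proof.
pose rk (w : {fmonom (label n)}) := choice.pickle (fmonom_val w).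
have rk_inj : injective rk by move=> u v /(pcan_inj choice.pickleK)/(can_inj (@fmonom_valK _)).
have fZ c (x : T) : fun_ev x = 0 -> fun_ev (c *: x) = 0.
  by move=> x0; apply: (eq_trans (free_evZ _ _ _)); apply: (eq_trans (congr1 _ x0)); rewrite mulr0.
have [s [sK sD sZ]] := linear_section rk_inj (free_evD (@fun_gen C n alpha0)) fZ (@fun_ev_surj C n alpha0).
exists s; split=> // c a.
have E : fun_ev (c *: s a) = scal FunO c * a.
  by apply: (eq_trans (free_evZ _ _ _)); congr (_ * _); exact: sK.
apply: (eq_trans (congr1 s (esym E))); apply: (eq_trans (sZ c (s a))).
apply: (eq_trans (congr1 (fun u => c *: s u) (sK a))).
by symmetry; exact: mul_malgC.
Qed.

Lemma Ahq_flat : exists p : {rmorphism Ahq n alpha0 q_gt1 -> FunO},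
  (forall z : That, p (quot_pr I z) = fun_ev (fcoef (fcoef z 0) 0)) /\ flat_deformation2 p.
Proof.
have [s [sK sD sZ]] := fun_ev_section.
pose f : {rmorphism T -> FunO} := (free_ev (@fun_gen C n alpha0) : {rmorphism T -> FunO}).
have f_scal c : f (scal T c) = scal FunO c := free_evC _ c.
apply: (quot_flat_exists f_scal sK sD sZ) => [z H|z i j Iz zi zj|F F0].
- change (in_defining_ideal alpha0 q_gt1 z).
  move=> J' cJ rJ; apply: (cJ z) => N; have [y Iy yz] := H N; exists y; first exact: Iy.
  exact: yz.
- apply/(fun_ev_eq0 n_gt1 a0); exact: (defining_ideal_vanishes n_gt3 a0 Iz zi zj).
- exact: fun_ev_ker_lift.
Qed.

(** Points with all b_i nonzero are exactly suited to the characters, which divide by the w_i = b_i,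
    and they suffice to recognize the zero function. *)
Lemma orbit_generic_eq0 (f : FunO) :
  (forall (x : orbit) (b a : 'I_n -> C), rank_one_point b a (val x) -> (forall i, b i != 0) ->
     \sum_i b i * a i = alpha0 -> fun_val f x = 0) -> f = 0.
Proof.
move=> H; have [F FE] := fun_ev_surj f; rewrite -FE; apply/(fun_ev_eq0 n_gt1 a0) => b a b0 a0'.
set s := \sum_m b m * a m.
have s0 : s != 0.
  apply: lt0r_neq0; rewrite /s (bigD1 (Ordinal (ltnW n_gt1))) //= ltr_pwDl ?mulr_gt0 //.
  by apply: sumr_ge0 => i _; rewrite mulr_ge0 ?ltW.
have ba : \sum_i b i * (a i * (alpha0 / s)) = alpha0.
  by rewrite (eq_bigr _ (fun i _ => mulrA _ _ _)) -mulr_suml -/s mulrCA mulfV // mulr1.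
have bn i : b i != 0 by apply: lt0r_neq0.
have [x Ox xE] := rank_one_orbit (n_gt1 := n_gt1) a0 (bn _) ba.
have := H (exist _ x (mem_set Ox)) _ _ xE bn ba; rewrite -FE.
rewrite (fun_ev_val F (x := exist _ x (mem_set Ox)) xE) => <-.
congr (free_ev (label_val _) _).
by apply/funext => i; apply/funext => j; rewrite -mulrA.
Qed.

Let diag_unique (d e : nat -> C) : (forall i, (0 < i < n)%N -> d i - d i.+1 = e i - e i.+1) ->
  \sum_(1 <= i < n.+1) d i = \sum_(1 <= i < n.+1) e i -> forall i, (0 < i <= n)%N -> d i = e i.
Proof.
move=> dE sE.
have c i : (0 < i <= n)%N -> d i - e i = d 1%N - e 1%N.
  elim: i => // i IH; have [->|i0] := posnP i => // iN.
  rewrite -IH; last by lia.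
  have := dE i; rewrite i0 iN => /(_ isT) E.
  have -> : d i = d i.+1 + (e i - e i.+1) by rewrite -E addrC subrK.
  by ring.
have d1 : d 1%N = e 1%N.
  have : \sum_(1 <= i < n.+1) (d i - e i) = 0 by rewrite sumrB sE subrr.
  rewrite (eq_big_nat _ _ (fun i (ip : (1 <= i < n.+1)%N) => c i ip)) sumr_const_nat subn1 /= => /eqP; rewrite mulrn_eq0 subr_eq0.
  by case/orP => [/eqP n0|/eqP //]; move: n_gt3; rewrite n0.
by move=> i /c /eqP; rewrite d1 subrr subr_eq0 => /eqP.
Qed.

Definition coord_fun (i j : nat) : FunO := fun_ev (xC n alpha0 i j).

Lemma coord_funE (x : orbit) b a : rank_one_point b a (val x) -> \sum_i b i * a i = alpha0 ->
  forall i j : 'I_n, fun_val (coord_fun i.+1 j.+1) x = b i * a j.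
Proof.
move=> xE ba i j; rewrite (fun_ev_val _ xE).
set E : T -> regular_alg C := free_ev _.
have Egen l : E (<< fmu l >>) = label_val (fun i j => b i * a j) l := free_ev_gen _ _.
have [ij|ij] := eqVneq i j; last first.
  pose p : {p : 'I_n * 'I_n | p.1 != p.2} := exist _ (i, j) ij.
  by apply: (eq_trans (congr1 E (esym (gen_xC alpha0 p)))); apply: (Egen (inl p)).
rewrite -{}ij -(nat_extE (fun i => b i * a i) i).
apply: (diag_unique (d := fun k => E (xC n alpha0 k k))) => [k k0||]; last exact: ltn_ord.
  have [m [tE <-]] := tq_label C n_gt3 k0.
  transitivity (E (tC C n m.+1)).
    have -> : tC C n m.+1 = xC n alpha0 m.+1 m.+1 - xC n alpha0 m.+2 m.+2 by apply: tCE.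
    by symmetry; apply: (raddfB E).
  rewrite -(gen_tC C m) Egen.
  exact: (congr2 (fun u v => u - v) (esym (nat_extE (fun i => b i * a i) (cart_lo m)))
    (esym (nat_extE (fun i => b i * a i) (cart_hi m)))).
rewrite sum_nat_ext ba; transitivity (E (\sum_(1 <= k < n.+1) xC n alpha0 k k)).
  by symmetry; apply: (raddf_sum E).
have -> : \sum_(1 <= k < n.+1) xC n alpha0 k k = scal T alpha0.
  by rewrite (eq_bigr _ (fun k _ => xC_diag n alpha0 k)) sum_diag_coord.
by apply: (eq_trans (free_evC (A := regular_alg C) _ _)).
Qed.

End Flatness.

(** * The Kirillov-Kostant-Souriau and R-matrix brackets *)

Section CoordinateBrackets.
Variables (C : numFieldType) (n : nat) (alpha0 : C).
Hypothesis n_gt3 : (3 < n)%N.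
Hypothesis a0 : alpha0 != 0.
Let n_gt1 : (1 < n)%N. Proof. lia. Qed.
Notation FunO := (FunO n alpha0).
Notation orbit := (coadjoint_orbit (n := n) alpha0).
Notation coord_fun := (@coord_fun C n alpha0).

Definition kks_gen (x x' : label n) : FunO :=
  label_val2 (fun i j k l : 'I_n => kks_coord coord_fun i.+1 j.+1 k.+1 l.+1) x x'.
Definition r_gen (x x' : label n) : FunO :=
  label_val2 (fun i j k l : 'I_n => r_coord n coord_fun i.+1 j.+1 k.+1 l.+1) x x'.

Lemma label_val2_morph (A B : pzRingType) (f : {rmorphism A -> B}) (F : 'I_n -> 'I_n -> 'I_n -> 'I_n -> A) x x' :
  f (label_val2 F x x') = label_val2 (fun i j k l => f (F i j k l)) x x'.
Proof. by rewrite /label_val2 label_val_morph; apply: eq_label_val => i j; rewrite label_val_morph. Qed.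

Lemma label_val2_sum (A : pzRingType) (r : seq nat) (F : nat -> 'I_n -> 'I_n -> 'I_n -> 'I_n -> A) x x' :
  label_val2 (fun i j k l => \sum_(p <- r) F p i j k l) x x' = \sum_(p <- r) label_val2 (F p) x x'.
Proof. by case: x => [p|m]; case: x' => [p'|m']; rewrite /label_val2 /= ?sumrB. Qed.

Lemma kks_coord_morph (A B : pzRingType) (f : {rmorphism A -> B}) X i j k l :
  f (kks_coord X i j k l) = kks_coord (fun i j => f (X i j)) i j k l.
Proof. by rewrite /kks_coord rmorphB !rmorphM !rmorph_nat. Qed.

Lemma r_coord_morph (A B : pzRingType) (f : {rmorphism A -> B}) X i j k l :
  f (r_coord n X i j k l) = r_coord n (fun i j => f (X i j)) i j k l.
Proof.
rewrite /r_coord rmorph_sum; apply: eq_bigr => p _; rewrite rmorph_sum; apply: eq_bigr => q _.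
by rewrite !(rmorphB, rmorphM, rmorphMn).
Qed.

Let inr_n p := (0 < p <= n)%N.

Lemma r_coord_ext (A : pzRingType) (X X' : nat -> nat -> A) i j k l :
  inr_n i -> inr_n j -> inr_n k -> inr_n l ->
  (forall p q, inr_n p -> inr_n q -> X p q = X' p q) -> r_coord n X i j k l = r_coord n X' i j k l.
Proof.
move=> i0 j0 k0 l0 XX; apply: eq_big_nat => p p0; apply: eq_big_nat => q /andP[q1 q2].
have q0 : inr_n q by rewrite /inr_n; lia.
by rewrite !XX.
Qed.

Lemma kks_coord_ext (A : pzRingType) (X X' : nat -> nat -> A) i j k l :
  inr_n i -> inr_n j -> inr_n k -> inr_n l ->
  (forall p q, inr_n p -> inr_n q -> X p q = X' p q) -> kks_coord X i j k l = kks_coord X' i j k l.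
Proof. by move=> i0 j0 k0 l0 XX; rewrite /kks_coord !XX. Qed.

Section AtPoint.
Variables (x : orbit) (b a : 'I_n -> C) (X : nat -> nat -> C).
Hypothesis xE : rank_one_point b a (val x).
Hypothesis ba : \sum_i b i * a i = alpha0.
Hypothesis XE : forall i j : 'I_n, X i.+1 j.+1 = b i * a j.

Let coordX p q : inr_n p -> inr_n q -> eval_at x (coord_fun p q) = X p q.
Proof.
case: p q => [|p] [|q] // p0 q0.
by have := coord_funE n_gt3 a0 xE ba (Ordinal p0) (Ordinal q0); rewrite -XE.
Qed.

Lemma kks_genE l l' : fun_val (kks_gen l l') x =
  label_val2 (fun i j k l : 'I_n => kks_coord X i.+1 j.+1 k.+1 l.+1) l l'.
Proof.
apply: (eq_trans (label_val2_morph (eval_at x) _ _ _)); apply: eq_label_val2 => i j k m.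
apply: (eq_trans (kks_coord_morph (eval_at x) _ _ _ _ _)).
by apply: kks_coord_ext; try exact: ltn_ord; exact: coordX.
Qed.

Lemma r_genE l l' : fun_val (r_gen l l') x =
  label_val2 (fun i j k l : 'I_n => r_coord n X i.+1 j.+1 k.+1 l.+1) l l'.
Proof.
apply: (eq_trans (label_val2_morph (eval_at x) _ _ _)); apply: eq_label_val2 => i j k m.
apply: (eq_trans (r_coord_morph (eval_at x) _ _ _ _ _)).
by apply: r_coord_ext; try exact: ltn_ord; exact: coordX.
Qed.

Let form (M : 'M[C]_n) : C := \sum_i \sum_j b i * M i j * a j.

Let formB M N : form (M - N) = form M - form N.
Proof.
rewrite /form -sumrB; apply: eq_bigr => i _; rewrite -sumrB; apply: eq_bigr => j _.
by rewrite !mxE mulrBr mulrBl.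
Qed.

Let form_unit p q : inr_n p -> inr_n q -> form (mxunit C n p q) = X p q.
Proof. by case: p q => [|p] [|q] // p0 q0; rewrite (XE (Ordinal p0) (Ordinal q0)) -sum_mxunit. Qed.

Lemma mxunitM (p q r s : nat) : inr_n q -> mxunit C n p q *m mxunit C n r s = (q == r)%:R *: mxunit C n p s.
Proof.
case: q => [|q] // q0; apply/matrixP => i j; rewrite !mxE (bigD1 (Ordinal q0)) //= !mxE /= eqxx andbT.
rewrite big1 ?addr0 => [|k kq].
  by rewrite -!natrM !mulnb andbCA.
by rewrite !mxE eqSS (_ : (k == q :> nat) = false) ?andbF ?mul0r //; apply/negbTE.
Qed.

Lemma label_mxE l : label_mx C l = label_val (fun i j : 'I_n => mxunit C n i.+1 j.+1) l.
Proof. by case: l. Qed.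

Let formZ c M : form (c *: M) = form M * c.
Proof.
rewrite /form mulr_suml; apply: eq_bigr => i _; rewrite mulr_suml; apply: eq_bigr => j _.
by rewrite mxE; ring.
Qed.

Let form_label (f : 'I_n -> 'I_n -> 'M[C]_n) l : form (label_val f l) = label_val (fun i j => form (f i j)) l.
Proof. by case: l => [p|m] //=; rewrite formB. Qed.

Lemma tr_comm (M N : 'M[C]_n) : \tr (M *m N - N *m M) = 0.
Proof. by rewrite raddfB /= mxtrace_mulC subrr. Qed.

Lemma orbit_lie (M N : 'M[C]_n) : \tr M = 0 -> \tr N = 0 ->
  val x (lie (to_sl M) (to_sl N)) = form (M *m N) - form (N *m M).
Proof. by move=> M0 N0; rewrite /lie !to_slK // (xE (tr_comm M N)) -formB. Qed.

Lemma orbit_lie_kks l l' : val x (lie (sl_basis C l) (sl_basis C l')) = fun_val (kks_gen l l') x.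
Proof.
rewrite kks_genE !sl_basisE orbit_lie ?tr_label_mx // !label_mxE.
have mE (f g : 'I_n -> 'I_n -> 'M[C]_n) u v :
   form (label_val f u *m label_val g v) = label_val2 (fun i j k m => form (f i j *m g k m)) u v.
  rewrite -[_ *m _]/(label_val f u * label_val g v) -label_val2M /label_val2 form_label.
  by apply: eq_label_val => i j; rewrite form_label.
rewrite !mE [X in _ - X]label_val2C -label_val2B; apply: eq_label_val2 => i j k m.
have oP (r : 'I_n) : inr_n r.+1 by apply: ltn_ord.
by rewrite !mxunitM // !formZ !form_unit // /kks_coord [m.+1 == _]eq_sym.
Qed.

Lemma orbit_lie_root p q l : inr_n p -> inr_n q -> p != q ->
  val x (lie (root_vector C n p q) (sl_basis C l)) =
  label_val (fun i j : 'I_n => X p j.+1 *+ (q == i.+1) - X i.+1 q *+ (j.+1 == p)) l.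
Proof.
move=> p0 q0 pq; rewrite /root_vector sl_basisE orbit_lie ?tr_label_mx //; last first.
  by case: p q p0 q0 pq => [|p] [|q] // p0 q0 pq; rewrite (@tr_mxunit C n (Ordinal p0) (Ordinal q0)) -val_eqE /= -eqSS (negPf pq).
rewrite label_mxE; set U := mxunit C n p q.
have -> : U *m label_val (fun i j : 'I_n => mxunit C n i.+1 j.+1) l =
    label_val (fun i j : 'I_n => U *m mxunit C n i.+1 j.+1) l.
  by case: l => [s|m] //=; rewrite mulmxBr.
have -> : label_val (fun i j : 'I_n => mxunit C n i.+1 j.+1) l *m U =
    label_val (fun i j : 'I_n => mxunit C n i.+1 j.+1 *m U) l.
  by case: l => [s|m] //=; rewrite mulmxBl.
rewrite !form_label -label_valB; apply: eq_label_val => i j.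
have oP (r : 'I_n) : inr_n r.+1 by apply: ltn_ord.
by rewrite /U !mxunitM // !formZ !form_unit // !mulr_natr.
Qed.

Lemma r_gen_lie l l' : fun_val (r_gen l l') x =
  \sum_(1 <= p < n.+1) \sum_(p.+1 <= q < n.+1)
   (val x (lie (root_vector C n p q) (sl_basis C l)) * val x (lie (root_vector C n q p) (sl_basis C l'))
   - val x (lie (root_vector C n q p) (sl_basis C l)) * val x (lie (root_vector C n p q) (sl_basis C l'))).
Proof.
rewrite r_genE /label_val2.
transitivity (\sum_(1 <= p < n.+1) \sum_(p.+1 <= q < n.+1)
   label_val2 (fun i j k m : 'I_n =>
     ((X p j.+1 *+ (q == i.+1) - X i.+1 q *+ (j.+1 == p)) * (X q m.+1 *+ (p == k.+1) - X k.+1 p *+ (m.+1 == q))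
   - (X q j.+1 *+ (p == i.+1) - X i.+1 p *+ (j.+1 == q)) * (X p m.+1 *+ (q == k.+1) - X k.+1 q *+ (m.+1 == p)))) l l').
  apply: (eq_trans (label_val2_sum _ _ _ _)); apply: eq_bigr => p _.
  exact: label_val2_sum.
apply: eq_big_nat => p p0; apply: eq_big_nat => q /andP[q1 q2].
have q0 : inr_n q by rewrite /inr_n; lia.
have pq : p != q by apply/eqP; lia.
by rewrite !orbit_lie_root // 1?eq_sym // label_val2B !label_val2M.
Qed.

End AtPoint.
End CoordinateBrackets.

(** * The Killing form as 2 n times the trace form *)

Section KillingForm.
Variables (C : fieldType) (n : nat).
Local Notation M := 'M[C]_n.

(** A map defined on all matrices with values in sl(n) has the same trace on the full matrix space
    as on sl(n), and on the former it is computed with matrix units. *)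
Lemma trace_sl (g : M -> sl C n) : (forall c u v, g (c *: u + v) = c *: g u + g v) ->
  \sum_i coord (vbasis {: sl C n}) i (g (mx_of (vbasis {: sl C n})`_i)) =
  \sum_i \sum_j mx_of (g (delta_mx i j)) i j.
Proof.
move=> gl; pose G : {linear M -> sl C n} := HB.pack g (GRing.isLinear.Build _ _ _ _ g gl).
rewrite -[g]/(G : M -> sl C n).
have E i : coord (vbasis {: sl C n}) i (G (mx_of (vbasis {: sl C n})`_i)) =
  \sum_p \sum_q mx_of (vbasis {: sl C n})`_i p q * coord (vbasis {: sl C n}) i (G (delta_mx p q)).
  rewrite {1}[mx_of _]matrix_sum_delta linear_sum linear_sum; apply: eq_bigr => p _.
  by rewrite linear_sum linear_sum; apply: eq_bigr => q _; rewrite linearZ linearZ.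
rewrite (eq_bigr _ (fun i _ => E i)) exchange_big; apply: eq_bigr => p _.
rewrite exchange_big; apply: eq_bigr => q _.
rewrite [in RHS](coord_vbasis (memvf (G (delta_mx p q)))) /mx_of linear_sum summxE.
by apply: eq_bigr => i _; rewrite linearZ mxE mulrC.
Qed.

Lemma killing_tr (Y Z : M) : \tr Y = 0 -> \tr Z = 0 ->
  killing (to_sl Y) (to_sl Z) = \tr (Y *m Z) *+ (2 * n).
Proof.
move=> Y0 Z0.
have tc (U V : M) : \tr (U *m V - V *m U) = 0 by rewrite raddfB /= mxtrace_mulC subrr.
pose ad (U V : M) := U *m V - V *m U.
have adl U c u v : ad U (c *: u + v) = c *: ad U u + ad U v.
  by rewrite /ad mulmxDr mulmxDl -scalemxAr -scalemxAl scalerBr opprD addrACA.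
pose g (V : M) := to_sl (ad Y (ad Z V)).
have gl c u v : g (c *: u + v) = c *: g u + g v by rewrite /g !adl /to_sl linearP.
rewrite /killing (eq_bigr (fun i => coord (vbasis {: sl C n}) i (g (mx_of (vbasis {: sl C n})`_i)))); last first.
  by move=> i _; rewrite /lie !to_slK.
rewrite trace_sl //.
have gE i j : mx_of (g (delta_mx i j)) i j =
    (Y *m Z) i i - Y i i * Z j j - Z i i * Y j j + (Z *m Y) j j.
  rewrite /g to_slK ?tc // /ad.
  have dE (U V : M) : (U *m delta_mx i j *m V) i j = U i i * V j j.
    rewrite mxE (bigD1 j) //= big1 ?addr0 => [|k kj].
      rewrite mxE (bigD1 i) //= big1 ?addr0 => [|k ki]; first by rewrite mxE !eqxx mulr1.
      by rewrite mxE (negPf ki) mulr0.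
    rewrite mxE big1 ?mul0r // => r _.
    by rewrite mxE (negPf kj) andbF mulr0.
  have -> : Y *m (Z *m delta_mx i j - delta_mx i j *m Z) - (Z *m delta_mx i j - delta_mx i j *m Z) *m Y =
      (Y *m Z *m delta_mx i j *m 1%:M - Y *m delta_mx i j *m Z)
      - (Z *m delta_mx i j *m Y - 1%:M *m delta_mx i j *m (Z *m Y)).
    by rewrite mulmxBr mulmxBl mulmx1 mul1mx !mulmxA.
  have subE (U V : M) : (U - V) i j = U i j - V i j by rewrite !mxE.
  by rewrite !subE !dE !(mxE _ _ i i) !(mxE _ _ j j) !eqxx mulr1 mul1r opprD opprK addrA.
have sumC (c : C) : \sum_(i < n) c = c *+ n by rewrite sumr_const card_ord.
transitivity (\sum_i \sum_j (((Y *m Z) i i + (Z *m Y) j j) - (Y i i * Z j j + Z i i * Y j j))).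
  apply: eq_bigr => i _; apply: eq_bigr => j _; rewrite gE.
  by move: ((Y *m Z) i i) ((Z *m Y) j j) (Y i i) (Z i i) (Y j j) (Z j j) => *; ring.
rewrite (eq_bigr (fun i => ((Y *m Z) i i *+ n + \tr (Z *m Y)) - (Y i i * \tr Z + Z i i * \tr Y))); last first.
  move=> i _; rewrite sumrB !big_split /= sumC /mxtrace -!mulr_sumr //.
rewrite Y0 Z0 (eq_bigr (fun i => (Y *m Z) i i *+ n + \tr (Z *m Y))); last first.
  by move=> i _; rewrite !mulr0 addr0 subr0.
by rewrite big_split /= sumC sumrMnl [\tr (Z *m Y)]mxtrace_mulC mul2n -addnn mulrnDr.
Qed.

End KillingForm.

Section PolynomialBrackets.
Variables (C : numFieldType) (n : nat) (alpha0 : C).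
Notation FunO := (FunO n alpha0).
Notation orbit := (coadjoint_orbit (n := n) alpha0).
Notation restrict := (@restrict_orbit C n alpha0).

Lemma mpoly_derivation (m : nat) (v : 'I_m -> C) (D : mpoly m C -> C) :
  (forall F G, D (F + G) = D F + D G) -> (forall F G, D (F * G) = F.@[v] * D G + D F * G.@[v]) ->
  (forall c, D (mpolyC m c) = 0) -> forall F, D F = \sum_i (mderiv i F).@[v] * D 'X_i.
Proof.
move=> DD DM DC; pose S F := D F = \sum_i (mderiv i F).@[v] * D 'X_i.
have SD F G : S F -> S G -> S (F + G).
  rewrite /S DD => -> ->; rewrite -big_split; apply: eq_bigr => i _.
  by rewrite mderivD mevalD mulrDl.
have SC c : S (mpolyC m c) by rewrite /S DC big1 // => i _; rewrite mderivC meval0 mul0r.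
have SM F G : S F -> S G -> S (F * G).
  rewrite /S DM => -> ->; rewrite mulr_sumr mulr_suml -big_split /=; apply: eq_bigr => i _.
  by rewrite mderivM mevalD !mevalM; move: (D _) => d; ring.
have SX i : S 'X_i.
  rewrite /S (bigD1 i) //= mderivX mnm1E eqxx big1 ?addr0 => [|j ji]; last first.
    by rewrite mderivX mnm1E eq_sym (negPf ji) scale0r meval0 mul0r.
  have -> : (U_(i) - U_(i))%MM = 0%MM by apply/mnmP => j; rewrite mnmBE subnn mnm0E.
  by rewrite mpolyX0 scale1r meval1 mul1r.
elim/mpolyind => [|c m' p _ _ Sp]; first by rewrite -mpolyC0; exact: SC.
apply: (SD) => //; rewrite -mul_mpolyC; apply: (SM) => //; rewrite mpolyXE_id.
elim/big_ind: _ => [||i _]; [rewrite -mpolyC1; exact: SC | exact: SM |].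
elim: (m' i) => [|r IH]; first by rewrite expr0 -mpolyC1; exact: SC.
by rewrite exprS; apply: SM.
Qed.

Lemma restrictD F G : restrict (F + G) = restrict F + restrict G.
Proof. by apply: funO_eq => x; rewrite /= /pf_eval mevalD. Qed.
Lemma restrictM F G : restrict (F * G) = restrict F * restrict G.
Proof. by apply: funO_eq => x; rewrite /= /pf_eval mevalM. Qed.

(** A Poisson bracket is a derivation in each argument, so at a point it is determined by the
    differentials of F and G and by its values on the linear generators. *)
Lemma poisson_polynomial (P : FunO -> FunO -> FunO) F G (x : orbit) : is_poisson P ->
  fun_val (P (restrict F) (restrict G)) x =
  \sum_i \sum_j (mderiv i F).@[lin_coord (val x)] * ((mderiv j G).@[lin_coord (val x)] *
     fun_val (P (fun_gen alpha0 (enum_val i)) (fun_gen alpha0 (enum_val j))) x).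
Proof.
move=> [PD PZ PS PL _].
have P1 g : P 1 g = 0.
  apply: (addrI (P 1 g)); rewrite addr0 -{3}[1 : FunO]mulr1 PL mulr1 mul1r //.
have PC c g : P (restrict (mpolyC #|label n| c)) g = 0.
  by rewrite -[restrict _]/(scal FunO c) -[scal FunO c]mulr1 PZ P1 mulr0.
have evD f g : fun_val (f + g : FunO) x = fun_val f x + fun_val g x by [].
have evM f g : fun_val (f * g : FunO) x = fun_val f x * fun_val g x by [].
have left g F' : fun_val (P (restrict F') g) x =
    \sum_i (mderiv i F').@[lin_coord (val x)] * fun_val (P (fun_gen alpha0 (enum_val i)) g) x.
  rewrite (@mpoly_derivation _ (lin_coord (val x)) (fun F => fun_val (P (restrict F) g) x)).
  - by apply: eq_bigr => i _; rewrite /fun_gen enum_valK.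
  - by move=> F1 F2; rewrite restrictD PD evD.
  - by move=> F1 F2; rewrite restrictM PL evD !evM.
  - by move=> c; rewrite PC.
rewrite left; apply: eq_bigr => i _; rewrite -mulr_sumr; congr (_ * _).
rewrite PS -[LHS]/(- fun_val _ x) left -sumrN; apply: eq_bigr => j _.
by rewrite -mulrN; congr (_ * _); rewrite [in RHS]PS.
Qed.

Lemma lie_sumZ (m : nat) (c : 'I_m -> C) (z : 'I_m -> sl C n) y :
  lie y (\sum_i c i *: z i) = \sum_i c i *: lie y (z i).
Proof.
have mZ d u : mx_of (d *: u) = d *: mx_of u :> 'M[C]_n := linearZ _ _.
have mS : mx_of (\sum_i c i *: z i) = \sum_i c i *: mx_of (z i) :> 'M[C]_n.
  by rewrite /mx_of linear_sum; apply: eq_bigr => i _; apply: mZ.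
rewrite /lie mS mulmx_sumr mulmx_suml -sumrB /to_sl linear_sum; apply: eq_bigr => i _.
by rewrite -scalemxAr -scalemxAl -scalerBr linearZ.
Qed.

Lemma rho_pf F y (x : sl_dual C n) : rho y F x =
  \sum_i (mderiv i F).@[lin_coord x] * x (lie y (sl_basis C (enum_val i))).
Proof. by rewrite /rho /pf_diff lie_sumZ linear_sum; apply: eq_bigr => i _; rewrite linearZ. Qed.

Lemma lie_anti (y z : sl C n) : lie y z = - lie z y.
Proof. by rewrite /lie -[RHS]linearN opprB. Qed.

Lemma lie_pf_diff F G (x : sl_dual C n) : x (lie (pf_diff F x) (pf_diff G x)) =
  \sum_i \sum_j (mderiv i F).@[lin_coord x] * ((mderiv j G).@[lin_coord x] *
    x (lie (sl_basis C (enum_val i)) (sl_basis C (enum_val j)))).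
Proof.
have lie_sumZl (m : nat) (c : 'I_m -> C) (z : 'I_m -> sl C n) y :
    lie (\sum_i c i *: z i) y = \sum_i c i *: lie (z i) y.
  by rewrite lie_anti lie_sumZ -sumrN; apply: eq_bigr => i _; rewrite -scalerN -lie_anti.
rewrite {1}/pf_diff lie_sumZl linear_sum; apply: eq_bigr => i _.
rewrite linearZ -mulr_sumr; congr (_ * _); exact: rho_pf.
Qed.

End PolynomialBrackets.

Lemma quot_commutator (k : comNzRingType) (B : alg k) (I : ideal B) (c d : k) (x y u v : B) :
  quot_pr I x * quot_pr I y - quot_pr I y * quot_pr I x =
    scal (quot_alg I) c * quot_pr I u + scal (quot_alg I) d * quot_pr I v ->
  I (x * y - y * x - (scal B c * u + scal B d * v)).
Proof.
move=> E; apply/to_quotP; rewrite to_quotB to_quotD.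
have qM a b : to_quot I (a * b) = quot_pr I a * quot_pr I b := rmorphM (quot_pr I) a b.
by rewrite !qM E.
Qed.

(** * Identification of the pencil *)

Section Assembly.
Variables (C : numFieldType) (n : nat) (alpha0 : C) (q_gt1 : bool).
Hypothesis n_gt3 : (3 < n)%N.
Hypothesis a0 : alpha0 != 0.
Let n_gt1 : (1 < n)%N. Proof. lia. Qed.
Notation T := (tens_C C n).
Notation That := (tens_hat C n).
Notation I := (Ideal (@defining_is_ideal C n alpha0 q_gt1)).
Notation Ahq := (Ahq n alpha0 q_gt1).
Notation FunO := (FunO n alpha0).
Notation orbit := (coadjoint_orbit (n := n) alpha0).
Notation gen := (@fun_gen C n alpha0).
Notation sc := (scal FunO).
Notation kks_gen := (@kks_gen C n alpha0).
Notation r_gen := (@r_gen C n alpha0).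
Let sigma := s01 n alpha0 q_gt1 + alpha0.

Section Brackets.
Variable p : {rmorphism Ahq -> FunO}.
Hypothesis pE : forall z : That, p (quot_pr I z) = fun_ev alpha0 (fcoef (fcoef z 0) 0).
Variables P1 P2 : FunO -> FunO -> FunO.
Hypothesis fob : first_order_brackets p P1 P2.

Lemma quot_gen l : p (Ahq_gen alpha0 q_gt1 l) = gen l.
Proof.
rewrite /Ahq_gen pE /gen_hat !fcoef_fpsC0; exact: free_ev_gen.
Qed.

Let Ahq_ex (u : Ahq) : exists z : That, u = quot_pr I z.
Proof. by exists (repr u); rewrite -[LHS]to_quot_repr. Qed.

(** The defect of the commutator formula lies in the defining ideal, so it acts as 0 for every
    choice of parameters. Taking w = b and y_i = b_i a_i evaluates both first-order terms at the
    point with entries b_i a_j. *)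
Lemma brackets_gen l l' : P1 (gen l) (gen l') = sc (alpha0 / n%:R) * kks_gen l l' /\
  P2 (gen l) (gen l') = sc sigma * kks_gen l l' + r_gen l l'.
Proof.
rewrite -!quot_gen; have [u [v [E <- <-]]] := fob (Ahq_gen alpha0 q_gt1 l) (Ahq_gen alpha0 q_gt1 l').
have [u' uE] := Ahq_ex u; have [v' vE] := Ahq_ex v.
have Iz : in_defining_ideal alpha0 q_gt1 (gen_hat C l * gen_hat C l' - gen_hat C l' * gen_hat C l
    - (scal That (hbar C) * u' + scal That (nu C) * v')).
  by rewrite uE vE in E; exact: (quot_commutator E).
rewrite uE vE !pE.
have key (x : orbit) (b a : 'I_n -> C) : rank_one_point b a (val x) -> (forall i, b i != 0) ->
  \sum_i b i * a i = alpha0 ->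
  fun_val (fun_ev alpha0 (fcoef (fcoef u' 0) 0)) x = alpha0 / n%:R * fun_val (kks_gen l l') x /\
  fun_val (fun_ev alpha0 (fcoef (fcoef v' 0) 0)) x = sigma * fun_val (kks_gen l l') x + fun_val (r_gen l l') x.
  move=> xE b0 ba.
  pose y := nat_ext (fun i => b i * a i).
  have w0 k : (0 < k <= n)%N -> nat_ext b k != 0.
    exact: (nat_ext_ord (P := fun c => c != 0)).
  have sy : \sum_(1 <= k < n.+1) y k = alpha0 by rewrite sum_nat_ext.
  have XE (i j : 'I_n) : torus_point (nat_ext b) y i.+1 j.+1 = b i * a j.
    rewrite /torus_point /y !nat_extE; have bj := b0 j; field; exact: bj.
  have ptE : at_point (n := n) (torus_point (nat_ext b) y) = (fun i j => b i * a j).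
    by apply/funext => i; apply/funext => j; exact: XE.
  have := commutator_point_values n_gt3 w0 sy (op_hat_defining_ideal y n_gt3 a0 Iz).
  rewrite ptE -(kks_genE n_gt3 a0 xE ba XE) -(r_genE n_gt3 a0 xE ba XE) => -[e1 e2].
  by rewrite !(fun_ev_val _ xE).
have fB (f g : FunO) x : fun_val (f - g : FunO) x = fun_val f x - fun_val g x by [].
have fD (f g : FunO) x : fun_val (f + g : FunO) x = fun_val f x + fun_val g x by [].
have fZ c (f : FunO) x : fun_val (sc c * f : FunO) x = c * fun_val f x.
  by rewrite -[LHS]/(fun_val (sc c) x * fun_val f x); congr (_ * _); exact: eval_at_scal.
split; apply/eqP; rewrite -subr_eq0; apply/eqP; apply: (orbit_generic_eq0 n_gt3 a0) => x b a xE b0 ba.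
  by rewrite fB fZ (key x b a xE b0 ba).1 subrr.
by rewrite fB fD fZ (key x b a xE b0 ba).2 subrr.
Qed.

End Brackets.

Let n0 : n%:R != 0 :> C. Proof. by rewrite pnatr_eq0; apply/eqP; lia. Qed.

Let fD (f g : FunO) x : fun_val (f + g : FunO) x = fun_val f x + fun_val g x. Proof. by []. Qed.
Let fZ c (f : FunO) x : fun_val (sc c * f : FunO) x = c * fun_val f x.
Proof. by rewrite -[LHS]/(fun_val (sc c) x * fun_val f x); congr (_ * _); exact: eval_at_scal. Qed.
Let scM c d (f : FunO) : sc c * (sc d * f) = sc (c * d) * f.
Proof. by rewrite mulrA -(rmorphM sc). Qed.
Let scD c d (f : FunO) : sc c * f + sc d * f = sc (c + d) * f.
Proof. by rewrite -mulrDl -(raddfD sc). Qed.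

Lemma is_KKS_gen P : is_poisson P -> (forall l l', P (gen l) (gen l') = kks_gen l l') -> is_KKS P.
Proof.
move=> PP Pg F G x; rewrite (poisson_polynomial F G x PP) lie_pf_diff.
have [b [a [ba xE]]] := orbit_rank_one n_gt1 (set_mem (valP x)).
have XE (i j : 'I_n) : nat_ext b i.+1 * nat_ext a j.+1 = b i * a j by rewrite !nat_extE.
apply: eq_bigr => i _; apply: eq_bigr => j _; rewrite Pg.
by rewrite (orbit_lie_kks n_gt3 a0 xE ba (X := fun i j => nat_ext b i * nat_ext a j) XE).
Qed.

Let sum_exchange3 (m : nat) (r : seq nat) (H : 'I_m -> 'I_m -> nat -> C) :
  \sum_i \sum_j \sum_(q <- r) H i j q = \sum_(q <- r) \sum_i \sum_j H i j q.
Proof. by rewrite [RHS]exchange_big; apply: eq_bigr => i _; rewrite exchange_big. Qed.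

Lemma is_R_gen P : is_poisson P ->
  (forall l l', P (gen l) (gen l') = sc (2 * n)%:R^-1 * r_gen l l') -> is_R_bracket P.
Proof.
move=> PP Pg F G x; rewrite (poisson_polynomial F G x PP).
have [b [a [ba xE]]] := orbit_rank_one n_gt1 (set_mem (valP x)).
have XE (i j : 'I_n) : nat_ext b i.+1 * nat_ext a j.+1 = b i * a j by rewrite !nat_extE.
pose r q s l := val x (lie (root_vector C n q s) (sl_basis C l)).
pose c : C := (2 * n)%:R^-1.
have rE l l' : fun_val (P (gen l) (gen l')) x =
   \sum_(1 <= q < n.+1) \sum_(q.+1 <= s < n.+1) c * (r q s l * r s q l' - r s q l * r q s l').
  rewrite Pg fZ (r_gen_lie n_gt3 a0 xE ba (X := fun i j => nat_ext b i * nat_ext a j) XE) mulr_sumr.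
  by apply: eq_bigr => q _; rewrite mulr_sumr.
pose f i := (mderiv i F).@[lin_coord (val x)]; pose g i := (mderiv i G).@[lin_coord (val x)].
transitivity (\sum_i \sum_j \sum_(1 <= q < n.+1) \sum_(q.+1 <= s < n.+1)
  f i * (g j * (c * (r q s (enum_val i) * r s q (enum_val j) - r s q (enum_val i) * r q s (enum_val j))))).
  apply: eq_bigr => i _; apply: eq_bigr => j _; rewrite rE !mulr_sumr.
  by apply: eq_bigr => q _; rewrite !mulr_sumr.
rewrite sum_exchange3; apply: eq_big_nat => q q0.
rewrite sum_exchange3; apply: eq_big_nat => s /andP[s1 s2].
have kE : killing (root_vector C n q s) (root_vector C n s q) = (2 * n)%:R.
  have s0 : (0 < s <= n)%N by lia.
  have qs : q != s by apply/eqP; lia.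
  have trU u v : (0 < u <= n)%N -> (0 < v <= n)%N -> \tr (mxunit C n u v) = (u == v)%:R.
    by case: u v => [|u] [|v] // u0 v0; rewrite (@tr_mxunit C n (Ordinal u0) (Ordinal v0)).
  have t1 : \tr (mxunit C n q s) = 0 by rewrite trU // (negPf qs).
  have t2 : \tr (mxunit C n s q) = 0 by rewrite trU // eq_sym (negPf qs).
  rewrite /root_vector killing_tr //.
  by rewrite mxunitM // eqxx scale1r trU // eqxx.
rewrite kE !rho_pf !big_distrlr /= -sumrB mulr_suml; apply: eq_bigr => i _.
rewrite -sumrB mulr_suml; apply: eq_bigr => j _.
by rewrite -/(f i) -/(g j) -!/(r _ _ _) -/c; ring.
Qed.

Theorem main_numField :
  exists p : {rmorphism Ahq -> FunO},
    [/\ forall (b : label n) (x : orbit),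
          fun_val (p (Ahq_gen alpha0 q_gt1 b)) x = val x (sl_basis C b),
        flat_deformation2 p,
        exists2 pq : {rmorphism Aq n alpha0 q_gt1 -> FunO},
          forall a, pq (to_Aq n alpha0 q_gt1 a) = p a & flat_deformation pq &
        exists P_hbar P_nu P_KKS P_R : FunO -> FunO -> FunO,
          [/\ first_order_brackets p P_hbar P_nu,
              is_KKS P_KKS, is_R_bracket P_R,
              forall Q, in_pencil P_hbar P_nu Q -> is_poisson Q &
              forall Q, in_pencil P_hbar P_nu Q <-> in_pencil P_KKS P_R Q]].
Proof.
have [p [pE flat]] := Ahq_flat q_gt1 n_gt3 a0; exists p.
have mulAC (f g : FunO) : f * g = g * f by exact: (@mulrC (@orbit_fun C n alpha0)).
have [P1 [P2 fob]] := first_order_exists flat mulAC.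
have gens := brackets_gen pE fob.
have pois := pencil_poisson flat mulAC fob.
split=> //.
- by move=> l x; rewrite (quot_gen pE) fun_genE.
- exact: mod_hbar_flat_exists flat.
(* The bracket in h is alpha0 / n times the first of these and the bracket in nu is sigma times the
   first plus 2 n times the second. This triangular system is invertible, so both pairs span the
   same pencil; the factor 2 n is the value of the Killing form on opposite root vectors. *)
pose PK f g := sc (n%:R / alpha0) * P1 f g.
pose PR f g := sc (2 * n)%:R^-1 * (P2 f g - sc sigma * PK f g).
have n20 : (2 * n)%:R != 0 :> C by rewrite natrM mulf_neq0 // pnatr_eq0.
have KP : in_pencil P1 P2 PK.
  by exists (n%:R / alpha0), 0 => f g; rewrite /PK (raddf0 sc) mul0r addr0.
have RP : in_pencil P1 P2 PR.
  exists (- ((2 * n)%:R^-1 * sigma * (n%:R / alpha0))), (2 * n)%:R^-1 => f g.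
  by rewrite /PR /PK mulrBr !scM (raddfN sc) mulNr addrC.
have P1E f g : P1 f g = sc (alpha0 / n%:R) * PK f g.
  rewrite /PK scM; have -> : alpha0 / n%:R * (n%:R / alpha0) = 1 by field; rewrite a0 n0.
  by rewrite (rmorph1 sc) mul1r.
have P2E f g : P2 f g = sc sigma * PK f g + sc (2 * n)%:R * PR f g.
  by rewrite /PR scM mulfV // (rmorph1 sc) mul1r addrC subrK.
exists P1, P2, PK, PR; split=> //.
- apply: is_KKS_gen; first exact: pois.
  move=> l l'; rewrite /PK (gens l l').1 scM.
  have -> : n%:R / alpha0 * (alpha0 / n%:R) = 1 by field; rewrite a0 n0.
  by rewrite (rmorph1 sc) mul1r.
- apply: is_R_gen; first exact: pois.
  move=> l l'; rewrite /PR /PK (gens l l').1 (gens l l').2 [sc (n%:R / alpha0) * _]scM.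
  have -> : n%:R / alpha0 * (alpha0 / n%:R) = 1 by field; rewrite a0 n0.
  by rewrite (rmorph1 sc) mul1r addrC addKr.
- move=> Q; split=> -[c [d QE]].
    exists (c * (alpha0 / n%:R) + d * sigma), (d * (2 * n)%:R) => f g.
    by rewrite QE P1E P2E; move: (PK f g) (PR f g) => u v; rewrite mulrDr !scM addrA scD.
  exists (c * (n%:R / alpha0) - d * (2 * n)%:R^-1 * sigma * (n%:R / alpha0)), (d * (2 * n)%:R^-1) => f g.
  rewrite QE /PR /PK mulrBr mulrBr !scM (raddfB sc) mulrBl.
  by rewrite -[in RHS]addrA [- _ + _]addrC.
Qed.

End Assembly.

Theorem mainTheorem1 (R : realType) (n : nat) (alpha0 : R[i]) (q_gt1 : bool) :
  (4 <= n)%N -> alpha0 != 0 ->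
  exists p : {rmorphism Ahq n alpha0 q_gt1 -> FunO n alpha0},
    [/\ forall (b : label n) (x : coadjoint_orbit (n := n) alpha0),
          fun_val (p (Ahq_gen alpha0 q_gt1 b)) x = val x (sl_basis R[i] b),
        flat_deformation2 p,
        exists2 pq : {rmorphism Aq n alpha0 q_gt1 -> FunO n alpha0},
          forall a, pq (to_Aq n alpha0 q_gt1 a) = p a & flat_deformation pq &
        exists P_hbar P_nu P_KKS P_R :
            FunO n alpha0 -> FunO n alpha0 -> FunO n alpha0,
          [/\ first_order_brackets p P_hbar P_nu,
              is_KKS P_KKS, is_R_bracket P_R,
              forall Q, in_pencil P_hbar P_nu Q -> is_poisson Q &
              forall Q, in_pencil P_hbar P_nu Q <-> in_pencil P_KKS P_R Q]].
Proof. by move=> n_gt3 a0; apply: main_numField. Qed.
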